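(* Let $M_1,M_2\in\mathbb R$, let $\rho,\phi\in C^\infty(\mathbb R^n,A_\theta^\infty)$ be symbols of orders $M_1$ and $M_2$ respectively, and let $P=P_\rho$ and $Q=P_\phi$ be the pseudodifferential operators on $A_\theta^\infty$ with symbols $\sigma(P)=\rho$ and $\sigma(Q)=\phi$. Then the product $QP=Q\circ P$ is a pseudodifferential operator $QP=P_{\sigma(QP)}$, whose symbol $\sigma(QP)$ is of order $M_1+M_2$ and satisfies $$\sigma(QP)(\xi)\sim\sum_{\ell\in\mathbb Z_{\ge 0}^n}\frac{1}{\ell_1!\,\ell_2!\cdots\ell_n!}\,\partial^{\ell}\phi(\xi)\,\delta^{\ell}\rho(\xi).$$
   Context: Let $n$ be a positive integer and fix a real skew-symmetric $n\times n$ matrix $\theta$ whose entries above the diagonal are irrational and linearly independent over $\mathbb Q$. $A_\theta$ is the universal $C^*$-algebra generated by unitaries $U_1,\dots,U_n$ with $U_kU_j=e^{2\pi i\theta_{j,k}}U_jU_k$. For $m\in\mathbb Z^n$ write $U^m=U_1^{m_1}\cdots U_n^{m_n}$. $\{\alpha_s\}_{s\in\mathbb R^n}$ is the $n$-parameter group of automorphisms of $A_\theta$ with $\alpha_s(U^m)=e^{is\cdot m}U^m$. $A_\theta^\infty$ is the subalgebra of those $a\in A_\theta$ for which $s\mapsto\alpha_s(a)$ is smooth from $\mathbb R^n$ to $A_\theta$; equivalently $a=\sum_m a_mU^m$ with $(a_m)_{m\in\mathbb Z^n}$ rapidly decreasing. $\tau:A_\theta\to\mathbb C$ is the trace with $\tau(1)=1$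 and $\tau(U^m)=0$ for $m\neq0$; $\langle a,b\rangle=\tau(b^*a)$ and $\|a\|=\langle a,a\rangle^{1/2}$. $\delta_j$ is the derivation on $A_\theta^\infty$ with $\delta_j(U_j)=U_j$ and $\delta_j(U_k)=0$ for $k\ne j$ (so $\delta_j(U^m)=m_jU^m$). $\partial_j=\partial/\partial\xi_j$, and for $\ell\in\mathbb Z_{\ge0}^n$, $\partial^\ell=\prod_j\partial_j^{\ell_j}$, $\delta^\ell=\prod_j\delta_j^{\ell_j}$. A map $\rho\in C^\infty(\mathbb R^n,A_\theta^\infty)$ is a symbol of order $m\in\mathbb R$ (written $\rho\in S^m$) if for all $i,j\in\mathbb Z_{\ge0}^n$ there is a constant $C$ (depending on $\rho,i,j$) with $\|\delta^i\partial^j\rho(\xi)\|\le C(1+|\xi|)^{m-|j|}$ for all $\xi\in\mathbb R^n$. For a symbol $\rho$, the pseudodifferential operator $P_\rho$ on $A_\theta^\infty$ with symbol $\rho$ is $$P_\rho(a)=\frac1{(2\pi)^n}\int_{\mathbb R^n}\int_{\mathbb R^n}e^{-is\cdot\xi}\rho(\xi)\alpha_s(a)\,ds\,d\xi,$$ an oscillatory integral, i.e. the limit as $\epsilon\to0$ of the integrals with integrand multiplied by $\varphi(\epsilon s,\epsilon\xi)$, where $\varphi$ is any Schwartz function on $\mathbb R^{2n}$ with $\varphi(0)=1$. Writing $\sigma(P)=\rho$ means $P=P_\rho$. For a symbol $\sigma$ of order $M$ and symbols $\sigma_\ell\in S^{M-|\ell|}$, $\sigma\sim\sum_\ell\sigma_\ell$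 means that $\sigma-\sum_{|\ell|<N}\sigma_\ell\in S^{M-N}$ for every integer $N\ge1$. *)

(* Defs.v *)
From Stdlib Require Import Reals QArith Qreals ZArith ClassicalEpsilon.
From mathcomp Require Import all_boot.
From Coquelicot Require Import Coquelicot.

Set Implicit Arguments.
Unset Strict Implicit.
Unset Printing Implicit Defensive.

Open Scope R_scope.

(** * Vectors and multi-indices *)

Definition sumR (d : nat) (f : 'I_d -> R) : R := \big[Rplus/0]_(i < d) f i.

Definition dot (d : nat) (x y : 'I_d -> R) : R := sumR (fun i => x i * y i).

Definition enorm (d : nat) (x : 'I_d -> R) : R := sqrt (dot x x).

Definition shift (d : nat) (x : 'I_d -> R) (j : 'I_d) (t : R) : 'I_d -> R :=
  fun i => if i == j then x i + t else x i.

Definition vcons (d : nat) (t : R) (x : 'I_d -> R) : 'I_d.+1 -> R :=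
  fun i => match unlift ord0 i with None => t | Some j => x j end.

Definition vcat (d e : nat) (x : 'I_d -> R) (y : 'I_e -> R) : 'I_(d + e) -> R :=
  fun i => match split i with inl j => x j | inr k => y k end.

Definition mi_size (d : nat) (l : 'I_d -> nat) : nat := (\sum_(i < d) l i)%N.

Definition mi_fact (d : nat) (l : 'I_d -> nat) : nat := (\prod_(i < d) (l i)`!)%N.

(** [mi_iter D l] is the operator $\prod_j D_j^{l_j}$. *)
Definition mi_iter (d : nat) (X : Type) (D : 'I_d -> X -> X) (l : 'I_d -> nat)
    (x : X) : X :=
  foldr (fun j y => iter (l j) (D j) y) x (enum 'I_d).

(** * Smooth maps from $\mathbb R^d$ to a space topologized by seminorms *)

(** The target is the subspace [dom] of the real vector space [V], with the
    topology of the seminorms [p i].  This covers a Banach space (one norm,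
    [dom] everything) and the Fréchet space $A_\theta^\infty\subset A_\theta$;
    the [p i] are only meaningful on [dom]. *)
Section Smooth.
Variables (V : ModuleSpace R_AbsRing) (I : Type) (dom : V -> Prop) (p : I -> V -> R).

Definition sn_cvg (T : Type) (F : (T -> Prop) -> Prop) (f : T -> V) (v : V) : Prop :=
  forall i, filterlim (fun t => p i (minus (f t) v)) F (locally 0).

Variable d : nat.

Definition is_partial (j : 'I_d) (f : ('I_d -> R) -> V) (x : 'I_d -> R) (v : V) : Prop :=
  dom v /\
  sn_cvg (locally' 0) (fun t : R => scal (/ t) (minus (f (shift x j t)) (f x))) v.

Definition partial (j : 'I_d) (f : ('I_d -> R) -> V) : ('I_d -> R) -> V :=
  fun x => epsilon (inhabits zero) (is_partial j f x).

Definition smooth (f : ('I_d -> R) -> V) : Prop :=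
  (forall x, dom (f x)) /\
  forall js : seq 'I_d,
    let g := foldr partial f js in
    (forall x, sn_cvg (locally x) g (g x)) /\
    (forall j x, exists v, is_partial j g x v).

End Smooth.

Definition C_smooth (d : nat) : (('I_d -> R) -> C) -> Prop :=
  @smooth C_R_NormedModule unit (fun _ => True) (fun _ => Cmod) d.

Definition C_deriv (d : nat) : ('I_d -> nat) -> (('I_d -> R) -> C) -> ('I_d -> R) -> C :=
  mi_iter (@partial C_R_NormedModule unit (fun _ => True) (fun _ => Cmod) d).

Definition schwartz (d : nat) (f : ('I_d -> R) -> C) : Prop :=
  C_smooth f /\
  forall (N : nat) (l : 'I_d -> nat), exists K : R, forall x,
    (1 + enorm x) ^ N * Cmod (C_deriv l f x) <= K.

(** * Integrals over $\mathbb R^d$ of vector-valued functions *)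

(** Iterated improper Riemann integral; for the continuous, rapidly decreasing
    integrands met below it is the Lebesgue (Bochner) integral. *)
Fixpoint is_int (V : NormedModule R_AbsRing) (d : nat) :
    (('I_d -> R) -> V) -> V -> Prop :=
  match d return (('I_d -> R) -> V) -> V -> Prop with
  | O => fun f v => v = f (fun _ => 0)
  | d'.+1 => fun f v => exists g : R -> V,
      (forall t, is_int (fun x => f (vcons t x)) (g t)) /\
      is_RInt_gen g (Rbar_locally m_infty) (Rbar_locally p_infty) v
  end.

(** * Unital C*-algebras *)

Record CstarAlgebra := {
  carrier :> CompleteNormedModule R_AbsRing;
  cscal : C -> carrier -> carrier;
  cmul : carrier -> carrier -> carrier;
  cone : carrier;
  cstar : carrier -> carrier;
  cscalR : forall (r : R) x, cscal (RtoC r) x = scal r x;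
  cscalA : forall (z w : C) x, cscal z (cscal w x) = cscal (Cmult z w) x;
  cscalDl : forall (z w : C) x, cscal (Cplus z w) x = plus (cscal z x) (cscal w x);
  cscalDr : forall (z : C) x y, cscal z (plus x y) = plus (cscal z x) (cscal z y);
  cmulA : forall x y z, cmul x (cmul y z) = cmul (cmul x y) z;
  cmul1l : forall x, cmul cone x = x;
  cmul1r : forall x, cmul x cone = x;
  cmulDl : forall x y z, cmul (plus x y) z = plus (cmul x z) (cmul y z);
  cmulDr : forall x y z, cmul x (plus y z) = plus (cmul x y) (cmul x z);
  cmulZl : forall (z : C) x y, cmul (cscal z x) y = cscal z (cmul x y);
  cmulZr : forall (z : C) x y, cmul x (cscal z y) = cscal z (cmul x y);
  cstarK : forall x, cstar (cstar x) = x;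
  cstarD : forall x y, cstar (plus x y) = plus (cstar x) (cstar y);
  cstarZ : forall (z : C) x, cstar (cscal z x) = cscal (Cconj z) (cstar x);
  cstarM : forall x y, cstar (cmul x y) = cmul (cstar y) (cstar x);
  cnormZ : forall (z : C) x, norm (cscal z x) = Cmod z * norm x;
  cnormM : forall x y, norm (cmul x y) <= norm x * norm y;
  cnorm_star : forall x, norm (cmul (cstar x) x) = norm x ^ 2
}.

Arguments cone {c}.

(** Continuity is automatic for *-homomorphisms of C*-algebras. *)
Definition star_hom (A B : CstarAlgebra) (f : A -> B) : Prop :=
  (forall x y, f (plus x y) = plus (f x) (f y)) /\
  (forall z x, f (cscal z x) = cscal z (f x)) /\
  (forall x y, f (cmul x y) = cmul (f x) (f y)) /\
  f cone = cone /\
  (forall x, f (cstar x) = cstar (f x)) /\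
  (forall x, continuous f x).

Definition unitary (A : CstarAlgebra) (u : A) : Prop :=
  cmul (cstar u) u = cone /\ cmul u (cstar u) = cone.

Definition zpow (A : CstarAlgebra) (u : A) (z : Z) : A :=
  match z with
  | Z0 => cone
  | Zpos k => iter (Pos.to_nat k) (cmul u) cone
  | Zneg k => iter (Pos.to_nat k) (cmul (cstar u)) cone
  end.

(** * The noncommutative torus *)

Definition skew_symmetric (n : nat) (theta : 'I_n -> 'I_n -> R) : Prop :=
  forall j k, theta j k = - theta k j.

Definition irrational (x : R) : Prop := ~ exists q : Q, x = Q2R q.

Definition generic (n : nat) (theta : 'I_n -> 'I_n -> R) : Prop :=
  (forall j k : 'I_n, (j < k)%N -> irrational (theta j k)) /\
  forall q : 'I_n -> 'I_n -> Q,
    \big[Rplus/0]_(j < n) \big[Rplus/0]_(k < n | (j < k)%N)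
       (Q2R (q j k) * theta j k) = 0 ->
    forall j k : 'I_n, (j < k)%N -> Qeq (q j k) 0%Q.

Definition cis (t : R) : C := (cos t, sin t).

Definition torus_relations (n : nat) (theta : 'I_n -> 'I_n -> R)
    (A : CstarAlgebra) (U : 'I_n -> A) : Prop :=
  (forall j, unitary (U j)) /\
  forall j k, cmul (U k) (U j) = cscal (cis (2 * PI * theta j k)) (cmul (U j) (U k)).

Definition generated_by (n : nat) (A : CstarAlgebra) (U : 'I_n -> A) : Prop :=
  forall S : A -> Prop,
    closed S -> (forall j, S (U j)) -> S cone ->
    (forall x y, S x -> S y -> S (plus x y)) ->
    (forall z x, S x -> S (cscal z x)) ->
    (forall x y, S x -> S y -> S (cmul x y)) ->
    (forall x, S x -> S (cstar x)) ->
    forall x, S x.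

(** Uniqueness of the homomorphism [h] follows from generation. *)
Definition is_nc_torus (n : nat) (theta : 'I_n -> 'I_n -> R)
    (A : CstarAlgebra) (U : 'I_n -> A) : Prop :=
  torus_relations theta U /\
  generated_by U /\
  forall (B : CstarAlgebra) (W : 'I_n -> B), torus_relations theta W ->
    exists h : A -> B, star_hom h /\ forall j, h (U j) = W j.

Section Torus.
Variables (n : nat) (A : CstarAlgebra) (U : 'I_n -> A).

Definition monomial (m : 'I_n -> Z) : A :=
  \big[@cmul A/cone]_(j < n) zpow (U j) (m j).

Definition is_gauge_action (alpha : ('I_n -> R) -> A -> A) : Prop :=
  (forall s, star_hom (alpha s)) /\
  (forall a, alpha (fun _ => 0) a = a) /\
  (forall s t a, alpha (fun i => s i + t i) a = alpha s (alpha t a)) /\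
  (forall s m,
     alpha s (monomial m) = cscal (cis (dot s (fun i => IZR (m i)))) (monomial m)).

(** Boundedness is automatic for positive functionals. *)
Definition is_canonical_trace (tau : A -> C) : Prop :=
  (forall a b, tau (plus a b) = Cplus (tau a) (tau b)) /\
  (forall z a, tau (cscal z a) = Cmult z (tau a)) /\
  (forall a, Cmod (tau a) <= norm a) /\
  (forall a, Im (tau (cmul (cstar a) a)) = 0 /\ 0 <= Re (tau (cmul (cstar a) a))) /\
  (forall a b, tau (cmul a b) = tau (cmul b a)) /\
  tau cone = RtoC 1 /\
  (forall m, (exists j, m j <> 0%Z) -> tau (monomial m) = RtoC 0).

Variable alpha : ('I_n -> R) -> A -> A.

(** ** The smooth subalgebra $A_\theta^\infty$ and its Fréchet topology *)

Definition Ainf (a : A) : Prop :=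
  @smooth A unit (fun _ => True) (fun _ => norm) n (fun s => alpha s a).

(** The topology of $A_\theta^\infty$ is that of its embedding
    $a\mapsto(s\mapsto\alpha_s(a))$ into $C^\infty(\mathbb R^n,A_\theta)$; as
    each $\alpha_t$ is isometric, the derivatives at $s=0$ suffice. *)
Definition Ainf_norm (k : 'I_n -> nat) (a : A) : R :=
  norm (mi_iter (@partial A unit (fun _ => True) (fun _ => norm) n) k
          (fun s => alpha s a) (fun _ => 0)).

(** Continuity makes the derivation the unique one with these values on the
    generators ([Ainf] is metrizable, so sequences suffice). *)
Definition is_basic_derivations (delta : 'I_n -> A -> A) : Prop :=
  forall j,
    (forall a, Ainf a -> Ainf (delta j a)) /\
    (forall a b, Ainf a -> Ainf b ->
       delta j (plus a b) = plus (delta j a) (delta j b)) /\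
    (forall z a, Ainf a -> delta j (cscal z a) = cscal z (delta j a)) /\
    (forall a b, Ainf a -> Ainf b ->
       delta j (cmul a b) = plus (cmul (delta j a) b) (cmul a (delta j b))) /\
    (forall (u : nat -> A) a, (forall i, Ainf (u i)) -> Ainf a ->
       sn_cvg Ainf_norm eventually u a ->
       sn_cvg Ainf_norm eventually (fun i => delta j (u i)) (delta j a)) /\
    (forall k, delta j (U k) = if k == j then U j else zero).

(** ** Symbols *)

Definition deriv (l : 'I_n -> nat) (f : ('I_n -> R) -> A) : ('I_n -> R) -> A :=
  mi_iter (@partial A ('I_n -> nat) Ainf Ainf_norm n) l f.

Definition L2norm (tau : A -> C) (a : A) : R := sqrt (Re (tau (cmul (cstar a) a))).

Definition symbol (tau : A -> C) (delta : 'I_n -> A -> A) (m : R)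
    (rho : ('I_n -> R) -> A) : Prop :=
  @smooth A ('I_n -> nat) Ainf Ainf_norm n rho /\
  forall i j : 'I_n -> nat, exists K : R, forall xi,
    L2norm tau (mi_iter delta i (deriv j rho xi))
      <= K * Rpower (1 + enorm xi) (m - INR (mi_size j)).

Definition partial_sum (sigma_ : ('I_n -> nat) -> ('I_n -> R) -> A) (N : nat)
    (xi : 'I_n -> R) : A :=
  \big[plus/zero]_(l : {ffun 'I_n -> 'I_N} | (mi_size (fun i => l i : nat) < N)%N)
     sigma_ (fun i => l i : nat) xi.

(** $\sigma\sim\sum_\ell\sigma_\ell$, for $\sigma\in S^M$. *)
Definition asymptotic (tau : A -> C) (delta : 'I_n -> A -> A) (M : R)
    (sigma : ('I_n -> R) -> A) (sigma_ : ('I_n -> nat) -> ('I_n -> R) -> A) : Prop :=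
  symbol tau delta M sigma /\
  (forall l, symbol tau delta (M - INR (mi_size l)) (sigma_ l)) /\
  forall N : nat, (1 <= N)%N ->
    symbol tau delta (M - INR N) (fun xi => minus (sigma xi) (partial_sum sigma_ N xi)).

(** ** Pseudodifferential operators *)

Definition osc_integrand (chi : ('I_(n + n) -> R) -> C) (eps : R)
    (rho : ('I_n -> R) -> A) (a : A) (xi s : 'I_n -> R) : A :=
  cscal (Cmult (chi (vcat (fun i => eps * s i) (fun i => eps * xi i)))
               (cis (- dot s xi)))
        (cmul (rho xi) (alpha s a)).

Definition is_osc_integral (rho : ('I_n -> R) -> A) (a b : A) : Prop :=
  forall chi : ('I_(n + n) -> R) -> C, schwartz chi -> chi (fun _ => 0) = RtoC 1 ->
  exists (inner : R -> ('I_n -> R) -> A) (outer : R -> A),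
    (forall eps, 0 < eps ->
       (forall xi, is_int (osc_integrand chi eps rho a xi) (inner eps xi)) /\
       is_int (inner eps) (outer eps)) /\
    filterlim (fun eps => scal (/ (2 * PI) ^ n) (outer eps)) (at_right 0) (locally b).

Definition is_psido (rho : ('I_n -> R) -> A) (P : {a : A | Ainf a} -> {a : A | Ainf a}) :
    Prop :=
  forall a, is_osc_integral rho (sval a) (sval (P a)).

End Torus.

(* Main.v *)
(** Expand [a] and [rho xi] in Fourier series, [a = \sum_m a_m U^m] and
    [rho xi = \sum_k rho_k xi U^k].  Fourier inversion at the origin shows that the
    oscillatory integral is [P_rho a = \sum_m a_m rho(m) U^m], so that
    [Q P = P_sigma] with the exact formula
    [sigma xi = \sum_k phi (xi + k) rho_k xi U^k].  Replacing [phi (xi + k)] by its Taylor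
    polynomial in [k] of degree [< N] gives the terms of the expansion, because
    [delta^l] multiplies [rho_k xi] by [k^l].  The Taylor remainder is
    [O((1 + |xi|)^(M2 - N))] up to a power of [1 + |k|] by Peetre's inequality, and that
    power is absorbed by the rapid decrease of [rho_k xi] in [k].

    Symbols are handled through their Fourier coefficients: [symbol] amounts to bounds
    [B (1 + |m|)^-K (1 + |xi|)^(M - |j|)] on the [j]-th derivatives of the [m]-th coefficient,
    for every [K], because [L2norm] dominates each coefficient and is dominated by [norm]. *)

(* Integrals are iterated improper Riemann integrals of Banach-valued functions, so dominated
   convergence and Fubini's theorem are proved for continuous integrands below a multiple of the
   product of the [1 / (1 + x_i ^ 2)], with locally uniform convergence in place of almost
   everywhere convergence. Partial derivatives are picked by [epsilon], and [deriv] takes them in a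
   fixed order while [smooth] allows any, so mixed derivatives must first be shown symmetric.
   Derivations, action and trace are known through their axioms only; facts about them are checked
   on monomials and extended by density, and elements are then compared through their Fourier
   coefficients, which determine them. Noncommutativity enters through phases of modulus one: the
   modulus suffices for estimates, a cocycle identity for composition. Translates, terms and Taylor
   remainders are all left factors of one twisted convolution [tconv], so a single estimate settles
   every symbol class. Since [is_osc_integral] quantifies over Schwartz functions, identifying the
   given [P] and [Q] takes an actual one, a Gaussian. *)
From HB Require Import structures.
From Stdlib Require Import Reals Lra Lia ZArith ClassicalEpsilon FunctionalExtensionality.
From mathcomp Require Import all_boot.
From Coquelicot Require Import Coquelicot.
Require Import Defs.

Set Implicit Arguments.
Unset Strict Implicit.
Unset Printing Implicit Defensive.

Open Scope R_scope.

(** * Dominated convergence for improper integrals *)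

Definition dist {V : NormedModule R_AbsRing} (x y : V) : R := norm (minus x y).

(** An epsilon form of [filterlim] (see [tendsP]), in which chains of estimates on [dist] can be
    closed by linear arithmetic. *)
Definition tends {T : Type} {V : NormedModule R_AbsRing} (F : (T -> Prop) -> Prop)
    (f : T -> V) (v : V) : Prop :=
  forall e, 0 < e -> F (fun t => dist (f t) v < e).

Lemma tendsP (T : Type) (V : NormedModule R_AbsRing) (F : (T -> Prop) -> Prop)
    {FF : Filter F} (f : T -> V) (v : V) :
  filterlim f F (locally v) <-> tends F f v.
Proof.
split=> [H e he|H].
- by move/filterlim_locally_ball_norm: H => /(_ (mkposreal e he)).
- by apply/filterlim_locally_ball_norm => e; apply: H; exact: cond_pos.
Qed.

Lemma contP (U : UniformSpace) (V : NormedModule R_AbsRing) (f : U -> V) (x : U) :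
  continuous f x <-> tends (locally x) f (f x).
Proof. exact: tendsP. Qed.

Lemma distC (V : NormedModule R_AbsRing) (x y : V) :
  dist x y = dist y x.
Proof. by rewrite /dist -norm_opp opp_minus. Qed.

Lemma dist_tri (V : NormedModule R_AbsRing) (y x z : V) :
  dist x z <= dist x y + dist y z.
Proof. by rewrite /dist (minus_trans y x z); exact: norm_triangle. Qed.

Lemma minus_eq0 (V : NormedModule R_AbsRing) (x y : V) : minus x y = zero -> x = y.
Proof.
move=> H; rewrite -[y]plus_zero_l -H /minus -plus_assoc plus_opp_l.
by rewrite plus_zero_r.
Qed.

Lemma small_eq (V : NormedModule R_AbsRing) (x y : V) :
  (forall e, 0 < e -> dist x y < e) -> x = y.
Proof.
move=> H; apply: minus_eq0; apply: norm_eq_zero.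
apply: Rle_antisym; last exact: norm_ge_0.
by apply: Rnot_lt_le => h; have := H _ h; rewrite /dist; lra.
Qed.

Lemma tends_unique (T : Type) (V : NormedModule R_AbsRing) (F : (T -> Prop) -> Prop)
    {FF : ProperFilter F} (f : T -> V) (v w : V) :
  tends F f v -> tends F f w -> v = w.
Proof.
move=> Hv Hw; apply: small_eq => e he.
have h2 : 0 < e / 2 by lra.
have [t [H1 H2]] := filter_ex _ (filter_and _ _ (Hv _ h2) (Hw _ h2)).
have := dist_tri (f t) v w; rewrite (distC v (f t)); lra.
Qed.

(** Real induction: the supremum of the points up to which [P] holds is reached, and the step would
    push it further unless it equals [b]. It stands in for the compactness of [[a, b]]. *)
Lemma interval_induction (a b : R) (P : R -> Prop) :
  a <= b ->
  (forall x, a <= x <= b -> (forall y, a <= y < x -> P y) ->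
     exists d, 0 < d /\ forall z, x <= z < x + d -> P z) ->
  P b.
Proof.
move=> hab H.
pose E := fun x => a <= x <= b /\ forall y, a <= y < x -> P y.
have Ea : E a by split; [lra | move=> y; lra].
have [s [Hub Hlub]] : { s | is_lub E s }.
  by apply: completeness; [exists b => x [] [] | exists a].
have has : a <= s by exact: Hub.
have hsb : s <= b by apply: Hlub => x [] [].
have Es : E s.
  split=> // y [hy1 hy2].
  apply: NNPP => HN.
  have : s <= y.
    apply: Hlub => x [hx1 hx2]; apply: Rnot_lt_le => hlt; apply: HN; apply: hx2; lra.
  lra.
have [d [hd Hd]] := H s (proj1 Es) (proj2 Es).
case: (Req_dec s b) => hs; first by apply: Hd; lra.
have : Rmin b (s + d / 2) <= s.
  apply: Hub; split.
    by split; [apply: Rmin_glb; lra | apply: Rmin_l].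
  move=> y [hy1 hy2]; case: (Rlt_le_dec y s) => h.
    by apply: (proj2 Es).
  apply: Hd; have := Rmin_r b (s + d / 2); lra.
rewrite /Rmin; case: Rle_dec => _; lra.
Qed.

(** Compactness of [[a, b]] by real induction: the filter set valid up to [x - d / 2] is intersected
    with the one that works near [x], so each step takes a finite intersection. *)
Lemma loc_unif_compact (T : Type) (F : (T -> Prop) -> Prop) {FF : Filter F}
    (P : T -> R -> Prop) (a b : R) :
  a <= b ->
  (forall x, a <= x <= b -> filter_prod F (locally x) (fun p => P p.1 p.2)) ->
  F (fun t => forall x, a <= x <= b -> P t x).
Proof.
move=> hab H.
apply: (interval_induction (P := fun c => F (fun t => forall x, a <= x <= c -> P t x)) hab).
move=> x hx IH.
have [Q S HQ [d HS] HP] := H x hx.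
have hd := cond_pos d.
exists (d / 2); split; first lra.
move=> z hz.
(* The point [x - d / 2] may lie outside the range of the induction hypothesis; then the
   neighbourhood of [x] alone covers [[a, z]]. *)
case: (Rle_lt_dec (x - d / 2) a) => hcase.
  apply: filter_imp HQ => t Qt y hy; apply: (HP t y Qt); apply: HS.
  rewrite /ball /= /AbsRing_ball /= /abs /minus /plus /opp /=; apply: Rabs_def1; lra.
have IH' := IH (x - d / 2) ltac:(lra).
apply: filter_imp (filter_and _ _ HQ IH') => t [Qt Ht] y hy.
case: (Rle_lt_dec y (x - d / 2)) => hy2; first by apply: Ht; lra.
apply: (HP t y Qt); apply: HS.
rewrite /ball /= /AbsRing_ball /= /abs /minus /plus /opp /=; apply: Rabs_def1; lra.
Qed.

Lemma atan_int (a b K : R) :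
  is_RInt (fun t => K * / (1 + t ^ 2)) a b (K * (atan b - atan a)).
Proof.
have -> : K * (atan b - atan a) = @minus R_AbelianGroup (K * atan b) (K * atan a).
  by rewrite /minus /plus /opp /=; ring.
apply: (@is_RInt_derive R_CompleteNormedModule (fun t => K * atan t)) => x _.
- apply: is_derive_scal; rewrite (_ : x ^ 2 = x²); last by rewrite /Rsqr; ring.
  exact: is_derive_atan.
- apply: (@ex_derive_continuous R_AbsRing R_NormedModule); auto_derive; nra.
Qed.

Section OneD.
Variable V : CompleteNormedModule R_AbsRing.

(** The majorant has the primitive [K * atan], from which all tail estimates below follow;
    continuity makes the integrals over bounded intervals exist. *)
Definition dom1 (K : R) (g : R -> V) : Prop :=
  (forall x, continuous g x) /\ forall x, norm (g x) <= K * / (1 + x ^ 2).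

Lemma dom1_ex K g a b : dom1 K g -> ex_RInt g a b.
Proof. by move=> [H _]; apply: ex_RInt_continuous. Qed.

Lemma dom1_le K g a b : a <= b -> dom1 K g -> norm (RInt g a b) <= K * (atan b - atan a).
Proof.
move=> hab H; apply: (@norm_RInt_le V g (fun t => K * / (1 + t ^ 2)) a b _ _ hab).
- by move=> x _; apply: (proj2 H).
- apply: RInt_correct; exact: dom1_ex H.
- exact: atan_int.
Qed.

Lemma RInt_tail K g a b a' b' :
  a' <= a -> a <= b -> b <= b' -> dom1 K g ->
  dist (RInt g a' b') (RInt g a b) <= K * (atan a - atan a' + (atan b' - atan b)).
Proof.
move=> h1 h2 h3 H.
rewrite -(RInt_Chasles g a' a b'); try exact: dom1_ex H.
rewrite -(RInt_Chasles g a b b'); try exact: dom1_ex H.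
set x := RInt g a' a; set y := RInt g a b; set z := RInt g b b'.
rewrite /dist; have -> : minus (plus x (plus y z)) y = plus x z.
  rewrite /minus -!plus_assoc (plus_comm y) -plus_assoc plus_opp_l plus_zero_r //.
apply: Rle_trans (norm_triangle _ _) _.
have := dom1_le h1 H; have := dom1_le h3 H; rewrite -/x -/z; lra.
Qed.

(** Both endpoints of a Riemann integral tend to infinity. *)
Definition pm := filter_prod (Rbar_locally m_infty) (Rbar_locally p_infty).

Global Instance pm_proper : ProperFilter pm.
Proof. exact: filter_prod_proper. Qed.

Lemma pm_ge (B : R) : pm (fun ab => ab.1 <= - B /\ B <= ab.2).
Proof.
exists (fun x => x < - B) (fun x => B < x).
- by exists (- B).
- by exists B.
- move=> x y /=; lra.
Qed.

(** [PI / 2 - atan x] equals [atan (/ x)], and [atan] is 1-Lipschitz. *)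
Lemma atan_big (e : R) : 0 < e -> exists B, 0 <= B /\ forall x, B <= x -> PI / 2 - atan x < e.
Proof.
move=> he; have h0 : 0 < / (e / 2) by apply: Rinv_0_lt_compat; lra.
exists (/ (e / 2)); split; first lra.
move=> x hx; have hx0 : 0 < x by lra.
have hinv : / x <= e / 2 by rewrite -(Rinv_inv (e / 2)); apply: Rinv_le_contravar.
have := atan_inv x hx0 => <-.
have hix : 0 < / x by apply: Rinv_0_lt_compat.
have hlip : Rabs (atan (/ x) - atan 0) <= 1 * Rabs (/ x - 0).
  apply: (bounded_variation atan (fun t => / (1 + t²))) => t _; split.
    exact: is_derive_atan.
  have h1 : 1 <= 1 + t² by have := Rle_0_sqr t; lra.
  rewrite Rabs_pos_eq; last by left; apply: Rinv_0_lt_compat; lra.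
  have := Rinv_le_contravar 1 (1 + t²) ltac:(lra) h1; rewrite Rinv_1; lra.
have := Rle_abs (atan (/ x) - atan 0); move: hlip.
rewrite atan_0 !Rminus_0_r (Rabs_pos_eq (/ x)); lra.
Qed.

Lemma dom1_K K g : dom1 K g -> 0 <= K.
Proof.
move=> [_ H]; have := H 0; have := norm_ge_0 (g 0).
have -> : / (1 + 0 ^ 2) = 1 by field.
lra.
Qed.

Lemma RInt_tail_sym K g B a b : 0 <= B -> a <= - B -> B <= b -> dom1 K g ->
  dist (RInt g a b) (RInt g (- B) B) <= K * (2 * (PI / 2 - atan B)).
Proof.
move=> hB ha hb H.
apply: Rle_trans (RInt_tail ha _ hb H) _; first lra.
apply: Rmult_le_compat_l; first exact: dom1_K H.
rewrite atan_opp; have := atan_bound a; have := atan_bound b; lra.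
Qed.

Lemma dom1_gen K g : dom1 K g ->
  is_RInt_gen g (Rbar_locally m_infty) (Rbar_locally p_infty)
    (RInt_gen g (Rbar_locally m_infty) (Rbar_locally p_infty)).
Proof.
move=> H; refine (@RInt_gen_correct V (Rbar_locally m_infty) (Rbar_locally p_infty) _ _ g _).
have hK := dom1_K H.
have [l Hl] : exists l, filterlim (fun ab => RInt g ab.1 ab.2) pm (locally l).
  apply (proj1 (@filterlim_locally_cauchy _ V pm pm_proper (fun ab => RInt g ab.1 ab.2))) => e.
  (* Two symmetric tails have to fit into [e], each at most [2 * K] times the chosen bound; the
     [+ 1] covers [K = 0]. *)
  have [B [hB0 hB]] := atan_big (e := e / (4 * K + 1)) ltac:(apply: Rdiv_lt_0_compat; [exact: cond_pos | lra]).
  exists (fun ab => ab.1 <= - B /\ B <= ab.2); split; first exact: pm_ge.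
  move=> [a b] [a' b'] /= [h1 h2] [h3 h4].
  suff key : dist (RInt g a' b') (RInt g a b) < e by exact: norm_compat1.
  apply: Rle_lt_trans (dist_tri (RInt g (- B) B) _ _) _.
  rewrite (distC (RInt g (- B) B)).
  have := RInt_tail_sym hB0 h1 h2 H; have := RInt_tail_sym hB0 h3 h4 H.
  have := hB B (Rle_refl _) => hlt.
  have he := cond_pos e.
  have : K * (2 * (PI / 2 - atan B)) < e / 2.
    have h5 : K * (2 * (PI / 2 - atan B)) <= 2 * K * (e / (4 * K + 1)).
      rewrite -Rmult_assoc (Rmult_comm K 2); apply: Rmult_le_compat_l; lra.
    apply: Rle_lt_trans h5 _.
    apply: (Rmult_lt_reg_r (4 * K + 1)); first lra.
    have -> : 2 * K * (e / (4 * K + 1)) * (4 * K + 1) = 2 * K * e by field; lra.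
    lra.
  lra.
exists l => P HP; have HP' := Hl P HP.
refine (@filter_imp _ pm _ _ _ _ HP') => ab Pab; exists (RInt g ab.1 ab.2); split; last exact: Pab.
apply: (@RInt_correct V g); exact: dom1_ex H.
Qed.

Definition gen (g : R -> V) := RInt_gen g (Rbar_locally m_infty) (Rbar_locally p_infty).

Lemma gen_lim K g : dom1 K g -> tends pm (fun ab => RInt g ab.1 ab.2) (gen g).
Proof.
move=> H e he.
have Hg := dom1_gen H.
have : locally (gen g) (fun y => dist y (gen g) < e).
  by move: (@filterlim_id _ (locally (gen g))) => /tendsP /(_ e he).
move/Hg => HP'; refine (@filter_imp _ pm _ _ _ _ HP') => ab [y [/is_RInt_unique -> //]].
Qed.

Lemma gen_unique (g : R -> V) v :
  is_RInt_gen g (Rbar_locally m_infty) (Rbar_locally p_infty) v -> gen g = v.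
Proof. exact (@is_RInt_gen_unique V (Rbar_locally m_infty) (Rbar_locally p_infty) _ _ g v). Qed.

Lemma gen_tail K g B : 0 <= B -> dom1 K g ->
  dist (gen g) (RInt g (- B) B) <= K * (2 * (PI / 2 - atan B)).
Proof.
move=> hB H; apply: le_epsilon => e he.
have [[a b] [/= h1 [h2 h3]]] := filter_ex _ (filter_and _ _ (gen_lim H he) (pm_ge B)).
have := RInt_tail_sym hB h2 h3 H.
have := dist_tri (RInt g a b) (gen g) (RInt g (- B) B).
rewrite (distC (gen g) (RInt g a b)); lra.
Qed.

Lemma gen_le K g : dom1 K g -> norm (gen g) <= K * PI.
Proof.
move=> H; have := gen_tail (Rle_refl 0) H.
rewrite atan_0 Ropp_0 RInt_point /dist /minus opp_zero plus_zero_r; lra.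
Qed.

Lemma gen_ext (f g : R -> V) : (forall x, f x = g x) -> gen f = gen g.
Proof. by move=> H; congr gen; apply: functional_extensionality. Qed.

(** Joint convergence along [filter_prod F (locally x)] towards a continuous [f0] is locally
    uniform, hence uniform on [[a, b]] by [loc_unif_compact]. *)
Lemma RInt_dct (T : Type) (F : (T -> Prop) -> Prop) {FF : Filter F}
    (f : T -> R -> V) (f0 : R -> V) a b :
  a <= b ->
  F (fun t => forall x, continuous (f t) x) -> (forall x, continuous f0 x) ->
  (forall x, tends (filter_prod F (locally x)) (fun p => f p.1 p.2) (f0 x)) ->
  tends F (fun t => RInt (f t) a b) (RInt f0 a b).
Proof.
move=> hab HK H0 Hlim e he.
pose e' := e / (2 * (b - a + 1)).
have he' : 0 < e' by apply: Rdiv_lt_0_compat; lra.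
have Hc : F (fun t => forall x, a <= x <= b -> dist (f t x) (f0 x) < e').
  apply: loc_unif_compact => // x _; have he2 : 0 < e' / 2 by lra.
  have H1 := Hlim x _ he2.
  have /contP /(_ _ he2) H2 := H0 x.
  have H2' : filter_prod F (locally x) (fun p => dist (f0 p.2) (f0 x) < e' / 2).
    exists (fun _ => True) (fun y => dist (f0 y) (f0 x) < e' / 2) => //.
    exact: filter_true.
  apply: filter_imp (filter_and _ _ H1 H2') => [[t y]] /= [h1 h2].
  have := dist_tri (f0 x) (f t y) (f0 y).
  rewrite (distC (f0 x)); lra.
apply: filter_imp (filter_and _ _ HK Hc) => t [Kt Ct].
have Hm : dist (RInt (f t) a b) (RInt f0 a b) <= e' * (b - a).
  have -> : e' * (b - a) = scal (b - a) e' by rewrite /scal /= /mult /=; ring.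
  rewrite /dist -RInt_minus; try by apply: ex_RInt_continuous.
  apply: (@norm_RInt_le V (fun x => minus (f t x) (f0 x)) (fun=> e') a b) => //.
  - by move=> x hx; left; apply: Ct.
  - by apply: RInt_correct; apply: ex_RInt_minus; apply: ex_RInt_continuous.
  - exact: is_RInt_const.
apply: Rle_lt_trans Hm _; rewrite /e'.
apply: (Rmult_lt_reg_r (2 * (b - a + 1))); first lra.
have -> : e / (2 * (b - a + 1)) * (b - a) * (2 * (b - a + 1)) = e * (b - a) by field; lra.
nra.
Qed.

(** The common majorant makes the parts outside [[- B, B]] small for all [t] at once; inside,
    [RInt_dct] applies. *)
Lemma gen_dct (T : Type) (F : (T -> Prop) -> Prop) {FF : Filter F}
    (f : T -> R -> V) (f0 : R -> V) K :
  F (fun t => dom1 K (f t)) -> dom1 K f0 ->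
  (forall x, tends (filter_prod F (locally x)) (fun p => f p.1 p.2) (f0 x)) ->
  tends F (fun t => gen (f t)) (gen f0).
Proof.
move=> HK H0 Hlim e he.
have hK := dom1_K H0.
have [B [hB0 hB]] := atan_big (e := e / (12 * K + 1)) ltac:(apply: Rdiv_lt_0_compat; lra).
have htail : K * (2 * (PI / 2 - atan B)) < e / 6.
  have h5 : K * (2 * (PI / 2 - atan B)) <= 2 * K * (e / (12 * K + 1)).
    rewrite -Rmult_assoc (Rmult_comm K 2); apply: Rmult_le_compat_l; first lra.
    by left; apply: hB; lra.
  apply: Rle_lt_trans h5 _.
  apply: (Rmult_lt_reg_r (12 * K + 1)); first lra.
  have -> : 2 * K * (e / (12 * K + 1)) * (12 * K + 1) = 2 * K * e by field; lra.
  lra.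
have he3 : 0 < e / 3 by lra.
have Hc : F (fun t => dist (RInt (f t) (- B) B) (RInt f0 (- B) B) < e / 3).
  apply: RInt_dct Hlim _ he3; [lra | | exact: proj1 H0].
  by apply: filter_imp HK => t [].
apply: filter_imp (filter_and _ _ HK Hc) => t [Kt Ct].
have T1 := gen_tail hB0 Kt; have T2 := gen_tail hB0 H0.
have := dist_tri (RInt (f t) (- B) B) (gen (f t)) (gen f0).
have := dist_tri (RInt f0 (- B) B) (RInt (f t) (- B) B) (gen f0).
rewrite (distC (RInt f0 (- B) B) (gen f0)); lra.
Qed.

End OneD.

(** * Iterated integrals *)

Lemma tends_comp (T S : Type) (V : NormedModule R_AbsRing) (F : (T -> Prop) -> Prop)
    (G : (S -> Prop) -> Prop) (f : T -> V) (p : S -> T) (v : V) :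
  tends F f v -> filterlim p G F -> tends G (fun s => f (p s)) v.
Proof. by move=> H Hp e he; exact (Hp _ (H e he)). Qed.

Lemma tends_ext (T : Type) (V : NormedModule R_AbsRing) (F : (T -> Prop) -> Prop)
    (f g : T -> V) (v : V) : (forall t, f t = g t) -> tends F f v -> tends F g v.
Proof. by move=> /functional_extensionality ->. Qed.

Lemma tends_ext_ev (T : Type) (V : NormedModule R_AbsRing) (F : (T -> Prop) -> Prop)
    {FF : Filter F} (f g : T -> V) (v : V) :
  F (fun t => f t = g t) -> tends F f v -> tends F g v.
Proof. by move=> H K e he; apply: filter_imp (filter_and _ _ H (K e he)) => t [<-]. Qed.

Section Vec.
Variable d : nat.

Definition vtl (x : 'I_d.+1 -> R) : 'I_d -> R := fun j => x (lift ord0 j).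

Lemma vcons0 t (x : 'I_d -> R) : vcons t x ord0 = t.
Proof. by rewrite /vcons unlift_none. Qed.

Lemma vconsS t (x : 'I_d -> R) j : vcons t x (lift ord0 j) = x j.
Proof. by rewrite /vcons liftK. Qed.

Lemma vcons_lim t (x : 'I_d -> R) :
  filterlim (fun p => vcons p.1 p.2) (filter_prod (locally t) (locally x))
    (locally (vcons t x)).
Proof.
move=> P [e HP]; exists (ball t e) (ball x e).
- by exists e.
- by exists e.
- move=> u y hu hy; apply: HP => i.
  by case: (unliftP ord0 i) => [j|] ->; rewrite /= ?vcons0 ?vconsS.
Qed.

End Vec.

(** Being a product, this majorant restricts to slices with an explicit factor ([dk_cons]), so
    iterated integrals inherit it. *)
Definition dk (d : nat) (x : 'I_d -> R) : R := \big[Rmult/1]_(i < d) / (1 + x i ^ 2).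

Lemma dk_cons d t (x : 'I_d -> R) : dk (vcons t x) = / (1 + t ^ 2) * dk x.
Proof.
rewrite /dk big_ord_recl vcons0; congr (_ * _).
by apply: eq_bigr => i _; rewrite vconsS.
Qed.

Lemma inv1p_pos t : 0 < / (1 + t ^ 2) <= 1.
Proof.
have h : 1 <= 1 + t ^ 2 by nra.
split; first by apply: Rinv_0_lt_compat; lra.
by have := Rinv_le_contravar 1 (1 + t ^ 2) ltac:(lra) h; rewrite Rinv_1.
Qed.

Lemma dk_pos d (x : 'I_d -> R) : 0 < dk x <= 1.
Proof.
rewrite /dk; elim/big_ind: _ => [|a b [] ? ? [] ? ?|i _]; [lra | | exact: inv1p_pos].
by split; nra.
Qed.

Section Int.
Variable V : CompleteNormedModule R_AbsRing.

(** For such [f], the total function [Int] below is the integral of [is_int]. *)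
Definition nice (d : nat) (K : R) (f : ('I_d -> R) -> V) : Prop :=
  (forall x, continuous f x) /\ forall x, norm (f x) <= K * dk x.

Lemma nice_K d K (f : ('I_d -> R) -> V) : nice K f -> 0 <= K.
Proof.
move=> [_ /(_ (fun=> 0)) H]; have := norm_ge_0 (f (fun=> 0)).
have := dk_pos (d := d) (fun=> 0); nra.
Qed.

Fixpoint Int (d : nat) : (('I_d -> R) -> V) -> V :=
  match d with
  | O => fun f => f (fun=> 0)
  | d'.+1 => fun f => gen (fun t => Int (fun x => f (vcons t x)))
  end.

Lemma cont_cons d (f : ('I_d.+1 -> R) -> V) t x :
  continuous f (vcons t x) ->
  tends (filter_prod (locally t) (locally x)) (fun p => f (vcons p.1 p.2)) (f (vcons t x)).
Proof. by move/contP => H; exact: tends_comp H (@vcons_lim _ _ _). Qed.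

Lemma cont_slice d (f : ('I_d.+1 -> R) -> V) t x :
  continuous f (vcons t x) -> continuous (fun x => f (vcons t x)) x.
Proof.
move/cont_cons => H; apply/contP; apply: (tends_comp (p := fun y => (t, y)) H).
by apply: filterlim_pair; [apply: filterlim_const | apply: filterlim_id].
Qed.

Lemma nice_slice d K (f : ('I_d.+1 -> R) -> V) t :
  nice K f -> nice (K * / (1 + t ^ 2)) (fun x => f (vcons t x)).
Proof.
move=> [H1 H2]; split=> x; first exact: cont_slice.
by have := H2 (vcons t x); rewrite dk_cons Rmult_assoc.
Qed.

Lemma nice_mono d K K' (f : ('I_d -> R) -> V) : K <= K' -> nice K f -> nice K' f.
Proof.
move=> h [H1 H2]; split=> // x; apply: Rle_trans (H2 x) _.
have := dk_pos x; nra.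
Qed.

Lemma nice_slice' d K (f : ('I_d.+1 -> R) -> V) t :
  nice K f -> nice K (fun x => f (vcons t x)).
Proof.
move=> H; apply: nice_mono (nice_slice t H).
have := nice_K H; have := inv1p_pos t; nra.
Qed.

(** The two claims need each other in the induction on [d]: existence in one more variable requires
    the inner integral to be continuous in the outer variable, which is dominated convergence in [d]
    variables. For the same reason the filter and the parameter type are arbitrary. *)
Lemma Int_main d :
  (forall K (f : ('I_d -> R) -> V), nice K f -> is_int f (Int f) /\ norm (Int f) <= K * PI ^ d) /\
  (forall T (F : (T -> Prop) -> Prop) (FF : Filter F) (f : T -> ('I_d -> R) -> V) f0 K,
     F (fun t => nice K (f t)) -> nice K f0 ->
     (forall x, tends (filter_prod F (locally x)) (fun p => f p.1 p.2) (f0 x)) ->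
     tends F (fun t => Int (f t)) (Int f0)).
Proof.
elim: d => [|d [IHA IHB]].
  split.
    move=> K f [_ H]; split=> //=; have := H (fun=> 0).
    by rewrite /dk big_ord0.
  move=> T F FF f f0 K _ _ H e he.
  have [Q S HQ HS HP] := H (fun=> 0) e he.
  by apply: filter_imp HQ => t Qt; apply: (HP t (fun=> 0)) => //; apply: locally_singleton.
have Hdom K f : nice K f -> dom1 (K * PI ^ d) (fun u => Int (fun x : 'I_d -> R => f (vcons u x))).
  move=> Hf; split=> u.
    apply/contP; apply: (IHB _ _ _ (fun u x => f (vcons u x)) _ K).
    - by apply: filter_forall => t; apply: nice_slice'.
    - exact: nice_slice'.
    - by move=> x; apply: cont_cons; apply: (proj1 Hf).
  have -> : K * PI ^ d * / (1 + u ^ 2) = K * / (1 + u ^ 2) * PI ^ d by ring.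
  exact: (proj2 (IHA _ _ (nice_slice u Hf))).
split.
  move=> K f Hf; split.
    exists (fun u => Int (fun x : 'I_d -> R => f (vcons u x))); split.
      by move=> t; apply: (proj1 (IHA _ _ (nice_slice t Hf))).
    exact: dom1_gen (Hdom _ _ Hf).
  have := gen_le (Hdom _ _ Hf) => /=.
  by rewrite Rmult_assoc (Rmult_comm (PI ^ d)).
move=> T F FF f f0 K HK H0 Hlim.
apply: (gen_dct (K := K * PI ^ d)).
- by apply: filter_imp HK => t; apply: Hdom.
- exact: Hdom.
(* The outer variable joins the parameter: the induction hypothesis is applied on [T * R]. *)
move=> u.
apply: (IHB _ _ _ (fun (p : T * R) x => f p.1 (vcons p.2 x)) _ K).
- exists (fun t => nice K (f t)) (fun=> True) => //; first exact: filter_true.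
  by move=> t v Ht _; apply: nice_slice'.
- exact: nice_slice'.
move=> x.
apply: (tends_comp (p := fun q : (T * R) * ('I_d -> R) => (q.1.1, vcons q.1.2 q.2)) (Hlim (vcons u x))).
apply: filterlim_pair.
  by apply: (filterlim_comp _ _ _ fst fst _ _ _ filterlim_fst filterlim_fst).
apply: (filterlim_comp _ _ _ (fun q : (T * R) * ('I_d -> R) => (q.1.2, q.2)) (fun p => vcons p.1 p.2) _
          (filter_prod (locally u) (locally x))); last exact: vcons_lim.
apply: filterlim_pair; last exact: filterlim_snd.
by apply: (filterlim_comp _ _ _ fst snd _ _ _ filterlim_fst filterlim_snd).
Qed.

Lemma Int_is_int d K (f : ('I_d -> R) -> V) : nice K f -> is_int f (Int f).
Proof. by move/(proj1 (Int_main d)) => []. Qed.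

Lemma Int_le d K (f : ('I_d -> R) -> V) : nice K f -> norm (Int f) <= K * PI ^ d.
Proof. by move/(proj1 (Int_main d)) => []. Qed.

Lemma Int_dct d T (F : (T -> Prop) -> Prop) {FF : Filter F} (f : T -> ('I_d -> R) -> V) f0 K :
  F (fun t => nice K (f t)) -> nice K f0 ->
  (forall x, tends (filter_prod F (locally x)) (fun p => f p.1 p.2) (f0 x)) ->
  tends F (fun t => Int (f t)) (Int f0).
Proof. exact: (proj2 (Int_main d)). Qed.

Lemma Int_unique d (f : ('I_d -> R) -> V) v : is_int f v -> Int f = v.
Proof.
elim: d f v => [|d IH] f v /=; first by move->.
move=> [g [H1 H2]]; rewrite -(gen_unique H2); apply: gen_ext => t; exact: IH.
Qed.

Lemma Int_ext d (f g : ('I_d -> R) -> V) : (forall x, f x = g x) -> Int f = Int g.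
Proof. by move=> /functional_extensionality ->. Qed.

End Int.

Section Deriv.
Variable V : NormedModule R_AbsRing.

Lemma norm_scalR (r : R) (v : V) : norm (scal r v) = Rabs r * norm v.
Proof.
apply: Rle_antisym; first exact: (norm_scal r v).
case: (Req_dec r 0) => [->|hr]; first by rewrite Rabs_R0 Rmult_0_l; exact: norm_ge_0.
have hp := Rabs_pos_lt _ hr.
have := norm_scal (/ r) (scal r v); rewrite scal_assoc /mult /= Rinv_l // scal_one.
rewrite /abs /= Rabs_inv => H.
have := Rmult_le_compat_l _ _ _ (Rlt_le _ _ hp) H.
by rewrite -Rmult_assoc Rinv_r ?Rmult_1_l //; lra.
Qed.

Lemma locally'_shift (x : R) (P : R -> Prop) :
  locally' 0 P <-> locally' x (fun y => P (y - x)).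
Proof.
split=> [] [e He]; exists e => y hy hne.
- apply: He; last by lra.
  move: hy; rewrite /ball /= /AbsRing_ball /= /minus /plus /opp /=.
  by rewrite Ropp_0 Rplus_0_r.
- have E1 : forall y : R, y = x + y - x by move=> ?; ring.
  rewrite (E1 y).
  apply: He; last by lra.
  move: hy; rewrite /ball /= /AbsRing_ball /= /minus /plus /opp /= => hy.
  have E2 : forall y : R, x + y + - x = y + - 0 by move=> ?; ring.
  by rewrite E2.
Qed.

Lemma dq_dist (a b l : V) (h e : R) : h <> 0 ->
  norm (minus (minus a b) (scal h l)) <= e * Rabs h <-> dist (scal (/ h) (minus a b)) l <= e.
Proof.
move=> hh; have hp : 0 < Rabs h by apply: Rabs_pos_lt.
have -> : minus (minus a b) (scal h l) = scal h (minus (scal (/ h) (minus a b)) l).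
  by rewrite scal_minus_distr_l scal_assoc /mult /= Rinv_r // scal_one.
rewrite norm_scalR -/(dist _ _); split=> H.
  by apply: (Rmult_le_reg_l (Rabs h)) => //; lra.
rewrite (Rmult_comm e); apply: Rmult_le_compat_l => //; lra.
Qed.

(** Links [is_derive] to the difference quotients in which [is_partial] is phrased; [dq_dist]
    rescales one estimate into the other. *)
Lemma is_deriveP (f : R -> V) (x : R) (l : V) :
  is_derive f x l <-> tends (locally' 0) (fun h => scal (/ h) (minus (f (x + h)) (f x))) l.
Proof.
split.
- move=> [_ /(_ x (fun P HP => HP))] H e he.
  apply/(locally'_shift x).
  have he2 : 0 < e / 2 by lra.
  have := H (mkposreal _ he2); apply: filter_imp => y /= hy hne.
  rewrite Rplus_minus.
  apply: (Rle_lt_trans _ (e / 2)); last lra.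
  apply/dq_dist; first lra.
  exact: hy.
- move=> H; split; first exact: is_linear_scal_l.
  move=> y Hy; have <- : x = y.
    by apply: (is_filter_lim_locally_unique (K := R_AbsRing) (V := R_NormedModule)).
  move=> e; have := H e (cond_pos e) => /(locally'_shift x) [del Hdel].
  exists del => z hz.
  case: (Req_dec z x) => [->|hne].
    rewrite /minus !plus_opp_r scal_zero_l plus_opp_r !norm_zero; lra.
  have {hz} := Hdel z hz hne.
  rewrite Rplus_minus.
  move=> hz; apply/dq_dist; last by left.
  rewrite /minus /plus /opp /=; lra.
Qed.

End Deriv.

(** * Bounded linear maps and affine substitutions under the integral *)

Section Linear.
Variables V W : CompleteNormedModule R_AbsRing.
Variable L : V -> W.
Hypothesis HL : is_linear L.

Lemma lin_zero : L zero = zero.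
Proof. by rewrite -(scal_zero_l zero) (linear_scal _ HL) scal_zero_l. Qed.

Lemma Riemann_sum_lin (f : R -> V) s : Riemann_sum (fun x => L (f x)) s = L (Riemann_sum f s).
Proof.
move: s; apply: (@SF_cons_ind R) => [x|h s IH]; first by rewrite /Riemann_sum /= lin_zero.
by rewrite !Riemann_sum_cons IH (linear_plus _ HL) (linear_scal _ HL).
Qed.

Lemma is_RInt_lin (f : R -> V) a b v : is_RInt f a b v -> is_RInt (fun x => L (f x)) a b (L v).
Proof.
move=> H; have := filterlim_comp _ _ _ _ L _ _ _ H (linear_cont L v HL).
apply: filterlim_ext => s.
by rewrite Riemann_sum_lin (linear_scal _ HL).
Qed.

Lemma is_int_lin d (f : ('I_d -> R) -> V) v : is_int f v -> is_int (fun x => L (f x)) (L v).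
Proof.
elim: d f v => [|d IH] f v /=; first by move->.
move=> [g [H1 H2]]; exists (fun t => L (g t)); split=> [t|]; first exact: IH.
move=> P HP; have := H2 _ (linear_cont L v HL P HP).
apply: (@filter_imp _ pm) => ab [y [h1 h2]]; exists (L y); split=> //.
exact: is_RInt_lin.
Qed.

Lemma nice_lin d K (f : ('I_d -> R) -> V) : nice K f -> exists K', nice K' (fun x => L (f x)).
Proof.
move=> Hf; have hK := nice_K Hf; have [M [hM HM]] := linear_norm _ HL.
exists (M * K); split=> x.
  apply: continuous_comp; [exact: (proj1 Hf) | exact: linear_cont].
apply: Rle_trans (HM _) _; rewrite Rmult_assoc.
by apply: Rmult_le_compat_l; [lra | exact: (proj2 Hf)].
Qed.

Lemma Int_lin d K (f : ('I_d -> R) -> V) : nice K f -> Int (fun x => L (f x)) = L (Int f).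
Proof. by move=> H; apply: Int_unique; apply: is_int_lin; apply: Int_is_int H. Qed.

End Linear.

Section Props.
Variable V : CompleteNormedModule R_AbsRing.

Lemma is_int_ext d (f g : ('I_d -> R) -> V) v : (forall x, f x = g x) -> is_int f v -> is_int g v.
Proof. by move=> /functional_extensionality ->. Qed.

Lemma is_int_scal d (f : ('I_d -> R) -> V) r v :
  is_int f v -> is_int (fun x => scal r (f x)) (scal r v).
Proof. by apply: (is_int_lin (L := fun x => scal r x)); apply: is_linear_scal_r => *; apply: Rmult_comm. Qed.

Lemma is_int_plus d (f g : ('I_d -> R) -> V) v w :
  is_int f v -> is_int g w -> is_int (fun x => plus (f x) (g x)) (plus v w).
Proof.
elim: d f g v w => [|d IH] f g v w /=; first by move=> -> ->.
move=> [f' [H1 H2]] [g' [H3 H4]]; exists (fun t => plus (f' t) (g' t)); split.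
  by move=> t; apply: IH.
exact: (is_RInt_gen_plus (Fa := Rbar_locally m_infty) (Fb := Rbar_locally p_infty)).
Qed.

Lemma pm_affine r c : 0 < r -> filterlim (fun ab : R * R => (r * ab.1 + c, r * ab.2 + c)) pm pm.
Proof.
move=> hr P [Q S [a Ha] [b Hb] HP].
exists (fun x => x < (a - c) / r) (fun x => (b - c) / r < x).
- by exists ((a - c) / r).
- by exists ((b - c) / r).
move=> x y hx hy; apply: HP => /=; [apply: Ha|apply: Hb].
- have := Rmult_lt_compat_r _ _ _ hr hx.
  have -> : (a - c) / r * r = a - c by field; lra.
  lra.
- have := Rmult_lt_compat_r _ _ _ hr hy.
  have -> : (b - c) / r * r = b - c by field; lra.
  lra.
Qed.

Lemma is_gen_affine (g : R -> V) r c v : 0 < r ->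
  is_RInt_gen g (Rbar_locally m_infty) (Rbar_locally p_infty) v ->
  is_RInt_gen (fun t => scal r (g (r * t + c))) (Rbar_locally m_infty) (Rbar_locally p_infty) v.
Proof.
move=> hr H P HP; have := @pm_affine r c hr _ (H P HP).
apply: (@filter_imp _ pm) => ab [y /= [h1 h2]]; exists y; split=> //.
exact: is_RInt_comp_lin.
Qed.

(** One factor [r] per variable, from the one-dimensional substitution; [0 < r] preserves the two
    ends of the line. *)
Lemma is_int_affine d (f : ('I_d -> R) -> V) r (c : 'I_d -> R) v : 0 < r ->
  is_int f v -> is_int (fun x => scal (r ^ d) (f (fun i => r * x i + c i))) v.
Proof.
move=> hr; elim: d f c v => [|d IH] f c v /=.
  move->; rewrite scal_one; congr f; apply: functional_extensionality.
  by case.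
move=> [g [H1 H2]]; exists (fun t => scal r (g (r * t + c ord0))); split; last first.
  exact: is_gen_affine.
move=> t; have := IH _ (fun j => c (lift ord0 j)) _ (H1 (r * t + c ord0)).
move/(is_int_scal r); apply: is_int_ext => x.
rewrite scal_assoc; congr (scal _ (f _)); apply: functional_extensionality => i.
by case: (unliftP ord0 i) => [j|] ->; rewrite ?vcons0 ?vconsS.
Qed.

Lemma is_int_shift d (f : ('I_d -> R) -> V) (c : 'I_d -> R) v :
  is_int f v -> is_int (fun x => f (fun i => x i + c i)) v.
Proof.
move/(@is_int_affine _ _ 1 c _ Rlt_0_1); apply: is_int_ext => x.
rewrite pow1 scal_one; congr f; apply: functional_extensionality => i; ring.
Qed.

Lemma nice_plus d K K' (f g : ('I_d -> R) -> V) :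
  nice K f -> nice K' g -> nice (K + K') (fun x => plus (f x) (g x)).
Proof.
move=> [H1 H2] [H3 H4]; split=> x; first exact: continuous_plus.
by apply: Rle_trans (norm_triangle _ _) _; have := H2 x; have := H4 x; lra.
Qed.

Lemma nice_scal d K (f : ('I_d -> R) -> V) r :
  nice K f -> nice (Rabs r * K) (fun x => scal r (f x)).
Proof.
move=> [H1 H2]; split=> x; first by apply: continuous_scal_r.
rewrite norm_scalR Rmult_assoc; apply: Rmult_le_compat_l => //; exact: Rabs_pos.
Qed.

Lemma Int_plus d K K' (f g : ('I_d -> R) -> V) :
  nice K f -> nice K' g -> Int (fun x => plus (f x) (g x)) = plus (Int f) (Int g).
Proof. by move=> H1 H2; apply: Int_unique; apply: is_int_plus; apply: Int_is_int; eassumption. Qed.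

Lemma Int_scal d K (f : ('I_d -> R) -> V) r :
  nice K f -> Int (fun x => scal r (f x)) = scal r (Int f).
Proof. by move=> H1; apply: Int_unique; apply: is_int_scal; apply: Int_is_int; eassumption. Qed.

Lemma Int_minus d K K' (f g : ('I_d -> R) -> V) :
  nice K f -> nice K' g -> Int (fun x => minus (f x) (g x)) = minus (Int f) (Int g).
Proof.
move=> H1 H2; rewrite /minus -[opp (Int g)]scal_opp_one.
rewrite -(Int_scal _ H2) -(Int_plus H1 (nice_scal (opp one) H2)).
by apply: Int_ext => x; rewrite scal_opp_one.
Qed.

End Props.

(** * Limits along filters and Fubini's theorem *)

Lemma Cmod_le_sum (z : C) : Cmod z <= Rabs z.1 + Rabs z.2.
Proof.
have h1 := Rabs_pos z.1; have h2 := Rabs_pos z.2.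
rewrite /Cmod -(sqrt_Rsqr (Rabs z.1 + Rabs z.2)); last lra.
apply: sqrt_le_1_alt; rewrite -(pow2_abs z.1) -(pow2_abs z.2) /Rsqr; nra.
Qed.

Section Toolkit.
Variables (T : Type) (F : (T -> Prop) -> Prop).
Context {FF : Filter F}.

Lemma lim_coord d (g : T -> 'I_d -> R) (x : 'I_d -> R) i :
  filterlim g F (locally x) -> filterlim (fun t => g t i) F (locally (x i)).
Proof.
move=> H P [e He]; have H' := H (fun y => P (y i)).
by apply: H'; exists e => y hy; apply: He; apply: hy.
Qed.

Lemma filter_ord d (P : T -> 'I_d -> Prop) :
  (forall i, F (fun t => P t i)) -> F (fun t => forall i, P t i).
Proof.
move=> H.
have Hs : forall s : seq 'I_d, F (fun t => forall i, i \in s -> P t i).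
  elim=> [|j s IH]; first by apply: filter_forall => t i; rewrite in_nil.
  apply: filter_imp (filter_and _ _ (H j) IH) => t [h1 h2] i.
  by rewrite in_cons => /orP [/eqP ->|]; [|apply: h2].
by apply: filter_imp (Hs (enum 'I_d)) => t Ht i; apply: Ht; rewrite mem_enum.
Qed.

Lemma lim_vec d (g : T -> 'I_d -> R) (x : 'I_d -> R) :
  (forall i, filterlim (fun t => g t i) F (locally (x i))) -> filterlim g F (locally x).
Proof.
move=> H P [e He].
suff HH : F (fun t => forall i, ball (x i) e (g t i)).
  by refine (@filter_imp _ F _ _ _ _ HH) => t Ht; apply: He.
by apply: filter_ord => i; apply: (H i (ball (x i) e)); exists e.
Qed.

(** [B (f t) (g t) - B v w] splits as [B (f t - v) (g t) + B v (g t - w)]. Real, complex, scalar and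
    algebra products are all instances. *)
Lemma lim_bilin (X Y Z : NormedModule R_AbsRing) (B : X -> Y -> Z) (f : T -> X) (g : T -> Y) v w :
  (forall x x' y, B (minus x x') y = minus (B x y) (B x' y)) ->
  (forall x y y', B x (minus y y') = minus (B x y) (B x y')) ->
  (forall x y, norm (B x y) <= norm x * norm y) ->
  filterlim f F (locally v) -> filterlim g F (locally w) ->
  filterlim (fun t => B (f t) (g t)) F (locally (B v w)).
Proof.
move=> Bl Br Bn /tendsP Hf /tendsP Hg; apply/tendsP => e he.
pose N := norm v + norm w + 1.
have hv := norm_ge_0 v; have hw := norm_ge_0 w.
pose e' := Rmin 1 (e / (2 * N)).
have hN : 0 < N by rewrite /N; lra.
have he' : 0 < e' by apply: Rmin_pos; [lra | apply: Rdiv_lt_0_compat; lra].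
apply: filter_imp (filter_and _ _ (Hf _ he') (Hg _ he')) => t [h1 h2].
apply: Rle_lt_trans (dist_tri (B v (g t)) _ _) _.
rewrite /dist -Bl -Br.
have h3 := Bn (minus (f t) v) (g t); have h4 := Bn v (minus (g t) w).
have h5 : norm (g t) <= norm w + 1.
  have := norm_triangle (minus (g t) w) w.
  have -> : plus (minus (g t) w) w = g t by rewrite /minus -plus_assoc plus_opp_l plus_zero_r.
  have := Rmin_l 1 (e / (2 * N)); rewrite -/e'; move: h2; rewrite /dist; lra.
have h6 : e' * N <= e / 2.
  have := Rmin_r 1 (e / (2 * N)); rewrite -/e' => h.
  have := Rmult_le_compat_r N _ _ (Rlt_le _ _ hN) h.
  have -> : e / (2 * N) * N = e / 2 by field; lra.
  lra.
move: h1 h2; rewrite /dist => h1 h2.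
have h7 : norm (minus (f t) v) * norm (g t) <= e' * (norm w + 1).
  by apply: Rmult_le_compat; try exact: norm_ge_0; lra.
have h8 : norm v * norm (minus (g t) w) <= norm v * e' by apply: Rmult_le_compat_l; lra.
rewrite /N in h6; nra.
Qed.

Lemma lim_plus (V : NormedModule R_AbsRing) (f g : T -> V) v w :
  filterlim f F (locally v) -> filterlim g F (locally w) ->
  filterlim (fun t => plus (f t) (g t)) F (locally (plus v w)).
Proof. by move=> H1 H2; apply: filterlim_comp_2 H1 H2 _; apply: filterlim_plus. Qed.

Lemma lim_Rplus (f g : T -> R) v w :
  filterlim f F (locally v) -> filterlim g F (locally w) ->
  filterlim (fun t => f t + g t) F (locally (v + w)).
Proof. exact: (@lim_plus R_NormedModule). Qed.

Lemma lim_Rmult (f g : T -> R) v w :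
  filterlim f F (locally v) -> filterlim g F (locally w) ->
  filterlim (fun t => f t * g t) F (locally (v * w)).
Proof.
apply: (@lim_bilin R_NormedModule R_NormedModule R_NormedModule Rmult).
- by move=> x x' y; rewrite /minus /plus /opp /=; ring.
- by move=> x x' y; rewrite /minus /plus /opp /=; ring.
- by move=> x y; rewrite /norm /= /abs /= Rabs_mult; lra.
Qed.

Lemma lim_comp (U W : UniformSpace) (f : T -> U) (h : U -> W) v :
  filterlim f F (locally v) -> continuous h v ->
  filterlim (fun t => h (f t)) F (locally (h v)).
Proof. by move=> H1 H2; apply: (filterlim_comp _ _ _ f h _ _ _ H1 H2). Qed.

Lemma lim_sumR d (f : T -> 'I_d -> R) v :
  (forall i, filterlim (fun t => f t i) F (locally (v i))) ->
  filterlim (fun t => sumR (f t)) F (locally (sumR v)).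
Proof.
move=> H; rewrite /sumR; elim: (index_enum _) => [|i s IH].
  rewrite big_nil; apply: (filterlim_ext (fun=> 0)); last exact: filterlim_const.
  by move=> t; rewrite big_nil.
rewrite big_cons; apply: (filterlim_ext (fun t => f t i + \big[Rplus/0]_(j <- s) f t j)).
  by move=> t; rewrite big_cons.
exact: lim_Rplus.
Qed.

Lemma lim_dot d (f g : T -> 'I_d -> R) v w :
  filterlim f F (locally v) -> filterlim g F (locally w) ->
  filterlim (fun t => dot (f t) (g t)) F (locally (dot v w)).
Proof.
move=> H1 H2; apply: (lim_sumR (f := fun t i => f t i * g t i)) => i.
by apply: lim_Rmult; apply: lim_coord.
Qed.

Lemma lim_prodR d (f : T -> 'I_d -> R) v :
  (forall i, filterlim (fun t => f t i) F (locally (v i))) ->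
  filterlim (fun t => \big[Rmult/1]_(i < d) (f t i)) F (locally (\big[Rmult/1]_(i < d) v i)).
Proof.
move=> H; elim: (index_enum _) => [|i s IH].
  rewrite big_nil; apply: (filterlim_ext (fun=> 1)); last exact: filterlim_const.
  by move=> t; rewrite big_nil.
rewrite big_cons; apply: (filterlim_ext (fun t => f t i * \big[Rmult/1]_(j <- s) f t j)).
  by move=> t; rewrite big_cons.
exact: lim_Rmult.
Qed.

Lemma normC (z : C) : @norm R_AbsRing C_R_NormedModule z = Cmod z.
Proof.
rewrite /norm /= /prod_norm /= /Cmod; congr sqrt.
by rewrite /norm /= /abs /= -!/(_ ^ 2) !pow2_abs.
Qed.

Lemma distC_mod (z w : C) : @dist C_R_NormedModule z w = Cmod (Cminus z w).
Proof. by rewrite /dist normC. Qed.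

Lemma lim_Cmult (f g : T -> C) v w :
  filterlim f F (@locally C_R_NormedModule v) -> filterlim g F (@locally C_R_NormedModule w) ->
  filterlim (fun t => Cmult (f t) (g t)) F (@locally C_R_NormedModule (Cmult v w)).
Proof.
apply: (@lim_bilin C_R_NormedModule C_R_NormedModule C_R_NormedModule Cmult).
- move=> x x' y; change (Cmult (Cminus x x') y = Cminus (Cmult x y) (Cmult x' y)); ring.
- move=> x x' y; change (Cmult x (Cminus x' y) = Cminus (Cmult x x') (Cmult x y)); ring.
- by move=> x y; rewrite !normC Cmod_mult; lra.
Qed.

Lemma lim_cis (f : T -> R) v :
  filterlim f F (locally v) -> filterlim (fun t => cis (f t)) F (@locally C_R_NormedModule (cis v)).
Proof.
move=> H; apply/(@tendsP _ C_R_NormedModule) => e he; have he2 : 0 < e / 2 by lra.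
have Hc : filterlim (fun t => cos (f t)) F (locally (cos v)) by exact: lim_comp H (continuous_cos v).
have Hs : filterlim (fun t => sin (f t)) F (locally (sin v)) by exact: lim_comp H (continuous_sin v).
have /(@tendsP _ R_NormedModule) /(_ _ he2) Hc' := Hc.
have /(@tendsP _ R_NormedModule) /(_ _ he2) Hs' := Hs.
apply: filter_imp (filter_and _ _ Hc' Hs') => t [h1 h2].
rewrite distC_mod; apply: Rle_lt_trans (Cmod_le_sum _) _ => /=.
have h1' : Rabs (cos (f t) + - cos v) < e / 2 by exact: h1.
have h2' : Rabs (sin (f t) + - sin v) < e / 2 by exact: h2.
lra.
Qed.

End Toolkit.

Lemma cisD s t : cis (s + t) = Cmult (cis s) (cis t).
Proof. by rewrite /cis /Cmult /= cos_plus sin_plus; congr pair; ring. Qed.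

Lemma cis0 : cis 0 = RtoC 1.
Proof. by rewrite /cis cos_0 sin_0. Qed.

Lemma Cmod_cis t : Cmod (cis t) = 1.
Proof.
rewrite /Cmod /= !Rmult_1_r -sqrt_1; congr sqrt.
by have := sin2_cos2 t; rewrite /Rsqr; lra.
Qed.

Section Fubini.
Variable V : CompleteNormedModule R_AbsRing.

Lemma lim_vcons d T (F : (T -> Prop) -> Prop) {FF : Filter F} (f : T -> R)
    (g : T -> 'I_d -> R) t x :
  filterlim f F (locally t) -> filterlim g F (locally x) ->
  filterlim (fun u => vcons (f u) (g u)) F (locally (vcons t x)).
Proof.
move=> Hf Hg; apply: lim_vec => i.
case: (unliftP ord0 i) => [j|] ->.
- rewrite vconsS; apply: (filterlim_ext (fun u => g u j)); last exact: lim_coord.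
  by move=> u; rewrite vconsS.
- rewrite vcons0; apply: (filterlim_ext f) => //.
  by move=> u; rewrite vcons0.
Qed.

Definition cont2 (X Y : UniformSpace) (f : X -> Y -> V) : Prop :=
  forall x y, filterlim (fun p => f p.1 p.2) (filter_prod (locally x) (locally y)) (locally (f x y)).

Lemma cont2_lim (X Y : UniformSpace) (f : X -> Y -> V) T (F : (T -> Prop) -> Prop) {FF : Filter F}
    g h x y :
  cont2 f -> filterlim g F (locally x) -> filterlim h F (locally y) ->
  filterlim (fun t => f (g t) (h t)) F (locally (f x y)).
Proof. by move=> H Hg Hh; apply: filterlim_comp_2 Hg Hh (H x y). Qed.

Lemma cont2_r (X Y : UniformSpace) (f : X -> Y -> V) x y : cont2 f -> continuous (f x) y.
Proof.
move=> H; apply: (@cont2_lim _ _ f _ (locally y) _ (fun=> x) (fun y => y) x y H).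
  exact: filterlim_const.
exact: filterlim_id.
Qed.

Lemma cont2_l (X Y : UniformSpace) (f : X -> Y -> V) x y :
  cont2 f -> continuous (fun x => f x y) x.
Proof.
move=> H; apply: (@cont2_lim _ _ f _ (locally x) _ (fun x => x) (fun=> y) x y H).
  exact: filterlim_id.
exact: filterlim_const.
Qed.

Definition nice2 (K : R) e d (f : ('I_e -> R) -> ('I_d -> R) -> V) : Prop :=
  cont2 f /\ forall y x, norm (f y x) <= K * dk y * dk x.

Definition nice1 (K : R) d (f : R -> ('I_d -> R) -> V) : Prop :=
  cont2 f /\ forall t x, norm (f t x) <= K * / (1 + t ^ 2) * dk x.

Section Fub1.
Variables (d : nat) (K : R) (f : R -> ('I_d -> R) -> V).
Hypothesis Hf : nice1 K f.

Lemma nice1_l t : nice (K * / (1 + t ^ 2)) (f t).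
Proof.
split; last exact: (proj2 Hf).
by move=> x; apply: cont2_r (proj1 Hf).
Qed.

Lemma nice1_K : 0 <= K.
Proof.
have := nice_K (nice1_l 0).
have -> : / (1 + 0 ^ 2) = 1 by field.
lra.
Qed.

Lemma nice1_l' t : nice K (f t).
Proof. by apply: nice_mono (nice1_l t); have := inv1p_pos t; have := nice1_K; nra. Qed.

Lemma nice1_r x : dom1 (K * dk x) (fun t => f t x).
Proof.
split=> t; last by have := proj2 Hf t x; rewrite (Rmult_comm _ (dk x)) -Rmult_assoc (Rmult_comm (dk x)).
exact: cont2_l (proj1 Hf).
Qed.

(** For [h <> 0] this is the difference quotient at [a] of a primitive of [f], but it also makes
    sense at [h = 0]; the limit of the quotients becomes continuity in [h]. *)
Definition avg (a h : R) (x : 'I_d -> R) : V := RInt (fun u => f (h * u + a) x) 0 1.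

Lemma avg_cont a : cont2 (avg a).
Proof.
move=> h0 x0; apply/tendsP; apply: (RInt_dct (f := fun p u => f (p.1 * u + a) p.2)); first lra.
- apply: filter_forall => p u; apply: (cont2_lim (h := fun=> p.2) (proj1 Hf)); last exact: filterlim_const.
  apply: lim_Rplus; last exact: filterlim_const.
  by apply: lim_Rmult; [exact: filterlim_const | exact: filterlim_id].
- move=> u; apply: (cont2_lim (h := fun=> x0) (proj1 Hf)); last exact: filterlim_const.
  apply: lim_Rplus; last exact: filterlim_const.
  by apply: lim_Rmult; [exact: filterlim_const | exact: filterlim_id].
move=> u; apply/tendsP; apply: (cont2_lim (g := fun q : (R * ('I_d -> R)) * R => q.1.1 * q.2 + a) (h := fun q => q.1.2) (proj1 Hf)).
  apply: lim_Rplus; last exact: filterlim_const.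
  apply: lim_Rmult; last exact: filterlim_snd.
  exact: (filterlim_comp _ _ _ fst fst _ _ _ filterlim_fst filterlim_fst).
exact: (filterlim_comp _ _ _ fst snd _ _ _ filterlim_fst filterlim_snd).
Qed.

Lemma line_cont a h x u : continuous (fun u => f (h * u + a) x) u.
Proof.
apply: (cont2_lim (h := fun=> x) (proj1 Hf)); last exact: filterlim_const.
apply: lim_Rplus; last exact: filterlim_const.
by apply: lim_Rmult; [exact: filterlim_const | exact: filterlim_id].
Qed.

Lemma avg_nice a h : nice K (avg a h).
Proof.
split=> x.
  exact (cont2_r (@avg_cont a)).
have -> : K * dk x = scal (1 - 0) (K * dk x) by rewrite /scal /= /mult /=; ring.
apply: (@norm_RInt_le V (fun u => f (h * u + a) x) (fun=> K * dk x) 0 1).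
- lra.
- by move=> u _; apply: (proj2 (nice1_l' _)).
- by apply: (@RInt_correct V); apply: ex_RInt_continuous => u _; apply: line_cont.
- exact: is_RInt_const.
Qed.

Lemma avg0 a x : avg a 0 x = f a x.
Proof.
rewrite /avg (RInt_ext _ (fun=> f a x)); last by move=> u _; rewrite Rmult_0_l Rplus_0_l.
by rewrite RInt_const Rminus_0_r scal_one.
Qed.

Lemma RInt_avg a h x : RInt (fun t => f t x) a (a + h) = scal h (avg a h x).
Proof.
rewrite /avg -RInt_scal; last by apply: ex_RInt_continuous => u _; apply: line_cont.
rewrite (RInt_comp_lin (fun t => f t x)); first by congr RInt; ring.
exact: dom1_ex (nice1_r x).
Qed.

Lemma RInt_nice a b : exists K', nice K' (fun x => RInt (fun t => f t x) a b).
Proof.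
exists (Rabs (b - a) * K).
have -> : (fun x => RInt (fun t => f t x) a b) = fun x => scal (b - a) (avg a (b - a) x).
  by apply: functional_extensionality => x; rewrite -RInt_avg Rplus_minus.
apply: nice_scal; exact: avg_nice.
Qed.

(** One variable is swapped with the others by differentiating in its upper limit. *)
Let H (r : R) : V := Int (fun x => RInt (fun t => f t x) 0 r).

Lemma H_diff a b : minus (H b) (H a) = Int (fun x => RInt (fun t => f t x) a b).
Proof.
have [K1 h1] := RInt_nice 0 a; have [K2 h2] := RInt_nice 0 b.
rewrite /H -(Int_minus h2 h1); apply: Int_ext => x.
rewrite -(RInt_Chasles _ 0 a b); try exact: dom1_ex (nice1_r x).
by rewrite /minus (plus_comm (RInt _ 0 a)) -plus_assoc plus_opp_r plus_zero_r.
Qed.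

(** The difference quotients of [H] are integrals of [avg r h], which is jointly continuous up to
    [h = 0] and uniformly dominated. *)
Lemma H_derive r : is_derive H r (Int (f r)).
Proof.
apply/is_deriveP.
apply: (tends_ext_ev (f := fun h => Int (avg r h))).
  exists (mkposreal _ Rlt_0_1) => h _ hne.
  rewrite H_diff -(Int_ext (fun x => esym (RInt_avg r h x))) (Int_scal _ (avg_nice r h)).
  by rewrite scal_assoc /mult /= Rinv_l // scal_one.
have -> : Int (f r) = Int (avg r 0) by apply: Int_ext => x; rewrite avg0.
apply: (Int_dct (K := K)).
- by apply: filter_forall => h; apply: avg_nice.
- exact: avg_nice.
move=> x; apply/tendsP; apply: (cont2_lim (@avg_cont r)); last exact: filterlim_snd.
apply: (filterlim_comp _ _ _ fst id _ (locally' 0) _ filterlim_fst).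
by move=> P [eps Heps]; exists eps => y hy _; apply: Heps.
Qed.

Lemma Int_l_cont r : continuous (fun t => Int (f t)) r.
Proof.
apply/contP; apply: (Int_dct (K := K)).
- by apply: filter_forall => t; apply: nice1_l'.
- exact: nice1_l'.
by move=> x; apply/tendsP; apply: (proj1 Hf).
Qed.

(** Both sides are the increment of [H], the left one by the fundamental theorem of calculus. *)
Lemma RInt_Int a b : RInt (fun t => Int (f t)) a b = Int (fun x => RInt (fun t => f t x) a b).
Proof.
rewrite -H_diff; apply: is_RInt_unique; apply: is_RInt_derive => r _; first exact: H_derive.
exact: Int_l_cont.
Qed.

Lemma Int_l_dom : dom1 (K * PI ^ d) (fun t => Int (f t)).
Proof.
split; first exact: Int_l_cont.
move=> t; have := Int_le (nice1_l t).
by have -> : K * / (1 + t ^ 2) * PI ^ d = K * PI ^ d * / (1 + t ^ 2) by ring.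
Qed.

Lemma gen_nice : nice (K * PI) (fun x => gen (fun t => f t x)).
Proof.
split=> x; last first.
  have -> : K * PI * dk x = K * dk x * PI by ring.
  exact: gen_le (nice1_r x).
apply/contP; apply: (gen_dct (f := fun x t => f t x) (K := K)).
- apply: filter_forall => y; split; first exact: (proj1 (nice1_r y)).
  move=> t; apply: Rle_trans (proj2 (nice1_r y) t) _.
  have := nice1_K; have := inv1p_pos t; have := dk_pos y => h1 h2 h3.
  by apply: Rmult_le_compat_r; [lra | nra].
- split; first exact: (proj1 (nice1_r x)).
  move=> t; apply: Rle_trans (proj2 (nice1_r x) t) _.
  have := nice1_K; have := inv1p_pos t; have := dk_pos x => h1 h2 h3.
  by apply: Rmult_le_compat_r; [lra | nra].
move=> t; apply/tendsP.
by apply: (cont2_lim (g := snd) (h := fst) (proj1 Hf)); [exact: filterlim_snd | exact: filterlim_fst].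
Qed.

(** [RInt_Int] settles bounded intervals; both sides then pass to the limit along [pm], the right
    one by dominated convergence. *)
Lemma fub1 : gen (fun t => Int (f t)) = Int (fun x => gen (fun t => f t x)).
Proof.
apply: (tends_unique (gen_lim Int_l_dom)).
apply: (tends_ext (f := fun ab => Int (fun x => RInt (fun t => f t x) ab.1 ab.2))).
  by move=> ab; rewrite RInt_Int.
apply: (Int_dct (K := K * PI)).
- apply: (@filter_imp _ pm _ _ _ _ (pm_ge 0)) => ab [h1 h2]; split=> x.
    by have [K' HK'] := RInt_nice ab.1 ab.2; apply: (proj1 HK').
  have hab : ab.1 <= ab.2 by lra.
  apply: Rle_trans (dom1_le hab (nice1_r x)) _.
  have -> : K * PI * dk x = K * dk x * PI by ring.
  apply: Rmult_le_compat_l; first exact: dom1_K (nice1_r x).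
  have := atan_bound ab.1; have := atan_bound ab.2; lra.
- exact: gen_nice.
move=> x e he.
have hK := nice1_K.
(* Tails at [y] are at most [K * dk y <= K] times an arctangent term, so one [B] serves all [y]; the
   constant makes each of the two tails at most [e / 4]. *)
have he' : 0 < e / (8 * K + 4) by apply: Rdiv_lt_0_compat; lra.
have [B [hB0 hB]] := atan_big he'.
have hB' := hB B (Rle_refl _).
have he2 : 0 < e / 2 by lra.
have /contP /(_ _ he2) Hx := proj1 gen_nice x.
exists (fun ab => ab.1 <= - B /\ B <= ab.2) (fun y => dist (gen (fun t => f t y)) (gen (fun t => f t x)) < e / 2) => //.
  exact: pm_ge.
move=> [a b] y [/= ha hb] hy.
have t1 := gen_tail hB0 (nice1_r y); have t2 := RInt_tail_sym hB0 ha hb (nice1_r y).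
have t3 := dist_tri (gen (fun t => f t y)) (RInt (fun t => f t y) a b) (gen (fun t => f t x)).
have t4 := dist_tri (RInt (fun t => f t y) (- B) B) (RInt (fun t => f t y) a b) (gen (fun t => f t y)).
rewrite (distC (gen _) (RInt _ _ _)) in t1.
have hdk := dk_pos y.
have hat : 0 <= PI / 2 - atan B by have := atan_bound B; lra.
have h5 : K * dk y * (2 * (PI / 2 - atan B)) <= K * (2 * (PI / 2 - atan B)).
  by apply: Rmult_le_compat_r; [lra | nra].
have h6 : K * (2 * (PI / 2 - atan B)) <= e / 4.
  have : K * (2 * (PI / 2 - atan B)) <= K * (2 * (e / (8 * K + 4))).
    by apply: Rmult_le_compat_l; lra.
  have -> : K * (2 * (e / (8 * K + 4))) = e / 4 * (2 * K / (2 * K + 1)) by field; lra.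
  have : 2 * K / (2 * K + 1) <= 1 by apply: (Rmult_le_reg_r (2 * K + 1)); [lra|]; rewrite /Rdiv Rmult_assoc Rinv_l; lra.
  nra.
lra.
Qed.

End Fub1.

(** Induction on the number [e] of variables of the first group, moving its outermost variable
    across by [fub1]. *)
Lemma fubini e d K (f : ('I_e -> R) -> ('I_d -> R) -> V) : nice2 K f ->
  Int (fun y => Int (f y)) = Int (fun x => Int (fun y => f y x)).
Proof.
elim: e f K => [|e IH] f K Hf /=; first by apply: Int_ext.
have Hs t : nice2 (K * / (1 + t ^ 2)) (fun y x => f (vcons t y) x).
  split=> [y x|y x].
    apply: (cont2_lim (g := fun p => vcons t p.1) (proj1 Hf)); last exact: filterlim_snd.
    by apply: lim_vcons; [exact: filterlim_const | exact: filterlim_fst].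
  by apply: Rle_trans (proj2 Hf _ _) _; rewrite dk_cons; right; ring.
have HK : 0 <= K.
  have := proj2 Hf (fun=> 0) (fun=> 0); have := norm_ge_0 (f (fun=> 0) (fun=> 0)).
  have := dk_pos (d := e.+1) (fun=> 0); have := dk_pos (d := d) (fun=> 0).
  set u := dk _; set v := dk _; move=> h1 h2 h3 h4.
  have h5 : 0 < v * u by nra.
  nra.
have Hn t x : nice (K * / (1 + t ^ 2) * dk x) (fun y => f (vcons t y) x).
  split=> y; last by apply: Rle_trans (proj2 (Hs t) _ _) _; right; ring.
  apply: (cont2_lim (h := fun=> x) (proj1 (Hs t))); last exact: filterlim_const.
  exact: filterlim_id.
rewrite (gen_ext (g := fun t => Int (fun x => Int (fun y => f (vcons t y) x)))); last first.
  by move=> t; rewrite (IH _ _ (Hs t)).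
rewrite (@fub1 _ (K * PI ^ e) (fun t x => Int (fun y => f (vcons t y) x))) //.
split=> t x; last first.
  by apply: Rle_trans (Int_le (Hn t x)) _; right; ring.
apply/tendsP; apply: (Int_dct (f := fun p y => f (vcons p.1 y) p.2) (K := K)).
- apply: filter_forall => p; apply: nice_mono (Hn p.1 p.2).
  have := inv1p_pos p.1; have := dk_pos p.2 => h1 h2.
  rewrite Rmult_assoc -[X in _ <= X]Rmult_1_r; apply: Rmult_le_compat_l => //; nra.
- apply: nice_mono (Hn t x).
  have := inv1p_pos t; have := dk_pos x => h1 h2.
  rewrite Rmult_assoc -[X in _ <= X]Rmult_1_r; apply: Rmult_le_compat_l => //; nra.
move=> y; apply/tendsP.
apply: (cont2_lim (g := fun q : (R * ('I_d -> R)) * ('I_e -> R) => vcons q.1.1 q.2) (h := fun q => q.1.2) (proj1 Hf)).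
  apply: lim_vcons; last exact: filterlim_snd.
  exact: (filterlim_comp _ _ _ fst fst _ _ _ filterlim_fst filterlim_fst).
exact: (filterlim_comp _ _ _ fst snd _ _ _ filterlim_fst filterlim_snd).
Qed.

End Fubini.

(** * Fourier inversion at the origin *)

Notation CV := C_R_CompleteNormedModule.

(** From [exp x = exp (x / 2) ^ 2] and [exp (x / 2) >= 1 + x / 2]; it brings the damping factor [ek]
    under the majorant [dk]. *)
Lemma exp_neg_le x : 0 <= x -> exp (- x) <= 4 / (1 + x ^ 2).
Proof.
move=> hx.
have h1 : (1 + x ^ 2) / 4 <= exp x.
  have -> : exp x = exp (x / 2) * exp (x / 2) by rewrite -exp_plus; congr exp; field.
  have := exp_ineq1_le (x / 2) => h; nra.
have h2 : 0 < (1 + x ^ 2) / 4 by nra.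
rewrite exp_Ropp.
have -> : 4 / (1 + x ^ 2) = / ((1 + x ^ 2) / 4) by field; nra.
exact: Rinv_le_contravar.
Qed.

Lemma is_gen_tends (V : CompleteNormedModule R_AbsRing) (f : R -> V) (v : V) :
  (forall a b, ex_RInt f a b) -> tends pm (fun ab => RInt f ab.1 ab.2) v ->
  is_RInt_gen f (Rbar_locally m_infty) (Rbar_locally p_infty) v.
Proof.
move=> Hex /tendsP H P HP; have HP' := H P HP.
refine (@filter_imp _ pm _ _ _ _ HP') => ab Pab; exists (RInt f ab.1 ab.2); split; last exact: Pab.
exact: (@RInt_correct V).
Qed.

Lemma is_gen_lin (V W : CompleteNormedModule R_AbsRing) (L : V -> W) (f : R -> V) (v : V) :
  is_linear L ->
  is_RInt_gen f (Rbar_locally m_infty) (Rbar_locally p_infty) v ->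
  is_RInt_gen (fun x => L (f x)) (Rbar_locally m_infty) (Rbar_locally p_infty) (L v).
Proof.
move=> HL H P HP; have := H _ (linear_cont L v HL P HP).
apply: (@filter_imp _ pm) => ab [y [h1 h2]]; exists (L y); split=> //.
exact: is_RInt_lin.
Qed.

(** Integrand of the Fourier transform of [exp (- |x|)]. An elementary primitive exists on each half
    line, so the transform [2 / (1 + eta ^ 2)] is computed directly. *)
Definition ek1 (eta x : R) : CV := Cmult (RtoC (exp (- Rabs x))) (cis (x * eta)).

Lemma ek1_pos eta b : 0 <= b ->
  is_RInt (ek1 eta) 0 b
    ((exp (- b) * (- cos (b * eta) + eta * sin (b * eta)) + 1) / (1 + eta ^ 2),
     (exp (- b) * (- sin (b * eta) - eta * cos (b * eta)) + eta) / (1 + eta ^ 2)).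
Proof.
move=> hb; have he : 1 + eta ^ 2 <> 0 by nra.
apply: (is_RInt_ext (fun x => (exp (- x) * cos (x * eta), exp (- x) * sin (x * eta)))).
  move=> x; rewrite Rmin_left // Rmax_right // => hx.
  by rewrite /ek1 Rabs_pos_eq; [rewrite /Cmult /cis /RtoC /=; congr pair; ring | lra].
apply: (@is_RInt_fct_extend_pair R_NormedModule R_NormedModule) => /=.
- pose p x := exp (- x) * (- cos (x * eta) + eta * sin (x * eta)) / (1 + eta ^ 2).
  have -> : (exp (- b) * (- cos (b * eta) + eta * sin (b * eta)) + 1) / (1 + eta ^ 2) = minus (p b) (p 0).
    by rewrite /minus /plus /opp /= /p Ropp_0 exp_0 Rmult_0_l cos_0 sin_0; field.
  apply: (@is_RInt_derive R_CompleteNormedModule p) => x _.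
    by rewrite /p; auto_derive => //; field; nra.
  by apply: (@ex_derive_continuous R_AbsRing R_NormedModule); auto_derive.
- pose p x := exp (- x) * (- sin (x * eta) - eta * cos (x * eta)) / (1 + eta ^ 2).
  have -> : (exp (- b) * (- sin (b * eta) - eta * cos (b * eta)) + eta) / (1 + eta ^ 2) = minus (p b) (p 0).
    by rewrite /minus /plus /opp /= /p Ropp_0 exp_0 Rmult_0_l cos_0 sin_0; field.
  apply: (@is_RInt_derive R_CompleteNormedModule p) => x _.
    by rewrite /p; auto_derive => //; field; nra.
  by apply: (@ex_derive_continuous R_AbsRing R_NormedModule); auto_derive.
Qed.

Lemma ek1_neg eta a : a <= 0 ->
  is_RInt (ek1 eta) a 0
    ((1 - exp a * (cos (a * eta) + eta * sin (a * eta))) / (1 + eta ^ 2),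
     (- eta - exp a * (sin (a * eta) - eta * cos (a * eta))) / (1 + eta ^ 2)).
Proof.
move=> hb; have he : 1 + eta ^ 2 <> 0 by nra.
apply: (is_RInt_ext (fun x => (exp x * cos (x * eta), exp x * sin (x * eta)))).
  move=> x; rewrite Rmin_left // Rmax_right // => hx.
  rewrite /ek1 Rabs_left; last lra.
  by rewrite Ropp_involutive /Cmult /cis /RtoC /=; congr pair; ring.
apply: (@is_RInt_fct_extend_pair R_NormedModule R_NormedModule) => /=.
- pose p x := exp x * (cos (x * eta) + eta * sin (x * eta)) / (1 + eta ^ 2).
  have -> : (1 - exp a * (cos (a * eta) + eta * sin (a * eta))) / (1 + eta ^ 2) = minus (p 0) (p a).
    by rewrite /minus /plus /opp /= /p exp_0 Rmult_0_l cos_0 sin_0; field.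
  apply: (@is_RInt_derive R_CompleteNormedModule p) => x _.
    by rewrite /p; auto_derive => //; field; nra.
  by apply: (@ex_derive_continuous R_AbsRing R_NormedModule); auto_derive.
- pose p x := exp x * (sin (x * eta) - eta * cos (x * eta)) / (1 + eta ^ 2).
  have -> : (- eta - exp a * (sin (a * eta) - eta * cos (a * eta))) / (1 + eta ^ 2) = minus (p 0) (p a).
    by rewrite /minus /plus /opp /= /p exp_0 Rmult_0_l cos_0 sin_0; field.
  apply: (@is_RInt_derive R_CompleteNormedModule p) => x _.
    by rewrite /p; auto_derive => //; field; nra.
  by apply: (@ex_derive_continuous R_AbsRing R_NormedModule); auto_derive.
Qed.

Lemma trig_le eta t s : Rabs t <= 1 -> Rabs s <= 1 -> Rabs (t + eta * s) / (1 + eta ^ 2) <= 2.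
Proof.
move=> ht hs.
apply: (Rmult_le_reg_r (1 + eta ^ 2)); first nra.
rewrite /Rdiv Rmult_assoc Rinv_l; last nra.
have := Rabs_triang t (eta * s); rewrite Rabs_mult Rmult_1_r.
have := Rabs_pos eta; have := Rabs_pos s; rewrite -(pow2_abs eta) => h1 h2 h3.
have : Rabs eta * Rabs s <= Rabs eta by nra.
nra.
Qed.

Lemma abs_cos_le x : Rabs (cos x) <= 1.
Proof. by apply/Rabs_le; have := COS_bound x; lra. Qed.

Lemma abs_sin_le x : Rabs (sin x) <= 1.
Proof. by apply/Rabs_le; have := SIN_bound x; lra. Qed.

Lemma ek1_int eta :
  is_RInt_gen (ek1 eta) (Rbar_locally m_infty) (Rbar_locally p_infty) (RtoC (2 / (1 + eta ^ 2))).
Proof.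
have he : 1 + eta ^ 2 <> 0 by nra.
suff H : forall e, 0 < e -> pm (fun ab => exists y : CV, is_RInt (ek1 eta) ab.1 ab.2 y /\ dist y (RtoC (2 / (1 + eta ^ 2)) : CV) < e).
  move=> P HP.
  have [e He] : exists e, 0 < e /\ forall y : CV, dist y (RtoC (2 / (1 + eta ^ 2)) : CV) < e -> P y.
    have [e He] := HP; exists e; split; first exact: cond_pos.
    move=> y hy; apply: He; exact: norm_compat1.
  have := H e (proj1 He); apply: (@filter_imp _ pm) => ab [y [h1 h2]].
  by exists y; split=> //; apply: (proj2 He).
move=> e hepos.
(* Beyond [B] the exponentials are below [1 / B = e / 16]; real and imaginary part each deviate by
   at most four of them. *)
pose B := 16 / e.
have hB : 0 < B by apply: Rdiv_lt_0_compat; lra.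
apply: (@filter_imp _ pm _ _ _ _ (pm_ge B)) => [[a b]] [/= ha hb].
have ha0 : a <= 0 by lra.
have hb0 : 0 <= b by lra.
have Hi := @is_RInt_Chasles C_R_NormedModule (ek1 eta) a 0 b _ _ (@ek1_neg eta a ha0) (@ek1_pos eta b hb0).
eexists; split; first exact: Hi.
have hexp : forall x, B <= x -> exp (- x) < e / 16.
  move=> x hx; rewrite exp_Ropp.
  have h1 : 1 + x <= exp x by apply: exp_ineq1_le.
  have -> : e / 16 = / B by rewrite /B; field; lra.
  by apply: Rinv_lt_contravar; nra.
have hea := hexp (- a) ltac:(lra); rewrite Ropp_involutive in hea.
have heb := hexp b hb.
rewrite distC_mod; apply: Rle_lt_trans (Cmod_le_sum _) _ => /=.
set X := Rabs _; set Y := Rabs _.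
have pa := exp_pos a; have pb := exp_pos (- b).
have key : forall t s, Rabs t <= 1 -> Rabs s <= 1 -> forall r, 0 < r -> Rabs (r * (t + eta * s) / (1 + eta ^ 2)) <= 2 * r.
  move=> t s ht hs r hr; have := trig_le eta ht hs.
  rewrite /Rdiv !Rabs_mult (Rabs_pos_eq r); last lra.
  rewrite (Rabs_pos_eq (/ _)); last by left; apply: Rinv_0_lt_compat; nra.
  by move=> h; rewrite Rmult_assoc (Rmult_comm 2); apply: Rmult_le_compat_l; lra.
have hX : X <= 2 * exp a + 2 * exp (- b).
  rewrite /X.
  have -> : (1 - exp a * (cos (a * eta) + eta * sin (a * eta))) / (1 + eta * (eta * 1)) +
    (exp (- b) * (- cos (b * eta) + eta * sin (b * eta)) + 1) / (1 + eta * (eta * 1)) + - (2 / (1 + eta * (eta * 1)))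
    = - (exp a * (cos (a * eta) + eta * sin (a * eta)) / (1 + eta ^ 2)) + (exp (- b) * (- cos (b * eta) + eta * sin (b * eta)) / (1 + eta ^ 2)).
    by field.
  apply: Rle_trans (Rabs_triang _ _) _; rewrite Rabs_Ropp.
  apply: Rplus_le_compat; apply: key => //; rewrite ?Rabs_Ropp; by [apply: abs_cos_le | apply: abs_sin_le].
have hY : Y <= 2 * exp a + 2 * exp (- b).
  rewrite /Y.
  have -> : (- eta - exp a * (sin (a * eta) - eta * cos (a * eta))) / (1 + eta * (eta * 1)) +
    (exp (- b) * (- sin (b * eta) - eta * cos (b * eta)) + eta) / (1 + eta * (eta * 1)) + - 0
    = - (exp a * (sin (a * eta) + eta * - cos (a * eta)) / (1 + eta ^ 2)) + (exp (- b) * (- sin (b * eta) + eta * - cos (b * eta)) / (1 + eta ^ 2)).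
    by field.
  apply: Rle_trans (Rabs_triang _ _) _; rewrite Rabs_Ropp.
  apply: Rplus_le_compat; apply: key => //; rewrite ?Rabs_Ropp; by [apply: abs_cos_le | apply: abs_sin_le].
lra.
Qed.

(** The total mass of the kernel; this is where the [2 * PI] of Fourier inversion comes from. *)
Lemma pk1_int : is_RInt_gen (fun x => RtoC (2 / (1 + x ^ 2)) : CV) (Rbar_locally m_infty) (Rbar_locally p_infty) (RtoC (2 * PI)).
Proof.
have Hi a b : is_RInt (fun x => RtoC (2 / (1 + x ^ 2)) : CV) a b (RtoC (2 * (atan b - atan a))).
  apply: (@is_RInt_fct_extend_pair R_NormedModule R_NormedModule) => /=.
    exact: atan_int.
  have := @is_RInt_const R_NormedModule a b 0.
  by rewrite /scal /= /mult /= Rmult_0_r.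
apply: is_gen_tends => [a b|e he]; first by exists (RtoC (2 * (atan b - atan a))).
have [B [hB0 hB]] := atan_big (e := e / 8) ltac:(lra).
apply: (@filter_imp _ pm _ _ _ _ (pm_ge B)) => [[a b]] [/= ha hb].
rewrite (is_RInt_unique _ _ _ _ (Hi a b)) distC_mod.
have -> : Cminus (RtoC (2 * (atan b - atan a))) (RtoC (2 * PI)) = RtoC (2 * (atan b - atan a) - 2 * PI).
  by rewrite RtoC_minus.
rewrite Cmod_R.
have h1 := hB b hb; have h2 := hB (- a) ltac:(lra).
move: h2; rewrite atan_opp => h2.
have := atan_bound a; have := atan_bound b => h3 h4.
by apply: Rabs_def1; lra.
Qed.

Lemma is_linear_Cmult_l (c : C) : @is_linear R_AbsRing CV CV (Cmult c).
Proof.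
split.
- move=> x y; change (Cmult c (Cplus x y) = Cplus (Cmult c x) (Cmult c y)); ring.
- by move=> k [x1 x2]; case: c => c1 c2; rewrite /scal /= /prod_scal /scal /= /mult /= /Cmult /=; congr pair; ring.
- exists (Cmod c + 1); split; first by have := Cmod_ge_0 c; lra.
  move=> x; rewrite !normC Cmod_mult; have := Cmod_ge_0 x; nra.
Qed.

Lemma is_linear_Cmult_r (c : C) : @is_linear R_AbsRing CV CV (fun x => Cmult x c).
Proof.
have -> : (fun x => Cmult x c) = Cmult c by apply: functional_extensionality => x; rewrite Cmult_comm.
exact: is_linear_Cmult_l.
Qed.

Lemma is_int_cons_prod d (c : R -> CV) (f : ('I_d -> R) -> CV) w v :
  is_RInt_gen c (Rbar_locally m_infty) (Rbar_locally p_infty) w -> is_int f v ->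
  is_int (fun x : 'I_d.+1 -> R => Cmult (c (x ord0)) (f (vtl x))) (Cmult w v).
Proof.
move=> Hc Hf; exists (fun t => Cmult (c t) v); split; last first.
  exact: (is_gen_lin (is_linear_Cmult_r v)).
move=> t; have := is_int_lin (is_linear_Cmult_l (c t)) Hf.
apply: is_int_ext => x; rewrite vcons0; congr (Cmult _ (f _)).
by apply: functional_extensionality => i; rewrite /vtl vconsS.
Qed.

(** Abel's damping factor and, in [pk], its Fourier transform, a Poisson kernel up to
    normalization. *)
Definition ek d (x : 'I_d -> R) : R := \big[Rmult/1]_(i < d) exp (- Rabs (x i)).
Definition pk d (x : 'I_d -> R) : R := \big[Rmult/1]_(i < d) (2 / (1 + x i ^ 2)).

Lemma dot_cons d (x y : 'I_d.+1 -> R) : dot x y = x ord0 * y ord0 + dot (vtl x) (vtl y).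
Proof. by rewrite /dot /sumR big_ord_recl. Qed.

Lemma Cmult4 (a b c d : C) : Cmult (Cmult a b) (Cmult c d) = Cmult (Cmult a c) (Cmult b d).
Proof. ring. Qed.

Lemma is_int_ek d (eta : 'I_d -> R) :
  is_int (fun x => Cmult (RtoC (ek x)) (cis (dot x eta)) : CV) (RtoC (pk eta)).
Proof.
elim: d eta => [|d IH] eta.
  rewrite /= /ek /pk /dot /sumR !big_ord0 cis0; by rewrite -RtoC_mult Rmult_1_l.
rewrite /pk big_ord_recl RtoC_mult.
have := is_int_cons_prod (@ek1_int (eta ord0)) (IH (vtl eta)).
move=> HH; refine (@is_int_ext CV _ _ _ _ _ HH) => x; rewrite /ek1 dot_cons cisD /ek big_ord_recl RtoC_mult -!/(ek _).
exact: Cmult4.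
Qed.

Lemma is_int_pk d : is_int (fun x : 'I_d -> R => RtoC (pk x) : CV) (RtoC ((2 * PI) ^ d)).
Proof.
elim: d => [|d IH]; first by rewrite /= /pk big_ord0.
have := is_int_cons_prod pk1_int IH; rewrite -RtoC_mult.
move=> HH; refine (@is_int_ext CV _ _ _ _ _ HH) => x.
by rewrite /pk big_ord_recl RtoC_mult.
Qed.

Lemma prodR_scale d (a b : 'I_d -> R) c : 0 <= c -> (forall i, 0 <= a i <= c * b i) ->
  0 <= \big[Rmult/1]_(i < d) a i <= c ^ d * \big[Rmult/1]_(i < d) b i.
Proof.
move=> hc; elim: d a b => [|d IH] a b H; first by rewrite !big_ord0 /=; lra.
rewrite !big_ord_recl /=.
have [h1 h2] := IH (fun i => a (lift ord0 i)) (fun i => b (lift ord0 i)) (fun i => H _).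
have [h3 h4] := H ord0.
split; first exact: Rmult_le_pos.
have -> : forall p q u v, p * q * (u * v) = (p * u) * (q * v) by move=> *; ring.
exact: Rmult_le_compat.
Qed.

Lemma ek_pos d (x : 'I_d -> R) : 0 < ek x <= 1.
Proof.
rewrite /ek; elim/big_ind: _ => [|a b [] ? ? [] ? ?|i _]; [lra | by split; nra |].
split; first exact: exp_pos.
rewrite -[X in _ <= X]exp_0; case: (Req_dec (x i) 0) => [->|h].
  by rewrite Rabs_R0 Ropp_0; lra.
by left; apply: exp_increasing; have := Rabs_pos_lt _ h; lra.
Qed.

(** Coordinatewise, [4 / (1 + del ^ 2 * x ^ 2)] is at most [4 / (del ^ 2 * (1 + x ^ 2))] because
    [del <= 1]. *)
Lemma ek_dk d (x : 'I_d -> R) del : 0 < del <= 1 ->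
  ek (fun i => del * x i) <= (4 / del ^ 2) ^ d * dk x.
Proof.
move=> hd; have hd2 : 0 < del ^ 2 by nra.
apply: (proj2 (prodR_scale _ _)) => [|i].
  by left; apply: Rdiv_lt_0_compat; lra.
split; first by left; apply: exp_pos.
apply: Rle_trans (exp_neg_le (Rabs_pos _)) _; rewrite pow2_abs.
have -> : 4 / del ^ 2 * / (1 + x i ^ 2) = 4 * / (del ^ 2 * (1 + x i ^ 2)).
  by field; split; nra.
apply: Rmult_le_compat_l; first lra.
apply: Rinv_le_contravar; nra.
Qed.

Lemma pk_dk d (x : 'I_d -> R) : pk x = 2 ^ d * dk x.
Proof.
rewrite /pk /dk; elim: d x => [|d IH] x; first by rewrite !big_ord0 /=; ring.
by rewrite !big_ord_recl IH /= /Rdiv; ring.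
Qed.

Lemma sumR_ext d (x y : 'I_d -> R) : (forall i, x i = y i) -> sumR x = sumR y.
Proof. by move=> /functional_extensionality ->. Qed.

Lemma sumRS d (x : 'I_d.+1 -> R) : sumR x = x ord0 + sumR (vtl x).
Proof. by rewrite /sumR big_ord_recl. Qed.

Lemma sumR0 (x : 'I_0 -> R) : sumR x = 0.
Proof. by rewrite /sumR big_ord0. Qed.

Lemma sumR_plus d (x y : 'I_d -> R) : sumR (fun i => x i + y i) = sumR x + sumR y.
Proof.
elim: d x y => [|d IH] x y; first by rewrite !sumR0; ring.
by rewrite !sumRS /= (IH (vtl x) (vtl y)); ring.
Qed.

Lemma sumR_scal d r (x : 'I_d -> R) : sumR (fun i => r * x i) = r * sumR x.
Proof.
elim: d x => [|d IH] x; first by rewrite !sumR0; ring.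
by rewrite !sumRS /= (IH (vtl x)); ring.
Qed.

Lemma sumR_le d (x y : 'I_d -> R) : (forall i, x i <= y i) -> sumR x <= sumR y.
Proof.
elim: d x y => [|d IH] x y H; first by rewrite !sumR0; lra.
by rewrite !sumRS; apply: Rplus_le_compat => //; apply: IH => i; apply: H.
Qed.

Lemma sumR_zero d : sumR (fun _ : 'I_d => 0) = 0.
Proof. by elim: d => [|d IH]; rewrite ?sumR0 // sumRS IH; ring. Qed.

Lemma dotC d (x y : 'I_d -> R) : dot x y = dot y x.
Proof. by apply: sumR_ext => i; ring. Qed.

Lemma dotZl d r (x y : 'I_d -> R) : dot (fun i => r * x i) y = r * dot x y.
Proof. by rewrite /dot -sumR_scal; apply: sumR_ext => i; ring. Qed.

Lemma dotDl d (x x' y : 'I_d -> R) : dot (fun i => x i + x' i) y = dot x y + dot x' y.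
Proof. by rewrite /dot -sumR_plus; apply: sumR_ext => i; ring. Qed.

Lemma dotZr d r (x y : 'I_d -> R) : dot x (fun i => r * y i) = r * dot x y.
Proof. by rewrite dotC dotZl dotC. Qed.

Lemma dotDr d (x y y' : 'I_d -> R) : dot x (fun i => y i + y' i) = dot x y + dot x y'.
Proof. by rewrite dotC dotDl !(dotC x). Qed.

Lemma nice2_Int (V : CompleteNormedModule R_AbsRing) e d K
    (f : ('I_e -> R) -> ('I_d -> R) -> V) : nice2 K f ->
  nice (K * PI ^ e) (fun x => Int (fun y => f y x)).
Proof.
move=> Hf.
have Hn x : nice (K * dk x) (fun y => f y x).
  split=> y; last by apply: Rle_trans (proj2 Hf y x) _; right; ring.
  exact: cont2_l (proj1 Hf).
split=> x; last by apply: Rle_trans (Int_le (Hn x)) _; right; ring.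
have HK : 0 <= K by have := nice_K (Hn x); have := dk_pos x => h1 h2; nra.
have Hn' z : nice K (fun y => f y z).
  by apply: nice_mono (Hn z); have := dk_pos z => h; nra.
apply/contP; apply: (Int_dct (f := fun z y => f y z) (K := K)).
- by apply: filter_forall => z.
- exact: Hn'.
move=> y; apply/tendsP.
by apply: (cont2_lim (g := snd) (h := fst) (proj1 Hf)); [exact: filterlim_snd | exact: filterlim_fst].
Qed.

Lemma lim_RtoC T (F : (T -> Prop) -> Prop) {FF : Filter F} (f : T -> R) v :
  filterlim f F (locally v) -> filterlim (fun t => RtoC (f t)) F (@locally C_R_NormedModule (RtoC v)).
Proof.
move=> /(@tendsP _ R_NormedModule) H; apply/(@tendsP _ C_R_NormedModule) => e he.
apply: filter_imp (H e he) => t ht.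
rewrite distC_mod; have -> : Cminus (RtoC (f t)) (RtoC v) = RtoC (f t - v) by rewrite RtoC_minus.
by rewrite Cmod_R.
Qed.

Lemma lim_scalv T (F : (T -> Prop) -> Prop) {FF : Filter F} d (f : T -> R) (g : T -> 'I_d -> R) r x :
  filterlim f F (locally r) -> filterlim g F (locally x) ->
  filterlim (fun t i => f t * g t i) F (locally (fun i => r * x i)).
Proof.
move=> Hf Hg; apply: (lim_vec (g := fun t i => f t * g t i)) => i.
by apply: lim_Rmult => //; apply: lim_coord.
Qed.

Lemma lim_proj d (u : 'I_d -> R) i : filterlim (fun t : 'I_d -> R => t i) (locally u) (locally (u i)).
Proof. by apply: (@lim_coord _ (locally u) _ (fun t => t) u i); exact: filterlim_id. Qed.

Lemma cont_expabs x : continuous (fun x => exp (- Rabs x)) x.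
Proof.
apply: (continuous_comp (fun x => - Rabs x) exp).
  by apply: (@continuous_opp _ _ R_NormedModule); exact: continuous_Rabs.
exact: continuous_exp.
Qed.

Lemma lim_ek T (F : (T -> Prop) -> Prop) {FF : Filter F} d (g : T -> 'I_d -> R) x :
  filterlim g F (locally x) -> filterlim (fun t => ek (g t)) F (locally (ek x)).
Proof.
move=> Hg; apply: (lim_prodR (f := fun t i => exp (- Rabs (g t i)))) => i.
by apply: (lim_comp (h := fun x => exp (- Rabs x))); [apply: lim_coord | exact: cont_expabs].
Qed.

Lemma lim_Ropp T (F : (T -> Prop) -> Prop) {FF : Filter F} (f : T -> R) v :
  filterlim f F (locally v) -> filterlim (fun t => - f t) F (locally (- v)).
Proof.
move=> H; apply: (lim_comp (h := Ropp)) => //.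
by apply: (@continuous_opp _ _ R_NormedModule (fun x => x)); exact: continuous_id.
Qed.

Lemma at_right_id : filterlim (fun t : R => t) (at_right 0) (locally 0).
Proof. by move=> P [e He]; exists e => y hy _; apply: He. Qed.

Lemma at_right_01 : at_right 0 (fun t => 0 < t <= 1).
Proof.
exists (mkposreal _ Rlt_0_1) => y; rewrite /ball /= /AbsRing_ball /= /abs /minus /plus /opp /=.
by move=> /Rabs_def2 [h _] hy; lra.
Qed.

Lemma at_right_proper : ProperFilter (at_right 0).
Proof. exact: at_right_proper_filter. Qed.

Section Inversion.
Variables (d : nat) (f : ('I_d -> R) -> CV) (K K' : R).
Hypothesis Hf : nice K f.
Let G (eta : 'I_d -> R) : CV := Int (fun s => Cmult (f s) (cis (- dot s eta)) : CV).
Hypothesis HG : nice K' G.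

Let HK : 0 <= K. Proof. exact: nice_K Hf. Qed.

Let F (del : R) (eta s : 'I_d -> R) : CV :=
  Cmult (RtoC (ek (fun i => del * eta i))) (Cmult (f s) (cis (- dot s eta))).

(** The undamped integrand has no decay in [eta]; the factor [ek] supplies it, with a constant that
    blows up as [del] tends to [0]. *)
Let F_nice2 del : 0 < del <= 1 -> nice2 (K * (4 / del ^ 2) ^ d) (F del).
Proof.
move=> hd; split=> [eta s|eta s].
  apply: lim_Cmult.
    by apply: lim_RtoC; apply: lim_ek; apply: lim_scalv; [exact: filterlim_const | exact: filterlim_fst].
  apply: lim_Cmult.
    by apply: lim_comp; [exact: filterlim_snd | apply: (proj1 Hf)].
  by apply: lim_cis; apply: lim_Ropp; apply: lim_dot; [exact: filterlim_snd | exact: filterlim_fst].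
rewrite /F normC !Cmod_mult Cmod_cis Cmod_R Rmult_1_r Rabs_pos_eq; last by left; apply: (proj1 (ek_pos _)).
have h1 := ek_dk eta hd; have h2 := proj2 Hf s; rewrite normC in h2.
have h3 := Cmod_ge_0 (f s); have h4 := ek_pos (fun i => del * eta i).
have -> : K * (4 / del ^ 2) ^ d * dk eta * dk s = ((4 / del ^ 2) ^ d * dk eta) * (K * dk s) by ring.
by apply: Rmult_le_compat; lra.
Qed.

Let slice_nice eta : nice K (fun s => Cmult (f s) (cis (- dot s eta)) : CV).
Proof.
split=> s.
  apply: lim_Cmult; first exact: (proj1 Hf).
  by apply: lim_cis; apply: lim_Ropp; apply: lim_dot; [exact: filterlim_id | exact: filterlim_const].
by rewrite normC Cmod_mult Cmod_cis Rmult_1_r -normC; exact: (proj2 Hf).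
Qed.

(** The [eta]-integral of the damping factor is a Poisson kernel concentrated at scale [del]. *)
Let inner del s : 0 < del <= 1 ->
  Int (fun eta => F del eta s) = Cmult (f s) (RtoC (/ del ^ d * pk (fun i => s i * / del))).
Proof.
move=> hd; apply: Int_unique.
have hd0 : del ^ d <> 0 by apply: pow_nonzero; lra.
have := is_int_ek (fun i => s i * - / del).
have -> : pk (fun i => s i * - / del) = pk (fun i => s i * / del).
  by rewrite /pk; congr bigop; apply: functional_extensionality => i; congr BigBody; congr (2 / (1 + _)); ring.
move/(@is_int_affine CV _ _ del (fun=> 0) _ (proj1 hd)) => H.
have := is_int_lin (is_linear_Cmult_l (Cmult (f s) (RtoC (/ del ^ d)))) H.
have E1 : Cmult (Cmult (f s) (RtoC (/ del ^ d))) (RtoC (pk (fun i => s i * / del))) =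
   Cmult (f s) (RtoC (/ del ^ d * pk (fun i => s i * / del))) by rewrite RtoC_mult; ring.
rewrite E1 => HH; refine (@is_int_ext CV _ _ _ _ _ HH) => eta.
have -> : (fun i => del * eta i + 0) = (fun i => del * eta i) by apply: functional_extensionality => i; ring.
have -> : dot (fun i => del * eta i) (fun i => s i * - / del) = - dot s eta.
  have -> : - dot s eta = -1 * dot s eta by ring.
  by rewrite /dot -sumR_scal; apply: sumR_ext => i; field; lra.
have HS : forall (r : R) (z : C), @scal R_Ring CV r z = Cmult (RtoC r) z.
  by move=> r [z1 z2]; rewrite /scal /= /prod_scal /scal /= /mult /= /Cmult /=; congr pair; ring.
rewrite HS /F.
have E2 : forall a b c e g : C, Cmult b c = RtoC 1 -> Cmult (Cmult a b) (Cmult c (Cmult e g)) = Cmult e (Cmult a g).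
  move=> a b c e g h.
  have -> : Cmult (Cmult a b) (Cmult c (Cmult e g)) = Cmult (Cmult b c) (Cmult e (Cmult a g)) by ring.
  by rewrite h Cmult_1_l.
by apply: E2; rewrite -RtoC_mult Rinv_l.
Qed.

Let damped del : 0 < del <= 1 ->
  Int (fun eta => Cmult (RtoC (ek (fun i => del * eta i))) (G eta) : CV) =
  Int (fun u => Cmult (f (fun i => del * u i)) (RtoC (pk u)) : CV).
Proof.
move=> hd.
rewrite (Int_ext (g := fun eta => Int (F del eta))); last first.
  by move=> eta; rewrite /F (Int_lin (is_linear_Cmult_l _) (slice_nice eta)).
rewrite (fubini (F_nice2 hd)).
have Hn := nice2_Int (F_nice2 hd).
symmetry; apply: Int_unique.
have := @is_int_affine CV _ _ del (fun=> 0) _ (proj1 hd) (Int_is_int Hn).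
apply: is_int_ext => u; rewrite inner //.
have hd0 : del ^ d <> 0 by apply: pow_nonzero; lra.
have -> : (fun i => del * u i + 0) = (fun i => del * u i) by apply: functional_extensionality => i; ring.
have -> : (fun i => (del * u i + 0) * / del) = u by apply: functional_extensionality => i; field; lra.
have HS : forall (r : R) (z : C), @scal R_Ring CV r z = Cmult (RtoC r) z.
  by move=> r [z1 z2]; rewrite /scal /= /prod_scal /scal /= /mult /= /Cmult /=; congr pair; ring.
rewrite HS.
have E2 : forall a b c e : C, Cmult a b = RtoC 1 -> Cmult a (Cmult e (Cmult b c)) = Cmult e c.
  move=> a b c e h.
  have -> : Cmult a (Cmult e (Cmult b c)) = Cmult (Cmult a b) (Cmult e c) by ring.
  by rewrite h Cmult_1_l.
by rewrite RtoC_mult; apply: E2; rewrite -RtoC_mult Rinv_r.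
Qed.

(** The factor [exp (- del |eta|)], whose transform is a Poisson kernel, makes Fubini's
    theorem applicable; then [del] tends to [0]. *)
Lemma fourier_inversion0 : Int G = Cmult (f (fun=> 0)) (RtoC ((2 * PI) ^ d)).
Proof.
(* The damping factor tends to [1] and never exceeds it, so the bound on [G] is the majorant. *)
have L1 : tends (at_right 0) (fun del => Int (fun eta => Cmult (RtoC (ek (fun i => del * eta i))) (G eta) : CV)) (Int G).
  apply: (Int_dct (f := fun del eta => Cmult (RtoC (ek (fun i => del * eta i))) (G eta) : CV) (K := K')).
  - apply: filter_forall => del; split=> eta.
      apply: lim_Cmult; last exact: (proj1 HG).
      by apply: lim_RtoC; apply: lim_ek; apply: lim_scalv; [exact: filterlim_const | exact: filterlim_id].
    have h1 := proj2 HG eta; rewrite normC Cmod_mult Cmod_R Rabs_pos_eq; last by left; apply: (proj1 (ek_pos _)).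
    rewrite normC in h1.
    have := ek_pos (fun i => del * eta i); have := Cmod_ge_0 (G eta); nra.
  - exact: HG.
  move=> eta; apply/tendsP.
  have -> : G eta = Cmult (RtoC (ek (fun i => 0 * eta i))) (G eta).
    have -> : ek (fun i => 0 * eta i) = 1.
      rewrite /ek; apply: (big_ind (fun x => x = 1)) => [//|x y -> ->|i _]; first by ring.
      by rewrite Rmult_0_l Rabs_R0 Ropp_0 exp_0.
    by rewrite Cmult_1_l.
  apply: lim_Cmult.
    apply: lim_RtoC; apply: lim_ek; apply: lim_scalv; last exact: filterlim_snd.
    exact: (filterlim_comp _ _ _ fst (fun t => t) _ (at_right 0) _ filterlim_fst at_right_id).
  by apply: lim_comp; [exact: filterlim_snd | apply: (proj1 HG)].
(* After the substitution [s = del * u] the kernel no longer depends on [del], and [f (del * u)]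
   tends to [f 0]. *)
have L2 : tends (at_right 0) (fun del => Int (fun u => Cmult (f (fun i => del * u i)) (RtoC (pk u)) : CV))
            (Int (fun u : 'I_d -> R => Cmult (f (fun=> 0)) (RtoC (pk u)) : CV)).
  have Hb del : nice (K * 2 ^ d) (fun u => Cmult (f (fun i => del * u i)) (RtoC (pk u)) : CV).
    split=> u.
      apply: lim_Cmult.
        by apply: lim_comp; [apply: lim_scalv; [exact: filterlim_const | exact: filterlim_id] | apply: (proj1 Hf)].
      apply: lim_RtoC; apply: (lim_prodR (f := fun (t : 'I_d -> R) i => 2 / (1 + t i ^ 2))) => i.
      apply: (lim_comp (h := fun x => 2 / (1 + x ^ 2))); first exact: lim_proj.
      by apply: (@ex_derive_continuous R_AbsRing R_NormedModule); auto_derive; nra.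
    rewrite normC Cmod_mult Cmod_R pk_dk; have h2 : 0 < 2 ^ d by apply: pow_lt; lra.
    have := dk_pos u => hu; rewrite Rabs_pos_eq; last by nra.
    have h3 := proj2 Hf (fun i => del * u i); rewrite normC in h3.
    have := dk_pos (fun i => del * u i) => hu2.
    rewrite Rmult_assoc; apply: Rmult_le_compat_r; first nra.
    by apply: Rle_trans h3 _; nra.
  have -> : Int (fun u : 'I_d -> R => Cmult (f (fun=> 0)) (RtoC (pk u)) : CV) = Int (fun u => Cmult (f (fun i => 0 * u i)) (RtoC (pk u)) : CV).
    apply: Int_ext => u; congr (Cmult (f _) _).
    by apply: functional_extensionality => i; ring.
  apply: (Int_dct (f := fun del u => Cmult (f (fun i => del * u i)) (RtoC (pk u)) : CV) (K := K * 2 ^ d)).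
  - exact: filter_forall.
  - exact: Hb.
  move=> u; apply/tendsP; apply: lim_Cmult.
    apply: lim_comp; last exact: (proj1 Hf).
    apply: lim_scalv; last exact: filterlim_snd.
    exact: (filterlim_comp _ _ _ fst (fun t => t) _ (at_right 0) _ filterlim_fst at_right_id).
  apply: lim_RtoC; apply: (lim_prodR (f := fun (t : R * ('I_d -> R)) i => 2 / (1 + t.2 i ^ 2))) => i.
  apply: (lim_comp (h := fun x => 2 / (1 + x ^ 2))); first by apply: (lim_coord (g := snd)); exact: filterlim_snd.
  by apply: (@ex_derive_continuous R_AbsRing R_NormedModule); auto_derive; nra.
have <- : Int (fun u : 'I_d -> R => Cmult (f (fun=> 0)) (RtoC (pk u)) : CV) = Cmult (f (fun=> 0)) (RtoC ((2 * PI) ^ d)).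
  by apply: Int_unique; apply: (is_int_lin (is_linear_Cmult_l _) (@is_int_pk d)).
apply: (@tends_unique _ CV (at_right 0) _ _ _ _ L1).
apply: tends_ext_ev L2.
by apply: filter_imp at_right_01 => del hd; rewrite damped.
Qed.

End Inversion.

(** * Decay of Fourier transforms *)

Lemma scalC (r : R) (z : CV) : scal r z = Cmult (RtoC r) z.
Proof. by case: z => z1 z2; rewrite /scal /= /prod_scal /scal /= /mult /= /Cmult /=; congr pair; ring. Qed.

Lemma minusC (z w : CV) : minus z w = Cminus z w. Proof. by []. Qed.
Lemma plusC (z w : CV) : plus z w = Cplus z w. Proof. by []. Qed.

Lemma tends_pair T (F : (T -> Prop) -> Prop) {FF : Filter F} (f : T -> C) (l : C) :
  tends (V := R_NormedModule) F (fun t => (f t).1) l.1 ->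
  tends (V := R_NormedModule) F (fun t => (f t).2) l.2 -> tends (V := CV) F f l.
Proof.
move=> H1 H2 e he; have he2 : 0 < e / 2 by lra.
apply: filter_imp (filter_and _ _ (H1 _ he2) (H2 _ he2)) => t [h1 h2].
rewrite distC_mod; apply: Rle_lt_trans (Cmod_le_sum _) _.
have h1' : Rabs ((f t).1 + - l.1) < e / 2 by exact: h1.
have h2' : Rabs ((f t).2 + - l.2) < e / 2 by exact: h2.
rewrite /=; lra.
Qed.

Lemma Rabs_snd_le (z : C) : Rabs z.2 <= Cmod z.
Proof. exact: Rle_trans (Rmax_r _ _) (Rmax_Cmod z). Qed.

Lemma tends_fst T (F : (T -> Prop) -> Prop) {FF : Filter F} (f : T -> C) (l : C) :
  tends (V := CV) F f l -> tends (V := R_NormedModule) F (fun t => (f t).1) l.1.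
Proof.
move=> H e he; apply: filter_imp (H e he) => t; rewrite distC_mod => h.
exact: Rle_lt_trans (re_le_Cmod (Cminus (f t) l)) h.
Qed.

Lemma tends_snd T (F : (T -> Prop) -> Prop) {FF : Filter F} (f : T -> C) (l : C) :
  tends (V := CV) F f l -> tends (V := R_NormedModule) F (fun t => (f t).2) l.2.
Proof.
move=> H e he; apply: filter_imp (H e he) => t; rewrite distC_mod => h.
exact: Rle_lt_trans (Rabs_snd_le (Cminus (f t) l)) h.
Qed.

Definition derC (f : R -> C) (x : R) (l : C) : Prop := @is_derive R_AbsRing CV f x l.

Lemma derC_pair (f : R -> C) x l :
  derC f x l <-> is_derive (fun t => (f t).1) x l.1 /\ is_derive (fun t => (f t).2) x l.2.
Proof.
rewrite /derC; split.
- move=> /is_deriveP H; split; apply/is_deriveP.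
    exact: (tends_fst H).
  exact: (tends_snd H).
- move=> [/is_deriveP H1 /is_deriveP H2]; apply/is_deriveP.
  by apply: tends_pair.
Qed.

Lemma derC_cis a b x : derC (fun t => cis (a + b * t)) x (Cmult (0, b) (cis (a + b * x))).
Proof. by apply/derC_pair; rewrite /cis /=; split; auto_derive => //; ring. Qed.

Lemma derC_mult (f g : R -> C) x f' g' :
  derC f x f' -> derC g x g' -> derC (fun t => Cmult (f t) (g t)) x (Cplus (Cmult f' (g x)) (Cmult (f x) g')).
Proof.
move=> /derC_pair [H1 H2] /derC_pair [H3 H4]; apply/derC_pair; rewrite /Cmult /Cplus /=; split.
- have -> : f'.1 * (g x).1 - f'.2 * (g x).2 + ((f x).1 * g'.1 - (f x).2 * g'.2) =
    minus (plus (mult f'.1 (g x).1) (mult (f x).1 g'.1)) (plus (mult f'.2 (g x).2) (mult (f x).2 g'.2)).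
    by rewrite /minus /plus /mult /opp /=; ring.
  apply: (@is_derive_minus R_AbsRing R_NormedModule); apply: (@is_derive_mult R_AbsRing) => //; exact: Rmult_comm.
- have -> : f'.1 * (g x).2 + f'.2 * (g x).1 + ((f x).1 * g'.2 + (f x).2 * g'.1) =
    plus (plus (mult f'.1 (g x).2) (mult (f x).1 g'.2)) (plus (mult f'.2 (g x).1) (mult (f x).2 g'.1)).
    by rewrite /minus /plus /mult /opp /=; ring.
  apply: (@is_derive_plus R_AbsRing R_NormedModule); apply: (@is_derive_mult R_AbsRing) => //; exact: Rmult_comm.
Qed.

Lemma shift0 d (x : 'I_d -> R) i : shift x i 0 = x.
Proof. by apply: functional_extensionality => k; rewrite /shift; case: (k == i); rewrite ?Rplus_0_r. Qed.

Lemma shift_shift d (x : 'I_d -> R) i s t : shift (shift x i s) i t = shift x i (s + t).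
Proof. by apply: functional_extensionality => k; rewrite /shift; case: (k == i); rewrite ?Rplus_assoc. Qed.

Lemma shiftE d (x : 'I_d -> R) i t : shift x i t = fun k => x k + (if k == i then t else 0).
Proof. by apply: functional_extensionality => k; rewrite /shift; case: (k == i); rewrite ?Rplus_0_r. Qed.

Lemma lim_shift T (F : (T -> Prop) -> Prop) {FF : Filter F} d (f : T -> 'I_d -> R) (g : T -> R) x r i :
  filterlim f F (locally x) -> filterlim g F (locally r) ->
  filterlim (fun t => shift (f t) i (g t)) F (locally (shift x i r)).
Proof.
move=> Hf Hg; apply: lim_vec => k; rewrite /shift; case: (k == i); last exact: lim_coord.
by apply: lim_Rplus => //; apply: lim_coord.
Qed.

Definition pder (V : NormedModule R_AbsRing) d (i : 'I_d) (f g : ('I_d -> R) -> V) : Prop :=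
  forall x, is_derive (fun t => f (shift x i t)) 0 (g x).

Lemma pder_at (V : NormedModule R_AbsRing) d (i : 'I_d) (f g : ('I_d -> R) -> V) x t :
  pder i f g -> is_derive (fun t => f (shift x i t)) t (g (shift x i t)).
Proof.
move=> /(_ (shift x i t)) /is_deriveP H; apply/is_deriveP.
apply: tends_ext H => h; rewrite !shift_shift Rplus_0_l Rplus_0_r //.
Qed.

Lemma dot_shift d (x y : 'I_d -> R) i t : dot (shift x i t) y = dot x y + y i * t.
Proof.
rewrite shiftE dotDl; congr (_ + _).
rewrite /dot /sumR.
elim: d x y i => [|d IH] x y i; first by case: i.
rewrite big_ord_recl /=; case: (unliftP ord0 i) => [j|] -> /=.
  rewrite Rmult_0_l Rplus_0_l -(IH (vtl x) (vtl y) j).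
  by apply: eq_bigr => k _; rewrite (inj_eq lift_inj).
rewrite -[RHS]Rplus_0_r; congr (_ + _); first by ring.
apply: (big_ind (fun x => x = 0)) => [//|a b -> ->|k _]; first by ring.
by ring.
Qed.

Section IBP.
Variables (V : CompleteNormedModule R_AbsRing) (d : nat) (i : 'I_d).
Variables (f g : ('I_d -> R) -> V) (K K' : R).
Hypotheses (Hf : nice K f) (Hg : nice K' g) (Hd : pder i f g).

(** As with [avg]: the difference quotient of [f] for [h <> 0], and [g] at [h = 0]. *)
Let D (h : R) (x : 'I_d -> R) : V := RInt (fun u => g (shift x i (h * u + 0))) 0 1.

(** In each coordinate [1 + x ^ 2 <= 3 * (1 + (x + t) ^ 2)] when [|t| <= 1]; the majorant thus
    survives small shifts. *)
Lemma dk_shift (x : 'I_d -> R) t : Rabs t <= 1 -> dk (shift x i t) <= 3 ^ d * dk x.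
Proof.
move=> ht; apply: (proj2 (prodR_scale _ _)) => [|k]; first lra.
split; first by left; apply: (proj1 (inv1p_pos _)).
have ht2 : t ^ 2 <= 1 by rewrite -pow2_abs; have := Rabs_pos t; nra.
have -> : 3 * / (1 + x k ^ 2) = / ((1 + x k ^ 2) / 3) by field; nra.
apply: Rinv_le_contravar; first nra.
rewrite /shift; case: (k == i); last nra.
have := Rle_0_sqr (x k + 2 * t); rewrite /Rsqr; nra.
Qed.

Let line_cont h x u : continuous (fun u => g (shift x i (h * u + 0))) u.
Proof.
apply: (lim_comp (f := fun u => shift x i (h * u + 0)) (h := g)); last exact: (proj1 Hg).
apply: lim_shift; first exact: filterlim_const.
apply: lim_Rplus; last exact: filterlim_const.
by apply: lim_Rmult; [exact: filterlim_const | exact: filterlim_id].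
Qed.

Let D_cont : cont2 D.
Proof.
move=> h0 x0; apply/tendsP; apply: (RInt_dct (f := fun p u => g (shift p.2 i (p.1 * u + 0)))); first lra.
- by apply: filter_forall => p u; apply: line_cont.
- by move=> u; apply: line_cont.
move=> u; apply/tendsP.
apply: (lim_comp (f := fun q : (R * ('I_d -> R)) * R => shift q.1.2 i (q.1.1 * q.2 + 0)) (h := g)); last exact: (proj1 Hg).
apply: lim_shift.
  exact: (filterlim_comp _ _ _ fst snd _ _ _ filterlim_fst filterlim_snd).
apply: lim_Rplus; last exact: filterlim_const.
apply: lim_Rmult; last exact: filterlim_snd.
exact: (filterlim_comp _ _ _ fst fst _ _ _ filterlim_fst filterlim_fst).
Qed.

Let D_nice h : Rabs h <= 1 -> nice (K' * 3 ^ d) (D h).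
Proof.
move=> hh; split=> x; first exact: cont2_r D_cont.
have -> : K' * 3 ^ d * dk x = scal (1 - 0) (K' * 3 ^ d * dk x) by rewrite /scal /= /mult /=; ring.
apply: (@norm_RInt_le V (fun u => g (shift x i (h * u + 0))) (fun=> K' * 3 ^ d * dk x) 0 1).
- lra.
- move=> u hu; apply: Rle_trans (proj2 Hg _) _; rewrite Rmult_assoc.
  apply: Rmult_le_compat_l; first exact: nice_K Hg.
  apply: dk_shift; rewrite Rplus_0_r Rabs_mult (Rabs_pos_eq u); last lra.
  have := Rabs_pos h; nra.
- by apply: (@RInt_correct V); apply: ex_RInt_continuous => u _; apply: line_cont.
- exact: is_RInt_const.
Qed.

Let D_dq h x : scal h (D h x) = minus (f (shift x i h)) (f x).
Proof.
rewrite /D -RInt_scal; last by apply: ex_RInt_continuous => u _; apply: line_cont.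
have Hc z : continuous (fun t => g (shift x i t)) z.
  apply: (lim_comp (f := fun t => shift x i t) (h := g)); last exact: (proj1 Hg).
  by apply: lim_shift; [exact: filterlim_const | exact: filterlim_id].
rewrite (RInt_comp_lin (fun t => g (shift x i t))); last first.
  by apply: ex_RInt_continuous => u _; apply: Hc.
rewrite Rmult_0_r !Rplus_0_r Rmult_1_r -[X in minus _ (f X)](shift0 x i).
apply: is_RInt_unique; apply: (is_RInt_derive (fun t => f (shift x i t))) => z _ //.
exact: pder_at.
Qed.

(** The integral is translation invariant, hence so are difference quotients under it. *)
Lemma int_deriv0 : Int g = zero.
Proof.
have E1 : g = D 0.
  apply: functional_extensionality => x; rewrite /D (RInt_ext _ (fun=> g x)).
    by rewrite RInt_const Rminus_0_r scal_one.
  by move=> u _; rewrite Rmult_0_l Rplus_0_r shift0.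
have E2 h : h <> 0 -> Int (D h) = zero.
  move=> hh.
  rewrite (Int_ext (g := fun x => scal (/ h) (minus (f (shift x i h)) (f x)))); last first.
    by move=> x; rewrite -D_dq scal_assoc /mult /= Rinv_l // scal_one.
  have Hs : is_int (fun x => f (shift x i h)) (Int f).
    have := is_int_shift (fun k => if k == i then h else 0) (Int_is_int Hf).
    by apply: is_int_ext => x; rewrite shiftE.
  apply: Int_unique; have -> : zero = scal (/ h) (plus (Int f) (scal (-1) (Int f))).
    by rewrite (scal_opp_one (Int f)) plus_opp_r scal_zero_r.
  apply: is_int_scal.
  have := is_int_plus Hs (is_int_scal (-1) (Int_is_int Hf)).
  by apply: is_int_ext => x; rewrite /minus -(scal_opp_one (f x)).
rewrite {1}E1; apply: (@tends_unique _ V (locally' 0) _ (fun h => Int (D h))).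
- exact: (Rbar_locally'_filter (Finite 0)).
- have h01 : locally' 0 (fun h : R => Rabs h <= 1).
    exists (mkposreal _ Rlt_0_1) => y; rewrite /ball /= /AbsRing_ball /= /abs /minus /plus /opp /=.
    by rewrite Ropp_0 Rplus_0_r => h _; left.
  apply: (Int_dct (f := D) (f0 := D 0) (K := K' * 3 ^ d)).
  + by apply: filter_imp h01 => h; apply: D_nice.
  + by apply: D_nice; rewrite Rabs_R0; lra.
  move=> x; apply/tendsP; apply: (cont2_lim D_cont); last exact: filterlim_snd.
  apply: (filterlim_comp _ _ _ fst id _ (locally' 0) _ filterlim_fst).
  by move=> P [e He]; exists e => y hy _; apply: He.
- move=> e he; exists (mkposreal _ Rlt_0_1) => h _ hne.
  by rewrite E2 // /dist /minus plus_opp_r norm_zero.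
Qed.

End IBP.

Definition ft d (f : ('I_d -> R) -> CV) (eta : 'I_d -> R) : CV :=
  Int (fun s => Cmult (f s) (cis (- dot s eta)) : CV).

Lemma ft_nice d K (f : ('I_d -> R) -> CV) eta : nice K f ->
  nice K (fun s => Cmult (f s) (cis (- dot s eta)) : CV).
Proof.
move=> Hf; split=> s.
  apply: lim_Cmult; first exact: (proj1 Hf).
  by apply: lim_cis; apply: lim_Ropp; apply: lim_dot; [exact: filterlim_id | exact: filterlim_const].
by rewrite normC Cmod_mult Cmod_cis Rmult_1_r -normC; exact: (proj2 Hf).
Qed.

(** Integration by parts: the derivative of [f] times the exponential has integral zero by
    [int_deriv0]. *)
Lemma ft_deriv d i (f g : ('I_d -> R) -> CV) K K' eta :
  nice K f -> nice K' g -> pder i f g -> ft g eta = Cmult (0, eta i) (ft f eta).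
Proof.
move=> Hf Hg Hd.
have hf := ft_nice eta Hf; have hg := ft_nice eta Hg.
have hl := nice_lin (is_linear_Cmult_l (0, - eta i)) hf.
have [K2 hK2] := hl.
have H0 := int_deriv0 (f := fun s => Cmult (f s) (cis (- dot s eta)) : CV)
  (g := fun s => plus (Cmult (g s) (cis (- dot s eta)) : CV) (Cmult (0, - eta i) (Cmult (f s) (cis (- dot s eta))))) (i := i) hf (nice_plus hg hK2).
have {}H0 := H0 _.
rewrite (Int_plus hg hK2) (Int_lin (is_linear_Cmult_l _) hf) in H0.
have H1 : plus (ft g eta) (Cmult (0, - eta i) (ft f eta) : CV) = zero.
  apply: H0 => x.
  have h1 : derC (fun t => f (shift x i t)) 0 (g x) by exact: Hd.
  have h2 := derC_cis (- dot x eta) (- eta i) 0.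
  have := derC_mult h1 h2; rewrite /derC shift0 Rmult_0_r Rplus_0_r => h3.
  have -> : plus (Cmult (g x) (cis (- dot x eta)) : CV) (Cmult (0, - eta i) (Cmult (f x) (cis (- dot x eta)))) =
     Cplus (Cmult (g x) (cis (- dot x eta))) (Cmult (f x) (Cmult (0, - eta i) (cis (- dot x eta)))).
    rewrite plusC; congr Cplus; ring.
  apply: is_derive_ext h3 => t; congr (Cmult _ (cis _)).
  by rewrite dot_shift; ring.
apply: (@minus_eq0 CV); rewrite -H1 minusC plusC /Cminus; congr Cplus.
by rewrite /Cmult /Copp /=; congr pair; ring.
Qed.

Lemma ft_le d K (f : ('I_d -> R) -> CV) eta : nice K f -> Cmod (ft f eta) <= K * PI ^ d.
Proof. by move=> Hf; rewrite -normC; apply: Int_le (ft_nice eta Hf). Qed.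

(** Pure derivatives in a single direction are taken here; [wt_pow_bound] later combines the
    directions. *)
Lemma ft_decay d i (D : nat -> ('I_d -> R) -> CV) (K : nat -> R) eta :
  (forall N, nice (K N) (D N)) -> (forall N, pder i (D N) (D N.+1)) ->
  forall N, Rabs (eta i) ^ N * Cmod (ft (D 0%N) eta) <= K N * PI ^ d.
Proof.
move=> HK Hd N.
have -> : Rabs (eta i) ^ N * Cmod (ft (D 0%N) eta) = Cmod (ft (D N) eta).
  elim: N => [|N IH]; first by rewrite /= Rmult_1_l.
  rewrite (ft_deriv eta (HK N) (HK N.+1) (Hd N)) Cmod_mult -IH /=.
  have -> : Cmod (0, eta i) = Rabs (eta i); last by ring.
  by rewrite /Cmod /= Rmult_0_l Rplus_0_l Rmult_1_r -sqrt_Rsqr_abs.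
exact: ft_le.
Qed.

(** Two features make this weight convenient: it is submultiplicative under addition ([wtD]), and
    its powers are controlled one coordinate at a time ([wt_pow_bound]). *)
Definition wt d (x : 'I_d -> R) : R := 1 + sumR (fun i => Rabs (x i)).

Lemma sumR_ge0 d (x : 'I_d -> R) : (forall i, 0 <= x i) -> 0 <= sumR x.
Proof. by move=> H; rewrite -(sumR_zero d); apply: sumR_le. Qed.

Lemma wt_ge1 d (x : 'I_d -> R) : 1 <= wt x.
Proof. by have := @sumR_ge0 d (fun i => Rabs (x i)) (fun i => Rabs_pos _); rewrite /wt; lra. Qed.

Lemma sumR_ge_term d (x : 'I_d -> R) i : (forall i, 0 <= x i) -> x i <= sumR x.
Proof.
elim: d x i => [|d IH] x i H; first by case: i.
rewrite sumRS; case: (unliftP ord0 i) => [j|] ->.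
  have := IH (vtl x) j (fun k => H _); have := H ord0; rewrite /vtl; lra.
have := @sumR_ge0 d (vtl x) (fun k => H _); lra.
Qed.

Lemma wt_ge_abs d (x : 'I_d -> R) i : 1 + Rabs (x i) <= wt x.
Proof. by have := @sumR_ge_term d (fun i => Rabs (x i)) i (fun i => Rabs_pos _); rewrite /wt; lra. Qed.

Lemma wtD d (x y : 'I_d -> R) : wt (fun i => x i + y i) <= wt x * wt y.
Proof.
have : wt (fun i => x i + y i) <= wt x + wt y - 1.
  rewrite /wt; have : sumR (fun i => Rabs (x i + y i)) <= sumR (fun i => Rabs (x i)) + sumR (fun i => Rabs (y i)).
    by rewrite -sumR_plus; apply: sumR_le => i; apply: Rabs_triang.
  lra.
have := wt_ge1 x; have := wt_ge1 y; nra.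
Qed.

Lemma wtZ d r (x : 'I_d -> R) : Rabs r <= 1 -> wt (fun i => r * x i) <= wt x.
Proof.
move=> hr; rewrite /wt; apply: Rplus_le_compat_l; apply: sumR_le => i.
rewrite Rabs_mult; have := Rabs_pos (x i); nra.
Qed.

Lemma prodR_const d (c : R) : \big[Rmult/1]_(i < d) c = c ^ d.
Proof. by elim: d => [|d IH]; rewrite ?big_ord0 // big_ord_recl IH. Qed.

Lemma sumR_const d (c : R) : sumR (fun _ : 'I_d => c) = INR d * c.
Proof.
elim: d => [|d IH]; first by rewrite sumR0 /=; ring.
by rewrite sumRS /vtl IH S_INR; ring.
Qed.

(** [1 + x_i ^ 2 <= wt x ^ 2] for each of the [d] coordinates; hence the exponent [2 * n] wherever a
    sum or an integral has to converge. *)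
Lemma wt_dk d (x : 'I_d -> R) : / wt x ^ (2 * d) <= dk x.
Proof.
rewrite pow_mult /dk.
have h0 : 0 < / wt x ^ 2 by apply: Rinv_0_lt_compat; have := wt_ge1 x; nra.
have := @prodR_scale d (fun=> / wt x ^ 2) (fun i => / (1 + x i ^ 2)) 1 ltac:(lra) _.
rewrite pow1 Rmult_1_l => H.
have -> : / (wt x ^ 2) ^ d = \big[Rmult/1]_(i < d) (/ wt x ^ 2).
  by rewrite -pow_inv prodR_const.
apply: (proj2 (H _)) => i; rewrite Rmult_1_l; split; first lra.
apply: Rinv_le_contravar; first nra.
have := wt_ge_abs x i; have := Rabs_pos (x i); rewrite -(pow2_abs (x i)); nra.
Qed.

(** Pigeonhole: [wt x] is a sum of [d + 1] terms, [1] and the [|x_i|], so one of them is at least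
    [wt x / (d + 1)], and the hypothesis for that term applies. *)
Lemma wt_pow_bound d (x : 'I_d -> R) N g B : 0 <= g -> g <= B ->
  (forall i, Rabs (x i) ^ N * g <= B) -> wt x ^ N * g <= INR d.+1 ^ N * B.
Proof.
move=> hg hB H.
have hd : 1 <= INR d.+1 by rewrite S_INR; have := pos_INR d; lra.
have hw := wt_ge1 x.
have hp : forall r, 0 <= r -> wt x <= INR d.+1 * r -> r ^ N * g <= B -> wt x ^ N * g <= INR d.+1 ^ N * B.
  move=> r hr h1 h2.
  have h3 : wt x ^ N <= INR d.+1 ^ N * r ^ N by rewrite -Rpow_mult_distr; apply: pow_incr; lra.
  apply: Rle_trans (_ : INR d.+1 ^ N * r ^ N * g <= _); first exact: Rmult_le_compat_r.
  rewrite Rmult_assoc; apply: Rmult_le_compat_l => //; apply: pow_le; lra.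
case: (classic (exists i, wt x <= INR d.+1 * Rabs (x i))) => [[i hi]|hn].
  by apply: (hp (Rabs (x i))) => //; exact: Rabs_pos.
case: (Rle_lt_dec (wt x) (INR d.+1)) => hw2.
  by apply: (hp 1); rewrite ?pow1; lra.
exfalso.
have hc i : Rabs (x i) <= wt x / INR d.+1.
  apply: Rnot_lt_le => h; apply: hn; exists i; left.
  have := Rmult_lt_compat_l (INR d.+1) _ _ ltac:(lra) h.
  by have -> : INR d.+1 * (wt x / INR d.+1) = wt x by field; lra.
have : sumR (fun i => Rabs (x i)) <= INR d * (wt x / INR d.+1).
  have -> : INR d * (wt x / INR d.+1) = sumR (fun _ : 'I_d => wt x / INR d.+1).
    by rewrite sumR_const.
  by apply: sumR_le.
have : 1 < wt x / INR d.+1.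
  by apply: (Rmult_lt_reg_r (INR d.+1)); rewrite /Rdiv ?Rmult_assoc ?Rinv_l; lra.
have : (INR d + 1) * (wt x / INR d.+1) = wt x by rewrite S_INR; field; rewrite S_INR in hd; lra.
have hw3 : wt x = 1 + sumR (fun i => Rabs (x i)) by [].
set q := wt x / INR d.+1; move=> h1 h2 h3; nra.
Qed.

(** * Unordered sums *)

HB.instance Definition _ (V : AbelianGroup) :=
  Monoid.isComLaw.Build V zero (@plus V) (@plus_assoc V) (@plus_comm V) (@plus_zero_l V).

HB.instance Definition _ :=
  Monoid.isComLaw.Build R 0 Rplus (fun x y z => esym (Rplus_assoc x y z)) Rplus_comm Rplus_0_l.

HB.instance Definition _ :=
  Monoid.isComLaw.Build R 1 Rmult (fun x y z => esym (Rmult_assoc x y z)) Rmult_comm Rmult_1_l.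

(** Finite duplicate-free sequences over [cl T] index partial sums; the equality test of
    [cl T] comes from classical logic, so that [T] may be a function type such as [Zn n]. *)
Definition cl (T : Type) : Type := T.

Definition cl_eqb (T : Type) (x y : cl T) : bool :=
  if excluded_middle_informative (x = y) then true else false.

Lemma cl_eqP (T : Type) : Equality.axiom (@cl_eqb T).
Proof. by move=> x y; rewrite /cl_eqb; case: excluded_middle_informative => h; constructor. Qed.

HB.instance Definition _ (T : Type) := hasDecEq.Build (cl T) (@cl_eqP T).

Lemma dist0r (V : NormedModule R_AbsRing) (x : V) : dist x zero = norm x.
Proof. by rewrite /dist /minus opp_zero plus_zero_r. Qed.

Section Sums.
Variable T : Type.
Implicit Types s : seq (cl T).

(** Finite sets directed by inclusion, so that sums over [T] make sense without an enumeration of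
    [T]. *)
Definition finF (P : seq (cl T) -> Prop) : Prop :=
  exists s0, forall s, uniq s -> {subset s0 <= s} -> P s.

Global Instance finF_proper : ProperFilter finF.
Proof.
split.
  move=> P [s0 H]; exists (undup s0); apply: H; first exact: undup_uniq.
  by move=> x; rewrite mem_undup.
split.
- by exists [::].
- move=> P Q [s0 H0] [s1 H1]; exists (s0 ++ s1) => s us hs; split.
    by apply: H0 => // x hx; apply: hs; rewrite mem_cat hx.
  by apply: H1 => // x hx; apply: hs; rewrite mem_cat hx orbT.
- by move=> P Q hPQ [s0 H]; exists s0 => s us hs; apply: hPQ; apply: H.
Qed.

Definition rsum s (g : T -> R) : R := \big[Rplus/0]_(x <- s) g x.

Definition summable_by (B : R) (g : T -> R) : Prop :=
  (forall x, 0 <= g x) /\ forall s, uniq s -> rsum s g <= B.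

Definition summable (g : T -> R) : Prop := exists B, summable_by B g.

Lemma rsum_ge0 s g : (forall x, 0 <= g x) -> 0 <= rsum s g.
Proof. move=> H; rewrite /rsum; apply: (big_ind (fun x => 0 <= x)) => //; [lra | move=> *; lra]. Qed.

Lemma rsum_le s f g : (forall x, f x <= g x) -> rsum s f <= rsum s g.
Proof. move=> H; rewrite /rsum; apply: (big_ind2 (fun x y => x <= y)) => //; [lra | move=> *; lra]. Qed.

Lemma perm_sub s0 s : uniq s0 -> uniq s -> {subset s0 <= s} ->
  perm_eq s (s0 ++ [seq x <- s | x \notin s0]).
Proof.
move=> u0 us h; apply: uniq_perm => //.
  rewrite cat_uniq u0 filter_uniq // andbT /=.
  by apply/hasPn => x; rewrite mem_filter => /andP [].
move=> x; rewrite mem_cat mem_filter.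
by case hx: (x \in s0) => //=; rewrite h.
Qed.

Lemma rsum_sub s l g : (forall x, 0 <= g x) -> uniq s -> {subset s <= l} -> rsum s g <= rsum l g.
Proof.
move=> Hg; elim: s l => [|x s IH] l /=.
  by move=> _ _; rewrite {1}/rsum big_nil; exact: rsum_ge0.
move=> /andP [hx us] hs.
have hxl : x \in l by apply: hs; rewrite mem_head.
rewrite /rsum (perm_big _ (perm_to_rem hxl)) !big_cons -!/(rsum _ _).
apply: Rplus_le_compat_l; apply: IH => // y hy.
have : y \in l by apply: hs; rewrite in_cons hy orbT.
rewrite (perm_mem (perm_to_rem hxl)) in_cons => /orP [/eqP hyx|//].
by move: hx; rewrite -hyx hy.
Qed.

(** A finite [s0] nearly attains the supremum of the partial sums; a set disjoint from it adds less
    than [e]. *)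
Lemma summable_tail g : summable g -> forall e, 0 < e ->
  exists s0, uniq s0 /\ forall s, uniq s -> (forall x, x \in s -> x \notin s0) -> rsum s g < e.
Proof.
move=> [B [H0 HB]] e he.
pose E := fun r => exists s, uniq s /\ r = rsum s g.
have [L [hub hlub]] : { L | is_lub E L }.
  apply: completeness; first by exists B => r [s [us ->]]; apply: HB.
  by exists (rsum [::] g); exists [::].
have [s0 [us0 hs0]] : exists s0, uniq s0 /\ L - e < rsum s0 g.
  apply: NNPP => hn.
  have : L <= L - e; last lra.
  apply: hlub => r [s [us ->]]; apply: Rnot_lt_le => h; apply: hn; by exists s.
exists s0; split=> // s us hs.
have : rsum (s0 ++ s) g <= L.
  apply: hub; exists (s0 ++ s); split=> //.
  rewrite cat_uniq us0 us andbT /=; apply/hasPn => x; exact: hs.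
rewrite /rsum big_cat -!/(rsum _ _) /= => h.
change (rsum s0 g + rsum s g <= L) in h; lra.
Qed.

Section Vec.
Variable V : CompleteNormedModule R_AbsRing.
Implicit Types f : T -> V.

Definition vsum s f : V := \big[plus/zero]_(x <- s) f x.
Definition is_sum f (v : V) : Prop := tends finF (fun s => vsum s f) v.
Definition Sum f : V := epsilon (inhabits zero) (is_sum f).
Definition dominated f (g : T -> R) : Prop := summable g /\ forall x, norm (f x) <= g x.

Lemma vsum_nil f : vsum [::] f = zero.
Proof. by rewrite /vsum big_nil. Qed.

Lemma vsum_cons x s f : vsum (x :: s) f = plus (f x) (vsum s f).
Proof. by rewrite /vsum big_cons. Qed.

Lemma vsum_cat s s' f : vsum (s ++ s') f = plus (vsum s f) (vsum s' f).
Proof. by rewrite /vsum big_cat. Qed.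

Lemma vsum_ext s f f' : (forall x, f x = f' x) -> vsum s f = vsum s f'.
Proof. by move=> H; apply: eq_bigr. Qed.

Lemma vsum_plus s f f' : vsum s (fun x => plus (f x) (f' x)) = plus (vsum s f) (vsum s f').
Proof. by rewrite /vsum big_split. Qed.

Lemma norm_vsum s f g : (forall x, norm (f x) <= g x) -> norm (vsum s f) <= rsum s g.
Proof.
move=> H; elim: s => [|x s IH]; first by rewrite vsum_nil norm_zero /rsum big_nil; lra.
rewrite vsum_cons /rsum big_cons; apply: Rle_trans (norm_triangle _ _) _.
exact: Rplus_le_compat.
Qed.

Lemma vsum_sub_dist s0 s f g : uniq s0 -> uniq s -> {subset s0 <= s} ->
  (forall x, norm (f x) <= g x) ->
  dist (vsum s f) (vsum s0 f) <= rsum [seq x <- s | x \notin s0] g.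
Proof.
move=> u0 us h H.
have -> : vsum s f = plus (vsum s0 f) (vsum [seq x <- s | x \notin s0] f).
  by rewrite -vsum_cat /vsum (perm_big _ (perm_sub u0 us h)).
rewrite /dist; have -> : minus (plus (vsum s0 f) (vsum [seq x <- s | x \notin s0] f)) (vsum s0 f) = vsum [seq x <- s | x \notin s0] f.
  by rewrite /minus (plus_comm (vsum s0 f)) -plus_assoc plus_opp_r plus_zero_r.
exact: norm_vsum.
Qed.

(** The set [s0] depends on the majorant [g] alone, which gives uniformity over every family below
    [g]; [Sum_dct] rests on this. *)
Lemma vsum_tail g e : summable g -> 0 < e ->
  exists s0, uniq s0 /\ forall f s, (forall x, norm (f x) <= g x) -> uniq s -> {subset s0 <= s} ->
    dist (vsum s f) (vsum s0 f) < e.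
Proof.
move=> Hg he; have [s0 [u0 H]] := summable_tail Hg he.
exists s0; split=> // f s Hf us hs.
apply: Rle_lt_trans (vsum_sub_dist u0 us hs Hf) _.
apply: H; first exact: filter_uniq.
by move=> x; rewrite mem_filter => /andP [].
Qed.

Lemma Sum_correct f g : dominated f g -> is_sum f (Sum f).
Proof.
move=> [Hg Hf]; apply: epsilon_spec.
have [v Hv] : exists v, filterlim (fun s => vsum s f) finF (locally v).
  apply (proj1 (@filterlim_locally_cauchy _ V finF finF_proper (fun s => vsum s f))) => e.
  have he : 0 < e / 2 by have := cond_pos e; lra.
  have [s0 [u0 H]] := vsum_tail Hg he.
  exists (fun s => uniq s /\ {subset s0 <= s}); split; first by exists s0.
  move=> s s' [us hs] [us' hs'].
  suff : dist (vsum s' f) (vsum s f) < e by exact: norm_compat1.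
  have := dist_tri (vsum s0 f) (vsum s' f) (vsum s f).
  have := H f s Hf us hs; have := H f s' Hf us' hs'; rewrite (distC (vsum s0 f)); lra.
exists v; exact/tendsP.
Qed.

Lemma Sum_unique f v : is_sum f v -> Sum f = v.
Proof.
move=> H; have H' : is_sum f (Sum f) by apply: epsilon_spec; exists v.
exact: tends_unique H' H.
Qed.

Lemma Sum_ext f f' : (forall x, f x = f' x) -> Sum f = Sum f'.
Proof. by move=> /functional_extensionality ->. Qed.

Lemma Sum_tail g e : summable g -> 0 < e ->
  exists s0, uniq s0 /\ forall f s, (forall x, norm (f x) <= g x) -> uniq s -> {subset s0 <= s} ->
    dist (vsum s f) (Sum f) < e.
Proof.
move=> Hg he; have he3 : 0 < e / 3 by lra.
have [s0 [u0 H]] := vsum_tail Hg he3.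
exists s0; split=> // f s Hf us hs.
have [s' [[us' hs'] h1]] : exists s', (uniq s' /\ {subset s0 <= s'}) /\ dist (vsum s' f) (Sum f) < e / 3.
  have [s' h] := filter_ex _ (filter_and _ _ (Sum_correct (conj Hg Hf) he3)
     (ex_intro _ s0 (fun s us hs => conj us hs) : finF (fun s => uniq s /\ {subset s0 <= s}))).
  by exists s'; case: h.
have := dist_tri (vsum s0 f) (vsum s f) (Sum f).
have := dist_tri (vsum s' f) (vsum s0 f) (Sum f).
have := H f s Hf us hs; have := H f s' Hf us' hs'.
rewrite (distC (vsum s' f) (vsum s0 f)); lra.
Qed.

Lemma Sum_le f g B : summable_by B g -> (forall x, norm (f x) <= g x) -> norm (Sum f) <= B.
Proof.
move=> HB Hf; have Hg : summable g by exists B.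
apply: le_epsilon => e he.
have [s0 [u0 H]] := Sum_tail Hg he.
have := H f s0 Hf u0 (fun x hx => hx).
have h1 := Rle_trans _ _ _ (norm_vsum s0 Hf) (proj2 HB s0 u0).
have h2 := dist_tri (vsum s0 f) (Sum f) zero.
rewrite !dist0r (distC (Sum f)) in h2; lra.
Qed.

Lemma Sum_dct (I : Type) (F : (I -> Prop) -> Prop) {FF : Filter F} (f : I -> T -> V) f0 g :
  F (fun t => forall x, norm (f t x) <= g x) -> dominated f0 g ->
  (forall x, tends F (fun t => f t x) (f0 x)) -> tends F (fun t => Sum (f t)) (Sum f0).
Proof.
move=> Hb [Hg H0] Hl e he; have he3 : 0 < e / 3 by lra.
have [s0 [u0 H]] := Sum_tail Hg he3.
have Hs : tends F (fun t => vsum s0 (f t)) (vsum s0 f0).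
  elim: {u0 H} s0 => [|x s IH].
    by move=> e' he'; apply: filter_forall => t; rewrite !vsum_nil /dist minus_eq_zero norm_zero.
  rewrite vsum_cons; apply: (tends_ext (f := fun t => plus (f t x) (vsum s (f t)))).
    by move=> t; rewrite vsum_cons.
  by apply/tendsP; apply: lim_plus; apply/tendsP.
apply: filter_imp (filter_and _ _ Hb (Hs _ he3)) => t [h1 h2].
have h3 := H _ s0 h1 u0 (fun x hx => hx); have h4 := H _ s0 H0 u0 (fun x hx => hx).
have := dist_tri (vsum s0 (f t)) (Sum (f t)) (Sum f0).
have := dist_tri (vsum s0 f0) (vsum s0 (f t)) (Sum f0).
rewrite (distC (Sum (f t)) (vsum s0 (f t))); lra.
Qed.

Lemma dominated_plus f f' g g' : dominated f g -> dominated f' g' ->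
  dominated (fun x => plus (f x) (f' x)) (fun x => g x + g' x).
Proof.
move=> [[B [h1 h2]] h3] [[B' [h4 h5]] h6]; split.
  exists (B + B'); split=> [x|s us]; first by have := h1 x; have := h4 x; lra.
  by rewrite /rsum big_split /=; apply: Rplus_le_compat; [apply: h2 | apply: h5].
by move=> x; apply: Rle_trans (norm_triangle _ _) _; apply: Rplus_le_compat.
Qed.

Lemma Sum_plus f f' g g' : dominated f g -> dominated f' g' ->
  Sum (fun x => plus (f x) (f' x)) = plus (Sum f) (Sum f').
Proof.
move=> H H'; apply: Sum_unique.
apply: (tends_ext (f := fun s => plus (vsum s f) (vsum s f'))).
  by move=> s; rewrite vsum_plus.
by apply/tendsP; apply: lim_plus; apply/tendsP; apply: Sum_correct; eassumption.
Qed.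

Lemma Sum_zero : Sum (fun _ : T => zero : V) = zero.
Proof.
apply: Sum_unique => e he; exists [::] => s _ _.
by rewrite /vsum big1 // /dist minus_eq_zero norm_zero.
Qed.

End Vec.

Lemma summable_scal g c : 0 <= c -> summable g -> summable (fun x => c * g x).
Proof.
move=> hc [B [h1 h2]]; exists (c * B); split=> [x|s us]; first exact: Rmult_le_pos.
have -> : rsum s (fun x => c * g x) = c * rsum s g.
  elim: s {us} => [|x s IH]; first by rewrite /rsum !big_nil; ring.
  by rewrite /rsum !big_cons -!/(rsum _ _) IH /=; ring.
exact: Rmult_le_compat_l (h2 _ us).
Qed.

Lemma summable_le g g' : (forall x, 0 <= g' x <= g x) -> summable g -> summable g'.
Proof.
move=> H [B [h1 h2]]; exists B; split=> [x|s us]; first by case: (H x).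
by apply: Rle_trans (h2 s us); apply: rsum_le => x; case: (H x).
Qed.

Lemma dominated_scal_le (V : CompleteNormedModule R_AbsRing) (f : T -> V) g c :
  0 <= c -> summable g -> (forall x, norm (f x) <= c * g x) -> dominated f (fun x => c * g x).
Proof. by move=> hc Hg H; split=> //; apply: summable_scal. Qed.

Section Lin.
Variables V W : CompleteNormedModule R_AbsRing.
Variable L : V -> W.
Hypothesis HL : is_linear L.

Lemma vsum_lin s (f : T -> V) : vsum s (fun x => L (f x)) = L (vsum s f).
Proof.
elim: s => [|x s IH]; first by rewrite !vsum_nil (lin_zero HL).
by rewrite !vsum_cons IH (linear_plus _ HL).
Qed.

Lemma Sum_lin f g : dominated f g -> Sum (fun x => L (f x)) = L (Sum f).
Proof.
move=> H; apply: Sum_unique.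
apply: (tends_ext (f := fun s => L (vsum s f))); first by move=> s; rewrite vsum_lin.
apply/tendsP; apply: lim_comp; last exact: linear_cont.
by apply/tendsP; apply: Sum_correct H.
Qed.

End Lin.

End Sums.

Lemma Sum_bij (T S : Type) (V : CompleteNormedModule R_AbsRing) (p : S -> T) (q : T -> S) (f : T -> V) g :
  cancel p q -> cancel q p -> dominated f g -> Sum (fun y => f (p y)) = Sum f.
Proof.
move=> pq qp H; apply: Sum_unique => e he.
have [s0 H0] := Sum_correct H he.
exists ([seq q x | x <- s0] : seq (cl S)) => s us hs.
have -> : vsum s (fun y => f (p y)) = vsum ([seq p y | y <- s] : seq (cl T)) f by rewrite /vsum big_map.
apply: H0.
  by rewrite (@map_inj_uniq (cl S) (cl T)) //; apply: (can_inj pq).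
move=> x hx; apply/(@mapP (cl S) (cl T)); exists (q x); last by rewrite qp.
by apply: hs; apply: (@map_f (cl T) (cl S) q).
Qed.

(** Finite sums over [y] commute with the sum over [x] by additivity; then dominated convergence for
    series is applied along the filter of finite sets of [S], with majorant [B * a x]. *)
Lemma Sum_fubini (T S : Type) (V : CompleteNormedModule R_AbsRing) (f : T -> S -> V) a b :
  summable a -> summable b -> (forall x y, norm (f x y) <= a x * b y) ->
  Sum (fun y => Sum (fun x => f x y)) = Sum (fun x => Sum (f x)).
Proof.
move=> Ha Hb H; have [A HA] := Ha; have [B HB] := Hb.
have hda y : dominated (fun x => f x y) (fun x => b y * a x).
  split; first by apply: summable_scal => //; apply: (proj1 HB).
  by move=> x; rewrite Rmult_comm.
have hB : 0 <= B by have := proj2 HB [::] isT; rewrite /rsum big_nil.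
have hd x : dominated (f x) (fun y => a x * b y).
  by split=> //; apply: summable_scal => //; apply: (proj1 HA).
have hs x (s : seq (cl S)) : uniq s -> norm (vsum s (f x)) <= B * a x.
  move=> us; apply: Rle_trans (norm_vsum s (H x)) _.
  have -> : rsum s (fun y => a x * b y) = a x * rsum s b.
    elim: s {us} => [|y s IH]; first by rewrite /rsum !big_nil; ring.
    by rewrite /rsum !big_cons -!/(rsum _ _) IH /=; ring.
  rewrite Rmult_comm; apply: Rmult_le_compat_r; [exact: (proj1 HA) | exact: (proj2 HB)].
have fin (s : seq (cl S)) : vsum s (fun y => Sum (fun x => f x y)) = Sum (fun x => vsum s (f x)) /\
     exists g, dominated (fun x => vsum s (f x)) g.
  elim: s => [|y s [IH [g Hg]]].
    rewrite vsum_nil (Sum_ext (f' := fun=> zero)) ?Sum_zero; last by move=> x; rewrite vsum_nil.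
    split=> //; exists (fun=> 0); split; last by move=> x; rewrite vsum_nil norm_zero; lra.
    by apply: summable_le Ha => x; have := proj1 HA x; lra.
  split; last first.
    exists (fun x => b y * a x + g x).
    have := dominated_plus (hda y) Hg.
    by rewrite /dominated => [[h1 h2]]; split=> // x; rewrite vsum_cons.
  rewrite vsum_cons IH -(Sum_plus (hda y) Hg); apply: Sum_ext => x.
  by rewrite vsum_cons.
apply: Sum_unique.
apply: (tends_ext (f := fun s => Sum (fun x => vsum s (f x)))); first by move=> s; rewrite (proj1 (fin s)).
apply: (Sum_dct (g := fun x => B * a x)).
- by exists [::] => s us _ x; apply: hs.
- split; first exact: summable_scal.
  move=> x; rewrite Rmult_comm; apply: (@Sum_le _ _ _ (fun y => a x * b y)) => //.
  split=> [y|s us]; first by apply: Rmult_le_pos; [apply: (proj1 HA) | apply: (proj1 HB)].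
  have -> : rsum s (fun y => a x * b y) = a x * rsum s b.
    elim: s {us} => [|y s IH]; first by rewrite /rsum !big_nil; ring.
    by rewrite /rsum !big_cons -!/(rsum _ _) IH /=; ring.
  by apply: Rmult_le_compat_l; [exact: (proj1 HA) | exact: (proj2 HB)].
- by move=> x; apply: Sum_correct (hd x).
Qed.

Definition Zn (n : nat) : Type := 'I_n -> Z.
Definition toR (n : nat) (m : Zn n) : 'I_n -> R := fun i => IZR (m i).

(** Telescoping [1 / (1 + N ^ 2) <= 3 * (1 / (N + 1) - 1 / (N + 2))] gives at most [3] for each
    sign. *)
Lemma summable_Z : summable_by 6 (fun z : Z => / (1 + IZR z ^ 2)).
Proof.
split=> [z|s us]; first by left; apply: (proj1 (inv1p_pos _)).
pose h k := Z.of_nat k : cl Z.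
have hk N : rsum [seq h k | k <- seq.iota 0%N N] (fun z : Z => / (1 + IZR z ^ 2)) <= 3 * (1 - / INR N.+1).
  elim: N => [|N IH]; first by rewrite /rsum big_nil /= Rinv_1; lra.
  have -> : rsum [seq h k | k <- seq.iota 0%N N.+1] (fun z : Z => / (1 + IZR z ^ 2)) =
      rsum [seq h k | k <- seq.iota 0%N N] (fun z : Z => / (1 + IZR z ^ 2)) + / (1 + INR N ^ 2).
    rewrite -addn1 iotaD add0n map_cat /rsum big_cat /= big_cons big_nil /h -INR_IZR_INZ.
    by congr (_ + _); exact: Rplus_0_r.
  have h1 : / (1 + INR N ^ 2) <= 3 * (/ INR N.+1 - / INR N.+2).
    rewrite !S_INR; have hN := pos_INR N.
    have -> : 3 * (/ (INR N + 1) - / (INR N + 1 + 1)) = / ((INR N + 1) * (INR N + 2) / 3) by field; lra.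
    apply: Rinv_le_contravar; first by nra.
    (* The inequality amounts to [(2 * N - 1) * (N - 1) >= 0], which fails for real [N] between
       [1 / 2] and [1]; hence [N = 0] is split off. *)
    case: N {IH} hN => [|N] hN; first by rewrite /=; lra.
    have := pos_INR N; rewrite S_INR; nra.
  lra.
have hk' N : rsum [seq (Z.opp (h k) : cl Z) | k <- seq.iota 0%N N] (fun z : Z => / (1 + IZR z ^ 2)) <= 3 * (1 - / INR N.+1).
  apply: Rle_trans (hk N); right; rewrite /rsum !big_map; apply: eq_bigr => k _.
  by rewrite opp_IZR; congr (/ (1 + _)); ring.
have [N HN] : exists N, forall z, z \in s -> (Z.abs_nat z < N)%coq_nat.
  elim: s {us} => [|z s [N HN]]; first by exists 0%N.
  exists (Nat.max (Z.abs_nat z).+1 N) => y; rewrite in_cons => /orP [/eqP ->|/HN]; lia.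
apply: Rle_trans (_ : rsum ([seq h k | k <- seq.iota 0%N N] ++ [seq (Z.opp (h k) : cl Z) | k <- seq.iota 0%N N]) (fun z : Z => / (1 + IZR z ^ 2)) <= 6); last first.
  rewrite /rsum big_cat -!/(rsum _ _) /=.
  have hp : 0 < / INR N.+1 by apply: Rinv_0_lt_compat; apply: lt_0_INR; lia.
  have := hk N; have := hk' N => h1 h2.
  apply: Rle_trans (Rplus_le_compat _ _ _ _ h2 h1) _; lra.
apply: rsum_sub => // [z|z hz]; first by left; apply: (proj1 (inv1p_pos _)).
have hN := HN z hz; rewrite mem_cat.
case: (Z_le_gt_dec 0 z) => hsgn; apply/orP; [left|right].
- apply/mapP; exists (Z.abs_nat z); first by rewrite mem_iota add0n; apply/ltP.
  by rewrite /h Zabs2Nat.abs_nat_nonneg // Z2Nat.id.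
- apply/mapP; exists (Z.abs_nat z); first by rewrite mem_iota add0n; apply/ltP.
  by rewrite /h; lia.
Qed.

Definition zcons n (z : Z) (m : Zn n) : Zn n.+1 :=
  fun i => match unlift ord0 i with None => z | Some j => m j end.

Lemma zcons_eta n (m : Zn n.+1) : m = zcons (m ord0) (fun j => m (lift ord0 j)).
Proof.
apply: functional_extensionality => i; rewrite /zcons.
by case: (unliftP ord0 i) => [j|] ->.
Qed.

(** A finite set of lattice points lies in the product of its projections, over which the product
    kernel sums to a product of sums. *)
Lemma summable_dk n : summable_by (6 ^ n) (fun m : Zn n => dk (toR m)).
Proof.
elim: n => [|n IH]; (split=> [m|s us]; first by left; apply: (proj1 (dk_pos _))).
  have : {subset s <= [:: (fun _ => 0%Z) : cl (Zn 0)]}.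
    by move=> m _; rewrite mem_seq1; apply/eqP; apply: functional_extensionality; case.
  move=> hs; apply: Rle_trans (rsum_sub _ us hs) _; first by move=> x; left; apply: (proj1 (dk_pos _)).
  by rewrite /rsum big_seq1 /dk big_ord0 /=; lra.
pose hd := undup [seq (m ord0 : cl Z) | m <- s].
pose tl := undup [seq ((fun j => m (lift ord0 j)) : cl (Zn n)) | m : cl (Zn n.+1) <- s].
pose l := [seq (zcons z m : cl (Zn n.+1)) | z <- hd, m <- tl].
have hs : {subset s <= l}.
  move=> m hm; apply/(@allpairsP (cl Z) (cl (Zn n)) (cl (Zn n.+1))).
  exists (m ord0, fun j => m (lift ord0 j)) => /=; split; last exact: zcons_eta.
    by rewrite mem_undup; apply/(@mapP (cl (Zn n.+1)) (cl Z)); exists m.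
  by rewrite mem_undup; apply/(@mapP (cl (Zn n.+1)) (cl (Zn n))); exists m.
apply: Rle_trans (rsum_sub _ us hs) _; first by move=> x; left; apply: (proj1 (dk_pos _)).
have hdk z (m : Zn n) : dk (toR (zcons z m)) = / (1 + IZR z ^ 2) * dk (toR m).
  rewrite -dk_cons; congr dk; apply: functional_extensionality => i.
  by rewrite /toR /zcons /vcons; case: (unlift ord0 i).
have hsum2 : rsum l (fun m : Zn n.+1 => dk (toR m)) = rsum hd (fun z => / (1 + IZR z ^ 2)) * rsum tl (fun m : Zn n => dk (toR m)).
  rewrite /l; elim: {hs l} hd => [|z h IHh]; first by rewrite /rsum !big_nil; ring.
  rewrite /= /rsum big_cat big_cons -!/(rsum _ _) IHh /=.
  suff -> : rsum [seq (zcons z m : cl (Zn n.+1)) | m <- tl] (fun m : Zn n.+1 => dk (toR m)) = / (1 + IZR z ^ 2) * rsum tl (fun m : Zn n => dk (toR m)).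
    by rewrite -Rmult_plus_distr_r.
  elim: {IHh} tl => [|m t IHt]; first by rewrite /rsum !big_nil; ring.
  by rewrite /= /rsum !big_cons -!/(rsum _ _) IHt hdk; rewrite -Rmult_plus_distr_l.
rewrite hsum2 /=; apply: Rmult_le_compat.
- by apply: rsum_ge0 => z; left; apply: (proj1 (inv1p_pos _)).
- by apply: rsum_ge0 => z; left; apply: (proj1 (dk_pos _)).
- by apply: (proj2 summable_Z); apply: undup_uniq.
- by apply: (proj2 IH); apply: undup_uniq.
Qed.

Lemma summable_wt n p : (2 * n <= p)%N -> summable (fun m : Zn n => / wt (toR m) ^ p).
Proof.
move=> hp; apply: (summable_le (g := fun m : Zn n => dk (toR m))); last by exists (6 ^ n); apply: summable_dk.
move=> m; have hw := wt_ge1 (toR m).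
split; first by left; apply: Rinv_0_lt_compat; apply: pow_lt; lra.
apply: Rle_trans (wt_dk (toR m)); apply: Rinv_le_contravar; first by apply: pow_lt; lra.
by apply: Rle_pow => //; apply/leP.
Qed.

(** * C*-algebras and monomials in the generators *)

Section Cstar.
Variable A : CstarAlgebra.
Implicit Types x y : A.

Lemma cscal1 x : cscal (RtoC 1) x = x.
Proof. by rewrite cscalR scal_one. Qed.

Lemma cscalN1 x : cscal (RtoC (-1)) x = opp x.
Proof. by rewrite cscalR (scal_opp_one x). Qed.

Lemma cscal0l x : cscal (RtoC 0) x = zero.
Proof. by rewrite cscalR scal_zero_l. Qed.

Lemma cscal0r z : cscal z (zero : A) = zero.
Proof. by rewrite -(cscal0l zero) cscalA Cmult_0_r. Qed.

Lemma cscal_opp z x : cscal z (opp x) = opp (cscal z x).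
Proof. by rewrite -!cscalN1 !cscalA Cmult_comm. Qed.

Lemma cscal_minus_r z x y : cscal z (minus x y) = minus (cscal z x) (cscal z y).
Proof. by rewrite /minus cscalDr cscal_opp. Qed.

Lemma cscal_minus_l (z w : C) x : cscal (Cminus z w) x = minus (cscal z x) (cscal w x).
Proof.
rewrite /minus -cscalN1 cscalA -cscalDl; congr cscal.
by rewrite /Cminus; congr Cplus; rewrite /Cmult /Copp /=; congr pair; ring.
Qed.

Lemma cmul0l x : cmul zero x = zero.
Proof. by rewrite -(cscal0l zero) cmulZl !cscal0l. Qed.

Lemma cmul0r x : cmul x zero = zero.
Proof. by rewrite -(cscal0l zero) cmulZr !cscal0l. Qed.

Lemma cmul_minus_l x x' y : cmul (minus x x') y = minus (cmul x y) (cmul x' y).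
Proof. by rewrite /minus cmulDl -cscalN1 cmulZl cscalN1. Qed.

Lemma cmul_minus_r x y y' : cmul x (minus y y') = minus (cmul x y) (cmul x y').
Proof. by rewrite /minus cmulDr -cscalN1 cmulZr cscalN1. Qed.

Lemma lim_cscal T (F : (T -> Prop) -> Prop) {FF : Filter F} (f : T -> C) (g : T -> A) z x :
  filterlim f F (@locally C_R_NormedModule z) -> filterlim g F (locally x) ->
  filterlim (fun t => cscal (f t) (g t)) F (locally (cscal z x)).
Proof.
apply: (@lim_bilin _ _ _ C_R_NormedModule A A (@cscal A)).
- by move=> *; apply: cscal_minus_l.
- by move=> *; apply: cscal_minus_r.
- by move=> w y; rewrite cnormZ normC; lra.
Qed.

Lemma lim_cmul T (F : (T -> Prop) -> Prop) {FF : Filter F} (f : T -> A) (g : T -> A) x y :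
  filterlim f F (locally x) -> filterlim g F (locally y) ->
  filterlim (fun t => cmul (f t) (g t)) F (locally (cmul x y)).
Proof.
apply: (@lim_bilin _ _ _ A A A (@cmul A)).
- by move=> *; apply: cmul_minus_l.
- by move=> *; apply: cmul_minus_r.
- by move=> w v; apply: cnormM.
Qed.

Lemma is_linear_cscal z : @is_linear R_AbsRing A A (cscal z).
Proof.
split.
- by move=> x y; rewrite cscalDr.
- by move=> r x; rewrite -!cscalR !cscalA Cmult_comm.
- exists (Cmod z + 1); split; first by have := Cmod_ge_0 z; lra.
  by move=> x; rewrite cnormZ; have := norm_ge_0 x; nra.
Qed.

Lemma is_linear_cscal_l x : @is_linear R_AbsRing CV A (fun z => cscal z x).
Proof.
split.
- by move=> z w; rewrite -cscalDl.
- by move=> r z; rewrite -!cscalR !cscalA scalC.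
- exists (norm x + 1); split; first by have := norm_ge_0 x; lra.
  by move=> z; rewrite cnormZ normC; have := Cmod_ge_0 z; have := norm_ge_0 x; nra.
Qed.

Lemma is_linear_cmul_l x : @is_linear R_AbsRing A A (cmul x).
Proof.
split.
- by move=> y z; rewrite cmulDr.
- by move=> r y; rewrite -!cscalR cmulZr.
- exists (norm x + 1); split; first by have := norm_ge_0 x; lra.
  by move=> y; have := cnormM x y; have := norm_ge_0 y; nra.
Qed.

(** The C*-identity gives [norm y ^ 2 <= norm (cstar y) * norm y]; the reverse inequality is the
    same one for [cstar y]. *)
Lemma norm_star x : norm (cstar x) = norm x.
Proof.
have le y : norm y <= norm (cstar y).
  case: (Req_dec (norm y) 0) => [->|hy]; first exact: norm_ge_0.
  have hp := norm_ge_0 y; have h1 := cnorm_star y; have h2 := cnormM (cstar y) y.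
  by apply: (Rmult_le_reg_r (norm y)); [lra | nra].
by apply: Rle_antisym; [have := le (cstar x); rewrite cstarK | exact: le].
Qed.

Lemma cstar1 : cstar (cone : A) = cone.
Proof. by rewrite -(cmul1l (cstar cone)) -[X in cmul X _]cstarK -cstarM cmul1l cstarK. Qed.

Definition sq x := cmul x x.

Lemma norm_sq_iter x k : cstar x = x ->
  cstar (iter k sq x) = iter k sq x /\ norm (iter k sq x) = norm x ^ (Nat.pow 2 k).
Proof.
move=> hx; elim: k => [|k [h1 h2]]; first by rewrite /= Rmult_1_r.
rewrite iterS /sq cstarM h1; split=> //.
rewrite -{1}h1 cnorm_star h2 -pow_mult; congr (_ ^ _).
by rewrite Nat.mul_comm.
Qed.

End Cstar.

(** If [a > b > 0], the powers of [a / b] exceed any [B]. This removes the constant from a bound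
    that is stable under repeated squaring. *)
Lemma pow2_root a b B : 0 <= a -> 0 <= b ->
  (forall k : nat, a ^ (Nat.pow 2 k) <= B * b ^ (Nat.pow 2 k)) -> a <= b.
Proof.
move=> ha hb H; apply: Rnot_lt_le => hlt.
case: (Req_dec b 0) => hb0.
  by have := H 0%N; rewrite /= hb0; lra.
have hr : 1 < a / b by apply: (Rmult_lt_reg_r b); rewrite /Rdiv ?Rmult_assoc ?Rinv_l; lra.
have [N HN] := Pow_x_infinity (a / b) ltac:(rewrite Rabs_pos_eq; lra) (B + 1).
have hk : (N <= Nat.pow 2 N)%coq_nat by apply: Nat.lt_le_incl; apply: Nat.pow_gt_lin_r; lia.
have := HN _ hk.
rewrite Rabs_pos_eq; last by apply: pow_le; lra.
have hbp : 0 < b ^ (Nat.pow 2 N) by apply: pow_lt; lra.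
have -> : (a / b) ^ (Nat.pow 2 N) = a ^ (Nat.pow 2 N) / b ^ (Nat.pow 2 N) by rewrite /Rdiv Rpow_mult_distr pow_inv.
move=> h; have h3 := H N.
have : (B + 1) * b ^ (Nat.pow 2 N) <= a ^ (Nat.pow 2 N).
  have := Rmult_le_compat_r _ _ _ (Rlt_le _ _ hbp) (Rge_le _ _ h).
  by rewrite /Rdiv Rmult_assoc Rinv_l ?Rmult_1_r; lra.
lra.
Qed.

Section Contract.
Variables (A B : CstarAlgebra) (f : A -> B).
Hypothesis Hf : star_hom f.

Lemma star_hom0 : f zero = zero.
Proof. by have [_ [hz _]] := Hf; rewrite -(cscal0l zero) hz cscal0l. Qed.

(** Continuity at [0], tested on the multiple of [x] of norm [d / 2]. *)
Lemma star_hom_bounded : exists M, 0 < M /\ forall x, norm (f x) <= M * norm x.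
Proof.
have [_ [hz [_ [_ [_ hc]]]]] := Hf.
have /contP /(_ _ Rlt_0_1) := hc zero.
rewrite star_hom0 => [[d Hd]].
have hd := cond_pos d.
have H0 : forall x, norm x < d -> norm (f x) < 1.
  move=> x hx; rewrite -dist0r; apply: Hd; apply: norm_compat1.
  by rewrite -/(dist x zero) dist0r.
exists (2 / d); split; first by apply: Rdiv_lt_0_compat; lra.
move=> x; case: (Req_dec (norm x) 0) => hx.
  by rewrite (norm_eq_zero _ hx) star_hom0 !norm_zero; lra.
have hp : 0 < norm x by have := norm_ge_0 x; lra.
have hr : 0 < d / (2 * norm x) by apply: Rdiv_lt_0_compat; lra.
have := H0 (cscal (RtoC (d / (2 * norm x))) x).
rewrite hz !cnormZ Cmod_R Rabs_pos_eq; last lra.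
have -> : d / (2 * norm x) * norm x = d / 2 by field.
move=> h; have {}h := h ltac:(lra).
apply: (Rmult_le_reg_l (d / (2 * norm x))) => //.
have -> : d / (2 * norm x) * (2 / d * norm x) = 1 by field; lra.
lra.
Qed.

(** Boundedness improves to contractivity since [norm (h ^ 2^k) = norm h ^ 2^k] for self-adjoint [h]. *)
Lemma star_hom_contract x : norm (f x) <= norm x.
Proof.
have [_ [hz [hm [_ [hs _]]]]] := Hf.
have [M [hM HM]] := star_hom_bounded.
pose h := cmul (cstar x) x.
have hh : cstar h = h by rewrite /h cstarM cstarK.
have hfh : cstar (f h) = f h by rewrite -hs hh.
have hit k : f (iter k (@sq A) h) = iter k (@sq B) (f h).
  by elim: k => [//|k IH]; rewrite !iterS /sq hm IH.
have : norm (f h) <= norm h.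
  apply: (@pow2_root _ _ M); try exact: norm_ge_0.
  move=> k; rewrite -(proj2 (norm_sq_iter k hh)) -(proj2 (norm_sq_iter k hfh)) -hit.
  exact: HM.
rewrite /h hm hs !cnorm_star => h2.
have h3 := norm_ge_0 (f x); have h4 := norm_ge_0 x.
by apply: Rnot_lt_le => h5; nra.
Qed.

End Contract.

Section Monomials.
Variables (n : nat) (theta : 'I_n -> 'I_n -> R) (A : CstarAlgebra) (U : 'I_n -> A).
Hypothesis HU : torus_relations theta U.
Hypothesis norm1 : norm (cone : A) = 1.

(** Equality up to a scalar of modulus one: commutation phases are carried along without being
    computed. *)
Definition eqU (x y : A) : Prop := exists z : C, Cmod z = 1 /\ x = cscal z y.

Lemma eqU_refl x : eqU x x.
Proof. by exists (RtoC 1); rewrite Cmod_1 cscal1. Qed.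

Lemma eqU_trans y x z : eqU x y -> eqU y z -> eqU x z.
Proof.
move=> [c [hc ->]] [d [hd ->]]; exists (Cmult c d); split; last by rewrite cscalA.
by rewrite Cmod_mult hc hd; ring.
Qed.

Lemma eqU_sym x y : eqU x y -> eqU y x.
Proof.
move=> [c [hc ->]]; exists (Cconj c); split; first by rewrite Cmod_conj.
rewrite cscalA Cmult_comm -Cmod2_conj hc.
by rewrite pow1 cscal1.
Qed.

Lemma eqU_mul x x' y y' : eqU x x' -> eqU y y' -> eqU (cmul x y) (cmul x' y').
Proof.
move=> [c [hc ->]] [d [hd ->]]; exists (Cmult c d); split; last by rewrite cmulZl cmulZr cscalA.
by rewrite Cmod_mult hc hd; ring.
Qed.

Lemma eqU_mull x y y' : eqU y y' -> eqU (cmul x y) (cmul x y').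
Proof. by apply: eqU_mul; apply: eqU_refl. Qed.

Lemma eqU_mulr x x' y : eqU x x' -> eqU (cmul x y) (cmul x' y).
Proof. by move=> h; apply: eqU_mul => //; apply: eqU_refl. Qed.

Section Zpow.
Variable u : A.
Hypothesis Hu : unitary u.

Lemma zpowS z : zpow u (Z.succ z) = cmul u (zpow u z).
Proof.
have [h1 h2] := Hu.
case: z => [|p|p].
- by [].
- by rewrite -Pos2Z.inj_succ /zpow Pos2Nat.inj_succ.
- case: (Pos.succ_pred_or p) => [->|hp].
    by rewrite /= cmulA h2 cmul1l.
  rewrite -hp; have -> : Z.succ (Z.neg (Pos.succ (Pos.pred p))) = Z.neg (Pos.pred p) by lia.
  by rewrite /zpow Pos2Nat.inj_succ /= cmulA h2 cmul1l.
Qed.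

Lemma zpowP z : zpow u (Z.pred z) = cmul (cstar u) (zpow u z).
Proof. by rewrite -{2}(Z.succ_pred z) zpowS cmulA (proj1 Hu) cmul1l. Qed.

Lemma zpowD a b : zpow u (a + b) = cmul (zpow u a) (zpow u b).
Proof.
elim/Z.peano_ind: a => [|a IH|a IH]; first by rewrite cmul1l.
- by rewrite Z.add_succ_l !zpowS IH cmulA.
- by rewrite Z.add_pred_l !zpowP IH cmulA.
Qed.

Lemma unitary_mul v : unitary v -> unitary (cmul u v).
Proof.
have [h1 h2] := Hu; move=> [h3 h4]; split; rewrite cstarM.
- by rewrite cmulA -(cmulA (cstar v)) h1 cmul1r.
- by rewrite cmulA -(cmulA u) h4 cmul1r.
Qed.

Lemma zpow_comm y z : eqU (cmul u y) (cmul y u) -> eqU (cmul (zpow u z) y) (cmul y (zpow u z)).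
Proof.
have [h1 h2] := Hu; move=> h.
(* Multiplying by [cstar u] on both sides shows that the inverse commutes up to a phase as well, as
   the downward induction requires. *)
have h' : eqU (cmul (cstar u) y) (cmul y (cstar u)).
  apply: eqU_sym.
  have -> : cmul y (cstar u) = cmul (cmul (cstar u) (cmul u y)) (cstar u) by rewrite cmulA h1 cmul1l.
  apply: eqU_trans (eqU_mulr (cstar u) (eqU_mull (cstar u) h)) _.
  by rewrite cmulA -(cmulA _ u) h2 cmul1r; apply: eqU_refl.
elim/Z.peano_ind: z => [|z IH|z IH].
- by rewrite cmul1l cmul1r; apply: eqU_refl.
- rewrite zpowS -cmulA; apply: eqU_trans (eqU_mull u IH) _.
  by rewrite !cmulA; apply: eqU_mulr.
- rewrite zpowP -cmulA; apply: eqU_trans (eqU_mull (cstar u) IH) _.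
  by rewrite !cmulA; apply: eqU_mulr.
Qed.

End Zpow.

Lemma unitary1 : unitary (cone : A).
Proof. by split; rewrite cstar1 cmul1l. Qed.

Lemma unitary_star u : @unitary A u -> unitary (cstar u).
Proof. by move=> [h1 h2]; split; rewrite cstarK. Qed.

Lemma zpow_unitary u z : @unitary A u -> unitary (zpow u z).
Proof.
move=> hu; elim/Z.peano_ind: z => [|z IH|z IH]; first exact: unitary1.
- by rewrite (zpowS hu); apply: unitary_mul.
- by rewrite (zpowP hu); apply: unitary_mul => //; apply: unitary_star.
Qed.

Local Notation mon := (monomial U).

Lemma mon_unitary m : unitary (mon m).
Proof.
rewrite /monomial; apply: (big_ind (@unitary A)); first exact: unitary1.
- by move=> x y hx hy; apply: unitary_mul.
- by move=> i _; apply: zpow_unitary; apply: (proj1 HU).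
Qed.

Lemma norm_unitary u : @unitary A u -> norm u = 1.
Proof.
move=> [h1 _]; have := cnorm_star u; rewrite h1 norm1 => h.
by have := norm_ge_0 u; nra.
Qed.

Lemma norm_mon m : norm (mon m) = 1.
Proof. exact: norm_unitary (mon_unitary m). Qed.

Lemma U_comm j k a b : eqU (cmul (zpow (U j) a) (zpow (U k) b)) (cmul (zpow (U k) b) (zpow (U j) a)).
Proof.
have [h1 h2] := HU.
apply: zpow_comm => //; apply: eqU_sym; apply: zpow_comm => //.
by exists (cis (2 * PI * theta j k)); rewrite Cmod_cis h2.
Qed.

Lemma big_eqU (r : seq 'I_n) (x y : 'I_n -> A) :
  (forall j k, eqU (cmul (x j) (y k)) (cmul (y k) (x j))) ->
  eqU (cmul (\big[@cmul A/cone]_(j <- r) x j) (\big[@cmul A/cone]_(j <- r) y j))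
      (\big[@cmul A/cone]_(j <- r) cmul (x j) (y j)).
Proof.
move=> H; elim: r => [|i r IH]; first by rewrite !big_nil cmul1l; apply: eqU_refl.
rewrite !big_cons; set X := \big[_/_]_(j <- r) x j; set Y := \big[_/_]_(j <- r) y j.
have hc : eqU (cmul X (y i)) (cmul (y i) X).
  rewrite /X; apply: (big_ind (fun X => eqU (cmul X (y i)) (cmul (y i) X))).
  - by rewrite cmul1l cmul1r; apply: eqU_refl.
  - move=> p q hp hq; rewrite -cmulA; apply: eqU_trans (eqU_mull p hq) _.
    by rewrite !cmulA; apply: eqU_mulr.
  - by move=> j _; apply: H.
have -> : cmul (cmul (x i) X) (cmul (y i) Y) = cmul (x i) (cmul (cmul X (y i)) Y) by rewrite !cmulA.
apply: eqU_trans (eqU_mull (x i) (eqU_mulr Y hc)) _.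
have -> : cmul (x i) (cmul (cmul (y i) X) Y) = cmul (cmul (x i) (y i)) (cmul X Y) by rewrite !cmulA.
exact: eqU_mull.
Qed.

Definition zadd (k m : Zn n) : Zn n := fun j => (k j + m j)%Z.
Definition zopp (m : Zn n) : Zn n := fun j => (- m j)%Z.

Lemma mon0 : mon (fun=> 0%Z) = cone.
Proof.
rewrite /monomial; apply: (big_ind (fun x => x = cone)) => //.
by move=> x y -> ->; rewrite cmul1l.
Qed.

Lemma mon_mul k m : eqU (cmul (mon k) (mon m)) (mon (zadd k m)).
Proof.
have := @big_eqU (index_enum 'I_n) (fun j => zpow (U j) (k j)) (fun j => zpow (U j) (m j)) (fun j l => U_comm j l _ _).
rewrite /monomial /zadd; under [X in eqU _ X]eq_bigr => j _ do rewrite -(zpowD (proj1 HU j)).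
by [].
Qed.

Lemma mon_star m : eqU (cstar (mon m)) (mon (zopp m)).
Proof.
have h := mon_mul (zopp m) m.
have e0 : zadd (zopp m) m = fun=> 0%Z by apply: functional_extensionality => j; rewrite /zadd /zopp; lia.
rewrite e0 mon0 in h.
have -> : mon (zopp m) = cmul (cmul (mon (zopp m)) (mon m)) (cstar (mon m)).
  by rewrite -cmulA (proj2 (mon_unitary m)) cmul1r.
apply: eqU_sym; apply: eqU_trans (eqU_mulr _ h) _.
by rewrite cmul1l; apply: eqU_refl.
Qed.

End Monomials.

(** * Fourier coefficients and the gauge action *)

Lemma locally_dist (V : NormedModule R_AbsRing) (y : V) e :
  0 < e -> locally y (fun z => dist z y < e).
Proof. by move=> he; move: (@filterlim_id _ (locally y)) => /tendsP /(_ e he). Qed.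

Lemma dist_plus (V : NormedModule R_AbsRing) (y z p q : V) :
  dist (plus y z) (plus p q) <= dist y p + dist z q.
Proof.
rewrite /dist; have -> : minus (plus y z) (plus p q) = plus (minus y p) (minus z q).
  rewrite /minus opp_plus -!plus_assoc; congr plus; rewrite !plus_assoc; congr plus.
  by rewrite plus_comm.
exact: norm_triangle.
Qed.

Lemma dist_cscal (A : CstarAlgebra) z (y p : A) : dist (cscal z y) (cscal z p) = Cmod z * dist y p.
Proof. by rewrite /dist -cscal_minus_r cnormZ. Qed.

Lemma dist_cmul_l (A : CstarAlgebra) (x y p : A) : dist (cmul x y) (cmul x p) <= norm x * dist y p.
Proof. by rewrite /dist -cmul_minus_r; apply: cnormM. Qed.

Lemma dist_cmul_r (A : CstarAlgebra) (x y p : A) : dist (cmul y x) (cmul p x) <= dist y p * norm x.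
Proof. by rewrite /dist -cmul_minus_l; apply: cnormM. Qed.

Lemma dist_ge0 (V : NormedModule R_AbsRing) (y p : V) : 0 <= dist y p.
Proof. exact: norm_ge_0. Qed.

Lemma dist_add (V W : NormedModule R_AbsRing) (L : V -> W) :
  (forall x y, L (plus x y) = plus (L x) (L y)) -> forall x y, dist (L x) (L y) = norm (L (minus x y)).
Proof.
move=> D x y; rewrite /dist; congr norm; have := D (minus x y) y.
have -> : plus (minus x y) y = x by rewrite /minus -plus_assoc plus_opp_l plus_zero_r.
by move=> ->; rewrite /minus -plus_assoc plus_opp_r plus_zero_r.
Qed.

Lemma dist_bounded (V W : NormedModule R_AbsRing) (L : V -> W) M :
  (forall x y, L (plus x y) = plus (L x) (L y)) -> (forall x, norm (L x) <= M * norm x) ->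
  forall x y, dist (L x) (L y) <= M * dist x y.
Proof. by move=> D B x y; rewrite (dist_add D); apply: B. Qed.

Lemma Cmult_sub (a x y : C) : Cmult a (Cminus x y) = Cplus (Cmult a x) (Cmult (Copp a) y).
Proof. ring. Qed.

Lemma Cmult_swap (a b c : C) : Cmult a (Cmult b c) = Cmult b (Cmult a c).
Proof. ring. Qed.

Lemma Sum_single (T : Type) (V : CompleteNormedModule R_AbsRing) (f : T -> V) (x0 : T) :
  (forall x, x <> x0 -> f x = zero) -> Sum f = f x0.
Proof.
move=> H; apply: Sum_unique => e he; exists ([:: x0] : seq (cl T)) => s us hs.
have h0 : (x0 : cl T) \in s by apply: hs; rewrite mem_seq1.
rewrite /vsum (perm_big _ (perm_to_rem h0)) big_cons big1_seq.
  by rewrite /= plus_zero_r /dist minus_eq_zero norm_zero.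
move=> x /= hx; apply: H => E.
by move: hx; rewrite E mem_rem_uniqF.
Qed.

Record torus_data (n : nat) (theta : 'I_n -> 'I_n -> R) (A : CstarAlgebra) (U : 'I_n -> A)
    (alpha : ('I_n -> R) -> A -> A) (tau : A -> C) : Prop := TorusData {
  td_rel : torus_relations theta U;
  td_gen : generated_by U;
  td_alpha : is_gauge_action U alpha;
  td_tau : is_canonical_trace U tau
}.

Section Torus.
Variables (n : nat) (theta : 'I_n -> 'I_n -> R) (A : CstarAlgebra) (U : 'I_n -> A).
Variables (alpha : ('I_n -> R) -> A -> A) (tau : A -> C).
Hypothesis HT : torus_data theta U alpha tau.

Local Notation mon := (@monomial n A U).
Local Notation Zn := (Zn n).

Let HU := td_rel HT.

Lemma tauD a b : tau (plus a b) = Cplus (tau a) (tau b).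
Proof. by have [h _] := td_tau HT. Qed.
Lemma tauZ z a : tau (cscal z a) = Cmult z (tau a).
Proof. by have [_ [h _]] := td_tau HT. Qed.
Lemma tau_le a : Cmod (tau a) <= norm a.
Proof. by have [_ [_ [h _]]] := td_tau HT. Qed.
Lemma tau1 : tau cone = RtoC 1.
Proof. by have [_ [_ [_ [_ [_ [h _]]]]]] := td_tau HT. Qed.
Lemma tau_mon m : (exists j, m j <> 0%Z) -> tau (mon m) = RtoC 0.
Proof. by have [_ [_ [_ [_ [_ [_ h]]]]]] := td_tau HT; apply: h. Qed.
Lemma alpha_hom s : star_hom (alpha s).
Proof. by have [h _] := td_alpha HT. Qed.
Lemma alpha0 a : alpha (fun=> 0) a = a.
Proof. by have [_ [h _]] := td_alpha HT. Qed.
Lemma alpha_mon s m : alpha s (mon m) = cscal (cis (dot s (toR m))) (mon m).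
Proof. by have [_ [_ [_ h]]] := td_alpha HT; apply: h. Qed.
Lemma alphaD s a b : alpha s (plus a b) = plus (alpha s a) (alpha s b).
Proof. by have [h _] := alpha_hom s. Qed.
Lemma alphaZ s z a : alpha s (cscal z a) = cscal z (alpha s a).
Proof. by have [_ [h _]] := alpha_hom s. Qed.
Lemma alpha_le s a : norm (alpha s a) <= norm a.
Proof. exact: star_hom_contract (alpha_hom s) a. Qed.

Lemma norm_one : norm (cone : A) = 1.
Proof.
have h1 := tau_le cone; rewrite tau1 Cmod_1 in h1.
have := cnorm_star (cone : A); rewrite cstar1 cmul1l => h2; nra.
Qed.

Let norm_mon m : norm (mon m) = 1 := norm_mon HU norm_one m.

Definition cf (m : Zn) (a : A) : C := tau (cmul (cstar (mon m)) a).

Lemma cfD m a b : cf m (plus a b) = Cplus (cf m a) (cf m b).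
Proof. by rewrite /cf cmulDr tauD. Qed.

Lemma cfZ m z a : cf m (cscal z a) = Cmult z (cf m a).
Proof. by rewrite /cf cmulZr tauZ. Qed.

Lemma cf_le m a : Cmod (cf m a) <= norm a.
Proof.
apply: Rle_trans (tau_le _) _; apply: Rle_trans (cnormM _ _) _.
by rewrite norm_star norm_mon; lra.
Qed.

Lemma is_linear_cf m : @is_linear R_AbsRing A CV (cf m).
Proof.
split.
- exact: cfD.
- by move=> r x; rewrite -cscalR cfZ scalC.
- by exists 1; split; [lra | move=> x; rewrite Rmult_1_l normC; apply: cf_le].
Qed.

Lemma cf0 m : cf m zero = RtoC 0.
Proof. by rewrite -(cscal0l zero) cfZ Cmult_0_l. Qed.

Lemma cf_mon_eq m : cf m (mon m) = RtoC 1.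
Proof. by rewrite /cf (proj1 (mon_unitary HU m)) tau1. Qed.

(** Up to a phase, [cstar (mon m)] times [mon k] is the monomial of exponent [k - m], whose trace
    vanishes. *)
Lemma cf_mon_neq m k : k <> m -> cf m (mon k) = RtoC 0.
Proof.
move=> hkm; rewrite /cf.
have [z [_ hz]] := eqU_trans (eqU_mulr (mon k) (mon_star HU m)) (mon_mul HU (zopp m) k).
rewrite hz tauZ tau_mon; first by rewrite Cmult_0_r.
apply: NNPP => hn; apply: hkm; apply: functional_extensionality => j.
apply: NNPP => hj; apply: hn; exists j; rewrite /zadd /zopp; lia.
Qed.

(** The phase is read off as a coefficient, so no formula in [theta] has to be derived. *)
Definition ph (k m : Zn) : C := cf (zadd k m) (cmul (mon k) (mon m)).

Lemma phP k m : Cmod (ph k m) = 1 /\ cmul (mon k) (mon m) = cscal (ph k m) (mon (zadd k m)).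
Proof.
have [z [hz h]] := mon_mul HU k m.
by rewrite /ph h cfZ cf_mon_eq Cmult_1_r.
Qed.

(** Associativity of a product of three monomials. It will match the phases when two operators are
    composed. *)
Lemma ph_cocycle a b c :
  Cmult (ph b c) (ph a (zadd b c)) = Cmult (ph a b) (ph (zadd a b) c).
Proof.
have e : zadd a (zadd b c) = zadd (zadd a b) c.
  by apply: functional_extensionality => j; rewrite /zadd Z.add_assoc.
have : cmul (mon a) (cmul (mon b) (mon c)) = cmul (cmul (mon a) (mon b)) (mon c) by rewrite cmulA.
rewrite (proj2 (phP b c)) (proj2 (phP a b)) cmulZr cmulZl (proj2 (phP a (zadd b c))) (proj2 (phP (zadd a b) c)) !cscalA e => /(congr1 (cf (zadd (zadd a b) c))).
by rewrite !cfZ !cf_mon_eq !Cmult_1_r.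
Qed.

Inductive pol : A -> Prop :=
| pol_zero : pol zero
| pol_add c m p : pol p -> pol (plus (cscal c (mon m)) p).

Lemma pol_mon c m : pol (cscal c (mon m)).
Proof. by rewrite -[cscal _ _]plus_zero_r; apply: pol_add; apply: pol_zero. Qed.

Lemma pol_plus p q : pol p -> pol q -> pol (plus p q).
Proof.
move=> hp hq; elim: hp => [|c m r _ IH]; first by rewrite plus_zero_l.
by rewrite -plus_assoc; apply: pol_add.
Qed.

Lemma pol_scal z p : pol p -> pol (cscal z p).
Proof.
elim=> [|c m r _ IH]; first by rewrite cscal0r; apply: pol_zero.
by rewrite cscalDr cscalA; apply: pol_add.
Qed.

Lemma pol_mul p q : pol p -> pol q -> pol (cmul p q).
Proof.
move=> hp hq; elim: hp => [|c m r _ IH]; first by rewrite cmul0l; apply: pol_zero.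
rewrite cmulDl; apply: pol_plus => //; rewrite cmulZl; apply: pol_scal.
elim: hq => [|d k t _ IHt]; first by rewrite cmul0r; apply: pol_zero.
rewrite cmulDr; apply: pol_plus => //; rewrite cmulZr; apply: pol_scal.
by rewrite (proj2 (phP m k)); apply: pol_mon.
Qed.

Lemma pol_star p : pol p -> pol (cstar p).
Proof.
elim=> [|c m r _ IH].
  have e : Cconj (RtoC 0) = RtoC 0 by rewrite /Cconj /= Ropp_0.
  by rewrite -(cscal0l zero) cstarZ e !cscal0l; apply: pol_zero.
rewrite cstarD; apply: pol_plus => //; rewrite cstarZ; apply: pol_scal.
by have [z [_ ->]] := mon_star HU m; apply: pol_mon.
Qed.

Definition approx (x : A) : Prop := forall e, 0 < e -> exists p, pol p /\ dist x p < e.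

Lemma mon_gen j : exists m, mon m = U j.
Proof.
exists (fun i => if i == j then 1%Z else 0%Z).
have hz i : zpow (U i) (if i == j then 1%Z else 0%Z) = if i == j then U j else cone.
  case: eqP => [->|_] //; by rewrite /= cmul1r.
rewrite /monomial; under eq_bigr => i _ do rewrite hz.
have H (r : seq 'I_n) : uniq r -> \big[@cmul A/cone]_(i <- r) (if i == j then U j else cone) = if j \in r then U j else cone.
  elim: r => [|i r IH] /=; first by rewrite big_nil.
  move=> /andP [hi ur]; rewrite big_cons IH // in_cons (eq_sym j i).
  case: (eqVneq i j) hi => [->|_] hi /=; last by rewrite cmul1l.
  by rewrite (negbTE hi) cmul1r.
by rewrite H ?index_enum_uniq // mem_index_enum.
Qed.

(** The limits of polynomials form a closed unital star-subalgebra that contains the generators,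
    hence everything by [generated_by]. *)
Lemma approx_all x : approx x.
Proof.
apply: (td_gen HT (S := approx)).
(* A set is [closed] here when it contains each point none of whose neighbourhoods avoids it; hence
   the argument by contradiction. *)
- move=> y hy e he; have he2 : 0 < e / 2 by lra.
  have [z [hz1 hz2]] : exists z, dist y z < e / 2 /\ approx z.
    apply: NNPP => hn; apply: hy.
    have HH := locally_dist y he2.
    refine (@filter_imp _ (locally y) _ _ _ _ HH) => z hz ha; apply: hn; exists z; split=> //.
    by rewrite distC.
  have [p [hp1 hp2]] := hz2 _ he2.
  by exists p; split=> //; have := dist_tri z y p; lra.
- move=> j e he; have [m <-] := mon_gen j; exists (mon m); split.
    by rewrite -[mon m]cscal1; apply: pol_mon.
  by rewrite /dist minus_eq_zero norm_zero.
- move=> e he; exists cone; split; last by rewrite /dist minus_eq_zero norm_zero.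
  by rewrite -(mon0 U) -[monomial _ _]cscal1; apply: pol_mon.
- move=> y z hy hz e he; have he2 : 0 < e / 2 by lra.
  have [p [hp1 hp2]] := hy _ he2; have [q [hq1 hq2]] := hz _ he2.
  exists (plus p q); split; first exact: pol_plus.
  by apply: Rle_lt_trans (dist_plus _ _ _ _) _; lra.
- move=> z y hy e he; have hz := Cmod_ge_0 z.
  have he2 : 0 < e / (Cmod z + 1) by apply: Rdiv_lt_0_compat; lra.
  have [p [hp1 hp2]] := hy _ he2; exists (cscal z p); split; first exact: pol_scal.
  rewrite dist_cscal.
  have : (Cmod z + 1) * dist y p < e.
    have := Rmult_lt_compat_l (Cmod z + 1) _ _ ltac:(lra) hp2.
    by have -> : (Cmod z + 1) * (e / (Cmod z + 1)) = e by field; lra.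
  have := dist_ge0 y p; nra.
- move=> y z hy hz e he.
  have hny := norm_ge_0 y; have hnz := norm_ge_0 z.
  pose M := norm y + norm z + 1.
  have hM : 0 < M by rewrite /M; lra.
  pose e1 := Rmin 1 (e / M).
  have he1 : 0 < e1 by apply: Rmin_pos; [lra | apply: Rdiv_lt_0_compat].
  have [p [hp1 hp2]] := hy _ he1; have [q [hq1 hq2]] := hz _ he1.
  exists (cmul p q); split; first exact: pol_mul.
  apply: Rle_lt_trans (dist_tri (cmul y q) _ _) _.
  have h1 := dist_cmul_l y z q; have h2 := dist_cmul_r q y p.
  have h3 : norm q <= norm z + 1.
    have := dist_tri z q zero; rewrite (distC q z) !dist0r.
    have := Rmin_l 1 (e / M); rewrite -/e1; lra.
  have h4 : e1 * M <= e.
    have := Rmult_le_compat_r M _ _ (Rlt_le _ _ hM) (Rmin_r 1 (e / M)); rewrite -/e1.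
    by have -> : e / M * M = e by field; lra.
  have h5 : norm y * dist z q <= norm y * e1 by apply: Rmult_le_compat_l; lra.
  have h6 : dist y p * norm q <= dist y p * (norm z + 1).
    by apply: Rmult_le_compat_l => //; exact: dist_ge0.
  have h7 : dist y p * (norm z + 1) < e1 * (norm z + 1) by apply: Rmult_lt_compat_r; lra.
  rewrite /M in h4; nra.
- move=> y hy e he; have [p [hp1 hp2]] := hy _ he; exists (cstar p); split; first exact: pol_star.
  by rewrite (dist_add (@cstarD A)) norm_star.
Qed.

(** Two additive maps with a common bound agree on the dense set of polynomials. The action on
    coefficients, the smoothing series and the products with monomials are obtained this way. *)
Lemma agree_on_monomials (V : NormedModule R_AbsRing) (L1 L2 : A -> V) M :
  (forall x y, L1 (plus x y) = plus (L1 x) (L1 y)) ->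
  (forall x y, L2 (plus x y) = plus (L2 x) (L2 y)) ->
  (forall x, norm (L1 x) <= M * norm x) -> (forall x, norm (L2 x) <= M * norm x) ->
  (forall c m, L1 (cscal c (mon m)) = L2 (cscal c (mon m))) -> forall x, L1 x = L2 x.
Proof.
move=> D1 D2 B1 B2 H x.
have Hp p : pol p -> L1 p = L2 p.
  elim=> [|c m q _ IH]; last by rewrite D1 D2 H IH.
  by have := H (RtoC 0) (fun=> 0%Z); rewrite cscal0l.
have hM : 0 <= M.
  have := B1 cone; rewrite norm_one; have := norm_ge_0 (L1 cone); lra.
apply: small_eq => e he.
have he1 : 0 < e / (2 * M + 1) by apply: Rdiv_lt_0_compat; lra.
have [p [hp1 hp2]] := approx_all x he1.
have h1 := dist_bounded D1 B1 x p; have h2 := dist_bounded D2 B2 x p.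
have h3 := dist_tri (L1 p) (L1 x) (L2 x).
rewrite [X in _ + dist X _](Hp p hp1) (distC (L2 p)) in h3.
have h4 : (2 * M + 1) * dist x p < e.
  have := Rmult_lt_compat_l (2 * M + 1) _ _ ltac:(lra) hp2.
  by have -> : (2 * M + 1) * (e / (2 * M + 1)) = e by field; lra.
have := dist_ge0 x p; lra.
Qed.

Lemma cf_alpha m s a : cf m (alpha s a) = Cmult (cis (dot s (toR m))) (cf m a).
Proof.
apply: (@agree_on_monomials CV (fun a => cf m (alpha s a)) (fun a => Cmult (cis (dot s (toR m))) (cf m a)) 1).
- by move=> x y; rewrite alphaD cfD.
- move=> x y; rewrite cfD; exact: Cmult_plus_distr_l.
- by move=> x; rewrite normC Rmult_1_l; apply: Rle_trans (cf_le _ _) (alpha_le _ _).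
- by move=> x; rewrite normC Cmod_mult Cmod_cis !Rmult_1_l; apply: cf_le.
- move=> c k; rewrite alphaZ alpha_mon !cfZ.
  case: (classic (k = m)) => [->|h]; first by rewrite cf_mon_eq; exact: Cmult_swap.
  by rewrite cf_mon_neq // !Cmult_0_r.
Qed.

(** Strong continuity is evident on polynomials, and passes to limits because every [alpha u] is
    contractive. *)
Lemma alpha_cont a s : continuous (fun s => alpha s a) s.
Proof.
have Hp p : pol p -> continuous (fun s => alpha s p) s.
  elim=> [|c m q _ IH].
    have -> : (fun s => alpha s zero) = (fun=> zero).
      by apply: functional_extensionality => t; rewrite (star_hom0 (alpha_hom t)).
    exact: filterlim_const.
  have -> : (fun s => alpha s (plus (cscal c (mon m)) q)) =
      (fun t => plus (cscal (Cmult c (cis (dot t (toR m)))) (mon m)) (alpha t q)).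
    by apply: functional_extensionality => t; rewrite alphaD alphaZ alpha_mon cscalA.
  apply: lim_plus => //; apply: lim_cscal; last exact: filterlim_const.
  apply: lim_Cmult; first exact: filterlim_const.
  by apply: lim_cis; apply: lim_dot; [exact: filterlim_id | exact: filterlim_const].
apply/contP => e he; have he3 : 0 < e / 3 by lra.
have [p [hp1 hp2]] := approx_all a he3.
have /contP /(_ _ he3) := Hp p hp1.
apply: filter_imp => t ht.
have hd u : dist (alpha u a) (alpha u p) <= dist a p.
  by rewrite (dist_add (alphaD u)); exact: alpha_le.
have := dist_tri (alpha t p) (alpha t a) (alpha s a).
have := dist_tri (alpha s p) (alpha t p) (alpha s a).
have := hd t; have := hd s; rewrite (distC (alpha s p)); lra.
Qed.

Lemma pk0 d : pk (fun _ : 'I_d => 0) = 2 ^ d.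
Proof.
rewrite pk_dk /dk; have -> : / (1 + 0 ^ 2) = 1 by field.
by rewrite prodR_const pow1 Rmult_1_r.
Qed.

(** Normalized to integral [1]: the integral of [exp (- |u|)] over the line is [2]. *)
Definition ek' (u : 'I_n -> R) : R := ek u / 2 ^ n.

Lemma pow2n : 0 < 2 ^ n. Proof. by apply: pow_lt; lra. Qed.

(** This average of the gauge action multiplies [U^m] by [\prod_j 1 / (1 + (del m_j)^2)], so
    its values have summable coefficients; it tends to [a] when [del] tends to [0]. *)
Definition smoothing (del : R) (a : A) : A :=
  Int (fun u => cscal (RtoC (ek' u)) (alpha (fun i => del * u i) a)).

Lemma smoothing_nice del a : nice (4 ^ n * norm a) (fun u => cscal (RtoC (ek' u)) (alpha (fun i => del * u i) a)).
Proof.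
have h2 := pow2n.
have h21 : 1 <= 2 ^ n by rewrite -(pow1 n); apply: pow_incr; lra.
split=> u.
  apply: lim_cscal.
    apply: lim_RtoC; apply: lim_Rmult; last exact: filterlim_const.
    by apply: lim_ek; exact: filterlim_id.
  apply: (lim_comp (f := fun u : 'I_n -> R => fun i => del * u i) (h := fun s => alpha s a)); last exact: alpha_cont.
  by apply: lim_scalv; [exact: filterlim_const | exact: filterlim_id].
rewrite cnormZ Cmod_R.
have h3 := ek_dk u (conj Rlt_0_1 (Rle_refl 1)).
have e1 : (fun i => 1 * u i) = u by apply: functional_extensionality => i; ring.
rewrite e1 pow1 Rdiv_1_r in h3.
have h4 := alpha_le (fun i => del * u i) a; have h5 := norm_ge_0 (alpha (fun i => del * u i) a).
have h6 := ek_pos u.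
have h7 : 0 <= ek' u <= ek u.
  split; first by apply: Rmult_le_pos; [lra | left; apply: Rinv_0_lt_compat].
  apply: (Rmult_le_reg_r (2 ^ n)) => //; rewrite /ek' /Rdiv Rmult_assoc Rinv_l; nra.
rewrite Rabs_pos_eq; last lra.
have -> : 4 ^ n * norm a * dk u = (4 ^ n * dk u) * norm a by ring.
by apply: Rmult_le_compat; lra.
Qed.

Lemma TdD del a b : smoothing del (plus a b) = plus (smoothing del a) (smoothing del b).
Proof.
rewrite /smoothing -(Int_plus (smoothing_nice del a) (smoothing_nice del b)); apply: Int_ext => u.
by rewrite alphaD cscalDr.
Qed.

Lemma smoothing_mon del c m : smoothing del (cscal c (mon m)) = cscal (Cmult (RtoC (pk (fun i => del * toR m i) / 2 ^ n)) c) (mon m).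
Proof.
have h2 := pow2n.
apply: Int_unique.
have H := is_int_ek (fun i => del * toR m i).
have := is_int_lin (is_linear_cscal_l (cscal (Cmult (RtoC (/ 2 ^ n)) c) (mon m))) H.
have -> : cscal (RtoC (pk (fun i => del * toR m i))) (cscal (Cmult (RtoC (/ 2 ^ n)) c) (mon m)) =
   cscal (Cmult (RtoC (pk (fun i => del * toR m i) / 2 ^ n)) c) (mon m).
  by rewrite cscalA /Rdiv RtoC_mult Cmult_assoc.
apply: is_int_ext => u.
rewrite alphaZ alpha_mon !cscalA; congr cscal.
rewrite dotZr -dotZl /ek' /Rdiv RtoC_mult; ring.
Qed.

Lemma smoothing_lim a : tends (at_right 0) (fun del => smoothing del a) a.
Proof.
have E0 : Int (fun u => cscal (RtoC (ek' u)) (alpha (fun i => 0 * u i) a)) = a.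
  apply: Int_unique.
  have H := is_int_ek (fun _ : 'I_n => 0); rewrite pk0 in H.
  have := is_int_lin (is_linear_cscal_l (cscal (RtoC (/ 2 ^ n)) a)) H.
  rewrite cscalA -RtoC_mult Rinv_r; last by have := pow2n; lra.
  rewrite cscal1; apply: is_int_ext => u.
  have -> : (fun i => 0 * u i) = (fun=> 0) by apply: functional_extensionality => i; ring.
  rewrite alpha0 cscalA; congr cscal.
  have -> : dot u (fun=> 0) = 0 by rewrite /dot -[RHS](sumR_zero n); apply: sumR_ext => i; ring.
  by rewrite cis0 /ek' /Rdiv RtoC_mult Cmult_1_r.
rewrite -{2}E0.
apply: (Int_dct (f := fun del u => cscal (RtoC (ek' u)) (alpha (fun i => del * u i) a)) (K := 4 ^ n * norm a)).
- by apply: filter_forall => del; apply: smoothing_nice.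
- exact: smoothing_nice.
move=> u; apply/tendsP; apply: lim_cscal.
  apply: lim_RtoC; apply: lim_Rmult; last exact: filterlim_const.
  by apply: lim_ek; exact: filterlim_snd.
apply: (lim_comp (f := fun p : R * ('I_n -> R) => fun i => p.1 * p.2 i) (h := fun s => alpha s a)); last exact: alpha_cont.
apply: lim_scalv; last exact: filterlim_snd.
exact: (filterlim_comp _ _ _ fst (fun t => t) _ (at_right 0) _ filterlim_fst at_right_id).
Qed.

Lemma smoothing_summable del : 0 < del <= 1 -> summable (fun m : Zn => pk (fun i => del * toR m i) / 2 ^ n).
Proof.
move=> hd; have h2 := pow2n.
apply: (summable_le (g := fun m : Zn => (/ del ^ 2) ^ n * dk (toR m))); last first.
  apply: summable_scal; last by exists (6 ^ n); apply: summable_dk.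
  by apply: pow_le; left; apply: Rinv_0_lt_compat; nra.
move=> m; rewrite pk_dk.
have -> : 2 ^ n * dk (fun i => del * toR m i) / 2 ^ n = dk (fun i => del * toR m i) by field; lra.
apply: prodR_scale => [|i]; first by left; apply: Rinv_0_lt_compat; nra.
split; first by left; apply: (proj1 (inv1p_pos _)).
have -> : / del ^ 2 * / (1 + toR m i ^ 2) = / (del ^ 2 * (1 + toR m i ^ 2)) by field; split; nra.
apply: Rinv_le_contravar; nra.
Qed.

(** Both sides are bounded additive maps of [a] that agree on monomials; [4 ^ n * PI ^ n + B] bounds
    both. *)
Lemma smoothing_series del a : 0 < del <= 1 ->
  smoothing del a = Sum (fun m : Zn => cscal (Cmult (RtoC (pk (fun i => del * toR m i) / 2 ^ n)) (cf m a)) (mon m)).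
Proof.
move=> hd; have hs := smoothing_summable hd; have [B HB] := hs.
have hB : 0 <= B by have := proj2 HB [::] isT; rewrite /rsum big_nil.
have hb x m : norm (cscal (Cmult (RtoC (pk (fun i => del * toR m i) / 2 ^ n)) (cf m x)) (mon m)) <= norm x * (pk (fun i => del * toR m i) / 2 ^ n).
  rewrite cnormZ norm_mon Rmult_1_r Cmod_mult Cmod_R Rabs_pos_eq; last exact: (proj1 HB m).
  by rewrite Rmult_comm; apply: Rmult_le_compat_r; [exact: (proj1 HB m) | exact: cf_le].
have hdom x : dominated (fun m : Zn => cscal (Cmult (RtoC (pk (fun i => del * toR m i) / 2 ^ n)) (cf m x)) (mon m)) (fun m => norm x * (pk (fun i => del * toR m i) / 2 ^ n)).
  by apply: dominated_scal_le => //; exact: norm_ge_0.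
apply: (@agree_on_monomials A (smoothing del) (fun a => Sum (fun m : Zn => cscal (Cmult (RtoC (pk (fun i => del * toR m i) / 2 ^ n)) (cf m a)) (mon m))) (4 ^ n * PI ^ n + B)).
- exact: TdD.
- move=> x y; rewrite -(Sum_plus (hdom x) (hdom y)); apply: Sum_ext => m.
  by rewrite -cscalDl cfD; congr cscal; ring.
- move=> x; apply: Rle_trans (Int_le (smoothing_nice del x)) _.
  have := norm_ge_0 x; nra.
- move=> x; apply: Rle_trans (_ : norm x * B <= _).
    apply: (Sum_le (g := fun m => norm x * (pk (fun i => del * toR m i) / 2 ^ n))); last exact: hb.
    split=> [m|s us]; first by apply: Rmult_le_pos; [exact: norm_ge_0 | exact: (proj1 HB m)].
    have -> : forall g, rsum s (fun m : Zn => norm x * g m) = norm x * rsum s g.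
      move=> g; elim: s {us} => [|y s IH]; first by rewrite /rsum !big_nil; ring.
      by rewrite /rsum !big_cons -!/(rsum _ _) IH /=; ring.
    by apply: Rmult_le_compat_l; [exact: norm_ge_0 | exact: (proj2 HB)].
  have h4 : 0 <= 4 ^ n * PI ^ n by apply: Rmult_le_pos; apply: pow_le; [lra | have := PI_RGT_0; lra].
  have := norm_ge_0 x; nra.
- move=> c k; rewrite smoothing_mon (Sum_single (x0 := k)); first by rewrite cfZ cf_mon_eq Cmult_1_r.
  move=> m hm; rewrite cfZ cf_mon_neq; last by move=> h; apply: hm.
  by rewrite !Cmult_0_r cscal0l.
Qed.

(** If all coefficients vanish, so does each average [smoothing del a], by its series; these
    averages tend to [a]. *)
Lemma cf_inj a : (forall m, cf m a = RtoC 0) -> a = zero.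
Proof.
move=> H; apply: (@tends_unique _ A (at_right 0) _ _ _ _ (smoothing_lim a)).
apply: (tends_ext_ev (f := fun=> zero)).
  apply: filter_imp at_right_01 => del hd; rewrite (smoothing_series a hd).
  by rewrite (Sum_ext (f' := fun=> zero)) ?Sum_zero // => m; rewrite H Cmult_0_r cscal0l.
by move=> e he; apply: filter_forall => t; rewrite /dist minus_eq_zero norm_zero.
Qed.

Lemma cf_eq a b : (forall m, cf m a = cf m b) -> a = b.
Proof.
move=> H; apply: (@minus_eq0 A); apply: cf_inj => m.
by rewrite /minus cfD -cscalN1 cfZ H; ring.
Qed.

Definition fser (c : Zn -> C) : A := Sum (fun m => cscal (c m) (mon m)).

Lemma norm_ser_term (c : Zn -> C) m : norm (cscal (c m) (mon m)) = Cmod (c m).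
Proof. by rewrite cnormZ norm_mon Rmult_1_r. Qed.

Lemma ser_dom (c : Zn -> C) g : summable g -> (forall m, Cmod (c m) <= g m) ->
  dominated (fun m => cscal (c m) (mon m)) g.
Proof. by move=> hg hc; split=> // m; rewrite norm_ser_term. Qed.

Lemma cf_ser (c : Zn -> C) g k : summable g -> (forall m, Cmod (c m) <= g m) -> cf k (fser c) = c k.
Proof.
move=> hg hc; rewrite /fser -(Sum_lin (is_linear_cf k) (ser_dom hg hc)).
rewrite (Sum_single (x0 := k)); first by rewrite cfZ cf_mon_eq Cmult_1_r.
by move=> m hm; rewrite cfZ cf_mon_neq // Cmult_0_r.
Qed.

Lemma ser_cf a g : summable g -> (forall m, Cmod (cf m a) <= g m) -> fser (fun m => cf m a) = a.
Proof. by move=> hg hc; apply: cf_eq => m; rewrite (cf_ser m hg hc). Qed.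

End Torus.

(** * The smooth subalgebra and its derivations *)

Lemma lim0P (T : Type) (F : (T -> Prop) -> Prop) {FF : Filter F} (r : T -> R) :
  (forall t, 0 <= r t) ->
  filterlim r F (locally 0) <-> forall e, 0 < e -> F (fun t => r t < e).
Proof.
move=> Hr.
have key t : dist (V := R_NormedModule) (r t) 0 = r t.
  by rewrite dist0r /norm /= /abs /= Rabs_pos_eq.
split.
- move=> /(@tendsP _ R_NormedModule) H e he; apply: filter_imp (H e he) => t.
  by rewrite key.
- move=> H; apply/(@tendsP _ R_NormedModule) => e he.
  by apply: filter_imp (H e he) => t; rewrite key.
Qed.

Lemma is_partial_norm (A : CompleteNormedModule R_AbsRing) d j (f : ('I_d -> R) -> A) x v :
  @is_partial A unit (fun _ => True) (fun _ => norm) d j f x v <->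
  is_derive (fun t => f (shift x j t)) 0 v.
Proof.
have E : forall t : R, f (shift x j (0 + t)) = f (shift x j t) by move=> t; rewrite Rplus_0_l.
split.
- move=> [_ /(_ tt) /lim0P H]; apply/is_deriveP => e he.
  have := H (fun t => norm_ge_0 _) e he; apply: filter_imp => t; rewrite E shift0.
  by apply.
- move=> /is_deriveP H; split=> // _; apply/lim0P; first by move=> t; apply: norm_ge_0.
  move=> e he; have := H e he; apply: filter_imp => t; rewrite E shift0.
  by apply.
Qed.

Lemma locally'_proper : ProperFilter (locally' (0 : R)).
Proof. exact: (Rbar_locally'_filter (Finite 0)). Qed.

Lemma is_derive_uniq (V : NormedModule R_AbsRing) (f : R -> V) x v w :
  is_derive f x v -> is_derive f x w -> v = w.
Proof.
move=> /is_deriveP H1 /is_deriveP H2.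
exact: (@tends_unique _ _ (locally' 0) locally'_proper _ _ _ H1 H2).
Qed.

(** The value of [partial] is chosen by [epsilon]; uniqueness of derivatives pins the choice
    down. *)
Lemma partial_norm_eq (A : CompleteNormedModule R_AbsRing) d j (f : ('I_d -> R) -> A) x v :
  is_derive (fun t => f (shift x j t)) 0 v ->
  @partial A unit (fun _ => True) (fun _ => norm) d j f x = v.
Proof.
move=> H.
have H' : @is_partial A unit (fun _ => True) (fun _ => norm) d j f x (@partial A unit (fun _ => True) (fun _ => norm) d j f x).
  by apply: epsilon_spec; exists v; apply/is_partial_norm.
by move/is_partial_norm: H' => H'; apply: is_derive_uniq H' H.
Qed.

Lemma mi_iter_foldr (d : nat) (X : Type) (D : 'I_d -> X -> X) (l : 'I_d -> nat) (x : X) :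
  mi_iter D l x = foldr D x (flatten [seq nseq (l j) j | j <- enum 'I_d]).
Proof.
rewrite /mi_iter; elim: (enum 'I_d) => [//|j s IH] /=.
rewrite foldr_cat -IH; elim: (l j) => [//|k IHk] /=; by rewrite IHk.
Qed.

Lemma Cmult_AC (a b c : C) : Cmult (Cmult a b) c = Cmult (Cmult a c) b.
Proof. ring. Qed.

(** Eigenvalue on [U^m] of the successive derivatives of the gauge action along [js]: every
    direction [j] contributes [i * m_j]. *)
Definition dirs n (js : seq 'I_n) (m : Zn n) : C :=
  foldr (fun j z => Cmult (0, IZR (m j)) z) (RtoC 1) js.

Lemma Cmod_im x : Cmod (0, x) = Rabs x.
Proof. by rewrite /Cmod /= Rmult_0_l Rplus_0_l Rmult_1_r -sqrt_Rsqr_abs. Qed.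

Lemma Cmod_dirs n (js : seq 'I_n) (m : Zn n) : Cmod (dirs js m) <= wt (toR m) ^ size js.
Proof.
elim: js => [|j js IH] /=; first by rewrite Cmod_1; lra.
rewrite Cmod_mult Cmod_im; apply: Rmult_le_compat => //; try exact: Rabs_pos; try exact: Cmod_ge_0.
have := wt_ge_abs (toR m) j; rewrite /toR; lra.
Qed.

Definition rapid n (c : Zn n -> C) : Prop :=
  forall K : nat, exists B, forall m, Cmod (c m) <= B * / wt (toR m) ^ K.

Lemma wt_pos d (x : 'I_d -> R) K : 0 < wt x ^ K.
Proof. by apply: pow_lt; have := wt_ge1 x; lra. Qed.

Lemma rapid_mul n (c c' : Zn n -> C) N B :
  rapid c -> (forall m, Cmod (c' m) <= B * wt (toR m) ^ N) -> rapid (fun m => Cmult (c' m) (c m)).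
Proof.
move=> Hc Hb K; have [B' HB'] := Hc (N + K)%N.
exists (B * B') => m; rewrite Cmod_mult.
have h1 := Hb m; have h2 := HB' m; have h3 := Cmod_ge_0 (c m); have h4 := Cmod_ge_0 (c' m).
apply: Rle_trans (Rmult_le_compat _ _ _ _ h4 h3 h1 h2) _; right.
rewrite pow_add; field; have h5 := wt_pos (toR m) N; have h6 := wt_pos (toR m) K; lra.
Qed.

Lemma rapid_summable n (c : Zn n -> C) N : rapid c -> summable (fun m => wt (toR m) ^ N * Cmod (c m)).
Proof.
move=> Hc; have [B HB] := Hc (N + 2 * n)%N.
have hB : 0 <= B.
  have := HB (fun=> 0%Z); have := Cmod_ge_0 (c (fun=> 0%Z)); have := wt_pos (toR (fun _ : 'I_n => 0%Z)) (N + 2 * n).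
  set w := _ ^ _ => h1 h2 h3.
  have h4 : 0 < / w by apply: Rinv_0_lt_compat.
  by apply: Rnot_lt_le => h5; nra.
apply: (summable_le (g := fun m => B * / wt (toR m) ^ (2 * n))); last by apply: summable_scal => //; apply: summable_wt.
move=> m; have h5 := wt_pos (toR m) N; have h6 := wt_pos (toR m) (2 * n).
split; first by apply: Rmult_le_pos; [lra | exact: Cmod_ge_0].
apply: Rle_trans (Rmult_le_compat_l _ _ _ (Rlt_le _ _ h5) (HB m)) _.
by right; rewrite pow_add; field; lra.
Qed.

Lemma rapid_summable0 n (c : Zn n -> C) : rapid c -> summable (fun m => Cmod (c m)).
Proof.
move=> Hc; have := rapid_summable 0 Hc; apply: summable_le => m /=.
by rewrite Rmult_1_l; split; [exact: Cmod_ge_0 | lra].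
Qed.

Lemma rapid_le n (c c' : Zn n -> C) : rapid c -> (forall m, Cmod (c' m) <= Cmod (c m)) -> rapid c'.
Proof. by move=> H Hle K; have [B HB] := H K; exists B => m; apply: Rle_trans (HB m). Qed.

Lemma rapid_plus n (c c' : Zn n -> C) : rapid c -> rapid c' -> rapid (fun m => Cplus (c m) (c' m)).
Proof.
move=> H H' K; have [B HB] := H K; have [B' HB'] := H' K.
exists (B + B') => m; apply: Rle_trans (Cmod_triangle _ _) _.
by have := HB m; have := HB' m; rewrite Rmult_plus_distr_r; lra.
Qed.

Lemma rapid_scal n (c : Zn n -> C) z : rapid c -> rapid (fun m => Cmult z (c m)).
Proof.
move=> H; apply: (rapid_mul (N := 0) (B := Cmod z) (c' := fun=> z) H) => m /=; lra.
Qed.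

Section Torus.
Variables (n : nat) (theta : 'I_n -> 'I_n -> R) (A : CstarAlgebra) (U : 'I_n -> A).
Variables (alpha : ('I_n -> R) -> A -> A) (tau : A -> C).
Hypothesis HT : torus_data theta U alpha tau.

Local Notation mon := (@monomial n A U).
Local Notation Zn := (Zn n).
Local Notation cf := (cf U tau).
Local Notation ser := (fser U).
Local Notation Ainf := (Ainf alpha).
Local Notation Ainf_norm := (Ainf_norm alpha).
Local Notation pn := (@partial A unit (fun _ => True) (fun _ => norm) n).

Definition fcoef (a : A) : Zn -> C := fun m => cf m a.

Lemma cf_ser_rapid c k : rapid c -> cf k (ser c) = c k.
Proof. by move=> H; apply: (cf_ser HT k (rapid_summable0 H)) => m; lra. Qed.

Lemma ser_coef a : rapid (fcoef a) -> ser (fcoef a) = a.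
Proof. by move=> H; apply: (ser_cf HT (rapid_summable0 H)) => m; rewrite /fcoef; lra. Qed.

Lemma rser_dom c : rapid c -> dominated (fun m => cscal (c m) (mon m)) (fun m => Cmod (c m)).
Proof. by move=> H; apply: (ser_dom HT (rapid_summable0 H)) => m; lra. Qed.

Lemma norm_ser_le c g B : summable_by B g -> (forall m, Cmod (c m) <= g m) -> norm (ser c) <= B.
Proof.
move=> HB H; apply: (Sum_le (g := g)) => // m.
by rewrite (norm_ser_term HT).
Qed.

Lemma alpha_coef s a : rapid (fcoef a) -> rapid (fcoef (alpha s a)).
Proof.
move=> H; apply: (rapid_le H) => m.
by rewrite /fcoef (cf_alpha HT) Cmod_mult Cmod_cis; lra.
Qed.

(** The infinitesimal generator of the action along [j], that is [i] times the derivation, defined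
    on coefficients so as to be independent of [delta]. *)
Definition Dj (j : 'I_n) (a : A) : A := ser (fun m => Cmult (0, IZR (m j)) (cf m a)).

Lemma Dj_rapid j a : rapid (fcoef a) -> rapid (fun m => Cmult (0, IZR (m j)) (cf m a)).
Proof.
move=> H; apply: (rapid_mul (N := 1) (B := 1) (c' := fun m : Zn => (0, IZR (m j))) H) => m.
rewrite Cmod_im pow_1; have := wt_ge_abs (toR m) j; rewrite /toR; lra.
Qed.

Lemma cf_Dj j a m : rapid (fcoef a) -> cf m (Dj j a) = Cmult (0, IZR (m j)) (cf m a).
Proof. by move=> H; rewrite /Dj cf_ser_rapid //; apply: Dj_rapid. Qed.

Lemma Dj_coef j a : rapid (fcoef a) -> rapid (fcoef (Dj j a)).
Proof.
move=> H; apply: (rapid_le (Dj_rapid j H)) => m.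
by rewrite /fcoef cf_Dj //; lra.
Qed.

Lemma cis_dq_le r t : Cmod (Cminus (cis (r * t)) (RtoC 1)) <= 2 * Rabs r * Rabs t.
Proof.
have hc : Rabs (cos (r * t) - cos 0) <= 1 * Rabs (r * t - 0).
  apply: (bounded_variation cos (fun x => - sin x)) => x _; split; first by auto_derive => //; ring.
  by rewrite Rabs_Ropp; apply: abs_sin_le.
have hs : Rabs (sin (r * t) - sin 0) <= 1 * Rabs (r * t - 0).
  apply: (bounded_variation sin cos) => x _; split; first by auto_derive => //; ring.
  exact: abs_cos_le.
rewrite Rminus_0_r cos_0 Rmult_1_l Rabs_mult in hc.
rewrite !Rminus_0_r sin_0 Rmult_1_l Rabs_mult in hs.
apply: Rle_trans (Cmod_le_sum _) _ => /=.
rewrite /Rminus in hc hs *; rewrite Ropp_0 in hs *; lra.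
Qed.

(** Termwise differentiation: the difference quotients of the coefficients are at most
    [2 * wt (toR m)] times the coefficient, which is summable by rapid decay. *)
Lemma alpha_derive j a x : rapid (fcoef a) ->
  is_derive (fun t => alpha (shift x j t) a) 0 (alpha x (Dj j a)).
Proof.
move=> H; apply/is_deriveP.
have Hx := alpha_coef x H.
pose q (t : R) m := cscal (Cmult (Cmult (RtoC (/ t)) (Cminus (cis (IZR (m j) * t)) (RtoC 1))) (cf m (alpha x a))) (mon m).
have hq t : t <> 0 -> forall m, norm (q t m) <= 2 * (wt (toR m) ^ 1 * Cmod (fcoef (alpha x a) m)).
  move=> ht m; rewrite /q (norm_ser_term HT (fun m => Cmult (Cmult (RtoC (/ t)) (Cminus (cis (IZR (m j) * t)) (RtoC 1))) (cf m (alpha x a)))).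
  rewrite !Cmod_mult -Rmult_assoc; apply: Rmult_le_compat_r; first exact: Cmod_ge_0.
  rewrite Cmod_R Rabs_inv; have hp := Rabs_pos_lt _ ht.
  apply: (Rmult_le_reg_l (Rabs t)) => //; rewrite -Rmult_assoc Rinv_r ?Rmult_1_l; last lra.
  apply: Rle_trans (cis_dq_le _ _) _.
  have := wt_ge_abs (toR m) j; rewrite /toR pow_1 => h; nra.
have hsum := rapid_summable 1 Hx.
apply: (tends_ext_ev (f := fun t => Sum (q t))).
  exists (mkposreal _ Rlt_0_1) => t _ ht.
  apply: (cf_eq HT) => m; rewrite Rplus_0_l shift0.
  rewrite -/(ser (fun m => Cmult (Cmult (RtoC (/ t)) (Cminus (cis (IZR (m j) * t)) (RtoC 1))) (cf m (alpha x a)))).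
  rewrite (cf_ser HT (g := fun m => 2 * (wt (toR m) ^ 1 * Cmod (fcoef (alpha x a) m)))).
  - rewrite -cscalR (cfZ HT) /minus (cfD HT) -cscalN1 (cfZ HT) !(cf_alpha HT) dot_shift cisD /toR; ring.
  - by apply: summable_scal hsum; lra.
  - by move=> k; rewrite -(norm_ser_term HT (fun m => Cmult (Cmult (RtoC (/ t)) (Cminus (cis (IZR (m j) * t)) (RtoC 1))) (cf m (alpha x a)))); apply: hq.
have -> : alpha x (Dj j a) = Sum (fun m => cscal (Cmult (0, IZR (m j)) (cf m (alpha x a))) (mon m)).
  apply: (cf_eq HT) => m; rewrite -/(ser (fun m => Cmult (0, IZR (m j)) (cf m (alpha x a)))).
  rewrite -/(Dj j (alpha x a)) cf_Dj // !(cf_alpha HT) cf_Dj //; ring.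
apply: (Sum_dct (g := fun m => 2 * (wt (toR m) ^ 1 * Cmod (fcoef (alpha x a) m)))).
- by exists (mkposreal _ Rlt_0_1) => t _ ht; apply: hq.
- split; first by apply: summable_scal hsum; lra.
  move=> m; rewrite (norm_ser_term HT (fun m => Cmult (0, IZR (m j)) (cf m (alpha x a)))) Cmod_mult Cmod_im -Rmult_assoc.
  apply: Rmult_le_compat_r; first exact: Cmod_ge_0.
  have := wt_ge_abs (toR m) j; have := Rabs_pos (IZR (m j)); rewrite /toR pow_1; lra.
move=> m; apply/tendsP; apply: lim_cscal; last exact: filterlim_const.
apply: lim_Cmult; last exact: filterlim_const.
have := derC_cis 0 (IZR (m j)) 0.
rewrite /derC Rmult_0_r Rplus_0_r cis0 Cmult_1_r => /is_deriveP /tendsP.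
apply: filterlim_ext => t.
by rewrite !Rplus_0_l Rmult_0_r cis0 scalC.
Qed.

Lemma pn_alpha j a : rapid (fcoef a) -> pn j (fun s => alpha s a) = (fun s => alpha s (Dj j a)).
Proof.
by move=> H; apply: functional_extensionality => x; apply: partial_norm_eq; apply: alpha_derive.
Qed.

Lemma foldr_pn_alpha js a : rapid (fcoef a) ->
  foldr pn (fun s => alpha s a) js = (fun s => alpha s (foldr Dj a js)) /\ rapid (fcoef (foldr Dj a js)).
Proof.
move=> H; elim: js => [//|j js [IH1 IH2]] /=.
by rewrite IH1 pn_alpha //; split=> //; apply: Dj_coef.
Qed.

Lemma cf_foldr_Dj js a m : rapid (fcoef a) -> cf m (foldr Dj a js) = Cmult (dirs js m) (cf m a).
Proof.
move=> H; elim: js => [|j js IH] /=; first by rewrite Cmult_1_l.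
by rewrite cf_Dj ?IH; [ring | case: (foldr_pn_alpha js H)].
Qed.

Lemma rapid_Ainf a : rapid (fcoef a) -> Ainf a.
Proof.
move=> H; split=> // js; have [-> H2] := foldr_pn_alpha js H; split.
- move=> x _; apply/lim0P; first by move=> t; apply: norm_ge_0.
  by have /contP := @alpha_cont _ _ _ _ _ _ HT (foldr Dj a js) x.
- by move=> j x; exists (alpha x (Dj j (foldr Dj a js))); apply/is_partial_norm; apply: alpha_derive.
Qed.

(** The [K]-th pure derivative of [alpha s a] at [0] in direction [j] has coefficients of modulus
    [|m_j| ^ K * |cf m a|], bounded by its norm; [wt_pow_bound] joins the directions. With
    [rapid_Ainf] this describes [Ainf] by coefficients. *)
Lemma Ainf_rapid a : Ainf a -> rapid (fcoef a).
Proof.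
move=> [_ H].
have Hd js j x : is_derive (fun t => foldr pn (fun s => alpha s a) js (shift x j t)) 0 (foldr pn (fun s => alpha s a) (j :: js) x).
  have [_ H2] := H js; have [v Hv] := H2 j x; move/is_partial_norm: Hv => Hv.
  by rewrite /= (partial_norm_eq Hv).
have Hc js m x : cf m (foldr pn (fun s => alpha s a) js x) = Cmult (Cmult (dirs js m) (cis (dot x (toR m)))) (cf m a).
  elim: js x => [|j js IH] x; first by rewrite /= (cf_alpha HT) Cmult_1_l.
  have h1 : derC (fun t => cf m (foldr pn (fun s => alpha s a) js (shift x j t))) 0 (cf m (foldr pn (fun s => alpha s a) (j :: js) x)).
    have /is_deriveP h := Hd js j x; apply/is_deriveP.
    apply/tendsP.
    have hl := linear_cont (cf m) (foldr pn (fun s => alpha s a) (j :: js) x) (is_linear_cf HT m).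
    move/tendsP: h => h; have := filterlim_comp _ _ _ _ (cf m) _ _ _ h hl.
    apply: filterlim_ext => t.
    by rewrite (linear_scal _ (is_linear_cf HT m)) /minus (linear_plus _ (is_linear_cf HT m)) -(scal_opp_one (foldr _ _ _ _)) (linear_scal _ (is_linear_cf HT m)) scal_opp_one.
  have h2 : derC (fun t => Cmult (Cmult (dirs js m) (cf m a)) (cis (dot x (toR m) + toR m j * t))) 0
     (Cplus (Cmult (RtoC 0) (cis (dot x (toR m) + toR m j * 0))) (Cmult (Cmult (dirs js m) (cf m a)) (Cmult (0, toR m j) (cis (dot x (toR m) + toR m j * 0))))).
    apply: (derC_mult (f := fun=> Cmult (dirs js m) (cf m a))); last exact: derC_cis.
    exact: (@is_derive_const R_AbsRing CV).
  have h3 := is_derive_uniq h1 (is_derive_ext _ _ _ _ _ h2).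
  rewrite h3 => [|t]; last by rewrite IH dot_shift Cmult_AC.
  rewrite /= /toR Rmult_0_r Rplus_0_r; ring.
move=> K.
pose b js := norm (foldr pn (fun s => alpha s a) js (fun=> 0)).
pose B := norm a + sumR (fun j => b (nseq K j)).
have hb0 js : 0 <= b js by exact: norm_ge_0.
have hsum := @sumR_ge0 _ (fun j => b (nseq K j)) (fun j => hb0 _).
have hna := norm_ge_0 a.
exists (INR n.+1 ^ K * B) => m.
have hw := wt_pos (toR m) K.
apply: (Rmult_le_reg_l (wt (toR m) ^ K)) => //.
have -> : wt (toR m) ^ K * (INR n.+1 ^ K * B * / wt (toR m) ^ K) = INR n.+1 ^ K * B by field; lra.
apply: wt_pow_bound; first exact: Cmod_ge_0.
  by apply: Rle_trans (cf_le HT _ _) _; rewrite /B; lra.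
move=> j; apply: Rle_trans (_ : b (nseq K j) <= _); last first.
  by have := @sumR_ge_term _ (fun j => b (nseq K j)) j (fun j => hb0 _); rewrite /B; lra.
apply: Rle_trans (cf_le HT m _); rewrite Hc !Cmod_mult Cmod_cis Rmult_1_r.
apply: Rmult_le_compat_r; first exact: Cmod_ge_0.
right; elim: K {b B hb0 hsum hw} => [|K IH] /=; first by rewrite Cmod_1.
by rewrite Cmod_mult Cmod_im -IH.
Qed.

(** [mi_iter] along [k] is a [foldr] over this list ([mi_iter_foldr]), so multi-index statements
    reduce to lists of directions. *)
Definition kdirs (k : 'I_n -> nat) : seq 'I_n := flatten [seq nseq (k j) j | j <- enum 'I_n].

Lemma size_kdirs k : size (kdirs k) = mi_size k.
Proof.
rewrite /kdirs size_flatten /mi_size /shape -map_comp sumnE big_map big_enum /=.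
by apply: eq_bigr => j _; rewrite size_nseq.
Qed.

Lemma Ainf_normE k a : rapid (fcoef a) ->
  Ainf_norm k a = norm (ser (fun m => Cmult (dirs (kdirs k) m) (cf m a))).
Proof.
move=> H; rewrite /Defs.Ainf_norm mi_iter_foldr -/(kdirs k).
have [-> H2] := foldr_pn_alpha (kdirs k) H.
rewrite (alpha0 HT) -(ser_coef H2); congr (norm (ser _)).
by apply: functional_extensionality => m; rewrite /fcoef cf_foldr_Dj.
Qed.

Lemma coef_plus a b : fcoef (plus a b) = fun m => Cplus (cf m a) (cf m b).
Proof. by apply: functional_extensionality => m; rewrite /fcoef (cfD HT). Qed.

Lemma coef_scal z a : fcoef (cscal z a) = fun m => Cmult z (cf m a).
Proof. by apply: functional_extensionality => m; rewrite /fcoef (cfZ HT). Qed.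

Lemma rapid_coef_plus a b : rapid (fcoef a) -> rapid (fcoef b) -> rapid (fcoef (plus a b)).
Proof. by move=> Ha Hb; rewrite coef_plus; apply: rapid_plus. Qed.

Lemma rapid_coef_scal z a : rapid (fcoef a) -> rapid (fcoef (cscal z a)).
Proof. by move=> Ha; rewrite coef_scal; apply: rapid_scal. Qed.

Lemma rapid_coef_minus a b : rapid (fcoef a) -> rapid (fcoef b) -> rapid (fcoef (minus a b)).
Proof. by move=> Ha Hb; rewrite /minus -cscalN1; apply: rapid_coef_plus => //; apply: rapid_coef_scal. Qed.

Lemma cf_minus m a b : cf m (minus a b) = Cminus (cf m a) (cf m b).
Proof. by rewrite /minus -cscalN1 (cfD HT) (cfZ HT); ring. Qed.

Lemma rapid_coef_mon c m : rapid (fcoef (cscal c (mon m))).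
Proof.
move=> K; exists (Cmod c * wt (toR m) ^ K) => k; rewrite /fcoef (cfZ HT) Cmod_mult.
have hw := wt_pos (toR m) K; have hw2 := wt_pos (toR k) K; have hc := Cmod_ge_0 c.
case: (classic (m = k)) => [->|h].
  by rewrite (cf_mon_eq HT) Cmod_1 Rmult_assoc Rinv_r; lra.
rewrite (cf_mon_neq HT) // Cmod_0 Rmult_0_r.
apply: Rmult_le_pos; first by apply: Rmult_le_pos; lra.
by left; apply: Rinv_0_lt_compat.
Qed.

Lemma rapid_coef_vsum (s : seq (cl Zn)) c : rapid (fcoef (vsum s (fun m => cscal (c m) (mon m)))).
Proof.
elim: s => [|m s IH].
  by rewrite vsum_nil -(cscal0l (mon (fun=> 0%Z))); apply: rapid_coef_mon.
by rewrite vsum_cons; apply: rapid_coef_plus => //; apply: rapid_coef_mon.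
Qed.

Section Delta.
Variable delta : 'I_n -> A -> A.
Hypothesis Hdelta : is_basic_derivations U alpha delta.

Lemma deltaD j a b : Ainf a -> Ainf b -> delta j (plus a b) = plus (delta j a) (delta j b).
Proof. by have [_ [h _]] := Hdelta j; apply: h. Qed.
Lemma deltaZ j z a : Ainf a -> delta j (cscal z a) = cscal z (delta j a).
Proof. by have [_ [_ [h _]]] := Hdelta j; apply: h. Qed.
Lemma deltaM j a b : Ainf a -> Ainf b ->
  delta j (cmul a b) = plus (cmul (delta j a) b) (cmul a (delta j b)).
Proof. by have [_ [_ [_ [h _]]]] := Hdelta j; apply: h. Qed.
Lemma deltaU j k : delta j (U k) = if k == j then U j else zero.
Proof. by have [_ [_ [_ [_ [_ h]]]]] := Hdelta j; apply: h. Qed.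
Lemma delta_Ainf j a : Ainf a -> Ainf (delta j a).
Proof. by have [h _] := Hdelta j; apply: h. Qed.

Lemma Ainf_mon c m : Ainf (cscal c (mon m)).
Proof. by apply: rapid_Ainf; apply: rapid_coef_mon. Qed.

(** [Ainf] is part of the notion since the Leibniz rule is available only there. *)
Definition eig j (r : R) (x : A) : Prop := Ainf x /\ delta j x = cscal (RtoC r) x.

(** The Leibniz rule for [1 * 1] gives [delta 1 = 2 * delta 1]. *)
Lemma eig_cone j : eig j 0 cone.
Proof.
have h1 : Ainf cone by rewrite -(mon0 U) -[monomial _ _]cscal1; apply: Ainf_mon.
split=> //; have := deltaM j h1 h1; rewrite cmul1l cmul1l cmul1r => h.
rewrite cscal0l; apply: (@minus_eq0 A).
have : minus (delta j cone) (delta j cone) = delta j cone.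
  by rewrite {1}h /minus -plus_assoc plus_opp_r plus_zero_r.
by rewrite minus_eq_zero => <-; rewrite minus_eq_zero.
Qed.

Lemma eig_mul j r s x y : Ainf (cmul x y) -> eig j r x -> eig j s y -> eig j (r + s) (cmul x y).
Proof.
move=> hxy [h1 h2] [h3 h4]; split=> //.
by rewrite deltaM // h2 h4 cmulZl cmulZr -cscalDl RtoC_plus.
Qed.

Lemma Ainf_eqU x m : eqU x (mon m) -> Ainf x.
Proof. by move=> [z [_ ->]]; apply: Ainf_mon. Qed.

Lemma zpow_mon k z : zpow (U k) z = mon (fun i => if i == k then z else 0%Z).
Proof.
rewrite /monomial.
have hz i : zpow (U i) (if i == k then z else 0%Z) = if i == k then zpow (U k) z else cone.
  by case: eqP => [->|_].
under eq_bigr => i _ do rewrite hz.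
have H (r : seq 'I_n) : uniq r -> \big[@cmul A/cone]_(i <- r) (if i == k then zpow (U k) z else cone) = if k \in r then zpow (U k) z else cone.
  elim: r => [|i r IH] /=; first by rewrite big_nil.
  move=> /andP [hi ur]; rewrite big_cons IH // in_cons (eq_sym k i).
  case: (eqVneq i k) hi => [->|_] hi /=; last by rewrite cmul1l.
  by rewrite (negbTE hi) cmul1r.
by rewrite H ?index_enum_uniq // mem_index_enum.
Qed.

Lemma Ainf_zpow k z : Ainf (zpow (U k) z).
Proof. by rewrite zpow_mon -[monomial _ _]cscal1; apply: Ainf_mon. Qed.

Lemma eig_zpow j k z : eig j (if k == j then IZR z else 0) (zpow (U k) z).
Proof.
have [HUu _] := td_rel HT.
have hU : eig j (if k == j then 1 else 0) (U k).
  split; first by have := Ainf_zpow k 1; rewrite /= cmul1r.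
  by rewrite deltaU; case: eqP => [->|_]; rewrite ?cscal1 ?cscal0l.
(* The value on the inverse follows from the Leibniz rule applied to the product of [cstar (U k)]
   and [U k], which is [1]. *)
have hUs : eig j (if k == j then -1 else 0) (cstar (U k)).
  have hs : Ainf (cstar (U k)) by have := Ainf_zpow k (-1); rewrite /= cmul1r.
  split=> //; have [h1 h2] := HUu k.
  have := deltaM j hs (proj1 hU); rewrite h1 (proj2 (eig_cone j)) cscal0l (proj2 hU) cmulZr h1 => h.
  have -> : delta j (cstar (U k)) = cmul (cmul (delta j (cstar (U k))) (U k)) (cstar (U k)).
    by rewrite -cmulA h2 cmul1r.
  have -> : cmul (delta j (cstar (U k))) (U k) = cscal (RtoC (if k == j then -1 else 0)) cone.
    have e : plus (cscal (RtoC (if k == j then 1 else 0)) (cone : A)) (cscal (RtoC (if k == j then -1 else 0)) cone) = zero.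
      rewrite -cscalDl -RtoC_plus.
      have -> : (if k == j then 1 else 0) + (if k == j then -1 else 0) = 0 by case: (k == j); ring.
      exact: cscal0l.
    rewrite -[LHS]plus_zero_r -e plus_assoc -h plus_zero_l //.
  by rewrite cmulZl cmul1l.
elim/Z.peano_ind: z => [|z IH|z IH].
- by case: (k == j); exact: eig_cone.
- rewrite (zpowS (HUu k)); have -> : (if k == j then IZR (Z.succ z) else 0) = (if k == j then 1 else 0) + (if k == j then IZR z else 0).
    by case: (k == j); rewrite ?succ_IZR; ring.
  by apply: eig_mul => //; rewrite -(zpowS (HUu k)); exact: Ainf_zpow.
- rewrite (zpowP (HUu k)); have -> : (if k == j then IZR (Z.pred z) else 0) = (if k == j then -1 else 0) + (if k == j then IZR z else 0).
    by case: (k == j); rewrite -?Z.sub_1_r ?minus_IZR; ring.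
  by apply: eig_mul => //; rewrite -(zpowP (HUu k)); exact: Ainf_zpow.
Qed.

Lemma delta_mon j m : delta j (mon m) = cscal (RtoC (IZR (m j))) (mon m).
Proof.
pose X (r : seq 'I_n) := \big[@cmul A/cone]_(i <- r) zpow (U i) (m i).
(* Partial products stay in [Ainf], being monomials up to a phase; [eig_mul] asks for this. *)
have HX r : exists m', eqU (X r) (mon m').
  rewrite /X; elim: r => [|i r [m' IH]].
    by rewrite big_nil; exists (fun=> 0%Z); rewrite mon0; apply: eqU_refl.
  rewrite big_cons zpow_mon; eexists.
  by apply: eqU_trans (eqU_mull _ IH) _; apply: (mon_mul (td_rel HT)).
have H r : eig j (\big[Rplus/0]_(i <- r) (if i == j then IZR (m i) else 0)) (X r).
  elim: r => [|i r IH]; first by rewrite /X !big_nil; exact: eig_cone.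
  have [m' hm'] := HX (i :: r); move: hm'; rewrite /X !big_cons => hm'.
  apply: eig_mul => //; first exact: Ainf_eqU hm'.
  exact: eig_zpow.
have := proj2 (H (index_enum 'I_n)).
have -> : \big[Rplus/0]_(i <- index_enum 'I_n) (if i == j then IZR (m i) else 0) = IZR (m j).
  by rewrite -big_mkcond big_pred1_eq.
by [].
Qed.

Lemma cf_delta j a m : Ainf a -> cf m (delta j a) = Cmult (RtoC (IZR (m j))) (cf m a).
Proof.
move=> Ha; have Hr := Ainf_rapid Ha.
(* [delta j] is continuous only for the topology of all seminorms, hence the partial sums
   below are shown to converge in each of them. *)
have Hs i : exists s : seq (cl Zn), uniq s /\ forall f : Zn -> A,
    (forall m, norm (f m) <= wt (toR m) ^ i * Cmod (cf m a)) -> dist (vsum s f) (Sum f) < / INR i.+1.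
  have hi : 0 < / INR i.+1 by apply: Rinv_0_lt_compat; apply: lt_0_INR; lia.
  have [s [us H]] := @Sum_tail Zn A _ _ (rapid_summable i Hr) hi.
  by exists s; split=> // f Hf; apply: H.
(* Diagonal choice: the [i]-th finite set is good up to [1 / (i + 1)] for all weights of degree at
   most [i], so one sequence converges in all seminorms. *)
have [s hs] : exists s : nat -> seq (cl Zn), forall i, uniq (s i) /\ forall f : Zn -> A,
    (forall m, norm (f m) <= wt (toR m) ^ i * Cmod (cf m a)) -> dist (vsum (s i) f) (Sum f) < / INR i.+1.
  exists (fun i => proj1_sig (constructive_indefinite_description _ (Hs i))) => i.
  exact: (proj2_sig (constructive_indefinite_description _ (Hs i))).
pose u i := vsum (s i) (fun m => cscal (cf m a) (mon m)).
have hu i : rapid (fcoef (u i)) by exact: rapid_coef_vsum.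
have Hev e : 0 < e -> eventually (fun i => / INR i.+1 < e).
  move=> he; have [N [hN hN0]] := archimed_cor1 e he; exists N => i hi.
  apply: Rle_lt_trans hN.
  apply: Rinv_le_contravar; first by apply: lt_0_INR.
  by apply: le_INR; lia.
have Hconv (js : seq 'I_n) (i : nat) : (size js <= i)%N ->
   norm (ser (fun m => Cmult (dirs js m) (cf m (minus (u i) a)))) < / INR i.+1.
  move=> hi.
  have hf k : norm (cscal (Cmult (dirs js k) (cf k a)) (mon k)) <= wt (toR k) ^ i * Cmod (cf k a).
    rewrite (norm_ser_term HT (fun m => Cmult (dirs js m) (cf m a))) Cmod_mult.
    apply: Rmult_le_compat_r; first exact: Cmod_ge_0.
    apply: Rle_trans (Cmod_dirs js k) _; apply: Rle_pow; first exact: wt_ge1.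
    exact/leP.
  have := proj2 (hs i) _ hf.
  have hd : rapid (fun m => Cmult (dirs js m) (cf m a)).
    by apply: (rapid_mul (N := size js) (B := 1) Hr) => k; rewrite Rmult_1_l; apply: Cmod_dirs.
  have hm : rapid (fun m => Cmult (dirs js m) (cf m (minus (u i) a))).
    apply: (rapid_mul (N := size js) (B := 1) (rapid_coef_minus (hu i) Hr)) => k; rewrite Rmult_1_l; exact: Cmod_dirs.
  suff -> : ser (fun m => Cmult (dirs js m) (cf m (minus (u i) a))) =
     minus (vsum (s i) (fun m => cscal (Cmult (dirs js m) (cf m a)) (mon m))) (ser (fun m => Cmult (dirs js m) (cf m a))) by [].
  apply: (cf_eq HT) => k; rewrite cf_ser_rapid // !cf_minus cf_ser_rapid // /u.
  rewrite -!(vsum_lin (is_linear_cf HT k)).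
  have -> : vsum (s i) (fun m => cf k (cscal (Cmult (dirs js m) (cf m a)) (mon m)) : CV) =
     vsum (s i) (fun m => Cmult (dirs js k) (cf k (cscal (cf m a) (mon m))) : CV).
    apply: vsum_ext => m'; rewrite !(cfZ HT).
    case: (classic (m' = k)) => [->|h]; first by rewrite Cmult_assoc.
    by rewrite (cf_mon_neq HT) // !Cmult_0_r.
  rewrite (vsum_lin (is_linear_Cmult_l (dirs js k))) /Cminus; ring.
have [_ [_ [_ [_ [hcont _]]]]] := Hdelta j.
have := hcont u a (fun i => rapid_Ainf (hu i)) Ha _.
have H1 : sn_cvg Ainf_norm eventually u a.
  move=> k; apply/lim0P; first by move=> t; apply: norm_ge_0.
  move=> e he; have HH := @filter_and _ eventually (@filter_filter _ _ eventually_filter) _ _ (Hev e he) (ex_intro _ (size (kdirs k)) (fun i hi => hi) : eventually (fun i => (size (kdirs k) <= i)%coq_nat)).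
  refine (@filter_imp _ eventually _ _ _ _ HH) => i [h1 /leP h2].
  rewrite Ainf_normE; last exact: rapid_coef_minus.
  by apply: Rlt_trans (Hconv _ _ h2) h1.
(* The seminorm of order [0] is the norm, and it controls each coefficient of the images. *)
move=> /(_ H1 (fun=> 0%N)) /lim0P H2.
have k0 : kdirs (fun=> 0%N) = [::] by rewrite /kdirs; elim: (enum 'I_n).
have hda : rapid (fcoef (delta j a)) by apply: Ainf_rapid; apply: delta_Ainf.
have hdu i : rapid (fcoef (delta j (u i))) by apply: Ainf_rapid; apply: delta_Ainf; apply: rapid_Ainf.
have cfu i : cf m (delta j (u i)) = Cmult (RtoC (IZR (m j))) (cf m (u i)).
  rewrite /u; elim: (s i) => [|m' t IH].
    rewrite vsum_nil (cf0 HT) Cmult_0_r -(cscal0l (mon m)) deltaZ; last by rewrite -[mon m]cscal1; exact: Ainf_mon.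
    by rewrite cscal0l (cf0 HT).
  have ht : Ainf (vsum t (fun m => cscal (cf m a) (mon m))) by apply: rapid_Ainf; apply: rapid_coef_vsum.
  rewrite vsum_cons deltaD ?deltaZ ?delta_mon //; try exact: Ainf_mon; try by rewrite -[mon m']cscal1; exact: Ainf_mon.
  rewrite !(cfD HT) IH !(cfZ HT).
  case: (classic (m' = m)) => [->|h]; first by rewrite (cf_mon_eq HT); ring.
  by rewrite (cf_mon_neq HT) // !Cmult_0_r; ring.
apply: (@tends_unique _ CV eventually _ (fun i => cf m (delta j (u i)) : CV)).
- move=> e he; have HH := H2 (fun i => norm_ge_0 _) e he; refine (@filter_imp _ eventually _ _ _ _ HH) => i.
  rewrite Ainf_normE; last exact: rapid_coef_minus.
  rewrite k0 => h; apply: Rle_lt_trans h.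
  rewrite distC_mod -cf_minus; apply: Rle_trans (cf_le HT m _) _; right; congr norm.
  rewrite -[LHS]ser_coef; last exact: rapid_coef_minus.
  by congr ser; apply: functional_extensionality => k; rewrite /= Cmult_1_l.
- apply: (tends_ext (f := fun i => Cmult (RtoC (IZR (m j))) (cf m (u i)) : CV)) => [i|]; first by rewrite cfu.
  apply/tendsP; apply: lim_Cmult; first exact: filterlim_const.
  apply/(@tendsP _ CV) => e he; apply: filter_imp (Hev e he) => i hi.
  apply: Rle_lt_trans hi; left.
  have := Hconv [::] i isT; apply: Rle_lt_trans.
  rewrite distC_mod -cf_minus; apply: Rle_trans (cf_le HT m _) _; right; congr norm.
  rewrite -[LHS]ser_coef; last exact: rapid_coef_minus.
  by congr ser; apply: functional_extensionality => k; rewrite /= Cmult_1_l.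
Qed.

End Delta.
End Torus.

(** * Symbol classes of coefficient families *)

(** The sign of [M] decides which of the two comparisons of [a] and [b] enters. *)
Lemma Rpower_ratio a b c M : 0 < a -> 0 < b -> 1 <= c -> a <= c * b -> b <= c * a ->
  Rpower a M <= Rpower c (Rabs M) * Rpower b M.
Proof.
move=> ha hb hc h1 h2; rewrite /Rpower -exp_plus.
suff H : M * ln a <= Rabs M * ln c + M * ln b.
  by case: H => [H|->]; [left; apply: exp_increasing | right].
have l1 : ln a <= ln c + ln b by rewrite -ln_mult; try lra; apply: ln_le.
have l2 : ln b <= ln c + ln a by rewrite -ln_mult; try lra; apply: ln_le.
rewrite /Rabs; case: Rcase_abs => hM; nra.
Qed.

(** [wt x] is comparable to [1 + enorm x]; being a sum, it is easier to split. *)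
Definition Rp d (M : R) (x : 'I_d -> R) : R := Rpower (wt x) M.

Lemma Rp_pos d M (x : 'I_d -> R) : 0 < Rp M x.
Proof. exact: exp_pos. Qed.

Lemma RpD d M M' (x : 'I_d -> R) : Rp (M + M') x = Rp M x * Rp M' x.
Proof. exact: Rpower_plus. Qed.

Lemma Rpower_pow_le a M N : 1 <= a -> M <= INR N -> Rpower a M <= a ^ N.
Proof.
move=> ha h; rewrite -Rpower_pow; last lra.
exact: Rle_Rpower.
Qed.

Lemma nat_above M : exists N : nat, M <= INR N.
Proof.
case: (Rle_lt_dec M 0) => h; first by exists 0%N.
have [N hN] := nfloor_ex M ltac:(lra).
exists N.+1; rewrite S_INR; lra.
Qed.

Lemma wt_opp d (x : 'I_d -> R) : wt (fun i => - x i) = wt x.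
Proof. by rewrite /wt; congr (_ + _); apply: sumR_ext => i; rewrite Rabs_Ropp. Qed.

(** Submultiplicativity of [wt], for [x + y] and for [x = (x + y) - y], covers both signs of [M];
    [p] is an integer at least [|M|]. *)
Lemma peetre d M : exists p, forall x y : 'I_d -> R,
  Rp M (fun i => x i + y i) <= wt y ^ p * Rp M x.
Proof.
have [p hp] := nat_above (Rabs M); exists p => x y.
apply: Rle_trans (_ : Rpower (wt y) (Rabs M) * Rpower (wt x) M <= _); last first.
  apply: Rmult_le_compat_r; first by left; apply: exp_pos.
  by apply: Rpower_pow_le => //; exact: wt_ge1.
have h1 := wt_ge1 x; have h2 := wt_ge1 y; have h3 := wt_ge1 (fun i => x i + y i).
apply: Rpower_ratio; try lra.
  by rewrite Rmult_comm; exact: wtD.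
have := wtD (fun i => x i + y i) (fun i => - y i); rewrite wt_opp Rmult_comm.
suff -> : (fun i => x i + y i + - y i) = x by [].
by apply: functional_extensionality => i; ring.
Qed.

Lemma wt_shift1 d (x : 'I_d -> R) j t : Rabs t <= 1 -> wt (shift x j t) <= wt x * 2.
Proof.
move=> ht; rewrite shiftE; apply: Rle_trans (wtD _ _) _.
apply: Rmult_le_compat_l; first by have := wt_ge1 x; lra.
rewrite /wt.
have -> : sumR (fun k => Rabs (if k == j then t else 0)) = Rabs t.
  have := dot_shift (fun=> 0) (fun=> 1) j (Rabs t).
  have e1 : dot (fun _ : 'I_d => 0) (fun=> 1) = 0 by rewrite /dot -[RHS](sumR_zero d); apply: sumR_ext => i; ring.
  rewrite e1 Rplus_0_l Rmult_1_l => <-; rewrite /dot; apply: sumR_ext => k.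
  by rewrite /shift; case: (k == j); rewrite ?Rabs_R0; ring.
lra.
Qed.

Lemma derC_scal c (h : R -> C) x l : derC h x l -> derC (fun t => Cmult c (h t)) x (Cmult c l).
Proof.
move=> H; have := derC_mult (@is_derive_const R_AbsRing CV c x) H.
have -> : Cplus (Cmult (zero : CV) (h x)) (Cmult c l) = Cmult c l; last by [].
by rewrite /zero /= Cmult_0_l Cplus_0_l.
Qed.

Definition fam (I : Type) d := I -> ('I_d -> R) -> C.

Section Fam.
Variables (I : Type) (d : nat).
Local Notation fam := (fam I d).
Implicit Types f g : fam.

Definition pdf j f g : Prop := forall m xi, derC (fun t => f m (shift xi j t)) 0 (g m xi).

Definition pd (j : 'I_d) f : fam :=
  fun m xi => epsilon (inhabits (RtoC 0)) (derC (fun t => f m (shift xi j t)) 0).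

Lemma pdf_pd j f g : pdf j f g -> pd j f = g.
Proof.
move=> H; apply: functional_extensionality => m; apply: functional_extensionality => xi.
have Hs : derC (fun t => f m (shift xi j t)) 0 (pd j f m xi) by apply: epsilon_spec; exists (g m xi).
exact: is_derive_uniq Hs (H m xi).
Qed.

Definition fplus f g : fam := fun m xi => Cplus (f m xi) (g m xi).

Lemma pdf_plus j f f' g g' : pdf j f f' -> pdf j g g' -> pdf j (fplus f g) (fplus f' g').
Proof. move=> H1 H2 m xi; exact (@is_derive_plus R_AbsRing CV _ _ _ _ _ (H1 m xi) (H2 m xi)). Qed.

Variable Bd : R -> fam -> Prop.

(** [Bd] is a parameter: one theory of derivatives serves families with one index ([BS]) and with
    two ([BK]). The derivative is existential here, and [CSg_pd] identifies it with [pd]. *)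
Fixpoint lev (N : nat) (M : R) f : Prop :=
  match N with
  | O => Bd M f
  | N'.+1 => Bd M f /\ forall j, exists g, pdf j f g /\ lev N' (M - 1) g
  end.

Definition CSg (M : R) f : Prop := forall N, lev N M f.

Lemma CSg_bd M f : CSg M f -> Bd M f.
Proof. by move/(_ 0%N). Qed.

Lemma CSg_pd M f j : CSg M f -> pdf j f (pd j f) /\ CSg (M - 1) (pd j f).
Proof.
move=> H.
have [g [Hg _]] := proj2 (H 1%N) j.
split; first by rewrite (pdf_pd Hg).
by move=> N; have [g' [Hg' HN]] := proj2 (H N.+1) j; rewrite (pdf_pd Hg').
Qed.

Hypothesis Bd_plus : forall M f g, Bd M f -> Bd M g -> Bd M (fplus f g).

Lemma lev_plus N M f g : lev N M f -> lev N M g -> lev N M (fplus f g).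
Proof.
elim: N M f g => [|N IH] M f g /=; first exact: Bd_plus.
move=> [h1 h2] [h3 h4]; split; first exact: Bd_plus.
move=> j; have [f' [a1 a2]] := h2 j; have [g' [b1 b2]] := h4 j.
by exists (fplus f' g'); split; [apply: pdf_plus | apply: IH].
Qed.

End Fam.

Definition BS n M (f : fam (Zn n) n) : Prop :=
  (forall m xi, continuous (f m : _ -> CV) xi) /\
  forall K : nat, exists B, 0 <= B /\ forall m xi, Cmod (f m xi) <= B * / wt (toR m) ^ K * Rp M xi.

(** Polynomial growth in [k] is allowed: in [tconv] the other factor decreases rapidly. *)
Definition BK n M (F : fam (Zn n * Zn n) n) : Prop :=
  (forall m xi, continuous (F m : _ -> CV) xi) /\
  forall K : nat, exists p B, 0 <= B /\ forall m k xi,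
    Cmod (F (m, k) xi) <= B * / wt (toR m) ^ K * wt (toR k) ^ p * Rp M xi.

Lemma winv_pos d (x : 'I_d -> R) K : 0 < / wt x ^ K.
Proof. by apply: Rinv_0_lt_compat; apply: wt_pos. Qed.

Lemma BS_plus n M (f g : fam (Zn n) n) : BS M f -> BS M g -> BS M (fplus f g).
Proof.
move=> [c1 h1] [c2 h2]; split; first by move=> m xi; apply: (@continuous_plus _ _ CV).
move=> K; have [B [b0 b]] := h1 K; have [B' [b0' b']] := h2 K.
exists (B + B'); split; first lra.
move=> m xi; apply: Rle_trans (Cmod_triangle _ _) _.
have := b m xi; have := b' m xi => h3 h4; apply: Rle_trans (Rplus_le_compat _ _ _ _ h4 h3) _.
right; ring.
Qed.

Lemma wt_pow_mono d (x : 'I_d -> R) p q : (p <= q)%N -> wt x ^ p <= wt x ^ q.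
Proof. by move=> h; apply: Rle_pow; [exact: wt_ge1 | exact/leP]. Qed.

Notation CS := (CSg (@BS _)).
Notation CK := (CSg (@BK _)).

Section Conv.
Variable n : nat.
Variable ph : Zn n -> Zn n -> C.
Hypothesis ph1 : forall k m, Cmod (ph k m) = 1.

Definition zsub (m k : Zn n) : Zn n := fun j => (m j - k j)%Z.

(** The coefficients of a product, for a left factor depending on the index [k] of the right one. *)
Definition tconv (F : fam (Zn n * Zn n) n) (g : fam (Zn n) n) : fam (Zn n) n :=
  fun m xi => Sum (fun k : Zn n => Cmult (ph (zsub m k) k) (Cmult (F (zsub m k, k) xi) (g k xi)) : CV).

Lemma wt_zsub (m k : Zn n) : wt (toR m) <= wt (toR (zsub m k)) * wt (toR k).
Proof.
have -> : toR m = fun i => toR (zsub m k) i + toR k i; last exact: wtD.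
by apply: functional_extensionality => i; rewrite /toR /zsub minus_IZR; ring.
Qed.

Lemma conv_bound M M' F g K : BK M F -> BS M' g -> exists B, 0 <= B /\
  forall m k xi, Cmod (Cmult (ph (zsub m k) k) (Cmult (F (zsub m k, k) xi) (g k xi))) <=
    B * / wt (toR m) ^ K * Rp (M + M') xi * / wt (toR k) ^ (2 * n).
Proof.
move=> [_ hF] [_ hg].
(* The decay of [g] in [k] is spent three ways: [K] to turn decay in [m - k] into decay in [m], [p]
   against the growth of [F], and [2 * n] for summability. *)
have [p [B [b0 b]]] := hF K; have [B' [b0' b']] := hg (K + p + 2 * n)%N.
exists (B * B'); split; first exact: Rmult_le_pos.
move=> m k xi; rewrite !Cmod_mult ph1 Rmult_1_l.
apply: Rle_trans (Rmult_le_compat _ _ _ _ (Cmod_ge_0 _) (Cmod_ge_0 _) (b _ _ _) (b' _ _)) _.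
set w := wt (toR (zsub m k)); set v := wt (toR k); set u := wt (toR m).
have hw : 1 <= w by exact: wt_ge1.
have hv : 1 <= v by exact: wt_ge1.
have hu : 1 <= u by exact: wt_ge1.
have huw : u <= w * v by exact: wt_zsub.
have pw : 0 < w ^ K by apply: pow_lt; lra.
have pvK : 0 < v ^ K by apply: pow_lt; lra.
have pvp : 0 < v ^ p by apply: pow_lt; lra.
have pvn : 0 < v ^ (2 * n) by apply: pow_lt; lra.
have pu : 0 < u ^ K by apply: pow_lt; lra.
have h1 : / (w ^ K * v ^ K) <= / u ^ K.
  by apply: Rinv_le_contravar => //; rewrite -Rpow_mult_distr; apply: pow_incr; lra.
rewrite RpD.
have -> : B * / w ^ K * v ^ p * Rp M xi * (B' * / v ^ (K + p + 2 * n) * Rp M' xi) =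
  (B * B' * Rp M xi * Rp M' xi * / v ^ (2 * n)) * / (w ^ K * v ^ K).
  by rewrite (pow_add v (K + p) (2 * n)) (pow_add v K p); field; repeat split; lra.
have -> : B * B' * / u ^ K * (Rp M xi * Rp M' xi) * / v ^ (2 * n) =
  (B * B' * Rp M xi * Rp M' xi * / v ^ (2 * n)) * / u ^ K by ring.
apply: Rmult_le_compat_l h1.
have := Rp_pos M xi; have := Rp_pos M' xi => r1 r2.
by repeat apply: Rmult_le_pos; try lra; left; apply: Rinv_0_lt_compat.
Qed.

Lemma Rp_local M (xi : 'I_n -> R) : exists B, 0 < B /\ locally xi (fun y => Rp M y <= B).
Proof.
have [p hp] := @peetre n M.
exists (INR n.+1 ^ p * Rp M xi).
have h0 : 0 < INR n.+1 ^ p by apply: pow_lt; apply: lt_0_INR; lia.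
split; first by apply: Rmult_lt_0_compat => //; exact: Rp_pos.
exists (mkposreal _ Rlt_0_1) => y hy.
have := hp xi (fun i => y i - xi i).
have -> : (fun i => xi i + (y i - xi i)) = y by apply: functional_extensionality => i; ring.
move=> h; apply: Rle_trans h _; apply: Rmult_le_compat_r; first by left; apply: Rp_pos.
apply: pow_incr; split; first by have := wt_ge1 (fun i => y i - xi i); lra.
rewrite /wt S_INR Rplus_comm; apply: Rplus_le_compat_r.
rewrite -[INR n]Rmult_1_r -sumR_const; apply: sumR_le => i; left; exact: hy.
Qed.

Lemma conv_summable B : 0 <= B -> summable (fun k : Zn n => B * / wt (toR k) ^ (2 * n)).
Proof. by move=> hB; apply: summable_scal => //; apply: summable_wt. Qed.

Lemma conv_dom M M' F g m xi : BK M F -> BS M' g ->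
  exists h, dominated (fun k : Zn n => Cmult (ph (zsub m k) k) (Cmult (F (zsub m k, k) xi) (g k xi)) : CV) h.
Proof.
move=> hF hg; have [B [b0 b]] := conv_bound 0 hF hg.
exists (fun k => B * / wt (toR m) ^ 0 * Rp (M + M') xi * / wt (toR k) ^ (2 * n)); split.
  apply: conv_summable; have := Rp_pos (M + M') xi; rewrite /= Rinv_1 => h; nra.
by move=> k; rewrite normC; apply: b.
Qed.

Lemma conv_BS M M' F g : BK M F -> BS M' g -> BS (M + M') (tconv F g).
Proof.
move=> hF hg; split.
  move=> m xi; have [B [b0 b]] := conv_bound 0 hF hg.
  have [B' [b0' hloc]] := Rp_local (M + M') xi.
  apply/contP; apply: (Sum_dct (f := fun xi (k : Zn n) => Cmult (ph (zsub m k) k) (Cmult (F (zsub m k, k) xi) (g k xi)) : CV) (g := fun k => B * B' * / wt (toR k) ^ (2 * n))).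
  - apply: filter_imp hloc => y hy k; rewrite normC; apply: Rle_trans (b m k y) _.
    rewrite /= Rinv_1 Rmult_1_r; apply: Rmult_le_compat_r; first by left; apply: winv_pos.
    exact: Rmult_le_compat_l.
  - split; first by apply: conv_summable; nra.
    move=> k; rewrite normC; apply: Rle_trans (b m k xi) _.
    rewrite /= Rinv_1 Rmult_1_r; apply: Rmult_le_compat_r; first by left; apply: winv_pos.
    by apply: Rmult_le_compat_l => //; exact: locally_singleton hloc.
  move=> k; apply/tendsP; apply: lim_Cmult; first exact: filterlim_const.
  by apply: lim_Cmult; [apply: (proj1 hF) | apply: (proj1 hg)].
move=> K; have [B [b0 b]] := conv_bound K hF hg.
have [S [S0 HS]] := summable_wt (leqnn (2 * n)).
have hS : 0 <= S by have := HS [::] isT; rewrite /rsum big_nil.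
exists (B * S); split; first nra.
move=> m xi; rewrite /tconv -normC.
apply: Rle_trans (_ : (B * / wt (toR m) ^ K * Rp (M + M') xi) * S <= _); last by right; ring.
have hc : 0 <= B * / wt (toR m) ^ K * Rp (M + M') xi.
  have := winv_pos (toR m) K; have := Rp_pos (M + M') xi => h1 h2.
  by repeat apply: Rmult_le_pos; lra.
apply: (@Sum_le (Zn n) CV _ (fun k : Zn n => B * / wt (toR m) ^ K * Rp (M + M') xi * / wt (toR k) ^ (2 * n))).
  split=> [k|s us]; first by apply: Rmult_le_pos => //; left; apply: winv_pos.
  have -> : forall c (h : Zn n -> R), rsum s (fun k => c * h k) = c * rsum s h.
    move=> c h; elim: s {us} => [|x s IH]; first by rewrite /rsum !big_nil; ring.
    by rewrite /rsum !big_cons -!/(rsum _ _) IH /=; ring.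
  by apply: Rmult_le_compat_l => //; apply: HS.
by move=> k; rewrite normC; apply: b.
Qed.

(** The mean value inequality is applied to real and imaginary parts separately, hence the factor
    [2]. *)
Lemma dq_bound d (f : ('I_d -> R) -> C) (f' : ('I_d -> R) -> C) xi j t B :
  (forall y, derC (fun s => f (shift y j s)) 0 (f' y)) ->
  (forall s, Rabs s <= Rabs t -> Cmod (f' (shift xi j s)) <= B) -> t <> 0 ->
  Cmod (Cmult (RtoC (/ t)) (Cminus (f (shift xi j t)) (f xi))) <= 2 * B.
Proof.
move=> Hd Hb ht.
have Hd' s : derC (fun s => f (shift xi j s)) s (f' (shift xi j s)).
  have := Hd (shift xi j s) => /is_deriveP H; apply/is_deriveP.
  by apply: tends_ext H => h; rewrite !shift_shift Rplus_0_l Rplus_0_r.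
have h1 : Rabs ((f (shift xi j t)).1 - (f (shift xi j 0)).1) <= B * Rabs (t - 0).
  apply: (bounded_variation (fun s => (f (shift xi j s)).1) (fun s => (f' (shift xi j s)).1)) => s; rewrite !Rminus_0_r => hs.
  split; first by have /derC_pair [] := Hd' s.
  exact: Rle_trans (re_le_Cmod _) (Hb s hs).
have h2 : Rabs ((f (shift xi j t)).2 - (f (shift xi j 0)).2) <= B * Rabs (t - 0).
  apply: (bounded_variation (fun s => (f (shift xi j s)).2) (fun s => (f' (shift xi j s)).2)) => s; rewrite !Rminus_0_r => hs.
  split; first by have /derC_pair [] := Hd' s.
  exact: Rle_trans (Rabs_snd_le _) (Hb s hs).
rewrite Rminus_0_r shift0 in h1; rewrite Rminus_0_r shift0 in h2.
have hp := Rabs_pos_lt _ ht.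
rewrite Cmod_mult Cmod_R Rabs_inv.
apply: (Rmult_le_reg_l (Rabs t)) => //; rewrite -Rmult_assoc Rinv_r ?Rmult_1_l; last lra.
apply: Rle_trans (Cmod_le_sum _) _ => /=; rewrite /Rminus in h1 h2; lra.
Qed.

Lemma locally'_le1 : locally' 0 (fun t : R => Rabs t <= 1 /\ t <> 0).
Proof.
exists (mkposreal _ Rlt_0_1) => y; rewrite /ball /= /AbsRing_ball /= /abs /minus /plus /opp /=.
by rewrite Ropp_0 Rplus_0_r => h hne; split=> //; left.
Qed.

Lemma shift_near M (xi : 'I_n -> R) : exists B, 0 < B /\ forall j s, Rabs s <= 1 -> Rp M (shift xi j s) <= B.
Proof.
have [p hp] := @peetre n M.
exists (2 ^ p * Rp M xi); split; first by apply: Rmult_lt_0_compat; [apply: pow_lt; lra | exact: Rp_pos].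
move=> j s hs; rewrite shiftE; apply: Rle_trans (hp _ _) _.
apply: Rmult_le_compat_r; first by left; apply: Rp_pos.
apply: pow_incr; split; first by have := wt_ge1 (fun k => if k == j then s else 0); lra.
have := @wt_shift1 n (fun=> 0) j s hs; rewrite shiftE.
have -> : wt (fun _ : 'I_n => 0) = 1.
  rewrite /wt Rabs_R0 sumR_zero; exact: Rplus_0_r.
have -> : (fun k => 0 + (if k == j then s else 0)) = (fun k => if k == j then s else 0).
  by apply: functional_extensionality => k; rewrite Rplus_0_l.
by rewrite Rmult_1_l.
Qed.

(** The derivatives are dominated on the segment [|s| <= 1], hence so are the difference quotients,
    and dominated convergence for series applies. *)
Lemma Sum_derC (f f' : Zn n -> ('I_n -> R) -> C) j xi h :
  summable h ->
  (forall k, forall y, derC (fun s => f k (shift y j s)) 0 (f' k y)) ->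
  (forall y, exists g, dominated (fun k : Zn n => f k y : CV) g) ->
  (forall k s, Rabs s <= 1 -> Cmod (f' k (shift xi j s)) <= h k) ->
  derC (fun t => Sum (fun k => f k (shift xi j t) : CV)) 0 (Sum (fun k => f' k xi : CV)).
Proof.
move=> hh Hd Hdom Hb; apply/is_deriveP.
pose q (t : R) (k : Zn n) : CV := Cmult (RtoC (/ t)) (Cminus (f k (shift xi j t)) (f k xi)).
apply: (tends_ext_ev (f := fun t => Sum (q t))).
  exists (mkposreal _ Rlt_0_1) => t _ ht; rewrite Rplus_0_l shift0.
  have [g1 h1] := Hdom (shift xi j t); have [g2 h2] := Hdom xi.
  rewrite /q; apply: Sum_unique.
  have L := is_linear_Cmult_l (RtoC (/ t)); have L2 := is_linear_Cmult_l (RtoC (- / t)).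
  have -> : scal (/ t) (minus (Sum (fun k => f k (shift xi j t) : CV)) (Sum (fun k => f k xi : CV))) =
    plus (Cmult (RtoC (/ t)) (Sum (fun k => f k (shift xi j t) : CV)) : CV) (Cmult (RtoC (- / t)) (Sum (fun k => f k xi : CV))).
    rewrite scalC minusC plusC RtoC_opp; apply: Cmult_sub.
  apply: (tends_ext (f := fun s => plus (Cmult (RtoC (/ t)) (vsum s (fun k => f k (shift xi j t) : CV)) : CV) (Cmult (RtoC (- / t)) (vsum s (fun k => f k xi : CV))))).
    move=> s; rewrite -(vsum_lin L) -(vsum_lin L2) -vsum_plus; apply: vsum_ext => k.
    by rewrite plusC RtoC_opp -Cmult_sub.
  apply/tendsP; apply: lim_plus; apply: lim_comp; try exact: linear_cont.
    by apply/tendsP; exact: Sum_correct h1.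
  by apply/tendsP; exact: Sum_correct h2.
apply: (Sum_dct (g := fun k => 2 * h k)).
- apply: filter_imp locally'_le1 => t [ht1 ht] k; rewrite /q normC.
  apply: (dq_bound (Hd k)) => // s hs; apply: Hb; lra.
- split; first by apply: summable_scal => //; lra.
  move=> k; rewrite normC; have := Hb k 0; rewrite Rabs_R0 shift0 => /(_ ltac:(lra)).
  have := Cmod_ge_0 (f' k xi); lra.
move=> k; have := Hd k xi => /is_deriveP; apply: tends_ext => t.
by rewrite /q Rplus_0_l shift0 scalC minusC.
Qed.

Lemma conv_pdf M M' F g j : CK M F -> CS M' g ->
  pdf j (tconv F g) (fplus (tconv (pd j F) g) (tconv F (pd j g))).
Proof.
move=> HF Hg m xi.
have [dF HF'] := CSg_pd j HF; have [dg Hg'] := CSg_pd j Hg.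
have bF := CSg_bd HF; have bg := CSg_bd Hg; have bF' := CSg_bd HF'; have bg' := CSg_bd Hg'.
have [B1 [b10 b1]] := conv_bound 0 bF' bg; have [B2 [b20 b2]] := conv_bound 0 bF bg'.
have [C1 [c10 c1]] := shift_near (M - 1 + M') xi; have [C2 [c20 c2]] := shift_near (M + (M' - 1)) xi.
have [g1 h1] := conv_dom m xi bF' bg; have [g2 h2] := conv_dom m xi bF bg'.
have -> : fplus (tconv (pd j F) g) (tconv F (pd j g)) m xi = Sum (fun k : Zn n =>
   Cplus (Cmult (ph (zsub m k) k) (Cmult (pd j F (zsub m k, k) xi) (g k xi)))
         (Cmult (ph (zsub m k) k) (Cmult (F (zsub m k, k) xi) (pd j g k xi))) : CV).
  by rewrite /fplus /tconv -plusC -(Sum_plus h1 h2).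
apply: (@Sum_derC (fun k y => Cmult (ph (zsub m k) k) (Cmult (F (zsub m k, k) y) (g k y)))
  (fun k y => Cplus (Cmult (ph (zsub m k) k) (Cmult (pd j F (zsub m k, k) y) (g k y)))
         (Cmult (ph (zsub m k) k) (Cmult (F (zsub m k, k) y) (pd j g k y)))) j xi
  (fun k => (B1 * C1 + B2 * C2) * / wt (toR k) ^ (2 * n))).
- by apply: conv_summable; nra.
- move=> k y; have h3 := derC_mult (dF (zsub m k, k) y) (dg k y); rewrite shift0 in h3.
  by have := derC_scal (ph (zsub m k) k) h3; rewrite Cmult_plus_distr_l.
- by move=> y; exact: conv_dom m y bF bg.
- move=> k s hs; apply: Rle_trans (Cmod_triangle _ _) _.
  have e1 := b1 m k (shift xi j s); have e2 := b2 m k (shift xi j s).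
  rewrite /= Rinv_1 !Rmult_1_r in e1 e2.
  have hw := winv_pos (toR k) (2 * n).
  apply: Rle_trans (Rplus_le_compat _ _ _ _ e1 e2) _.
  rewrite -Rmult_plus_distr_r; apply: Rmult_le_compat_r; first lra.
  by apply: Rplus_le_compat; apply: Rmult_le_compat_l => //; [apply: c1 | apply: c2].
Qed.

(** The Leibniz rule expresses derivatives by convolutions of the same kind, of order one less, so
    the induction closes. *)
Lemma conv_lev N M M' F g : CK M F -> CS M' g -> lev (@BS n) N (M + M') (tconv F g).
Proof.
elim: N M M' F g => [|N IH] M M' F g HF Hg /=; first by apply: conv_BS; apply: CSg_bd.
split; first by apply: conv_BS; apply: CSg_bd.
move=> j; exists (fplus (tconv (pd j F) g) (tconv F (pd j g))); split; first exact: conv_pdf HF Hg.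
have [_ HF'] := CSg_pd j HF; have [_ Hg'] := CSg_pd j Hg.
apply: (lev_plus (@BS_plus n)).
  have -> : M + M' - 1 = (M - 1) + M' by ring.
  exact: IH.
have -> : M + M' - 1 = M + (M' - 1) by ring.
exact: IH.
Qed.

Lemma conv_CS M M' F g : CK M F -> CS M' g -> CS (M + M') (tconv F g).
Proof. by move=> HF Hg N; apply: conv_lev. Qed.

End Conv.

(** * Coefficients of symbols *)

Lemma abs_le_enorm d (x : 'I_d -> R) i : Rabs (x i) <= enorm x.
Proof.
rewrite /enorm -sqrt_Rsqr_abs; apply: sqrt_le_1_alt.
by have := @sumR_ge_term d (fun i => x i * x i) i (fun i => Rle_0_sqr (x i)).
Qed.

Lemma enorm_le_sum d (x : 'I_d -> R) : enorm x <= sumR (fun i => Rabs (x i)).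
Proof.
have h0 : 0 <= sumR (fun i => Rabs (x i)) by apply: sumR_ge0 => i; exact: Rabs_pos.
rewrite /enorm -(sqrt_Rsqr (sumR _)) //; apply: sqrt_le_1_alt.
rewrite /dot; elim: d x {h0} => [|d IH] x; first by rewrite !sumR0 /Rsqr; lra.
have h1 := IH (vtl x); rewrite !sumRS.
have h2 : 0 <= sumR (vtl (fun i => Rabs (x i))) by apply: sumR_ge0 => i; exact: Rabs_pos.
have h3 := Rabs_pos (x ord0); have h4 : x ord0 * x ord0 = Rabs (x ord0) * Rabs (x ord0).
  by have := Rsqr_abs (x ord0); rewrite /Rsqr.
rewrite h4; move: h1; rewrite /Rsqr.
change (sumR (vtl (fun i => x i * x i))) with (sumR (fun i => vtl x i * vtl x i)).
change (sumR (vtl (fun i => Rabs (x i)))) with (sumR (fun i => Rabs (vtl x i))).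
change (sumR (vtl (fun i => Rabs (x i)))) with (sumR (fun i => Rabs (vtl x i))) in h2.
move=> h1; nra.
Qed.

Lemma enorm_ge0 d (x : 'I_d -> R) : 0 <= enorm x.
Proof. exact: sqrt_pos. Qed.

Lemma Rp_enorm d M : exists B, 0 < B /\ forall x : 'I_d -> R,
  Rp M x <= B * Rpower (1 + enorm x) M /\ Rpower (1 + enorm x) M <= B * Rp M x.
Proof.
exists (Rpower (INR d.+1) (Rabs M)); split; first exact: exp_pos.
move=> x; have h1 := enorm_ge0 x; have h2 := enorm_le_sum x; have h3 := wt_ge1 x.
have hd : 1 <= INR d.+1 by rewrite S_INR; have := pos_INR d; lra.
have h4 : 1 + enorm x <= wt x by rewrite /wt; lra.
have h5 : wt x <= INR d.+1 * (1 + enorm x).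
  rewrite /wt S_INR.
  have : sumR (fun i => Rabs (x i)) <= INR d * enorm x.
    by rewrite -sumR_const; apply: sumR_le => i; exact: abs_le_enorm.
  by have := pos_INR d; nra.
by split; apply: Rpower_ratio; try lra; nra.
Qed.

Lemma shift_comm d (x : 'I_d -> R) i j s t : shift (shift x i s) j t = shift (shift x j t) i s.
Proof.
apply: functional_extensionality => k; rewrite /shift.
by case: (k == i); case: (k == j); ring.
Qed.

Lemma pder_lin (V W : NormedModule R_AbsRing) (L : V -> W) (f : R -> V) x l :
  is_linear L -> is_derive f x l -> is_derive (fun t => L (f t)) x (L l).
Proof.
move=> HL /is_deriveP /tendsP H; apply/is_deriveP; apply/tendsP.
have := filterlim_comp _ _ _ _ L _ _ _ H (linear_cont L l HL).
apply: filterlim_ext => t.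
rewrite (linear_scal _ HL) /minus (linear_plus _ HL).
by rewrite -(scal_opp_one (f x)) (linear_scal _ HL) scal_opp_one.
Qed.

(** Reduced to the two-variable theorem on the plane through [x] spanned by the directions [i] and
    [j]. *)
Lemma schwarz_real d (f fi fj fij fji : ('I_d -> R) -> R) i j x :
  (forall y, is_derive (fun t => f (shift y i t)) 0 (fi y)) ->
  (forall y, is_derive (fun t => f (shift y j t)) 0 (fj y)) ->
  (forall y, is_derive (fun t => fj (shift y i t)) 0 (fij y)) ->
  (forall y, is_derive (fun t => fi (shift y j t)) 0 (fji y)) ->
  (forall y, continuous fij y) -> (forall y, continuous fji y) -> fij x = fji x.
Proof.
move=> Hi Hj Hij Hji Cij Cji.
have at_ (h h' : ('I_d -> R) -> R) k y t : (forall y, is_derive (fun t => h (shift y k t)) 0 (h' y)) ->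
    is_derive (fun t => h (shift y k t)) t (h' (shift y k t)).
  exact: (@pder_at R_NormedModule).
pose g u v := f (shift (shift x i u) j v).
have Du u v : is_derive (g^~ v) u (fi (shift (shift x i u) j v)).
  rewrite /g; apply: (is_derive_ext (fun u => f (shift (shift x j v) i u))).
    by move=> t; rewrite shift_comm.
  by rewrite shift_comm; apply: (at_ f fi).
have Dv u v : is_derive (g u) v (fj (shift (shift x i u) j v)) by apply: (at_ f fj).
have Duv u v : is_derive (fun z => Derive (g z) v) u (fij (shift (shift x i u) j v)).
  apply: (is_derive_ext (fun z => fj (shift (shift x j v) i z))).
    by move=> t; rewrite (is_derive_unique _ _ _ (Dv t v)) shift_comm.
  by rewrite shift_comm; apply: (at_ fj fij).
have Dvu u v : is_derive (fun z => Derive (g^~ z) u) v (fji (shift (shift x i u) j v)).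
  apply: (is_derive_ext (fun z => fi (shift (shift x i u) j z))).
    by move=> t; rewrite (is_derive_unique _ _ _ (Du u t)).
  by apply: (at_ fi fji).
have cont2d (h : ('I_d -> R) -> R) : (forall y, continuous h y) ->
    continuity_2d_pt (fun u v => h (shift (shift x i u) j v)) 0 0.
  move=> hc e.
  have L : filterlim (fun p : R * R => h (shift (shift x i p.1) j p.2)) (filter_prod (locally 0) (locally 0)) (locally (h (shift (shift x i 0) j 0))).
    apply: (lim_comp (f := fun p : R * R => shift (shift x i p.1) j p.2) (h := h)); last exact: hc.
    by apply: lim_shift; [apply: lim_shift; [exact: filterlim_const | exact: filterlim_fst] | exact: filterlim_snd].
  have /(@tendsP _ R_NormedModule) /(_ e (cond_pos e)) [P Q [d1 HP] [d2 HQ] H] := L.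
  exists (mkposreal _ (Rmin_stable_in_posreal d1 d2)) => u v /= hu hv.
  apply: (H u v).
    apply: HP; apply: Rlt_le_trans (Rmin_l d1 d2); exact: hu.
  apply: HQ; apply: Rlt_le_trans (Rmin_r d1 d2); exact: hv.
have := @Schwarz g 0 0.
rewrite (is_derive_unique _ _ _ (Duv 0 0)) (is_derive_unique _ _ _ (Dvu 0 0)) !shift0.
apply.
- exists (mkposreal _ Rlt_0_1) => u v _ _; split; first by exists (fi (shift (shift x i u) j v)).
  split; first by exists (fj (shift (shift x i u) j v)).
  by split; [exists (fij (shift (shift x i u) j v)) | exists (fji (shift (shift x i u) j v))].
- have -> : (fun u v => Derive (fun z => Derive (g z) v) u) = (fun u v => fij (shift (shift x i u) j v)).
    by apply: functional_extensionality => u; apply: functional_extensionality => v; apply: is_derive_unique.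
  exact: cont2d.
- have -> : (fun u v => Derive (fun z => Derive (g^~ z) u) v) = (fun u v => fji (shift (shift x i u) j v)).
    by apply: functional_extensionality => u; apply: functional_extensionality => v; apply: is_derive_unique.
  exact: cont2d.
Qed.

Lemma schwarzC d (f fi fj fij fji : ('I_d -> R) -> CV) i j x :
  pder i f fi -> pder j f fj -> pder i fj fij -> pder j fi fji ->
  (forall y, continuous fij y) -> (forall y, continuous fji y) -> fij x = fji x.
Proof.
move=> Hi Hj Hij Hji Cij Cji.
have c1 (h : ('I_d -> R) -> CV) y : continuous h y -> continuous (fun y => (h y).1) y.
  by move=> /contP H; apply/(@tendsP _ R_NormedModule); apply: tends_fst.
have c2 (h : ('I_d -> R) -> CV) y : continuous h y -> continuous (fun y => (h y).2) y.
  by move=> /contP H; apply/(@tendsP _ R_NormedModule); apply: tends_snd.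
rewrite (surjective_pairing (fij x)) (surjective_pairing (fji x)); congr pair.
- apply: (@schwarz_real d (fun y => (f y).1) (fun y => (fi y).1) (fun y => (fj y).1) (fun y => (fij y).1) (fun y => (fji y).1) i j).
  + by move=> y; case/derC_pair: (Hi y).
  + by move=> y; case/derC_pair: (Hj y).
  + by move=> y; case/derC_pair: (Hij y).
  + by move=> y; case/derC_pair: (Hji y).
  + by move=> y; apply: c1.
  + by move=> y; apply: c1.
- apply: (@schwarz_real d (fun y => (f y).2) (fun y => (fi y).2) (fun y => (fj y).2) (fun y => (fij y).2) (fun y => (fji y).2) i j).
  + by move=> y; case/derC_pair: (Hi y).
  + by move=> y; case/derC_pair: (Hj y).
  + by move=> y; case/derC_pair: (Hij y).
  + by move=> y; case/derC_pair: (Hji y).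
  + by move=> y; apply: c2.
  + by move=> y; apply: c2.
Qed.

Section FoldComm.
Variables (d : nat) (X : Type) (D : 'I_d -> X -> X) (x : X).
Hypothesis Hcomm : forall js i j, D i (D j (foldr D x js)) = D j (D i (foldr D x js)).

Lemma foldr_move (j : 'I_d) js : j \in js -> foldr D x js = foldr D x (j :: rem j js).
Proof.
elim: js => [//|i js IH]; rewrite in_cons /=.
case: (eqVneq i j) => [->|hij] //=.
by move=> hj; rewrite (IH hj) /= Hcomm.
Qed.

Lemma foldr_perm (js js' : seq 'I_d) : perm_eq js js' -> foldr D x js = foldr D x js'.
Proof.
elim: js js' => [|j js IH] js' hp.
  by have /eqP := perm_size hp; rewrite eq_sym size_eq0 => /eqP ->.
have hj : j \in js' by rewrite -(perm_mem hp) mem_head.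
rewrite (foldr_move hj) /=; congr (D j _); apply: IH.
by rewrite -(perm_cons j); apply: perm_trans hp (perm_to_rem hj).
Qed.

Lemma count_kdirs (k : 'I_d -> nat) j : count_mem j (kdirs k) = k j.
Proof.
rewrite /kdirs count_flatten sumnE -map_comp big_map big_enum /=.
rewrite (bigD1 j) //= big1 ?addn0; first by rewrite count_nseq /= eqxx mul1n.
by move=> i hi; rewrite count_nseq /= (negbTE hi).
Qed.

(** Commuting derivatives can be sorted, and the sorted list is the one that [mi_iter] runs
    through. *)
Lemma foldr_kdirs js : foldr D x js = mi_iter D (fun j => count_mem j js) x.
Proof.
rewrite mi_iter_foldr; apply: foldr_perm.
by apply/allP => j _ /=; rewrite -/(kdirs _) count_kdirs.
Qed.

End FoldComm.

Lemma size_count d (js : seq 'I_d) : mi_size (fun j => count_mem j js) = size js.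
Proof.
rewrite -size_kdirs; apply: perm_size; apply/allP => j _ /=.
by rewrite count_kdirs.
Qed.

Section Torus.
Variables (n : nat) (theta : 'I_n -> 'I_n -> R) (A : CstarAlgebra) (U : 'I_n -> A).
Variables (alpha : ('I_n -> R) -> A -> A) (tau : A -> C) (delta : 'I_n -> A -> A).
Hypothesis HT : torus_data theta U alpha tau.
Hypothesis Hdelta : is_basic_derivations U alpha delta.

Local Notation mon := (@monomial n A U).
Local Notation Zn := (Zn n).
Local Notation cf := (cf U tau).
Local Notation Ainf := (Ainf alpha).
Local Notation Ainf_norm := (Ainf_norm alpha).
Local Notation pa := (@partial A ('I_n -> nat) Ainf Ainf_norm n).
Local Notation ispa := (@is_partial A ('I_n -> nat) Ainf Ainf_norm n).

(** Polarization: positivity on [a + b] gives opposite imaginary parts, on [a + i b] equal real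
    parts. *)
Lemma tau_herm a b : tau (cmul (cstar a) b) = Cconj (tau (cmul (cstar b) a)).
Proof.
have Hpos x : (tau (cmul (cstar x) x)).2 = 0 by have [_ [_ [_ [h _]]]] := td_tau HT; case: (h x).
set s := tau (cmul (cstar a) b); set t := tau (cmul (cstar b) a).
have h1 : s.2 + t.2 = 0.
  have := Hpos (plus a b); rewrite cstarD cmulDl !cmulDr !(tauD HT) -/s -/t /=.
  by rewrite !Hpos; lra.
have h2 : s.1 - t.1 = 0.
  have := Hpos (plus a (cscal Ci b)); rewrite cstarD cstarZ cmulDl !cmulDr !(cmulZl, cmulZr) !(tauD HT) !(tauZ HT) -/s -/t /=.
  by rewrite !Hpos; lra.
by rewrite (surjective_pairing s) (surjective_pairing t) /Cconj /=; congr pair; lra.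
Qed.

(** Bessel's inequality for one vector: with [z = cf m a], positivity of the trace on [a - z U^m]
    says that [|z| ^ 2] is at most the square of [L2norm tau a]. *)
Lemma cf_le_L2 m a : Cmod (cf m a) <= L2norm tau a.
Proof.
have Hpos x : 0 <= (tau (cmul (cstar x) x)).1 by have [_ [_ [_ [h _]]]] := td_tau HT; case: (h x).
set z := cf m a; have := Hpos (minus a (cscal z (mon m))).
have hz : tau (cmul (cstar (mon m)) a) = z by [].
have hz' : tau (cmul (cstar a) (mon m)) = Cconj z by rewrite tau_herm hz.
rewrite /minus -cscalN1 cscalA cstarD cstarZ cmulDl !cmulDr !(cmulZl, cmulZr) !(tauD HT) !(tauZ HT).
rewrite (proj1 (mon_unitary (td_rel HT) m)) (tau1 HT) hz hz'.
rewrite /L2norm /Re => h.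
apply: Rsqr_incr_0_var; last exact: sqrt_pos.
rewrite Rsqr_sqrt; last exact: Hpos.
rewrite Rsqr_pow2 Cmod2_alt /Re /Im.
by move: h; case: (z) => z1 z2 /=; lra.
Qed.

Lemma L2_le_norm a : L2norm tau a <= norm a.
Proof.
rewrite /L2norm -(sqrt_Rsqr (norm a)); last exact: norm_ge_0.
apply: sqrt_le_1_alt; apply: Rle_trans (Rle_abs _) _; apply: Rle_trans (re_le_Cmod _) _.
apply: Rle_trans (tau_le HT _) _; apply: Rle_trans (cnormM _ _) _.
by rewrite norm_star /Rsqr; lra.
Qed.

Lemma cf_mi_delta i a m : Ainf a ->
  Ainf (mi_iter delta i a) /\ Cmod (cf m (mi_iter delta i a)) = Cmod (dirs (kdirs i) m) * Cmod (cf m a).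
Proof.
move=> Ha; rewrite mi_iter_foldr -/(kdirs i).
elim: (kdirs i) => [|j js [IH1 IH2]] /=; first by rewrite Cmod_1 Rmult_1_l.
split; first exact: (delta_Ainf Hdelta).
by rewrite (cf_delta HT Hdelta) // !Cmod_mult IH2 Cmod_im Cmod_R Rmult_assoc.
Qed.

Lemma cf_mi_delta_exact i a m : Ainf a ->
  cf m (mi_iter delta i a) = Cmult (RtoC (\big[Rmult/1]_(j <- kdirs i) IZR (m j))) (cf m a).
Proof.
move=> Ha; rewrite mi_iter_foldr -/(kdirs i).
have Hk js : Ainf (foldr delta a js) by elim: js => [//|j js IH] /=; exact: (delta_Ainf Hdelta).
elim: (kdirs i) => [|j js IH] /=; first by rewrite big_nil Cmult_1_l.
by rewrite (cf_delta HT Hdelta) // IH big_cons RtoC_mult Cmult_assoc.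
Qed.

Definition scoef (rho : ('I_n -> R) -> A) : fam Zn n := fun m xi => cf m (rho xi).

Lemma Ainf_norm0 a : Ainf a -> Ainf_norm (fun=> 0%N) a = norm a.
Proof.
move=> Ha; have Hr := Ainf_rapid HT Ha.
rewrite (Ainf_normE HT _ Hr); congr norm; rewrite -[RHS](ser_coef HT Hr); congr (fser _ _).
have k0 : kdirs (fun _ : 'I_n => 0%N) = [::] by rewrite /kdirs; elim: (enum 'I_n).
by apply: functional_extensionality => m; rewrite k0 /= Cmult_1_l.
Qed.

Lemma Ainf_plus a b : Ainf a -> Ainf b -> Ainf (plus a b).
Proof. by move=> /(Ainf_rapid HT) Ha /(Ainf_rapid HT) Hb; apply: (rapid_Ainf HT); apply: (rapid_coef_plus HT). Qed.
Lemma Ainf_cscal z a : Ainf a -> Ainf (cscal z a).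
Proof. by move=> /(Ainf_rapid HT) Ha; apply: (rapid_Ainf HT); apply: (rapid_coef_scal HT). Qed.
Lemma Ainf_minus a b : Ainf a -> Ainf b -> Ainf (minus a b).
Proof. by move=> /(Ainf_rapid HT) Ha /(Ainf_rapid HT) Hb; apply: (rapid_Ainf HT); apply: (rapid_coef_minus HT). Qed.

(** Convergence in the seminorm of order [0] is convergence in norm. *)
Lemma ispa_derive j f x v : (forall x, Ainf (f x)) -> ispa j f x v -> is_derive (fun t => f (shift x j t)) 0 v.
Proof.
move=> Hf [Hv /(_ (fun=> 0%N)) /lim0P H]; apply/is_deriveP => e he.
have [d Hd] := H (fun t => norm_ge_0 _) e he; exists d => t ht hne.
have := Hd t ht hne; rewrite Rplus_0_l shift0 Ainf_norm0 //.
apply: Ainf_minus => //; rewrite -cscalR; apply: Ainf_cscal; exact: Ainf_minus.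
Qed.

Lemma pa_eq j f x v : (forall x, Ainf (f x)) -> ispa j f x v -> pa j f x = v.
Proof.
move=> Hf H.
have H' : ispa j f x (pa j f x) by apply: epsilon_spec; exists v.
exact: is_derive_uniq (ispa_derive Hf H') (ispa_derive Hf H).
Qed.

Section FromSymbol.
Variables (M : R) (rho : ('I_n -> R) -> A).
Hypothesis Hrho : symbol alpha tau delta M rho.

Let g js := foldr pa rho js.

Lemma g_Ainf js x : Ainf (g js x).
Proof.
elim: js x => [|j js IH] x; first exact: (proj1 (proj1 Hrho)).
have [_ H] := proj2 (proj1 Hrho) js; have [v Hv] := H j x.
have e : g (j :: js) x = v by exact: (pa_eq IH Hv).
by rewrite e; case: Hv.
Qed.

Lemma g_derive js j x : is_derive (fun t => g js (shift x j t)) 0 (g (j :: js) x).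
Proof.
have [_ H] := proj2 (proj1 Hrho) js; have [v Hv] := H j x.
have e : g (j :: js) x = v by exact: (pa_eq (g_Ainf js) Hv).
by rewrite e; apply: ispa_derive => //; exact: g_Ainf.
Qed.

Lemma g_cont js x : continuous (g js) x.
Proof.
have [H _] := proj2 (proj1 Hrho) js; apply/contP => e he.
have /lim0P H2 := H x (fun=> 0%N).
have [d Hd] := H2 (fun t => norm_ge_0 _) e he; exists d => y hy.
by have := Hd y hy; rewrite Ainf_norm0 //; apply: Ainf_minus; exact: g_Ainf.
Qed.

Lemma sc_g_pder js j m : pder j (fun x => cf m (g js x) : CV) (fun x => cf m (g (j :: js) x)).
Proof. by move=> x; apply: (pder_lin (is_linear_cf HT m)); apply: g_derive. Qed.

Lemma sc_g_cont js m x : continuous (fun x => cf m (g js x) : CV) x.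
Proof. by apply: lim_comp; [exact: g_cont | exact: linear_cont (is_linear_cf HT m)]. Qed.

(** Tested on Fourier coefficients, where the complex-valued symmetry theorem applies. *)
Lemma g_comm js i j : pa i (pa j (foldr pa rho js)) = pa j (pa i (foldr pa rho js)).
Proof.
apply: functional_extensionality => x; apply: (cf_eq HT) => m.
exact (@schwarzC n (fun x => cf m (g js x)) (fun x => cf m (g (i :: js) x)) (fun x => cf m (g (j :: js) x))
  (fun x => cf m (g (i :: j :: js) x)) (fun x => cf m (g (j :: i :: js) x)) i j x
  (@sc_g_pder js i m) (@sc_g_pder js j m) (@sc_g_pder (j :: js) i m) (@sc_g_pder (i :: js) j m)
  (@sc_g_cont _ m) (@sc_g_cont _ m)).
Qed.

Lemma g_deriv js : g js = deriv alpha (fun j => count_mem j js) rho.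
Proof. exact: foldr_kdirs g_comm js. Qed.

Lemma g_BS js : BS (M - INR (size js)) (scoef (g js)).
Proof.
split; first by move=> m xi; exact: sc_g_cont.
move=> K.
have [B0 [hB0 HB0]] := @Rp_enorm n (M - INR (size js)).
have Hk (k : 'I_n -> nat) : exists B, forall xi, L2norm tau (mi_iter delta k (g js xi)) <= B * Rp (M - INR (size js)) xi.
  have [B HB] := proj2 Hrho k (fun j => count_mem j js).
  exists (Rabs B * B0) => xi; apply: Rle_trans (_ : Rabs B * Rpower (1 + enorm xi) (M - INR (size js)) <= _).
    rewrite g_deriv; have := HB xi; rewrite size_count => h; apply: Rle_trans h _.
    by apply: Rmult_le_compat_r; [left; apply: exp_pos | exact: Rle_abs].
  rewrite Rmult_assoc; apply: Rmult_le_compat_l; first exact: Rabs_pos.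
  by case: (HB0 xi).
have [b hb] : exists b : ('I_n -> nat) -> R, forall k xi, L2norm tau (mi_iter delta k (g js xi)) <= b k * Rp (M - INR (size js)) xi.
  exists (fun k => proj1_sig (constructive_indefinite_description _ (Hk k))) => k.
  exact: (proj2_sig (constructive_indefinite_description _ (Hk k))).
(* The multi-indices [0] and [K] times a unit vector provide exactly the hypotheses of
   [wt_pow_bound]. *)
pose k0 : 'I_n -> nat := fun=> 0%N.
pose kj j : 'I_n -> nat := fun i => if i == j then K else 0%N.
pose B := Rabs (b k0) + sumR (fun j => Rabs (b (kj j))).
have hB : 0 <= B.
  rewrite /B; have := Rabs_pos (b k0); have := @sumR_ge0 _ (fun j => Rabs (b (kj j))) (fun j => Rabs_pos _); lra.
exists (INR n.+1 ^ K * B); split.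
  by apply: Rmult_le_pos => //; apply: pow_le; apply: pos_INR.
move=> m xi; have hw := wt_pos (toR m) K; have hr := Rp_pos (M - INR (size js)) xi.
apply: (Rmult_le_reg_l (wt (toR m) ^ K)) => //.
have -> : wt (toR m) ^ K * (INR n.+1 ^ K * B * / wt (toR m) ^ K * Rp (M - INR (size js)) xi) =
   INR n.+1 ^ K * (B * Rp (M - INR (size js)) xi) by field; lra.
have hA := g_Ainf js xi.
have low k : Cmod (dirs (kdirs k) m) * Cmod (cf m (g js xi)) <= Rabs (b k) * Rp (M - INR (size js)) xi.
  rewrite -(proj2 (cf_mi_delta k m hA)); apply: Rle_trans (cf_le_L2 _ _) _.
  apply: Rle_trans (hb k xi) _; apply: Rmult_le_compat_r; [lra | exact: Rle_abs].
apply: wt_pow_bound; first exact: Cmod_ge_0.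
- have := low k0; have -> : kdirs k0 = [::] by rewrite /kdirs; elim: (enum 'I_n).
  rewrite /= Cmod_1 Rmult_1_l => h; apply: Rle_trans h _.
  apply: Rmult_le_compat_r; first lra.
  have := @sumR_ge0 _ (fun j => Rabs (b (kj j))) (fun j => Rabs_pos _); rewrite /B; lra.
move=> j.
have -> : Rabs (toR m j) ^ K = Cmod (dirs (kdirs (kj j)) m).
  have hall : all (pred1 j) (kdirs (kj j)).
    apply/allP => i; rewrite /= -has_pred1 has_count count_kdirs /kj.
    by case: eqP.
  have hs : size (kdirs (kj j)) = K.
    by move: hall; rewrite all_count => /eqP <-; rewrite count_kdirs /kj eqxx.
  rewrite -{1}hs; elim: (kdirs (kj j)) hall => [|i t IH] /=; first by rewrite Cmod_1.
  by move=> /andP [/eqP -> ht]; rewrite Cmod_mult Cmod_im IH.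
apply: Rle_trans (low (kj j)) _.
apply: Rmult_le_compat_r; first lra.
have := @sumR_ge_term _ (fun j => Rabs (b (kj j))) j (fun j => Rabs_pos _); have := Rabs_pos (b k0); rewrite /B; lra.
Qed.

Lemma sc_g_pdf js j : pdf j (scoef (g js)) (scoef (g (j :: js))).
Proof. by move=> m xi; exact: sc_g_pder. Qed.

Lemma sc_g_lev N js : lev (@BS n) N (M - INR (size js)) (scoef (g js)).
Proof.
elim: N js => [|N IH] js; first exact: g_BS.
split; first exact: g_BS.
move=> j; exists (scoef (g (j :: js))); split; first exact: sc_g_pdf.
have -> : M - INR (size js) - 1 = M - INR (size (j :: js)) by rewrite [size (_ :: _)]/= S_INR; ring.
exact: IH.
Qed.

Lemma symbol_CS : CS M (scoef rho).
Proof. by move=> N; have := sc_g_lev N [::]; rewrite /= Rminus_0_r. Qed.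

Lemma symbol_Ainf xi : Ainf (rho xi).
Proof. exact: (g_Ainf [::]). Qed.

Lemma sc_deriv l : scoef (deriv alpha l rho) = mi_iter (@pd Zn n) l (scoef rho) /\ forall xi, Ainf (deriv alpha l rho xi).
Proof.
rewrite /deriv !mi_iter_foldr -/(kdirs l); split; last exact: g_Ainf.
elim: (kdirs l) => [//|j js IH] /=.
by rewrite -IH; symmetry; apply: pdf_pd; exact: sc_g_pdf.
Qed.

End FromSymbol.

End Torus.

(** * From coefficient families back to symbols; coefficients of products *)

Section Torus.
Variables (n : nat) (theta : 'I_n -> 'I_n -> R) (A : CstarAlgebra) (U : 'I_n -> A).
Variables (alpha : ('I_n -> R) -> A -> A) (tau : A -> C) (delta : 'I_n -> A -> A).
Hypothesis HT : torus_data theta U alpha tau.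
Hypothesis Hdelta : is_basic_derivations U alpha delta.

Local Notation mon := (@monomial n A U).
Local Notation Zn := (Zn n).
Local Notation cf := (cf U tau).
Local Notation coef := (fcoef U tau).
Local Notation ser := (fser U).
Local Notation Ainf := (Ainf alpha).
Local Notation Ainf_norm := (Ainf_norm alpha).
Local Notation pa := (@partial A ('I_n -> nat) Ainf Ainf_norm n).
Local Notation ispa := (@is_partial A ('I_n -> nat) Ainf Ainf_norm n).
Local Notation sc := (scoef U tau).

(** Inverse of [scoef]. *)
Definition synth (c : fam Zn n) : ('I_n -> R) -> A := fun xi => ser (fun m => c m xi).

Lemma BS_rapid M (c : fam Zn n) xi : BS M c -> rapid (fun m => c m xi).
Proof.
move=> [_ H] K; have [B [hB hb]] := H K; exists (B * Rp M xi) => m.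
by apply: Rle_trans (hb m xi) _; right; ring.
Qed.

Lemma coef_ser c : rapid c -> coef (ser c) = c.
Proof. by move=> H; apply: functional_extensionality => m; rewrite /coef (cf_ser_rapid HT). Qed.

Lemma rapid_coef_ser c : rapid c -> rapid (coef (ser c)).
Proof. by move=> H; rewrite coef_ser. Qed.

Lemma sc_synth M (c : fam Zn n) : BS M c -> sc (synth c) = c.
Proof.
move=> H; apply: functional_extensionality => m; apply: functional_extensionality => xi.
by rewrite /scoef /synth (cf_ser_rapid HT) //; apply: BS_rapid H.
Qed.

Lemma synth_Ainf M (c : fam Zn n) xi : BS M c -> Ainf (synth c xi).
Proof. by move=> H; apply: (rapid_Ainf HT); apply: rapid_coef_ser; apply: BS_rapid H. Qed.

(** Convergence in the seminorm along [js]: [size js] powers of [wt] pay for [dirs], the other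
    [2 * n] for summability. *)
Lemma dirs_ser_lim (T : Type) (F : (T -> Prop) -> Prop) {FF : Filter F} (js : seq 'I_n)
    (q : T -> Zn -> C) (l : Zn -> C) B :
  F (fun t => forall m, Cmod (q t m) <= B * / wt (toR m) ^ (size js + 2 * n)) ->
  (forall m, Cmod (l m) <= B * / wt (toR m) ^ (size js + 2 * n)) ->
  (forall m, tends (V := CV) F (fun t => q t m) (l m)) ->
  tends F (fun t => ser (fun m => Cmult (dirs js m) (q t m))) (ser (fun m => Cmult (dirs js m) (l m))).
Proof.
move=> Hq Hl Hlim.
have B0 : 0 <= B.
  have := Hl (fun=> 0%Z); have := Cmod_ge_0 (l (fun=> 0%Z)); have := winv_pos (toR (fun _ : 'I_n => 0%Z)) (size js + 2 * n).
  by move=> h1 h2 h3; apply: Rnot_lt_le => h4; nra.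
have key z m : Cmod z <= B * / wt (toR m) ^ (size js + 2 * n) ->
   norm (cscal (Cmult (dirs js m) z) (mon m)) <= B * / wt (toR m) ^ (2 * n).
  move=> hz; rewrite cnormZ (norm_mon (td_rel HT) (norm_one HT)) Rmult_1_r Cmod_mult.
  apply: Rle_trans (Rmult_le_compat _ _ _ _ (Cmod_ge_0 _) (Cmod_ge_0 _) (Cmod_dirs js m) hz) _.
  have h1 := wt_pos (toR m) (size js); have h2 := wt_pos (toR m) (2 * n).
  by right; rewrite (pow_add _ (size js) (2 * n)); field; lra.
apply: (Sum_dct (g := fun m => B * / wt (toR m) ^ (2 * n))).
- by apply: filter_imp Hq => t Ht m; apply: key.
- by split; [apply: conv_summable | move=> m; apply: key].
move=> m; apply/tendsP; apply: lim_cscal; last exact: filterlim_const.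
by apply: lim_Cmult; [exact: filterlim_const | apply/(@tendsP _ CV)].
Qed.

Lemma Ainf_norm_dist k a b : rapid (coef a) -> rapid (coef b) ->
  Ainf_norm k (minus a b) = dist (ser (fun m => Cmult (dirs (kdirs k) m) (cf m a))) (ser (fun m => Cmult (dirs (kdirs k) m) (cf m b))).
Proof.
move=> Ha Hb; rewrite (Ainf_normE HT); last exact: (rapid_coef_minus HT).
rewrite /dist; congr norm; apply: (cf_eq HT) => m.
have hr c : rapid c -> rapid (fun m => Cmult (dirs (kdirs k) m) (c m)).
  move=> hc; apply: (rapid_mul (N := size (kdirs k)) (B := 1) hc) => m'.
  by rewrite Rmult_1_l; exact: Cmod_dirs.
rewrite (cf_minus HT) !(cf_ser_rapid HT); try exact: hr.
  by rewrite (cf_minus HT); ring.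
apply: hr; exact: (rapid_coef_minus HT).
Qed.

Section ToSymbol.
Variables (M : R) (c : fam Zn n).
Hypothesis Hc : CS M c.

(** The bounds on [pd j c] near [xi] dominate the difference quotients of all coefficients, with
    enough decay in [m] for any given seminorm. *)
Lemma synth_ispa j xi : ispa j (synth c) xi (synth (pd j c) xi).
Proof.
have [Hd Hc'] := CSg_pd j Hc; have bc := CSg_bd Hc; have bc' := CSg_bd Hc'.
split; first exact: synth_Ainf bc'.
move=> k; apply/lim0P; first by move=> t; apply: norm_ge_0.
have [C1 [c10 c1]] := shift_near (M - 1) xi.
have [B [b0 hb]] := proj2 bc' (size (kdirs k) + 2 * n)%N.
pose q (t : R) m := Cmult (RtoC (/ t)) (Cminus (c m (shift xi j t)) (c m xi)).
have hb1 m s : Rabs s <= 1 -> Cmod (pd j c m (shift xi j s)) <= B * C1 * / wt (toR m) ^ (size (kdirs k) + 2 * n).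
  move=> hs; apply: Rle_trans (hb m _) _.
  have := c1 j s hs; have := winv_pos (toR m) (size (kdirs k) + 2 * n) => h1 h2.
  have -> : B * C1 * / wt (toR m) ^ (size (kdirs k) + 2 * n) = B * / wt (toR m) ^ (size (kdirs k) + 2 * n) * C1 by ring.
  by apply: Rmult_le_compat_l => //; apply: Rmult_le_pos; lra.
have L : tends (locally' 0) (fun t => ser (fun m => Cmult (dirs (kdirs k) m) (q t m))) (ser (fun m => Cmult (dirs (kdirs k) m) (pd j c m xi))).
  apply: (dirs_ser_lim (B := 2 * (B * C1))).
  - apply: filter_imp locally'_le1 => t [ht1 ht] m.
    rewrite Rmult_assoc; apply: (dq_bound (Hd m)) => // s hs; apply: hb1; lra.
  - move=> m; have := hb1 m 0; rewrite Rabs_R0 shift0 => /(_ ltac:(lra)).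
    have := Cmod_ge_0 (pd j c m xi); lra.
  - move=> m; have := Hd m xi => /is_deriveP; apply: tends_ext => t.
    by rewrite /q Rplus_0_l shift0 scalC minusC.
move=> e he; have := L e he; apply: filter_imp => t Ht.
have hr x : rapid (coef (synth c x)) by apply: rapid_coef_ser; apply: BS_rapid bc.
have hr' x : rapid (coef (synth (pd j c) x)) by apply: rapid_coef_ser; apply: BS_rapid bc'.
rewrite Ainf_norm_dist //; last first.
  by rewrite -cscalR; apply: (rapid_coef_scal HT); apply: (rapid_coef_minus HT).
apply: Rle_lt_trans Ht; right; congr dist.
  congr (fser _ _); apply: functional_extensionality => m.
  rewrite -cscalR (cfZ HT) (cf_minus HT) /synth !(cf_ser_rapid HT) //; exact: BS_rapid bc.
congr (fser _ _); apply: functional_extensionality => m.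
rewrite /synth (cf_ser_rapid HT) //; exact: BS_rapid bc'.
Qed.

Lemma synth_pa j : pa j (synth c) = synth (pd j c).
Proof.
apply: functional_extensionality => xi; apply: (pa_eq HT); last exact: synth_ispa.
by move=> x; apply: synth_Ainf (CSg_bd Hc).
Qed.

Lemma synth_cont xi : sn_cvg Ainf_norm (locally xi) (synth c) (synth c xi).
Proof.
have bc := CSg_bd Hc.
move=> k; apply/lim0P; first by move=> t; apply: norm_ge_0.
have [C1 [c10 c1]] := Rp_local M xi.
have [B [b0 hb]] := proj2 bc (size (kdirs k) + 2 * n)%N.
have hr x : rapid (fun m => c m x) by apply: BS_rapid bc.
have key m y : Rp M y <= C1 -> Cmod (c m y) <= B * C1 * / wt (toR m) ^ (size (kdirs k) + 2 * n).
  move=> hy; apply: Rle_trans (hb m y) _.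
  have -> : B * C1 * / wt (toR m) ^ (size (kdirs k) + 2 * n) = B * / wt (toR m) ^ (size (kdirs k) + 2 * n) * C1 by ring.
  by apply: Rmult_le_compat_l => //; apply: Rmult_le_pos => //; left; exact: winv_pos.
have L : tends (locally xi) (fun y => ser (fun m => Cmult (dirs (kdirs k) m) (c m y))) (ser (fun m => Cmult (dirs (kdirs k) m) (c m xi))).
  apply: (dirs_ser_lim (B := B * C1)).
  - by apply: filter_imp c1 => y hy m; apply: key.
  - by move=> m; apply: key; exact: locally_singleton c1.
  - by move=> m; apply/contP; apply: (proj1 bc).
move=> e he; have := L e he; apply: filter_imp => y Hy.
rewrite Ainf_norm_dist; try by apply: rapid_coef_ser.
apply: Rle_lt_trans Hy; right; congr dist; congr (fser _ _); apply: functional_extensionality => m;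
  by rewrite /synth (cf_ser_rapid HT).
Qed.

End ToSymbol.

Lemma synth_foldr M c js : CS M c ->
  foldr pa (synth c) js = synth (foldr (@pd Zn n) c js) /\ CS (M - INR (size js)) (foldr (@pd Zn n) c js).
Proof.
move=> Hc; elim: js => [|j js [IH1 IH2]]; first by rewrite /= Rminus_0_r.
have E : INR (size (j :: js)) = INR (size js) + 1 by rewrite -S_INR.
rewrite E; split; first by rewrite [LHS]/= IH1; exact: (synth_pa IH2 j).
have -> : M - (INR (size js) + 1) = M - INR (size js) - 1 by ring.
by case: (CSg_pd j IH2).
Qed.

Lemma synth_deriv M c l : CS M c ->
  deriv alpha l (synth c) = synth (mi_iter (@pd Zn n) l c) /\ CS (M - INR (mi_size l)) (mi_iter (@pd Zn n) l c).
Proof.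
by move=> Hc; rewrite /deriv !mi_iter_foldr -/(kdirs l) -size_kdirs; exact: synth_foldr.
Qed.

(** Converse of [symbol_CS]: the [L2norm] is at most the norm, which is at most the sum of the
    moduli of the coefficients. *)
Lemma CS_symbol M c : CS M c -> symbol alpha tau delta M (synth c).
Proof.
move=> Hc; split.
  split; first by move=> x; apply: synth_Ainf (CSg_bd Hc).
  move=> js /=; have [-> H] := synth_foldr js Hc; split; first exact: (synth_cont H).
  by move=> j x; exists (synth (pd j (foldr (@pd Zn n) c js)) x); exact: (synth_ispa H j x).
move=> i l; have [-> H] := synth_deriv l Hc.
have bc := CSg_bd H.
have [B [b0 hb]] := proj2 bc (size (kdirs i) + 2 * n)%N.
have [S [S0 HS]] := summable_wt (leqnn (2 * n)).
have [B1 [b10 hb1]] := @Rp_enorm n (M - INR (mi_size l)).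
exists (B * S * B1) => xi.
have hS : 0 <= S by have := HS [::] isT; rewrite /rsum big_nil.
apply: Rle_trans (L2_le_norm HT _) _.
have hA := synth_Ainf xi bc.
have [hAi hcf] := cf_mi_delta HT Hdelta i (fun=> 0%Z) hA.
have hr := Ainf_rapid HT hAi.
rewrite -(ser_coef HT hr).
apply: Rle_trans (_ : B * Rp (M - INR (mi_size l)) xi * S <= _); last first.
  have := proj1 (hb1 xi) => h.
  have := Rmult_le_compat_l (B * S) _ _ (Rmult_le_pos _ _ b0 hS) h; lra.
apply: (norm_ser_le HT (g := fun m => B * Rp (M - INR (mi_size l)) xi * / wt (toR m) ^ (2 * n))).
  have hp : 0 <= B * Rp (M - INR (mi_size l)) xi by apply: Rmult_le_pos => //; left; exact: Rp_pos.
  split=> [k|s us]; first by apply: Rmult_le_pos => //; left; apply: winv_pos.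
  have -> : forall c (h : Zn -> R), rsum s (fun k => c * h k) = c * rsum s h.
    move=> c' h; elim: s {us} => [|x s IH]; first by rewrite /rsum !big_nil; ring.
    by rewrite /rsum !big_cons -!/(rsum _ _) IH /=; ring.
  by apply: Rmult_le_compat_l => //; apply: HS.
move=> m; rewrite /coef (proj2 (cf_mi_delta HT Hdelta i m hA)) /synth (cf_ser_rapid HT); last exact: BS_rapid bc.
apply: Rle_trans (Rmult_le_compat _ _ _ _ (Cmod_ge_0 _) (Cmod_ge_0 _) (Cmod_dirs _ m) (hb m xi)) _.
have h1 := wt_pos (toR m) (size (kdirs i)); have h2 := wt_pos (toR m) (2 * n).
by right; rewrite (pow_add _ (size (kdirs i)) (2 * n)); field; lra.
Qed.

Lemma synth_sc rho : (forall xi, Ainf (rho xi)) -> synth (sc rho) = rho.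
Proof.
move=> H; apply: functional_extensionality => xi.
exact: (ser_coef HT (Ainf_rapid HT (H xi))).
Qed.

Local Notation ph := (ph U tau).

(** By density: only the component of [a] of exponent [m - k] contributes. *)
Lemma cf_mul_mon m k a : cf m (cmul a (mon k)) = Cmult (ph (zsub m k) k) (cf (zsub m k) a).
Proof.
have e : zadd (zsub m k) k = m by apply: functional_extensionality => j; rewrite /zadd /zsub; lia.
apply: (@agree_on_monomials _ _ _ _ _ _ HT CV (fun a => cf m (cmul a (mon k))) (fun a => Cmult (ph (zsub m k) k) (cf (zsub m k) a)) 1).
- by move=> x y; rewrite cmulDl (cfD HT).
- by move=> x y; rewrite (cfD HT) Cmult_plus_distr_l.
- move=> x; rewrite normC Rmult_1_l; apply: Rle_trans (cf_le HT _ _) _; apply: Rle_trans (cnormM _ _) _.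
  by rewrite (norm_mon (td_rel HT) (norm_one HT)); lra.
- move=> x; rewrite normC Cmod_mult (proj1 (phP HT _ _)) !Rmult_1_l; exact: (cf_le HT).
- move=> z l; rewrite cmulZl !(cfZ HT) (proj2 (phP HT l k)) (cfZ HT).
  case: (classic (l = zsub m k)) => [->|h]; first by rewrite e !(cf_mon_eq HT) !Cmult_1_r Cmult_comm.
  rewrite !(cf_mon_neq HT) ?Cmult_0_r //.
  move=> h2; apply: h; apply: functional_extensionality => j.
  by have := congr1 (fun f => f j) h2; rewrite /zadd /zsub; lia.
Qed.

Lemma cf_mul m a b : rapid (coef b) ->
  cf m (cmul a b) = Sum (fun k : Zn => Cmult (ph (zsub m k) k) (Cmult (cf (zsub m k) a) (cf k b)) : CV).
Proof.
move=> Hb; have hd := rser_dom HT Hb.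
rewrite -{1}(ser_coef HT Hb) /fser -(Sum_lin (is_linear_cmul_l a) hd).
have hd2 : dominated (fun k => cmul a (cscal (coef b k) (mon k))) (fun k => norm a * Cmod (coef b k)).
  apply: dominated_scal_le; [exact: norm_ge_0 | exact: (rapid_summable0 Hb) |].
  move=> k; apply: Rle_trans (cnormM _ _) _; apply: Rmult_le_compat_l; first exact: norm_ge_0.
  exact: (proj2 hd).
rewrite -(Sum_lin (is_linear_cf HT m) hd2); refine (@Sum_ext Zn CV _ _ _) => k.
by rewrite cmulZr (cfZ HT) cf_mul_mon /coef Cmult_comm -Cmult_assoc.
Qed.

(** Elements of [Ainf] are regarded as symbols of order [0] constant in [xi]; the convolution
    estimate then yields rapid decay of the product. *)
Lemma Ainf_cmul a b : Ainf a -> Ainf b -> Ainf (cmul a b).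
Proof.
move=> Ha Hb; have ha := Ainf_rapid HT Ha; have hb := Ainf_rapid HT Hb.
have hF : BK 0 (fun (p : Zn * Zn) (_ : 'I_n -> R) => cf p.1 a).
  split; first by move=> m xi; exact: continuous_const.
  move=> K; have [B HB] := ha K; exists 0%N, (Rabs B); split; first exact: Rabs_pos.
  move=> m k xi /=; rewrite Rmult_1_r /Rp Rpower_O ?Rmult_1_r; last by have := wt_ge1 xi; lra.
  apply: Rle_trans (HB m) _; apply: Rmult_le_compat_r; [left; exact: winv_pos | exact: Rle_abs].
have hg : BS 0 (fun (k : Zn) (_ : 'I_n -> R) => cf k b).
  split; first by move=> m xi; exact: continuous_const.
  move=> K; have [B HB] := hb K; exists (Rabs B); split; first exact: Rabs_pos.
  move=> m xi; rewrite /Rp Rpower_O ?Rmult_1_r; last by have := wt_ge1 xi; lra.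
  apply: Rle_trans (HB m) _; apply: Rmult_le_compat_r; [left; exact: winv_pos | exact: Rle_abs].
have := conv_BS (fun k m => proj1 (phP HT k m)) hF hg; rewrite Rplus_0_r => H.
apply: (rapid_Ainf HT); have := BS_rapid (fun=> 0) H.
congr rapid; apply: functional_extensionality => m.
by rewrite /coef cf_mul.
Qed.

End Torus.

(** * Taylor expansion with remainder *)

Section MultiIndex.
Variable n : nat.
Implicit Types (l : 'I_n -> nat) (x : 'I_n -> R).

Definition inc (j : 'I_n) l : 'I_n -> nat := fun i => if i == j then (l i).+1 else l i.
Definition mp x l : R := \big[Rmult/1]_(i < n) x i ^ l i.

Lemma mi_size_inc j l : mi_size (inc j l) = (mi_size l).+1.
Proof.
rewrite /mi_size (bigD1 j) //= [in RHS](bigD1 j) //= /inc eqxx addSn; congr (_ + _).+1%N.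
by apply: eq_bigr => i /negbTE ->.
Qed.

Lemma mi_fact_inc j l : mi_fact (inc j l) = ((l j).+1 * mi_fact l)%N.
Proof.
rewrite /mi_fact (bigD1 j) //= [in RHS](bigD1 j) //= /inc eqxx factS -mulnA; congr (_ * (_ * _))%N.
by apply: eq_bigr => i /negbTE ->.
Qed.

Lemma mp_inc j l x : mp x (inc j l) = x j * mp x l.
Proof.
rewrite /mp (bigD1 j) //= [in RHS](bigD1 j) //= /inc eqxx /= Rmult_assoc; congr (_ * (_ * _)).
by apply: eq_bigr => i /negbTE ->.
Qed.

Lemma mi_fact_pos l : 0 < INR (mi_fact l).
Proof.
apply: lt_0_INR; apply/ltP; rewrite /mi_fact.
by apply: (big_ind (fun k => 0 < k)%N) => // [a b|i _]; [rewrite muln_gt0 => -> -> | exact: fact_gt0].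
Qed.

Lemma kdirs_inc j l : perm_eq (kdirs (inc j l)) (kdirs l ++ [:: j]).
Proof.
apply/allP => i _ /=; rewrite count_cat !count_kdirs /inc /= addn0.
by case: (eqVneq i j) => [->|_]; rewrite ?addn1 ?addn0.
Qed.

(** The multi-indices with [l j > 0] are the successors under [inc j]. The bounded type ['I_D.+1] is
    modelled on the one of [partial_sum], and [L <= D] keeps successors inside it. *)
Lemma reindex_inc (V : AbelianGroup) D L (G : ('I_n -> nat) -> V) j : (L <= D)%N ->
  \big[plus/zero]_(l : {ffun 'I_n -> 'I_D.+1} | (mi_size (fun i => l i : nat) < L.+1)%N && (0 < l j)%N) G (fun i => l i : nat) =
  \big[plus/zero]_(l : {ffun 'I_n -> 'I_D.+1} | (mi_size (fun i => l i : nat) < L)%N) G (inc j (fun i => l i : nat)).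
Proof.
move=> hLD.
pose up (l : {ffun 'I_n -> 'I_D.+1}) : {ffun 'I_n -> 'I_D.+1} := [ffun i => if i == j then inord (l i).+1 else l i].
pose dn (l : {ffun 'I_n -> 'I_D.+1}) : {ffun 'I_n -> 'I_D.+1} := [ffun i => if i == j then inord (l i).-1 else l i].
have le_size (l : {ffun 'I_n -> 'I_D.+1}) i : (l i <= mi_size (fun i => l i : nat))%N.
  by rewrite /mi_size (bigD1 i) //= leq_addr.
have upE (l : {ffun 'I_n -> 'I_D.+1}) : (l j < D)%N -> (fun i => up l i : nat) = inc j (fun i => l i : nat).
  move=> h; apply: functional_extensionality => i; rewrite /up /inc ffunE.
  by case: eqP => [->|//]; rewrite inordK.
rewrite (reindex_onto up dn) /=; last first.
  move=> l /andP [_ hl]; apply/ffunP => i; rewrite /up /dn !ffunE; case: eqP => [->|//].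
  rewrite inordK; last exact: leq_ltn_trans (leq_pred _) (ltn_ord _).
  by rewrite prednK // inord_val.
have cond (l : {ffun 'I_n -> 'I_D.+1}) : (mi_size (fun i => up l i : nat) < L.+1)%N && (0 < up l j)%N && (dn (up l) == l) = (mi_size (fun i => l i : nat) < L)%N.
  case: (ltnP (l j) D) => hlj.
    rewrite upE // mi_size_inc ltnS.
    have -> : (0 < up l j)%N by rewrite /up ffunE eqxx inordK.
    have -> : dn (up l) == l.
      apply/eqP/ffunP => i; rewrite /up /dn !ffunE; case: eqP => [->|//].
      by rewrite inordK //= inord_val.
    by rewrite !andbT.
  (* If the entry is already [D], [inord] falls back to [0]; such an [l] has size at least [D >= L]
     and is excluded on the other side too. *)
  have -> : (0 < up l j)%N = false.
    rewrite /up ffunE eqxx /inord /insubd insubF //; apply/negbTE; rewrite -leqNgt ltnS; exact: hlj.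
  rewrite andbF /=; apply/esym/negbTE; rewrite -leqNgt.
  exact: leq_trans hLD (leq_trans hlj (le_size l j)).
rewrite (eq_bigl _ _ cond); apply: eq_bigr => l hl.
by rewrite upE //; apply: leq_ltn_trans (le_size l j) (leq_trans hl hLD).
Qed.

End MultiIndex.

(** Continuous partial derivatives give differentiability along lines: coordinates are moved one at
    a time, [y s h] having moved those in [s]. *)
Lemma deriv_line d (f : ('I_d -> R) -> CV) (g : 'I_d -> ('I_d -> R) -> CV) (k x : 'I_d -> R) :
  (forall j, pder j f (g j)) -> (forall j y, continuous (g j) y) ->
  derC (fun t => f (fun i => x i + t * k i)) 0 (\big[@plus CV/zero]_(j < d) Cmult (RtoC (k j)) (g j x)).
Proof.
move=> Hd Hc.
pose y (s : seq 'I_d) (h : R) : 'I_d -> R := fun i => x i + (if i \in s then h * k i else 0).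
have y0 s : y s 0 = x.
  by apply: functional_extensionality => i; rewrite /y; case: ifP => _; ring.
have ylim s : filterlim (y s) (locally' 0) (locally x).
  apply: (lim_vec (g := y s)) => i; rewrite /y.
  rewrite -[X in locally X](_ : x i + (if i \in s then 0 * k i else 0) = x i); last by case: ifP => _; ring.
  apply: lim_Rplus; first exact: filterlim_const.
  case: ifP => _; last exact: filterlim_const.
  apply: lim_Rmult; last exact: filterlim_const.
  by move=> P [e He]; exists e => z hz _; apply: He.
have key s : uniq s -> tends (V := CV) (locally' 0) (fun h => scal (/ h) (minus (f (y s h)) (f x)))
    (\big[@plus CV/zero]_(j <- s) Cmult (RtoC (k j)) (g j x)).
  elim: s => [_|j s IH /= /andP [hj us]].
    rewrite big_nil => e he; apply: filter_forall => h.
    have -> : y [::] h = x by apply: functional_extensionality => i; rewrite /y in_nil; ring.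
    by rewrite /minus plus_opp_r scal_zero_r dist0r norm_zero.
  rewrite big_cons.
  have yc h : y (j :: s) h = shift (y s h) j (h * k j).
    apply: functional_extensionality => i; rewrite /y /shift in_cons.
    by case: eqP => [->|_] /=; rewrite ?(negbTE hj); ring.
  have split_ h : scal (/ h) (minus (f (y (j :: s) h)) (f x)) =
     plus (scal (/ h) (minus (f (shift (y s h) j (h * k j))) (f (y s h)))) (scal (/ h) (minus (f (y s h)) (f x))).
    by rewrite yc -scal_distr_l -minus_trans.
  apply: (tends_ext (f := fun h => plus (scal (/ h) (minus (f (shift (y s h) j (h * k j))) (f (y s h)))) (scal (/ h) (minus (f (y s h)) (f x))))).
    by move=> h; rewrite split_.
  apply/tendsP; apply: lim_plus; last by apply/tendsP; exact: IH.
  apply/tendsP => e he.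
  case: (Req_dec (k j) 0) => hk0.
    apply: filter_forall => h; rewrite hk0 Rmult_0_r shift0 /minus plus_opp_r scal_zero_r.
    by rewrite Cmult_0_l distC dist0r norm_zero.
  have hkp := Rabs_pos_lt _ hk0.
  pose e1 := e / (4 * Rabs (k j)).
  have he1 : 0 < e1 by apply: Rdiv_lt_0_compat; lra.
  have /contP /(_ _ he1) [r Hr] := Hc j x.
  have hr := cond_pos r.
  have Hy : locally' 0 (fun h => forall i, Rabs (y s h i - x i) < r / 2).
    have hr2 : 0 < r / 2 by lra.
    have : locally x (fun z : 'I_d -> R => forall i, Rabs (z i - x i) < r / 2) by exists (mkposreal _ hr2) => z hz i; exact: hz.
    exact: ylim.
  have Hh : locally' 0 (fun h : R => Rabs h * Rabs (k j) < r / 2 /\ h <> 0).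
    have hq : 0 < r / (2 * Rabs (k j)) by apply: Rdiv_lt_0_compat; lra.
    exists (mkposreal _ hq) => h; rewrite /ball /= /AbsRing_ball /= /abs /minus /plus /opp /=.
    rewrite Ropp_0 Rplus_0_r => h1 h2; split=> //.
    have := Rmult_lt_compat_r _ _ _ hkp h1.
    by have -> : r / (2 * Rabs (k j)) * Rabs (k j) = r / 2 by field; lra.
  apply: filter_imp (filter_and _ _ Hy Hh) => h [hy [hh1 hh2]].
  have hne : h * k j <> 0 by apply: Rmult_integral_contrapositive_currified.
  pose c : C := g j x.
  (* The linear function [z j * c] is subtracted, so that the remaining derivative [g j z - c] is
     small near [x]. *)
  have := @dq_bound d (fun z => Cminus (f z) (Cmult (RtoC (z j)) c)) (fun z => Cminus (g j z) c) (y s h) j (h * k j) e1 _ _ hne.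
  move=> H.
  have {}H : Cmod (Cmult (RtoC (/ (h * k j))) (Cminus (Cminus (f (shift (y s h) j (h * k j))) (Cmult (RtoC (shift (y s h) j (h * k j) j)) c)) (Cminus (f (y s h)) (Cmult (RtoC (y s h j)) c)))) <= 2 * e1.
    apply: H => [z|t ht].
      have h1 := Hd j z.
      have hs : derC (fun t => RtoC (shift z j t j)) 0 (RtoC 1).
        apply/derC_pair; split=> /=; last exact: (@is_derive_const R_AbsRing R_NormedModule).
        apply: (is_derive_ext (fun t => z j + t)); first by move=> t; rewrite /shift eqxx.
        by auto_derive => //; ring.
      have h2 := derC_mult hs (@is_derive_const R_AbsRing CV c 0).
      have e2 : Cplus (Cmult (RtoC 1) c) (Cmult (RtoC (shift z j 0 j)) (zero : CV)) = c.
        by rewrite -[zero]/(RtoC 0); ring.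
      rewrite e2 in h2.
      exact: (@is_derive_minus R_AbsRing CV _ _ _ _ _ h1 h2).
    rewrite -distC_mod; left; apply: Hr => i.
    rewrite /ball /= /AbsRing_ball /= /abs /minus /plus /opp /= /shift.
    have hyi := hy i; rewrite Rabs_mult in ht.
    case: (i == j); last by move: hyi; rewrite /Rminus; lra.
    have -> : y s h i + t + - x i = (y s h i - x i) + t by ring.
    by apply: Rle_lt_trans (Rabs_triang _ _) _; lra.
  have E : Cminus (scal (/ h) (minus (f (shift (y s h) j (h * k j))) (f (y s h))) : CV) (Cmult (RtoC (k j)) c) =
     Cmult (RtoC (k j)) (Cmult (RtoC (/ (h * k j))) (Cminus (Cminus (f (shift (y s h) j (h * k j))) (Cmult (RtoC (shift (y s h) j (h * k j) j)) c)) (Cminus (f (y s h)) (Cmult (RtoC (y s h j)) c)))).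
    rewrite scalC minusC.
    have -> : shift (y s h) j (h * k j) j = y s h j + h * k j by rewrite /shift eqxx.
    rewrite !RtoC_inv // RtoC_plus !RtoC_mult.
    have c1 : RtoC h <> RtoC 0 by move=> /RtoC_inj.
    have c2 : RtoC (k j) <> RtoC 0 by move=> /RtoC_inj.
    by field; split.
  rewrite distC_mod E Cmod_mult Cmod_R.
  have := Rmult_le_compat_l _ _ _ (Rlt_le _ _ hkp) H.
  have -> : Rabs (k j) * (2 * e1) = e / 2 by rewrite /e1; field; lra.
  lra.
have := key (index_enum 'I_d) (index_enum_uniq _).
move=> H; apply/is_deriveP; apply: tends_ext H => h; rewrite Rplus_0_l; congr (scal _ (minus (f _) (f _))).
  by apply: functional_extensionality => i; rewrite /y mem_index_enum.
by apply: functional_extensionality => i; ring.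
Qed.

Lemma CS_foldr n M (f : fam (Zn n) n) js : CS M f -> CS (M - INR (size js)) (foldr (@pd _ n) f js).
Proof.
move=> Hf; elim: js => [|j js IH]; first by rewrite /= Rminus_0_r.
have E : INR (size (j :: js)) = INR (size js) + 1 by rewrite -S_INR.
rewrite E; have -> : M - (INR (size js) + 1) = M - INR (size js) - 1 by ring.
by case: (CSg_pd j IH).
Qed.

Lemma CS_comm n M (f : fam (Zn n) n) i j : CS M f -> pd i (pd j f) = pd j (pd i f).
Proof.
move=> Hf.
have [di hi] := CSg_pd i Hf; have [dj hj] := CSg_pd j Hf.
have [dij hij] := CSg_pd i hj; have [dji hji] := CSg_pd j hi.
apply: functional_extensionality => m; apply: functional_extensionality => xi.
exact (@schwarzC n (f m) (pd i f m) (pd j f m) (pd i (pd j f) m) (pd j (pd i f) m) i j xi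
  (di m) (dj m) (dij m) (dji m) (proj1 (CSg_bd hij) m) (proj1 (CSg_bd hji) m)).
Qed.

Lemma CS_foldr_comm n M (f : fam (Zn n) n) js i j : CS M f ->
  pd i (pd j (foldr (@pd _ n) f js)) = pd j (pd i (foldr (@pd _ n) f js)).
Proof. by move=> Hf; apply: CS_comm (CS_foldr js Hf). Qed.

Lemma CS_mi n M (f : fam (Zn n) n) l : CS M f -> CS (M - INR (mi_size l)) (mi_iter (@pd _ n) l f).
Proof. by move=> Hf; rewrite mi_iter_foldr -/(kdirs l) -size_kdirs; apply: CS_foldr. Qed.

Lemma mi_iter_inc n M (f : fam (Zn n) n) j l : CS M f ->
  mi_iter (@pd _ n) (inc j l) f = mi_iter (@pd _ n) l (pd j f).
Proof.
move=> Hf; rewrite !mi_iter_foldr -!/(kdirs _).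
rewrite (foldr_perm (fun js i k => CS_foldr_comm js i k Hf) (kdirs_inc j l)).
by rewrite foldr_cat.
Qed.

Lemma pd_mi n M (f : fam (Zn n) n) j l : CS M f ->
  pd j (mi_iter (@pd _ n) l f) = mi_iter (@pd _ n) l (pd j f).
Proof.
move=> Hf; rewrite -(mi_iter_inc j l Hf) !mi_iter_foldr -!/(kdirs _).
have hp : perm_eq (j :: kdirs l) (kdirs (inc j l)).
  by rewrite perm_sym (perm_trans (kdirs_inc j l)) // cats1 perm_rcons.
exact: (foldr_perm (fun js i k => CS_foldr_comm js i k Hf) hp).
Qed.

Lemma derC_big (I : Type) (s : seq I) (P : pred I) (f : I -> R -> C) (f' : I -> C) t :
  (forall i, derC (f i) t (f' i)) ->
  derC (fun t => \big[@plus CV/zero]_(i <- s | P i) f i t) t (\big[@plus CV/zero]_(i <- s | P i) f' i).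
Proof.
move=> H; elim: s => [|i s IH].
  rewrite big_nil; apply: (is_derive_ext (fun=> zero : CV)); first by move=> u; rewrite big_nil.
  exact: (@is_derive_const R_AbsRing CV).
rewrite big_cons; case hP: (P i).
  apply: (is_derive_ext (fun u => plus (f i u : CV) (\big[@plus CV/zero]_(i <- s | P i) f i u))).
    by move=> u; rewrite big_cons hP.
  exact: (@is_derive_plus R_AbsRing CV _ _ _ _ _ (H i) IH).
by apply: is_derive_ext IH => u; rewrite big_cons hP.
Qed.

Lemma Cmult_big_l (I : Type) (s : seq I) (P : pred I) (f : I -> C) (c : C) :
  Cmult c (\big[@plus CV/zero]_(i <- s | P i) f i) = \big[@plus CV/zero]_(i <- s | P i) Cmult c (f i).
Proof.
apply: (big_ind2 (fun x y : C => Cmult c x = y)) => //; first exact: Cmult_0_r.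
by move=> x x' y y' <- <-; exact: Cmult_plus_distr_l.
Qed.

Lemma Cmult_big_r (I : Type) (s : seq I) (P : pred I) (f : I -> R) (c : C) :
  Cmult (RtoC (\big[Rplus/0]_(i <- s | P i) f i)) c = \big[@plus CV/zero]_(i <- s | P i) Cmult (RtoC (f i)) c.
Proof.
apply: (big_ind2 (fun (x : R) (y : C) => Cmult (RtoC x) c = y)) => //; first exact: Cmult_0_l.
by move=> x x' y y' <- <-; rewrite RtoC_plus; exact: Cmult_plus_distr_r.
Qed.

Lemma INR_mi_size n (l : 'I_n -> nat) : INR (mi_size l) = \big[Rplus/0]_(j < n) INR (l j).
Proof. by rewrite /mi_size; apply: (big_morph INR) => // x y; rewrite plus_INR. Qed.

Lemma norm_big (I : Type) (s : seq I) (f : I -> C) :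
  Cmod (\big[@plus CV/zero]_(i <- s) f i) <= \big[Rplus/0]_(i <- s) Cmod (f i).
Proof.
elim: s => [|i s IH]; first by rewrite !big_nil -[zero]/(RtoC 0) Cmod_0; lra.
rewrite !big_cons; apply: Rle_trans (Cmod_triangle _ _) _; exact: Rplus_le_compat_l.
Qed.

Lemma big_supp (V : AbelianGroup) (I : finType) (P a : pred I) (F : I -> V) :
  (forall i, P i -> ~~ a i -> F i = zero) ->
  \big[plus/zero]_(i | P i) F i = \big[plus/zero]_(i | P i && a i) F i.
Proof.
move=> H; rewrite (bigID a) /= [X in plus _ X]big1 ?plus_zero_r // => i /andP [h1 h2].
exact: H.
Qed.

Lemma minus_big (V : AbelianGroup) (I : Type) (s : seq I) (P : pred I) (F G : I -> V) :
  minus (\big[plus/zero]_(i <- s | P i) F i) (\big[plus/zero]_(i <- s | P i) G i) =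
  \big[plus/zero]_(i <- s | P i) minus (F i) (G i).
Proof.
rewrite big_split; congr plus.
by apply: (big_morph (@opp V)); [exact: opp_plus | exact: opp_zero].
Qed.

Lemma big_only (V : AbelianGroup) (I : finType) (P : pred I) (F : I -> V) i0 :
  P i0 -> (forall i, P i -> i != i0 -> F i = zero) -> \big[plus/zero]_(i | P i) F i = F i0.
Proof.
move=> h0 H; rewrite (bigD1 i0) //= big1 ?plus_zero_r // => i /andP [h1 h2].
exact: H.
Qed.

Section Taylor.
Variables (n D : nat).
Implicit Types (f : fam (Zn n) n) (m k : Zn n) (xi : 'I_n -> R) (t : R).

Local Notation mi := (mi_iter (@pd (Zn n) n)).

(** Taylor polynomial of [t |-> f m (xi + t k)]. The entry bound [D] is separate from [L], so that
    the recursion on [L] keeps a fixed index type. *)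
Definition taylor_sum L f m k xi t : CV :=
  \big[@plus CV/zero]_(l : {ffun 'I_n -> 'I_D.+1} | (mi_size (fun i => l i : nat) < L)%N)
    Cmult (RtoC (t ^ mi_size (fun i => l i : nat) * (mp (toR k) (fun i => l i : nat) / INR (mi_fact (fun i => l i : nat)))))
          (mi (fun i => l i : nat) f m xi).

(** Since [|l|] is the sum of the [l j], the derivative splits by direction; the part of direction
    [j] runs over [l = inc j l'], where [l j / l! = 1 / l'!]. *)
Lemma taylor_sum_deriv M L f m k xi t : CS M f -> (L <= D)%N ->
  derC (fun t => taylor_sum L.+1 f m k xi t) t
    (\big[@plus CV/zero]_(j < n) Cmult (RtoC (toR k j)) (taylor_sum L (pd j f) m k xi t)).
Proof.
move=> Hf hL.
pose T (l : 'I_n -> nat) : CV := Cmult (RtoC (t ^ (mi_size l).-1 * (mp (toR k) l / INR (mi_fact l)))) (mi l f m xi).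
have H : derC (fun t => taylor_sum L.+1 f m k xi t) t (\big[@plus CV/zero]_(l : {ffun 'I_n -> 'I_D.+1} | (mi_size (fun i => l i : nat) < L.+1)%N)
    Cmult (RtoC (INR (mi_size (fun i => l i : nat)))) (T (fun i => l i : nat))).
  rewrite /taylor_sum; apply: derC_big => l; rewrite /T; set s := mi_size _; set c := _ / _; set z := mi _ f m xi.
  have h1 : derC (fun t => RtoC (t ^ s * c)) t (RtoC (INR s * t ^ s.-1 * c)).
    apply/derC_pair; split=> /=; last exact: (@is_derive_const R_AbsRing R_NormedModule).
    by auto_derive => //; ring.
  have := derC_mult h1 (@is_derive_const R_AbsRing CV z t).
  have -> : Cplus (Cmult (RtoC (INR s * t ^ s.-1 * c)) z) (Cmult (RtoC (t ^ s * c)) (zero : CV)) = Cmult (RtoC (INR s)) (Cmult (RtoC (t ^ s.-1 * c)) z).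
    by rewrite -[zero]/(RtoC 0) !RtoC_mult; ring.
  by [].
have -> : \big[@plus CV/zero]_(j < n) Cmult (RtoC (toR k j)) (taylor_sum L (pd j f) m k xi t) =
  \big[@plus CV/zero]_(l : {ffun 'I_n -> 'I_D.+1} | (mi_size (fun i => l i : nat) < L.+1)%N)
    Cmult (RtoC (INR (mi_size (fun i => l i : nat)))) (T (fun i => l i : nat)); last exact: H.
symmetry.
rewrite (eq_bigr (fun l : {ffun 'I_n -> 'I_D.+1} => \big[@plus CV/zero]_(j < n) Cmult (RtoC (INR (l j))) (T (fun i => l i : nat)))); last first.
  by move=> l _; rewrite INR_mi_size Cmult_big_r.
rewrite exchange_big /=; apply: eq_bigr => j _.
refine (eq_trans (@big_supp CV {ffun 'I_n -> 'I_D.+1} _ (fun l => (0 < l j)%N) _ _) _).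
  by move=> l _; rewrite lt0n negbK => /eqP -> /=; exact: Cmult_0_l.
refine (eq_trans (@reindex_inc n CV D L (fun l => Cmult (RtoC (INR (l j))) (T l)) j hL) _).
rewrite /taylor_sum Cmult_big_l.
apply: eq_bigr => l _; set l' := fun i => _.
rewrite /T mi_size_inc mi_fact_inc mp_inc (mi_iter_inc j l' Hf) /= {1}/inc eqxx.
rewrite !Cmult_assoc -!RtoC_mult; congr (Cmult (RtoC _) _).
have hf := mi_fact_pos l'.
have hj : 0 < INR (l' j).+1 by apply: lt_0_INR; lia.
rewrite mult_INR; field; split; lra.
Qed.

Definition taylor_rem L f m k xi t : C := Cminus (f m (fun i => xi i + t * toR k i)) (taylor_sum L f m k xi t).

Lemma line_deriv M f m k xi t : CS M f ->
  derC (fun t => f m (fun i => xi i + t * toR k i)) t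
    (\big[@plus CV/zero]_(j < n) Cmult (RtoC (toR k j)) (pd j f m (fun i => xi i + t * toR k i))).
Proof.
move=> Hf.
have := @deriv_line n (f m) (fun j => pd j f m) (toR k) (fun i => xi i + t * toR k i)
  (fun j => proj1 (CSg_pd j Hf) m) (fun j => proj1 (CSg_bd (proj2 (CSg_pd j Hf))) m).
move=> /is_deriveP H; apply/is_deriveP; apply: tends_ext H => h.
have -> : (fun i => xi i + t * toR k i + (0 + h) * toR k i) = (fun i => xi i + (t + h) * toR k i).
  by apply: functional_extensionality => i; ring.
by have -> : (fun i => xi i + t * toR k i + 0 * toR k i) = (fun i => xi i + t * toR k i)
  by apply: functional_extensionality => i; ring.
Qed.

Lemma taylor_rem_deriv M L f m k xi t : CS M f -> (L <= D)%N ->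
  derC (fun t => taylor_rem L.+1 f m k xi t) t
    (\big[@plus CV/zero]_(j < n) Cmult (RtoC (toR k j)) (taylor_rem L (pd j f) m k xi t)).
Proof.
move=> Hf hL.
have := @is_derive_minus R_AbsRing CV _ _ _ _ _ (line_deriv m k xi t Hf) (taylor_sum_deriv m k xi t Hf hL).
have -> : minus (\big[@plus CV/zero]_(j < n) Cmult (RtoC (toR k j)) (pd j f m (fun i => xi i + t * toR k i)))
    (\big[@plus CV/zero]_(j < n) Cmult (RtoC (toR k j)) (taylor_sum L (pd j f) m k xi t)) =
    \big[@plus CV/zero]_(j < n) Cmult (RtoC (toR k j)) (taylor_rem L (pd j f) m k xi t).
  rewrite minus_big; apply: eq_bigr => j _; rewrite /taylor_rem.
  have H (a b c : C) : Cminus (Cmult a b) (Cmult a c) = Cmult a (Cminus b c) by ring.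
  exact: H.
by [].
Qed.

Lemma taylor_sum0 f m k xi L : taylor_sum L.+1 f m k xi 0 = f m xi.
Proof.
rewrite /taylor_sum.
pose l0 : {ffun 'I_n -> 'I_D.+1} := [ffun => ord0].
have e0 : (fun i => l0 i : nat) = (fun=> 0%N) by apply: functional_extensionality => i; rewrite ffunE.
have s0 : mi_size (fun _ : 'I_n => 0%N) = 0%N by rewrite /mi_size big1.
refine (eq_trans (@big_only CV _ _ _ l0 _ _) _).
- by rewrite /= e0 s0.
- move=> l _ hl.
  have hs : mi_size (fun i => l i : nat) <> 0%N.
    move=> hs; move/negP: hl; apply; apply/eqP/ffunP => i; apply: val_inj; rewrite ffunE /=.
    apply/eqP; rewrite -leqn0 -hs /mi_size (bigD1 i) //=; exact: leq_addr.
  case E: (mi_size _) hs => [//|s] _.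
  by rewrite /= !Rmult_0_l; exact: Cmult_0_l.
- rewrite e0 s0 /mi_fact big1 // /mp big1 //= Rmult_1_l Rdiv_1_r Cmult_1_l.
  by rewrite mi_iter_foldr; have -> : flatten [seq nseq 0 j | j <- enum 'I_n] = [::] by elim: (enum 'I_n).
Qed.

Lemma mvt01 (h h' : R -> C) t B : 0 <= t <= 1 -> (forall s, derC h s (h' s)) ->
  (forall s, 0 <= s <= 1 -> Cmod (h' s) <= B) -> Cmod (Cminus (h t) (h 0)) <= 2 * B.
Proof.
move=> ht Hd Hb.
have hB : 0 <= B by apply: Rle_trans (Cmod_ge_0 _) (Hb 0 _); lra.
have h1 : Rabs ((h t).1 - (h 0).1) <= B * t.
  have [c [hc ->]] := MVT_gen (fun s => (h s).1) 0 t (fun s => (h' s).1)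
    (fun s _ => proj1 (proj1 (derC_pair _ _ _) (Hd s)))
    (fun s _ => derivable_continuous_pt _ _ (ex_derive_Reals_0 _ _ (ex_intro _ _ (proj1 (proj1 (derC_pair _ _ _) (Hd s)))))).
  rewrite Rminus_0_r Rabs_mult (Rabs_pos_eq t); last lra.
  apply: Rmult_le_compat_r; first lra.
  apply: Rle_trans (re_le_Cmod _) (Hb c _).
  move: hc; rewrite Rmin_left ?Rmax_right; lra.
have h2 : Rabs ((h t).2 - (h 0).2) <= B * t.
  have [c [hc ->]] := MVT_gen (fun s => (h s).2) 0 t (fun s => (h' s).2)
    (fun s _ => proj2 (proj1 (derC_pair _ _ _) (Hd s)))
    (fun s _ => derivable_continuous_pt _ _ (ex_derive_Reals_0 _ _ (ex_intro _ _ (proj2 (proj1 (derC_pair _ _ _) (Hd s)))))).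
  rewrite Rminus_0_r Rabs_mult (Rabs_pos_eq t); last lra.
  apply: Rmult_le_compat_r; first lra.
  apply: Rle_trans (Rabs_snd_le _) (Hb c _).
  move: hc; rewrite Rmin_left ?Rmax_right; lra.
apply: Rle_trans (Cmod_le_sum _) _ => /=; rewrite /Rminus in h1 h2; nra.
Qed.

(** Induction on [L]: the remainder vanishes at [t = 0], and its derivative is a combination with
    weights [k_j] of remainders of the [pd j f], which have order [M - 1]. The mean value inequality
    takes the place of an integral form of the remainder. For [L = 0] this is Peetre's
    inequality. *)
Lemma taylor_rem_bound L : (L <= D.+1)%N -> forall M f, CS M f -> forall K : nat, exists p B, 0 <= B /\
  forall m k xi t, 0 <= t <= 1 ->
    Cmod (taylor_rem L f m k xi t) <= B * / wt (toR m) ^ K * wt (toR k) ^ p * Rp (M - INR L) xi.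
Proof.
elim: L => [|L IH] hL M f Hf K.
  have [p hp] := @peetre n M; have [B [b0 hb]] := proj2 (CSg_bd Hf) K.
  exists p, B; split=> // m k xi t ht.
  rewrite /taylor_rem /taylor_sum big_pred0 // /Cminus -[zero]/(RtoC 0).
  have -> : Cplus (f m (fun i => xi i + t * toR k i)) (Copp (RtoC 0)) = f m (fun i => xi i + t * toR k i) by ring.
  apply: Rle_trans (hb m _) _.
  rewrite /= Rminus_0_r (Rmult_assoc _ (wt (toR k) ^ p)); apply: Rmult_le_compat_l.
    by apply: Rmult_le_pos => //; left; exact: winv_pos.
  apply: Rle_trans (hp xi (fun i => t * toR k i)) _.
  apply: Rmult_le_compat_r; first by left; exact: Rp_pos.
  apply: pow_incr; split; first by have := wt_ge1 (fun i => t * toR k i); lra.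
  by apply: wtZ; rewrite Rabs_pos_eq; lra.
have hj j : exists p B, 0 <= B /\ forall m k xi t, 0 <= t <= 1 ->
    Cmod (taylor_rem L (pd j f) m k xi t) <= B * / wt (toR m) ^ K * wt (toR k) ^ p * Rp (M - INR L.+1) xi.
  have -> : M - INR L.+1 = (M - 1) - INR L by rewrite S_INR; ring.
  by apply: IH (ltnW hL) _ _ (proj2 (CSg_pd j Hf)) K.
have [p hpp] : exists p : 'I_n -> nat, forall j, exists B, 0 <= B /\ forall m k xi t, 0 <= t <= 1 ->
    Cmod (taylor_rem L (pd j f) m k xi t) <= B * / wt (toR m) ^ K * wt (toR k) ^ p j * Rp (M - INR L.+1) xi.
  exists (fun j => proj1_sig (constructive_indefinite_description _ (hj j))) => j.
  exact: (proj2_sig (constructive_indefinite_description _ (hj j))).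
have [B hB] : exists B : 'I_n -> R, forall j, 0 <= B j /\ forall m k xi t, 0 <= t <= 1 ->
    Cmod (taylor_rem L (pd j f) m k xi t) <= B j * / wt (toR m) ^ K * wt (toR k) ^ p j * Rp (M - INR L.+1) xi.
  exists (fun j => proj1_sig (constructive_indefinite_description _ (hpp j))) => j.
  exact: (proj2_sig (constructive_indefinite_description _ (hpp j))).
(* One exponent for all directions: it dominates every [p j + 1], the extra power coming from the
   factor [k_j]. *)
pose P := (\sum_(j < n) p j).+1%N.
exists P, (2 * sumR B); split.
  by have := sumR_ge0 (fun j => proj1 (hB j)); lra.
move=> m k xi t ht.
have hr := Rp_pos (M - INR L.+1) xi; have hi := winv_pos (toR m) K; have hwP := wt_pos (toR k) P.
have h0 : taylor_rem L.+1 f m k xi 0 = RtoC 0.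
  rewrite /taylor_rem taylor_sum0.
  have -> : (fun i => xi i + 0 * toR k i) = xi by apply: functional_extensionality => i; ring.
  exact: Cplus_opp_r.
have -> : taylor_rem L.+1 f m k xi t = Cminus (taylor_rem L.+1 f m k xi t) (taylor_rem L.+1 f m k xi 0) by rewrite h0; ring.
have -> : 2 * sumR B * / wt (toR m) ^ K * wt (toR k) ^ P * Rp (M - INR L.+1) xi =
   2 * sumR (fun j => / wt (toR m) ^ K * wt (toR k) ^ P * Rp (M - INR L.+1) xi * B j) by rewrite sumR_scal; ring.
apply: (mvt01 ht (fun s => taylor_rem_deriv m k xi s Hf hL)) => s hs.
apply: Rle_trans (norm_big _ _) _; rewrite -/(sumR _); apply: sumR_le => j.
rewrite Cmod_mult Cmod_R.
have h1 := proj2 (hB j) m k xi s hs.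
have h2 := wt_ge_abs (toR k) j.
apply: Rle_trans (_ : wt (toR k) * (B j * / wt (toR m) ^ K * wt (toR k) ^ p j * Rp (M - INR L.+1) xi) <= _).
  apply: Rmult_le_compat => //; [exact: Rabs_pos | exact: Cmod_ge_0 | lra].
have h3 : wt (toR k) ^ (p j).+1 <= wt (toR k) ^ P.
  by apply: wt_pow_mono; rewrite /P ltnS (bigD1 j) //= leq_addr.
have hBj := proj1 (hB j).
have -> : wt (toR k) * (B j * / wt (toR m) ^ K * wt (toR k) ^ p j * Rp (M - INR L.+1) xi) =
  (B j * / wt (toR m) ^ K * Rp (M - INR L.+1) xi) * wt (toR k) ^ (p j).+1 by rewrite /=; ring.
have -> : / wt (toR m) ^ K * wt (toR k) ^ P * Rp (M - INR L.+1) xi * B j =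
  (B j * / wt (toR m) ^ K * Rp (M - INR L.+1) xi) * wt (toR k) ^ P by ring.
apply: Rmult_le_compat_l h3; apply: Rmult_le_pos; [apply: Rmult_le_pos; lra | lra].
Qed.

End Taylor.

(** * The symbol of a product and its expansion *)

Lemma lim_big (V : NormedModule R_AbsRing) (T I : Type) (F : (T -> Prop) -> Prop) {FF : Filter F}
    (s : seq I) (P : pred I) (f : I -> T -> V) (l : I -> V) :
  (forall i, filterlim (f i) F (locally (l i))) ->
  filterlim (fun t => \big[plus/zero]_(i <- s | P i) f i t) F (locally (\big[plus/zero]_(i <- s | P i) l i)).
Proof.
move=> H; elim: s => [|i s IH].
  rewrite big_nil; apply: (filterlim_ext (fun=> zero)); first by move=> t; rewrite big_nil.
  exact: filterlim_const.
rewrite big_cons; case hP: (P i).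
  apply: (filterlim_ext (fun t => plus (f i t) (\big[plus/zero]_(i <- s | P i) f i t))).
    by move=> t; rewrite big_cons hP.
  exact: lim_plus (H i) IH.
by apply: (filterlim_ext (fun t => \big[plus/zero]_(i <- s | P i) f i t)) => // t; rewrite big_cons hP.
Qed.

Lemma Sum_big (V : CompleteNormedModule R_AbsRing) (T I : Type) (s : seq I) (P : pred I) (f : I -> T -> V) :
  (forall i, exists g, dominated (f i) g) ->
  (exists g, dominated (fun x => \big[plus/zero]_(i <- s | P i) f i x) g) /\
  Sum (fun x => \big[plus/zero]_(i <- s | P i) f i x) = \big[plus/zero]_(i <- s | P i) Sum (f i).
Proof.
move=> H; elim: s => [|i s [[g hg] IH]].
  rewrite big_nil; split; last by rewrite -[RHS](@Sum_zero T V); apply: Sum_ext => x; rewrite big_nil.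
  exists (fun=> 0); split; last by move=> x; rewrite big_nil norm_zero; lra.
  exists 0; split=> [x|u _]; [lra | rewrite /rsum big1 //; lra].
have [g' hg'] := H i.
case hP: (P i); last first.
  have -> : (fun x => \big[plus/zero]_(i <- i :: s | P i) f i x) = (fun x => \big[plus/zero]_(i <- s | P i) f i x).
    by apply: functional_extensionality => x; rewrite big_cons hP.
  by rewrite big_cons hP; split; first exists g.
have -> : (fun x => \big[plus/zero]_(i <- i :: s | P i) f i x) = (fun x => plus (f i x) (\big[plus/zero]_(i <- s | P i) f i x)).
  by apply: functional_extensionality => x; rewrite big_cons hP.
rewrite big_cons hP -IH; split; last exact: Sum_plus hg' hg.
by eexists; exact: dominated_plus hg' hg.
Qed.

Section Rem.
Variables n D : nat.

Lemma pder_translate (f g : ('I_n -> R) -> C) j c xi :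
  (forall y, derC (fun t => f (shift y j t)) 0 (g y)) ->
  derC (fun t => f (fun i => shift xi j t i + c i)) 0 (g (fun i => xi i + c i)).
Proof.
move=> H; have := H (fun i => xi i + c i); apply: is_derive_ext => t; congr f.
by apply: functional_extensionality => i; rewrite /shift; case: (i == j); ring.
Qed.

(** For [L = 0] there is no Taylor polynomial, and this is the family of translates
    [f m (xi + k)]. *)
Definition remainder_fam L (f : fam (Zn n) n) : fam (Zn n * Zn n) n := fun p xi => taylor_rem D L f p.1 p.2 xi 1.

(** Differentiation in [xi] commutes with forming the Taylor remainder; the symbol estimates
    therefore pass to all derivatives. *)
Lemma remainder_fam_pdf M L f j : CS M f -> pdf j (remainder_fam L f) (remainder_fam L (pd j f)).
Proof.
move=> Hf [m k] xi; rewrite /remainder_fam /taylor_rem /=.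
have [dj _] := CSg_pd j Hf.
have h1 := @pder_translate (f m) (pd j f m) j (fun i => 1 * toR k i) xi (dj m).
have h2 : derC (fun t => taylor_sum D L f m k (shift xi j t) 1) 0 (taylor_sum D L (pd j f) m k xi 1).
  rewrite /taylor_sum; apply: derC_big => l; apply: derC_scal.
  pose l' (i : 'I_n) : nat := l i; rewrite -(pd_mi j l' Hf); exact: (proj1 (CSg_pd j (CS_mi l' Hf))).
exact: (@is_derive_minus R_AbsRing CV _ _ _ _ _ h1 h2).
Qed.

Lemma remainder_fam_BK M L f : (L <= D.+1)%N -> CS M f -> BK (M - INR L) (remainder_fam L f).
Proof.
move=> hL Hf; split.
  move=> [m k] xi; rewrite /remainder_fam /taylor_rem /=; apply: (@continuous_minus _ _ CV).
    apply: (@continuous_comp _ _ _ (fun x i => x i + 1 * toR k i) (f m)); last exact: (proj1 (CSg_bd Hf)).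
    by apply: lim_vec => i; apply: lim_Rplus; [exact: lim_proj | exact: filterlim_const].
  rewrite /taylor_sum; apply: (@lim_big CV) => l; apply: lim_Cmult; first exact: filterlim_const.
  by apply: (proj1 (CSg_bd (CS_mi _ Hf))).
move=> K; have [p [B [hB H]]] := taylor_rem_bound hL Hf K; exists p, B; split=> // m k xi.
by apply: H; lra.
Qed.

Lemma remainder_fam_CK M L f : (L <= D.+1)%N -> CS M f -> CK (M - INR L) (remainder_fam L f).
Proof.
move=> hL Hf N; elim: N M f Hf => [|N IH] M f Hf /=; first exact: remainder_fam_BK.
split; first exact: remainder_fam_BK.
move=> j; exists (remainder_fam L (pd j f)); split; first exact: remainder_fam_pdf Hf.
have -> : M - INR L - 1 = M - 1 - INR L by ring.
by apply: IH; case: (CSg_pd j Hf).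
Qed.

Lemma remainder_fam0 f m k xi : remainder_fam 0 f (m, k) xi = f m (fun i => xi i + toR k i).
Proof.
rewrite /remainder_fam /taylor_rem /taylor_sum big_pred0 //= -[zero]/(RtoC 0).
have -> : (fun i => xi i + 1 * toR k i) = (fun i => xi i + toR k i).
  by apply: functional_extensionality => i; ring.
by ring.
Qed.

End Rem.

Lemma const_BK n M (f : fam (Zn n) n) (c : Zn n -> R) p : BS M f ->
  (forall k, Rabs (c k) <= wt (toR k) ^ p) -> BK M (fun q xi => Cmult (RtoC (c q.2)) (f q.1 xi)).
Proof.
move=> [h1 h2] hc; split.
  by move=> [m k] xi; apply: lim_Cmult; [exact: filterlim_const | exact: h1].
move=> K; have [B [hB H]] := h2 K; exists p, B; split=> // m k xi /=.
rewrite Cmod_mult Cmod_R Rmult_comm.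
have -> : B * / wt (toR m) ^ K * wt (toR k) ^ p * Rp M xi = (B * / wt (toR m) ^ K * Rp M xi) * wt (toR k) ^ p by ring.
by apply: Rmult_le_compat; [exact: Cmod_ge_0 | exact: Rabs_pos | exact: H | exact: hc].
Qed.

Lemma const_CK n M (f : fam (Zn n) n) (c : Zn n -> R) p : CS M f ->
  (forall k, Rabs (c k) <= wt (toR k) ^ p) -> CK M (fun q xi => Cmult (RtoC (c q.2)) (f q.1 xi)).
Proof.
move=> Hf hc N; elim: N M f Hf => [|N IH] M f Hf; first exact: const_BK (CSg_bd Hf) hc.
split; first exact: const_BK (CSg_bd Hf) hc.
move=> j; have [dj hj] := CSg_pd j Hf; exists (fun q xi => Cmult (RtoC (c q.2)) (pd j f q.1 xi)); split.
  by move=> [m k] xi; apply: derC_scal; exact: dj.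
exact: IH.
Qed.

Lemma scale_CK n M (F : fam (Zn n * Zn n) n) (c : R) : CK M F -> CK M (fun q xi => Cmult (RtoC c) (F q xi)).
Proof.
have HB M' F' : BK M' F' -> BK M' (fun q xi => Cmult (RtoC c) (F' q xi)).
  move=> [h1 h2]; split; first by move=> q xi; apply: lim_Cmult; [exact: filterlim_const | exact: h1].
  move=> K; have [p [B [hB H]]] := h2 K; exists p, (Rabs c * B); split.
    by apply: Rmult_le_pos => //; exact: Rabs_pos.
  move=> m k xi; rewrite Cmod_mult Cmod_R.
  have -> : Rabs c * B * / wt (toR m) ^ K * wt (toR k) ^ p * Rp M' xi =
    Rabs c * (B * / wt (toR m) ^ K * wt (toR k) ^ p * Rp M' xi) by ring.
  by apply: Rmult_le_compat_l; [exact: Rabs_pos | exact: H].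
move=> HF N; elim: N M F HF => [|N IH] M F HF; first exact: HB (CSg_bd HF).
split; first exact: HB (CSg_bd HF).
move=> j; have [dj hj] := CSg_pd j HF; exists (fun q xi => Cmult (RtoC c) (pd j F q xi)); split.
  by move=> q xi; apply: derC_scal; exact: dj.
exact: IH.
Qed.

Lemma mp_kdirs n (x : 'I_n -> R) l : \big[Rmult/1]_(j <- kdirs l) x j = mp x l.
Proof.
rewrite /kdirs big_flatten big_map /mp big_enum /=; apply: eq_bigr => j _.
by rewrite big_nseq; elim: (l j) => [|k IH] //=; rewrite IH.
Qed.

Lemma mp_le n (x : 'I_n -> R) l : Rabs (mp x l) <= wt x ^ mi_size l.
Proof.
rewrite -mp_kdirs -size_kdirs; elim: (kdirs l) => [|j js IH]; first by rewrite big_nil Rabs_R1 /=; lra.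
rewrite big_cons Rabs_mult /=; apply: Rmult_le_compat => //; try exact: Rabs_pos.
by have := wt_ge_abs x j; lra.
Qed.

Section Torus.
Variables (n : nat) (theta : 'I_n -> 'I_n -> R) (A : CstarAlgebra) (U : 'I_n -> A).
Variables (alpha : ('I_n -> R) -> A -> A) (tau : A -> C) (delta : 'I_n -> A -> A).
Hypothesis HT : torus_data theta U alpha tau.
Hypothesis Hdelta : is_basic_derivations U alpha delta.
Variables (M1 M2 : R) (rho phi : ('I_n -> R) -> A).
Hypothesis hrho : symbol alpha tau delta M1 rho.
Hypothesis hphi : symbol alpha tau delta M2 phi.

Local Notation Zn := (Zn n).
Local Notation cf := (cf U tau).
Local Notation sc := (scoef U tau).
Local Notation Ainf := (Ainf alpha).
Local Notation conv := (tconv (ph U tau)).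
Local Notation mi := (mi_iter (@pd Zn n)).
Local Notation synth := (synth U).

(** The coefficients of [\sum_k phi (xi + k) rho_k xi U^k]. *)
Definition product_coef : fam Zn n := conv (remainder_fam 0 0 (sc phi)) (sc rho).
Definition product_term l : ('I_n -> R) -> A := fun xi =>
  scal (/ INR (mi_fact l)) (cmul (deriv alpha l phi xi) (mi_iter delta l (rho xi))).
(** The power [k^l] that [delta^l] produces on the [k]-th coefficient of [rho] is moved to the left
    factor, so that all terms are convolved with the same [sc rho]. *)
Definition term_fam l : fam (Zn * Zn) n := fun q xi =>
  Cmult (RtoC (/ INR (mi_fact l))) (Cmult (RtoC (mp (toR q.2) l)) (mi l (sc phi) q.1 xi)).

Let Hr : CS M1 (sc rho) := symbol_CS HT Hdelta hrho.
Let Hp : CS M2 (sc phi) := symbol_CS HT Hdelta hphi.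
Let ph1 k m := proj1 (phP HT k m).

Lemma translate_CK D : CK M2 (remainder_fam D 0 (sc phi)).
Proof. by have := @remainder_fam_CK n D M2 0 _ (leq0n _) Hp; rewrite /= Rminus_0_r. Qed.

Lemma product_coef_CS : CS (M1 + M2) product_coef.
Proof. by rewrite Rplus_comm; apply: (conv_CS ph1 (translate_CK 0) Hr). Qed.

Lemma term_fam_CK l : CK (M2 - INR (mi_size l)) (term_fam l).
Proof. exact: scale_CK (const_CK (CS_mi l Hp) (fun k => mp_le (toR k) l)). Qed.

Lemma product_term_Ainf l xi : Ainf (product_term l xi).
Proof.
rewrite /product_term -cscalR; apply: (Ainf_cscal HT); apply: (Ainf_cmul HT).
  exact: (proj2 (sc_deriv HT hphi l)).
exact: (proj1 (cf_mi_delta HT Hdelta l (fun=> 0%Z) (symbol_Ainf HT hrho xi))).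
Qed.

Lemma scoef_product_term l : sc (product_term l) = conv (term_fam l) (sc rho).
Proof.
apply: functional_extensionality => m; apply: functional_extensionality => xi.
have Hx := symbol_Ainf HT hrho xi.
rewrite /scoef /product_term -cscalR (cfZ HT) (cf_mul HT); last first.
  exact: (Ainf_rapid HT (proj1 (cf_mi_delta HT Hdelta l (fun=> 0%Z) Hx))).
have hG : CK (M2 - INR (mi_size l)) (fun q xi => Cmult (RtoC (mp (toR q.2) l)) (mi l (sc phi) q.1 xi)).
  exact: const_CK (CS_mi l Hp) (fun k => mp_le (toR k) l).
have [g hg] := conv_dom ph1 m xi (CSg_bd hG) (CSg_bd Hr).
rewrite (Sum_ext (f' := fun k => Cmult (ph U tau (zsub m k) k)
  (Cmult (Cmult (RtoC (mp (toR k) l)) (mi l (sc phi) (zsub m k) xi)) (sc rho k xi)) : CV)); last first.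
  move=> k; rewrite (cf_mi_delta_exact HT Hdelta) // (mp_kdirs (toR k) l).
  have -> : cf (zsub m k) (deriv alpha l phi xi) = mi l (sc phi) (zsub m k) xi.
    by rewrite -(proj1 (sc_deriv HT hphi l)).
  congr (Cmult _ _); rewrite /scoef; set a := mi _ _ _ _; set b := cf k _; set c := RtoC _.
  have H (x y z : C) : Cmult x (Cmult y z) = Cmult (Cmult y x) z by ring.
  exact: H.
refine (eq_trans (esym (Sum_lin (is_linear_Cmult_l _) hg)) _).
rewrite /tconv; refine (@Sum_ext Zn CV _ _ _) => k; rewrite /term_fam /=.
set a := ph _ _ _ _; set b := RtoC (/ _); set c := Cmult _ (mi _ _ _ _); set d := sc rho k xi.
have H (x y z t : C) : Cmult x (Cmult y (Cmult z t)) = Cmult y (Cmult (Cmult x z) t) by ring.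
exact: H.
Qed.

Lemma product_term_symbol l : symbol alpha tau delta (M1 + M2 - INR (mi_size l)) (product_term l).
Proof.
rewrite -(synth_sc HT (product_term_Ainf l)) scoef_product_term; apply: (CS_symbol HT Hdelta).
have -> : M1 + M2 - INR (mi_size l) = (M2 - INR (mi_size l)) + M1 by ring.
exact: (conv_CS ph1 (term_fam_CK l) Hr).
Qed.

Lemma cf_big m (I : Type) (s : seq I) (P : pred I) (f : I -> A) :
  cf m (\big[plus/zero]_(i <- s | P i) f i) = \big[@plus CV/zero]_(i <- s | P i) cf m (f i).
Proof. by apply: (big_morph (cf m)); [exact: (cfD HT) | exact: (cf0 HT)]. Qed.

Lemma partial_sum_Ainf N xi : Ainf (partial_sum product_term N xi).
Proof.
apply: (big_ind Ainf) => [||l _]; last exact: product_term_Ainf.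
  have -> : (zero : A) = cscal (RtoC 0) (rho xi) by rewrite cscal0l.
  by apply: (Ainf_cscal HT); exact: (symbol_Ainf HT hrho).
by move=> x y; exact: (Ainf_plus HT).
Qed.

(** [tconv] is additive in its left factor, and pointwise the translate of [phi] is its Taylor
    polynomial plus the remainder. The same [D] bounds entries and degree, as in [partial_sum] for
    [N = D + 1]. *)
Lemma scoef_remainder D :
  sc (fun xi => minus (synth product_coef xi) (partial_sum product_term D.+1 xi)) = conv (remainder_fam D D.+1 (sc phi)) (sc rho).
Proof.
apply: functional_extensionality => m; apply: functional_extensionality => xi.
rewrite /scoef (cf_minus HT) cf_big.
have -> : cf m (synth product_coef xi) = product_coef m xi by rewrite -[LHS]/(sc _ m xi) (sc_synth HT (CSg_bd product_coef_CS)).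
pose T (l : {ffun 'I_n -> 'I_D.+1}) (k : Zn) : CV := Cmult (ph U tau (zsub m k) k) (Cmult (term_fam (fun i => l i : nat) (zsub m k, k) xi) (sc rho k xi)).
have hT l : exists g, dominated (T l) g := conv_dom ph1 m xi (CSg_bd (term_fam_CK _)) (CSg_bd Hr).
have [g0 hg0] := conv_dom ph1 m xi (CSg_bd (remainder_fam_CK (leqnn D.+1) Hp)) (CSg_bd Hr).
have [[g1 hg1] e1] := Sum_big (index_enum _) (fun l : {ffun 'I_n -> 'I_D.+1} => (mi_size (fun i => l i : nat) < D.+1)%N) hT.
have e2 : \big[@plus CV/zero]_(l : {ffun 'I_n -> 'I_D.+1} | (mi_size (fun i => l i : nat) < D.+1)%N) cf m (product_term (fun i => l i : nat) xi) =
    \big[@plus CV/zero]_(l : {ffun 'I_n -> 'I_D.+1} | (mi_size (fun i => l i : nat) < D.+1)%N) Sum (T l).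
  apply: eq_bigr => l _; pose l' (i : 'I_n) : nat := l i.
  by rewrite -[LHS]/(sc (product_term l') m xi) scoef_product_term.
refine (eq_trans (congr1 (Cminus _) (eq_trans e2 (esym e1))) _).
have -> : product_coef m xi = plus (conv (remainder_fam D D.+1 (sc phi)) (sc rho) m xi : CV)
  (Sum (fun k => \big[@plus CV/zero]_(l : {ffun 'I_n -> 'I_D.+1} | (mi_size (fun i => l i : nat) < D.+1)%N) T l k)).
  rewrite -(Sum_plus hg0 hg1) /product_coef /tconv; refine (@Sum_ext Zn CV _ _ _) => k.
  have hE : remainder_fam 0 0 (sc phi) (zsub m k, k) xi = Cplus (remainder_fam D D.+1 (sc phi) (zsub m k, k) xi)
     (\big[@plus CV/zero]_(l : {ffun 'I_n -> 'I_D.+1} | (mi_size (fun i => l i : nat) < D.+1)%N) term_fam (fun i => l i : nat) (zsub m k, k) xi).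
    rewrite remainder_fam0 /remainder_fam /taylor_rem /=.
    have -> : (fun i => xi i + 1 * toR k i) = (fun i => xi i + toR k i).
      by apply: functional_extensionality => i; ring.
    set X := sc phi _ _; set Y := taylor_sum _ _ _ _ _ _ _; set Z := bigop _ _ _.
    have -> : Z = Y; last by ring.
    rewrite /Z /Y /taylor_sum; apply: eq_bigr => l _; rewrite /term_fam pow1 Rmult_1_l /Rdiv Rmult_comm RtoC_mult.
    exact: Cmult_assoc.
  rewrite hE /T -Cmult_big_l.
  set b := bigop _ _ _; set x := remainder_fam _ _ _ _ _; set y := sc rho k xi; set z := ph _ _ _ _.
  have H (p q r s : C) : Cmult r (Cmult (Cplus p s) q) = Cplus (Cmult r (Cmult p q)) (Cmult r (Cmult s q)) by ring.
  refine (eq_trans (H _ _ _ _) _); congr (Cplus _ _).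
  congr (Cmult _ _).
  by rewrite Cmult_comm Cmult_big_l; apply: eq_bigr => l _; exact: Cmult_comm.
set x := conv _ _ _ _; set y := Sum _.
have H (a b : C) : Cminus (Cplus a b) b = a by ring.
exact: H.
Qed.

Lemma product_asymptotic : asymptotic alpha tau delta (M1 + M2) (synth product_coef) product_term.
Proof.
split; first exact: (CS_symbol HT Hdelta product_coef_CS).
split; first exact: product_term_symbol.
case=> [//|D] _.
rewrite -(synth_sc HT (rho := fun xi => minus (synth product_coef xi) (partial_sum product_term D.+1 xi))); last first.
  by move=> xi; apply: (Ainf_minus HT); [exact: (synth_Ainf HT _ (CSg_bd product_coef_CS)) | exact: partial_sum_Ainf].
rewrite scoef_remainder; apply: (CS_symbol HT Hdelta).
have -> : M1 + M2 - INR D.+1 = (M2 - INR D.+1) + M1 by ring.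
exact: (conv_CS ph1 (remainder_fam_CK (leqnn D.+1) Hp) Hr).
Qed.

End Torus.

(** * Partial Fourier transforms of Schwartz functions *)

Lemma mi_iter_single d (X : Type) (D : 'I_d -> X -> X) i N x :
  mi_iter D (fun j => if j == i then N else 0%N) x = iter N (D i) x.
Proof.
have H s : uniq s -> foldr (fun j y => iter (if j == i then N else 0%N) (D j) y) x s = if i \in s then iter N (D i) x else x.
  elim: s => [//|j s IH] /= /andP [hj us]; rewrite (IH us) in_cons eq_sym.
  by case: eqP => [->|_] //=; rewrite (negbTE hj).
by rewrite /mi_iter H ?enum_uniq // mem_enum.
Qed.

Lemma wt_le_enorm d (x : 'I_d -> R) : wt x <= INR d.+1 * (1 + enorm x).
Proof.
have h0 := enorm_ge0 x.
have : sumR (fun i => Rabs (x i)) <= INR d * enorm x.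
  by rewrite -sumR_const; apply: sumR_le => i; exact: abs_le_enorm.
rewrite /wt S_INR; have := pos_INR d; nra.
Qed.

Section Schwartz.
Variables (d : nat) (f : ('I_d -> R) -> CV).
Hypothesis Hf : @schwartz d f.
Local Notation P := (@partial CV unit (fun _ => True) (fun _ => Cmod) d).

Lemma Cmod_norm : (fun _ : unit => Cmod) = (fun _ : unit => @norm R_AbsRing CV).
Proof. by apply: functional_extensionality => _; apply: functional_extensionality => z; rewrite normC. Qed.

Lemma schwartz_pder i N : pder i (iter N (P i) f : _ -> CV) (iter N.+1 (P i) f).
Proof.
move=> x; have [[_ /(_ (nseq N i)) [_ /(_ i x) [v hv]]] _] := Hf.
have E : foldr P f (nseq N i) = iter N (P i) f by elim: (N) => [//|k IH] /=; rewrite IH.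
have Hv : is_derive (fun t => (iter N (P i) f : _ -> CV) (shift x i t)) 0 v.
  by apply/(@is_partial_norm CV); rewrite -Cmod_norm -E; exact: hv.
suff -> : iter N.+1 (P i) f x = v by [].
by rewrite /= {1}Cmod_norm; apply: (@partial_norm_eq CV).
Qed.

Lemma schwartz_cont i N x : continuous (iter N (P i) f : _ -> CV) x.
Proof.
have [[_ /(_ (nseq N i)) [h _]] _] := Hf.
have E : foldr P f (nseq N i) = iter N (P i) f by elim: (N) => [//|k IH] /=; rewrite IH.
apply/contP => e he; have /lim0P h' := h x tt.
have := h' (fun t => Cmod_ge_0 _) e he; rewrite -E; apply: filter_imp => y.
by rewrite -normC.
Qed.

Lemma schwartz_bd l p : exists K, 0 <= K /\ forall x, Cmod (C_deriv l f x) <= K * / wt x ^ p.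
Proof.
have [_ /(_ p l) [K hK]] := Hf.
exists (INR d.+1 ^ p * Rabs K); split.
  by apply: Rmult_le_pos; [apply: pow_le; exact: pos_INR | exact: Rabs_pos].
move=> x; have := hK x => h.
apply: (Rmult_le_reg_r (wt x ^ p)); first exact: wt_pos.
rewrite Rmult_assoc Rinv_l; last by apply: Rgt_not_eq; exact: wt_pos.
rewrite Rmult_1_r.
apply: Rle_trans (_ : Cmod (C_deriv l f x) * (INR d.+1 ^ p * (1 + enorm x) ^ p) <= _).
  apply: Rmult_le_compat_l; first exact: Cmod_ge_0.
  rewrite -Rpow_mult_distr; apply: pow_incr; split; last exact: wt_le_enorm.
  by have := wt_ge1 x; lra.
rewrite Rmult_comm Rmult_assoc; apply: Rmult_le_compat_l; first by apply: pow_le; exact: pos_INR.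
by apply: Rle_trans (Rle_abs K).
Qed.

Lemma schwartz_decay i N p : exists K, 0 <= K /\ forall x, Cmod (iter N (P i) f x) <= K * / wt x ^ p.
Proof. by rewrite -mi_iter_single; exact: schwartz_bd. Qed.

Lemma schwartz_decay0 p : exists K, 0 <= K /\ forall x, Cmod (f x) <= K * / wt x ^ p.
Proof.
have [K hK] := schwartz_bd (fun=> 0%N) p; exists K.
have E : C_deriv (fun=> 0%N) f = f by rewrite /C_deriv /mi_iter; elim: (enum _).
by rewrite E in hK.
Qed.

Lemma schwartz_cont0 x : continuous f x.
Proof.
have [[_ /(_ [::]) [h _]] _] := Hf.
apply/contP => e he; have /lim0P h' := h x tt.
have := h' (fun t => Cmod_ge_0 _) e he; apply: filter_imp => y.
by rewrite -normC.
Qed.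

End Schwartz.

Section Vcat.
Variables n : nat.
Implicit Types s z : 'I_n -> R.

Lemma vcat_l e s (z : 'I_e -> R) i : vcat s z (lshift e i) = s i.
Proof. by rewrite /vcat -[lshift e i]/(unsplit (inl i)) unsplitK. Qed.
Lemma vcat_r e s (z : 'I_e -> R) i : vcat s z (rshift n i) = z i.
Proof. by rewrite /vcat -[rshift n i]/(unsplit (inr i)) unsplitK. Qed.

Lemma shift_vcat s z i t : shift (vcat s z) (lshift n i) t = vcat (shift s i t) z.
Proof.
apply: functional_extensionality => k; rewrite /shift -[k]splitK; case: (split k) => j /=.
  by rewrite !vcat_l eq_lshift.
by rewrite !vcat_r eq_rlshift.
Qed.

Lemma wt_vcat s z : wt (vcat s z) = wt s + wt z - 1.
Proof.
rewrite /wt /sumR big_split_ord /=.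
under eq_bigr do rewrite vcat_l.
under [X in _ + (_ + X)]eq_bigr do rewrite vcat_r.
by lra.
Qed.

(** [wt (vcat s z)] is at least both [wt s] and [wt z]; joint decay can be shared out between the
    two halves at will. *)
Lemma wt_vcat_inv s z p q : / wt (vcat s z) ^ (p + q) <= / wt s ^ p * / wt z ^ q.
Proof.
have h1 := wt_ge1 s; have h2 := wt_ge1 z.
rewrite pow_add -Rinv_mult; apply: Rinv_le_contravar.
  by apply: Rmult_lt_0_compat; exact: wt_pos.
apply: Rmult_le_compat; try by left; exact: wt_pos.
  by apply: pow_incr; rewrite wt_vcat; lra.
by apply: pow_incr; rewrite wt_vcat; lra.
Qed.

Lemma lim_vcat T (F : (T -> Prop) -> Prop) {FF : Filter F} (f g : T -> 'I_n -> R) s z :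
  filterlim f F (locally s) -> filterlim g F (locally z) ->
  filterlim (fun t => vcat (f t) (g t)) F (locally (vcat s z)).
Proof.
move=> hf hg; apply: lim_vec => i; rewrite -[i]splitK; case: (split i) => j /=.
  rewrite vcat_l; apply: (filterlim_ext (fun t => f t j)); first by move=> t; rewrite vcat_l.
  exact: lim_coord.
rewrite vcat_r; apply: (filterlim_ext (fun t => g t j)); first by move=> t; rewrite vcat_r.
exact: lim_coord.
Qed.

End Vcat.

Section PartialFT.
Variables (n : nat) (chi : ('I_(n + n) -> R) -> CV).
Hypothesis Hchi : @schwartz (n + n) chi.
Local Notation P := (@partial CV unit (fun _ => True) (fun _ => Cmod) (n + n)).
Implicit Types s z eta : 'I_n -> R.

Lemma schwartz_iter_nice i N : exists K, 0 <= K /\ forall z, nice K (fun s => iter N (P i) chi (vcat s z) : CV).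
Proof.
have [K [hK h]] := schwartz_decay Hchi i N (2 * n + 0); exists K; split=> // z; split.
  move=> s; apply: (@continuous_comp _ _ _ (fun s => vcat s z) (iter N (P i) chi : _ -> CV)).
    by apply: lim_vcat; [exact: filterlim_id | exact: filterlim_const].
  exact: (schwartz_cont Hchi).
move=> s; rewrite normC; apply: Rle_trans (h _) _; apply: Rmult_le_compat_l => //.
apply: Rle_trans (wt_vcat_inv _ _ _ _) _; rewrite /= Rinv_1 Rmult_1_r; exact: wt_dk.
Qed.

(** Fourier transform in the first [n] variables, where [osc_integrand] puts [s]; the last [n] keep
    the scaled [xi]. *)
Definition pft eta z : CV := ft (fun s => chi (vcat s z)) eta.

Lemma schwartz_nice : exists K, 0 <= K /\ forall z, nice K (fun s => chi (vcat s z) : CV).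
Proof.
have [K [hK h]] := schwartz_decay0 Hchi (2 * n + 0); exists K; split=> // z; split.
  move=> s; apply: (@continuous_comp _ _ _ (fun s => vcat s z) chi); last exact: schwartz_cont0.
  by apply: lim_vcat; [exact: filterlim_id | exact: filterlim_const].
move=> s; rewrite normC; apply: Rle_trans (h _) _; apply: Rmult_le_compat_l => //.
apply: Rle_trans (wt_vcat_inv _ _ _ _) _; rewrite /= Rinv_1 Rmult_1_r; exact: wt_dk.
Qed.

(** The derivatives fall on the first [n] variables, and their majorants from [schwartz_iter_nice]
    do not depend on [z]. *)
Lemma pft_decay p : exists K, 0 <= K /\ forall eta z, Cmod (pft eta z) <= K * / wt eta ^ p.
Proof.
have [K0 [hK0 h0]] := schwartz_nice.
pose Ki i N := proj1_sig (constructive_indefinite_description _ (schwartz_iter_nice (lshift n i) N)).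
have hKi i N : 0 <= Ki i N /\ forall z, nice (Ki i N) (fun s => iter N (P (lshift n i)) chi (vcat s z) : CV).
  exact: (proj2_sig (constructive_indefinite_description _ (schwartz_iter_nice (lshift n i) N))).
have hpi : 0 <= PI ^ n by apply: pow_le; have := PI_RGT_0; lra.
have hs0 : 0 <= sumR (fun i => Ki i p) by apply: sumR_ge0 => i; case: (hKi i p).
pose B := (K0 + sumR (fun i => Ki i p)) * PI ^ n.
exists (INR n.+1 ^ p * B); split.
  apply: Rmult_le_pos; first by apply: pow_le; exact: pos_INR.
  by apply: Rmult_le_pos => //; lra.
move=> eta z.
apply: (Rmult_le_reg_r (wt eta ^ p)); first exact: wt_pos.
rewrite Rmult_assoc Rinv_l; last by apply: Rgt_not_eq; exact: wt_pos.
rewrite Rmult_1_r Rmult_comm; apply: wt_pow_bound; first exact: Cmod_ge_0.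
  apply: Rle_trans (ft_le eta (h0 z)) _; apply: Rmult_le_compat_r => //; lra.
move=> i; apply: Rle_trans (_ : Ki i p * PI ^ n <= _); last first.
  apply: Rmult_le_compat_r => //.
  by have := @sumR_ge_term n (fun i => Ki i p) i (fun i => proj1 (hKi i p)); lra.
apply: (ft_decay (D := fun N s => iter N (P (lshift n i)) chi (vcat s z)) eta (fun N => proj2 (hKi i N) z) _ p) => N s.
have := schwartz_pder Hchi (lshift n i) N (vcat s z).
by apply: is_derive_ext => t; rewrite shift_vcat.
Qed.

Lemma pft_lim T (F : (T -> Prop) -> Prop) {FF : Filter F} (f g : T -> 'I_n -> R) eta z :
  filterlim f F (locally eta) -> filterlim g F (locally z) ->
  filterlim (fun t => pft (f t) (g t)) F (locally (pft eta z)).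
Proof.
move=> hf hg; have [K0 [hK0 h0]] := schwartz_nice.
apply/tendsP; rewrite /pft /ft.
apply: (@Int_dct CV n T F FF (fun t s => Cmult (chi (vcat s (g t))) (cis (- dot s (f t)))) _ K0).
- by apply: filter_forall => t; exact: ft_nice.
- exact: ft_nice.
move=> s; apply/tendsP.
have h1 : filterlim (fun p : T * ('I_n -> R) => f p.1) (filter_prod F (locally s)) (locally eta).
  exact: filterlim_comp filterlim_fst hf.
have h2 : filterlim (fun p : T * ('I_n -> R) => g p.1) (filter_prod F (locally s)) (locally z).
  exact: filterlim_comp filterlim_fst hg.
apply: lim_Cmult.
  by apply: (lim_comp (h := chi)); [apply: lim_vcat => //; exact: filterlim_snd | exact: schwartz_cont0].
by apply: lim_cis; apply: lim_Ropp; apply: lim_dot => //; exact: filterlim_snd.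
Qed.

Lemma pft_scale eta z eps : 0 < eps ->
  is_int (fun s => scal (eps ^ n) (Cmult (chi (vcat (fun i => eps * s i) z)) (cis (- dot s (fun i => eps * eta i))) : CV)) (pft eta z).
Proof.
move=> he; have [K0 [hK0 h0]] := schwartz_nice.
have := is_int_affine (fun=> 0) he (Int_is_int (ft_nice eta (h0 z))).
apply: is_int_ext => s; congr scal.
have -> : (fun i => eps * s i + 0) = (fun i => eps * s i) by apply: functional_extensionality => i; ring.
by rewrite dotZl dotZr.
Qed.

Lemma pft_inversion : Int (fun eta => pft eta (fun=> 0)) = Cmult (chi (fun=> 0)) (RtoC ((2 * PI) ^ n)).
Proof.
have [K0 [hK0 h0]] := schwartz_nice; have [K1 [hK1 h1]] := pft_decay (2 * n).
have hG : nice K1 (fun eta => pft eta (fun=> 0)).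
  split; first by move=> eta; apply: pft_lim; [exact: filterlim_id | exact: filterlim_const].
  move=> eta; rewrite normC; apply: Rle_trans (h1 _ _) _; apply: Rmult_le_compat_l => //; exact: wt_dk.
rewrite (fourier_inversion0 (h0 (fun=> 0)) hG).
congr (Cmult (chi _) _); apply: functional_extensionality => i; rewrite /vcat; by case: split.
Qed.

End PartialFT.

(** * The oscillatory integral *)

Section Osc.
Variables (n : nat) (theta : 'I_n -> 'I_n -> R) (A : CstarAlgebra) (U : 'I_n -> A).
Variables (alpha : ('I_n -> R) -> A -> A) (tau : A -> C) (delta : 'I_n -> A -> A).
Hypothesis HT : torus_data theta U alpha tau.
Hypothesis Hdelta : is_basic_derivations U alpha delta.
Variables (M : R) (rho : ('I_n -> R) -> A).
Hypothesis hrho : symbol alpha tau delta M rho.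

Local Notation mon := (@monomial n A U).
Local Notation Zn := (Zn n).
Local Notation coef := (fcoef U tau).
Local Notation Ainf := (Ainf alpha).

Lemma symbol_cont xi : continuous rho xi.
Proof.
have [[hA /(_ [::]) [h _]] _] := hrho.
apply/contP => e he; have /lim0P h' := h xi (fun=> 0%N).
have := h' (fun t => norm_ge_0 _) e he; apply: filter_imp => y.
by rewrite (Ainf_norm0 HT) //; apply: (Ainf_minus HT); exact: hA.
Qed.

(** A Sobolev type step: a symbol bounds only the [L2norm], but of all [delta^i], which makes the
    coefficients summable and so bounds the norm of the algebra. *)
Lemma symbol_norm : exists B, 0 <= B /\ forall xi, norm (rho xi) <= B * Rp M xi.
Proof.
have [_ /(_ (2 * n)%N) [B [hB h]]] := CSg_bd (symbol_CS HT Hdelta hrho).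
have [S HS] := summable_wt (leqnn (2 * n)).
have hS : 0 <= S by have := proj2 HS [::] isT; rewrite /rsum big_nil.
exists (B * S); split; first exact: Rmult_le_pos.
move=> xi; rewrite -[rho xi](ser_coef HT (Ainf_rapid HT (symbol_Ainf HT hrho xi))).
have hc : 0 <= B * Rp M xi by apply: Rmult_le_pos => //; left; exact: Rp_pos.
have -> : B * S * Rp M xi = (B * Rp M xi) * S by ring.
apply: (norm_ser_le HT (g := fun m => B * Rp M xi * / wt (toR m) ^ (2 * n))).
  split=> [m|s us]; first by apply: Rmult_le_pos => //; left; exact: winv_pos.
  have -> : forall c (h : Zn -> R), rsum s (fun k => c * h k) = c * rsum s h.
    move=> c h1; elim: s {us} => [|x s IH]; first by rewrite /rsum !big_nil; ring.
    by rewrite /rsum !big_cons -!/(rsum _ _) IH /=; ring.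
  by apply: Rmult_le_compat_l => //; apply: (proj2 HS).
by move=> m; apply: Rle_trans (h m xi) _; right; rewrite /scoef; ring.
Qed.

Lemma lim_alpha T (F : (T -> Prop) -> Prop) {FF : Filter F} (f : T -> 'I_n -> R) s a :
  filterlim f F (locally s) -> filterlim (fun t => alpha (f t) a) F (locally (alpha s a)).
Proof. move=> h; apply: (lim_comp (h := fun s => alpha s a)) => //; exact: (alpha_cont HT). Qed.

Section Chi.
Variable chi : ('I_(n + n) -> R) -> CV.
Hypothesis Hchi : @schwartz (n + n) chi.

Local Notation F := (osc_integrand alpha chi).

Lemma wt_scale_inv (s : 'I_n -> R) eps p : 0 < eps ->
  / wt (fun i => eps * s i) ^ p <= (1 + / eps) ^ p * / wt s ^ p.
Proof.
move=> he; have hi : 0 < / eps by apply: Rinv_0_lt_compat.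
have h : wt s <= (1 + / eps) * wt (fun i => eps * s i).
  have -> : wt (fun i => eps * s i) = 1 + eps * sumR (fun i => Rabs (s i)).
    rewrite /wt -sumR_scal; congr (1 + _); apply: sumR_ext => i.
    by rewrite Rabs_mult (Rabs_pos_eq eps); lra.
  have h0 : 0 <= sumR (fun i => Rabs (s i)) by apply: sumR_ge0 => i; exact: Rabs_pos.
  have -> : (1 + / eps) * (1 + eps * sumR (fun i => Rabs (s i))) =
    1 + / eps + eps * sumR (fun i => Rabs (s i)) + (/ eps * eps) * sumR (fun i => Rabs (s i)) by ring.
  by rewrite Rinv_l /wt; [nra | lra].
have h1 := wt_pos s p; have h2 := wt_pos (fun i => eps * s i) p.
apply: (Rmult_le_reg_l (wt (fun i => eps * s i) ^ p)) => //.
rewrite Rinv_r; last lra.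
apply: (Rmult_le_reg_r (wt s ^ p)) => //.
rewrite Rmult_1_l -!Rmult_assoc (Rmult_assoc _ (/ _)) Rinv_l ?Rmult_1_r; last lra.
rewrite -Rpow_mult_distr; apply: pow_incr; split; first by have := wt_ge1 s; lra.
by rewrite Rmult_comm.
Qed.

(** With [q >= M] the decay exponent [2 * n + q] in [xi] beats the growth of [rho]. The constant
    depends on [eps] and serves the existence of the integrals; the estimate uniform in [eps] is
    [scaled_nice]. *)
Lemma osc_nice2 eps : 0 < eps -> exists K, 0 < K /\ forall a, nice2 (K * norm a) (fun s xi => F eps rho a xi s).
Proof.
move=> he; have [B [hB h]] := symbol_norm; have [q hq] := nat_above M.
have [K [hK hk]] := schwartz_decay0 Hchi (2 * n + (2 * n + q)).
have hi : 0 < / eps by apply: Rinv_0_lt_compat.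
pose E := (1 + / eps) ^ (2 * n) * (1 + / eps) ^ (2 * n + q).
have hE : 0 < E by apply: Rmult_lt_0_compat; apply: pow_lt; lra.
exists (K * E * B + 1); split.
  by have := Rmult_le_pos _ _ (Rmult_le_pos _ _ hK (Rlt_le _ _ hE)) hB; lra.
move=> a; split.
  move=> s xi; apply: lim_cscal.
    apply: lim_Cmult; last by apply: lim_cis; apply: lim_Ropp; apply: lim_dot; [exact: filterlim_fst | exact: filterlim_snd].
    apply: (lim_comp (h := chi)); last exact: schwartz_cont0.
    by apply: lim_vcat; apply: lim_scalv; try exact: filterlim_const; [exact: filterlim_fst | exact: filterlim_snd].
  apply: lim_cmul; first by apply: (lim_comp (h := rho)); [exact: filterlim_snd | exact: symbol_cont].
  by apply: lim_alpha; exact: filterlim_fst.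
move=> s xi; rewrite /osc_integrand cnormZ Cmod_mult Cmod_cis Rmult_1_r.
have hs := wt_dk s; have hx := wt_dk xi.
have ha := norm_ge_0 a.
have h1 : norm (cmul (rho xi) (alpha s a)) <= B * wt xi ^ q * norm a.
  apply: Rle_trans (cnormM _ _) _; apply: Rmult_le_compat; try exact: norm_ge_0; last exact: (alpha_le HT).
  apply: Rle_trans (h xi) _; apply: Rmult_le_compat_l => //; apply: Rpower_pow_le => //; exact: wt_ge1.
have h2 : Cmod (chi (vcat (fun i => eps * s i) (fun i => eps * xi i))) <= K * E * dk s * / wt xi ^ (2 * n + q).
  have -> : K * E * dk s * / wt xi ^ (2 * n + q) = K * (E * (dk s * / wt xi ^ (2 * n + q))) by ring.
  apply: Rle_trans (hk _) _; apply: Rmult_le_compat_l => //.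
  apply: Rle_trans (wt_vcat_inv _ _ _ _) _.
  have e1 := wt_scale_inv s (2 * n) he; have e2 := wt_scale_inv xi (2 * n + q) he.
  have p1 := winv_pos (fun i => eps * s i) (2 * n); have p2 := winv_pos (fun i => eps * xi i) (2 * n + q).
  apply: Rle_trans (Rmult_le_compat _ _ _ _ (Rlt_le _ _ p1) (Rlt_le _ _ p2) e1 e2) _.
  have p3 := winv_pos xi (2 * n + q).
  apply: Rle_trans (_ : E * (/ wt s ^ (2 * n) * / wt xi ^ (2 * n + q)) <= _); first by right; rewrite /E; ring.
  by apply: Rmult_le_compat_l; [lra | apply: Rmult_le_compat_r; lra].
apply: Rle_trans (Rmult_le_compat _ _ _ _ (Cmod_ge_0 _) (norm_ge_0 _) h2 h1) _.
have -> : K * E * dk s * / wt xi ^ (2 * n + q) * (B * wt xi ^ q * norm a) =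
   (K * E * B) * (norm a * (dk s * / wt xi ^ (2 * n))).
  rewrite pow_add; field; have := wt_pos xi (2 * n); have := wt_pos xi q; split; lra.
have -> : (K * E * B + 1) * norm a * dk s * dk xi = (K * E * B + 1) * (norm a * (dk s * dk xi)) by ring.
have [d1 _] := dk_pos s; have p4 := winv_pos xi (2 * n).
have hKEB : 0 <= K * E * B by apply: Rmult_le_pos => //; apply: Rmult_le_pos => //; lra.
apply: Rmult_le_compat; [lra | | lra |].
  by apply: Rmult_le_pos => //; apply: Rmult_le_pos; lra.
by apply: Rmult_le_compat_l => //; apply: Rmult_le_compat_l; lra.
Qed.

Definition osc_inner eps a xi : A := Int (fun s => F eps rho a xi s).
Definition osc_outer eps a : A := Int (osc_inner eps a).

Lemma osc_nice eps : 0 < eps -> exists K, 0 < K /\ forall a,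
  (forall xi, nice (K * norm a) (fun s => F eps rho a xi s)) /\ nice (K * norm a) (osc_inner eps a).
Proof.
move=> he; have [K [hK h]] := osc_nice2 he; exists (K + K * PI ^ n); split.
  by have : 0 < PI ^ n := pow_lt _ _ PI_RGT_0; nra.
move=> a; have ha := norm_ge_0 a; have hp : 0 < PI ^ n := pow_lt _ _ PI_RGT_0.
have hKa : 0 <= K * norm a by apply: Rmult_le_pos; lra.
split.
  move=> xi; split.
    by move=> s; exact: (@cont2_l A _ _ (fun s xi => F eps rho a xi s) s xi (proj1 (h a))).
  move=> s; apply: Rle_trans (proj2 (h a) s xi) _.
  have [d1 d2] := dk_pos xi; have [d3 d4] := dk_pos s.
  have h1 : 0 <= K * norm a * dk s by apply: Rmult_le_pos; lra.
  have h2 : 0 <= K * norm a * dk s * PI ^ n by apply: Rmult_le_pos; lra.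
  have h3 := Rmult_le_compat_l _ _ _ h1 d2; lra.
apply: (nice_mono _ (nice2_Int (h a))); nra.
Qed.

Lemma osc_outer_is_int eps a : 0 < eps ->
  (forall xi, is_int (F eps rho a xi) (osc_inner eps a xi)) /\ is_int (osc_inner eps a) (osc_outer eps a).
Proof.
move=> he; have [K [_ /(_ a) [h1 h2]]] := osc_nice he.
by split=> [xi|]; [exact: Int_is_int (h1 xi) | exact: Int_is_int h2].
Qed.

(** Boundedness at a fixed [eps] allows the Fourier series of [a] to be summed outside the
    integral. *)
Lemma osc_outer_linear eps : 0 < eps -> @is_linear R_AbsRing A A (osc_outer eps).
Proof.
move=> he; have [K [hK h]] := osc_nice he; split.
- move=> x y; rewrite /osc_outer.
  rewrite -(Int_plus (proj2 (h x)) (proj2 (h y))); apply: Int_ext => xi; rewrite /osc_inner.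
  rewrite -(Int_plus (proj1 (h x) xi) (proj1 (h y) xi)); apply: Int_ext => s.
  by rewrite /osc_integrand (alphaD HT) cmulDr cscalDr.
- move=> k x; rewrite /osc_outer.
  rewrite -(Int_scal k (proj2 (h x))); apply: Int_ext => xi; rewrite /osc_inner.
  rewrite -(Int_scal k (proj1 (h x) xi)); apply: Int_ext => s.
  by rewrite /osc_integrand -!cscalR (alphaZ HT) cmulZr !cscalA Cmult_comm.
- exists (K * PI ^ n); split; first by apply: Rmult_lt_0_compat => //; apply: pow_lt; exact: PI_RGT_0.
  move=> x; apply: Rle_trans (Int_le (proj2 (h x))) _; right; ring.
Qed.

(** The outer integrand at [cscal c (mon m)] after the substitutions [s / eps] for [s] and
    [eps eta + m] for [xi]. *)
Definition scaled eps m c (eta : 'I_n -> R) : A :=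
  cscal (pft chi eta (fun i => eps * (eps * eta i + toR m i)))
        (cmul (rho (fun i => eps * eta i + toR m i)) (cscal c (mon m))).

(** On a monomial [alpha s] is a phase, so the exponent becomes [- s . (xi - m)]. The factor
    [eps ^ n] from substituting for [xi] is the one that the inner substitution absorbs. *)
Lemma osc_outer_mon eps m c : 0 < eps -> osc_outer eps (cscal c (mon m)) = Int (scaled eps m c).
Proof.
move=> he; have [_ h] := osc_outer_is_int (cscal c (mon m)) he.
rewrite -(Int_unique (is_int_affine (toR m) he h)); apply: Int_ext => eta.
set pt := fun i => eps * eta i + toR m i.
have [K [hK /(_ (cscal c (mon m))) [hn _]]] := osc_nice he.
rewrite /osc_inner -(Int_scal (eps ^ n) (hn pt)).
apply: Int_unique.
have := is_int_lin (is_linear_cscal_l (cmul (rho pt) (cscal c (mon m)))) (pft_scale Hchi eta (fun i => eps * pt i) he).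
apply: is_int_ext => s.
rewrite (linear_scal _ (is_linear_cscal_l _)) /osc_integrand; congr scal.
rewrite (alphaZ HT) (alpha_mon HT).
have -> z : cmul (rho pt) (cscal c (cscal z (mon m))) = cscal z (cmul (rho pt) (cscal c (mon m))).
  by rewrite cscalA (Cmult_comm c) -cscalA cmulZr.
rewrite cscalA -Cmult_assoc -cisD; congr (cscal (Cmult _ (cis _)) _).
have -> : dot s pt = dot s (fun i => eps * eta i) + dot s (toR m) by rewrite -dotDr.
ring.
Qed.

(** Peetre's inequality splits the growth of [rho] at [eps * eta + m] into [wt eta ^ p], absorbed by
    the decay of [pft], and a power of [wt (toR m)], absorbed later by rapid decay. The range
    includes the limit value [eps = 0]. *)
Lemma scaled_nice : exists K q, 0 <= K /\ forall eps m c, 0 <= eps <= 1 ->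
  nice (K * (wt (toR m) ^ q * Cmod c)) (scaled eps m c).
Proof.
have [B [hB hb]] := symbol_norm; have [q hq] := nat_above M; have [p hp] := @peetre n M.
have [K [hK hk]] := pft_decay Hchi (2 * n + p).
exists (K * B), q; split; first exact: Rmult_le_pos.
move=> eps m c he.
have lpt xi : filterlim (fun eta i => eps * eta i + toR m i) (locally xi) (locally (fun i => eps * xi i + toR m i)).
  apply: lim_vec => i; apply: lim_Rplus; last exact: filterlim_const.
  by apply: lim_Rmult; [exact: filterlim_const | exact: lim_proj].
split=> eta.
  apply: lim_cscal.
    by apply: (pft_lim Hchi); [exact: filterlim_id | apply: lim_scalv => //; exact: filterlim_const].
  by apply: lim_cmul; [apply: (lim_comp (h := rho)) => //; exact: symbol_cont | exact: filterlim_const].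
have h1 : norm (cmul (rho (fun i => eps * eta i + toR m i)) (cscal c (mon m))) <= B * (wt eta ^ p * wt (toR m) ^ q) * Cmod c.
  apply: Rle_trans (cnormM _ _) _; rewrite cnormZ (norm_mon (td_rel HT) (norm_one HT)) Rmult_1_r.
  apply: Rmult_le_compat_r; first exact: Cmod_ge_0.
  apply: Rle_trans (hb _) _; apply: Rmult_le_compat_l => //.
  have -> : (fun i => eps * eta i + toR m i) = (fun i => toR m i + eps * eta i).
    by apply: functional_extensionality => i; ring.
  apply: Rle_trans (hp _ (fun i => eps * eta i)) _.
  apply: Rmult_le_compat; [left; exact: wt_pos | left; exact: Rp_pos | |].
    apply: pow_incr; split; first by have := wt_ge1 (fun i => eps * eta i); lra.
    by apply: wtZ; rewrite Rabs_pos_eq; lra.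
  by apply: Rpower_pow_le => //; exact: wt_ge1.
rewrite /scaled cnormZ.
apply: Rle_trans (Rmult_le_compat _ _ _ _ (Cmod_ge_0 _) (norm_ge_0 _) (hk _ _) h1) _.
have -> : K * / wt eta ^ (2 * n + p) * (B * (wt eta ^ p * wt (toR m) ^ q) * Cmod c) =
  K * B * (wt (toR m) ^ q * Cmod c) * / wt eta ^ (2 * n).
  by rewrite pow_add; field; have := wt_pos eta (2 * n); have := wt_pos eta p; split; lra.
apply: Rmult_le_compat_l; last exact: wt_dk.
apply: Rmult_le_pos; first exact: Rmult_le_pos.
by apply: Rmult_le_pos; [left; exact: wt_pos | exact: Cmod_ge_0].
Qed.

Hypothesis chi0 : chi (fun=> 0) = RtoC 1.

(** At [eps = 0] only the factor [pft] depends on [eta], and Fourier inversion at the origin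
    integrates it to [(2 * PI) ^ n * chi 0]. *)
Lemma scaled0 m c :
  cscal (RtoC ((2 * PI) ^ n)) (cmul (rho (toR m)) (cscal c (mon m))) = Int (scaled 0 m c).
Proof.
have [K1 [hK1 h1]] := pft_decay Hchi (2 * n).
have hG : nice K1 (fun eta => pft chi eta (fun=> 0)).
  split; first by move=> eta; apply: (pft_lim Hchi); [exact: filterlim_id | exact: filterlim_const].
  move=> eta; rewrite normC; apply: Rle_trans (h1 _ _) _; apply: Rmult_le_compat_l => //; exact: wt_dk.
have := pft_inversion Hchi; rewrite chi0 Cmult_1_l => <-.
rewrite -(Int_lin (is_linear_cscal_l _) hG); apply: Int_ext => eta; rewrite /scaled.
have -> : (fun i => 0 * (0 * eta i + toR m i)) = (fun=> 0) by apply: functional_extensionality => i; ring.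
by have -> : (fun i => 0 * eta i + toR m i) = toR m by apply: functional_extensionality => i; ring.
Qed.

Lemma osc_outer_mon_lim m c :
  tends (at_right 0) (fun eps => Int (scaled eps m c))
    (cscal (RtoC ((2 * PI) ^ n)) (cmul (rho (toR m)) (cscal c (mon m)))).
Proof.
have [K [q [hK hk]]] := scaled_nice.
rewrite scaled0.
apply: (@Int_dct A n R (at_right 0) _ (fun eps => scaled eps m c) _ (K * (wt (toR m) ^ q * Cmod c))).
- by apply: filter_imp at_right_01 => eps he; apply: hk; lra.
- by apply: hk; lra.
move=> eta; apply/tendsP.
have lf : filterlim (fun p : R * ('I_n -> R) => p.1) (filter_prod (at_right 0) (locally eta)) (locally 0).
  exact: filterlim_comp filterlim_fst at_right_id.
have lpt : filterlim (fun (p : R * ('I_n -> R)) i => p.1 * p.2 i + toR m i)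
    (filter_prod (at_right 0) (locally eta)) (locally (fun i => 0 * eta i + toR m i)).
  apply: lim_vec => i; apply: lim_Rplus; last exact: filterlim_const.
  by apply: lim_Rmult => //; apply: lim_coord; exact: filterlim_snd.
apply: lim_cscal.
  apply: (pft_lim Hchi); first exact: filterlim_snd.
  exact: lim_scalv.
by apply: lim_cmul; [apply: (lim_comp (h := rho)) => //; exact: symbol_cont | exact: filterlim_const].
Qed.

End Chi.

Definition symbol_op (a : A) : A := Sum (fun m : Zn => cmul (rho (toR m)) (cscal (coef a m) (mon m))).

Lemma symbol_op_dom a : Ainf a -> exists g, dominated (fun m : Zn => cmul (rho (toR m)) (cscal (coef a m) (mon m))) g.
Proof.
move=> Ha; have [B [hB hb]] := symbol_norm; have [q hq] := nat_above M.
exists (fun m => B * (wt (toR m) ^ q * Cmod (coef a m))).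
apply: dominated_scal_le => //; first exact: rapid_summable (Ainf_rapid HT Ha).
move=> m; apply: Rle_trans (cnormM _ _) _; rewrite cnormZ (norm_mon (td_rel HT) (norm_one HT)) Rmult_1_r -Rmult_assoc.
apply: Rmult_le_compat_r; first exact: Cmod_ge_0.
apply: Rle_trans (hb _) _; apply: Rmult_le_compat_l => //; apply: Rpower_pow_le => //; exact: wt_ge1.
Qed.

(** Two limits are exchanged, [eps] to [0] and the Fourier series of [a], by dominated convergence
    with the majorant of [scaled_nice], summable since the coefficients of [a] decrease rapidly. *)
Lemma osc_integral_symbol_op a : Ainf a -> is_osc_integral alpha rho a (symbol_op a).
Proof.
move=> Ha chi Hchi chi0.
have Hr := Ainf_rapid HT Ha.
exists (fun eps => osc_inner chi eps a), (fun eps => osc_outer chi eps a); split.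
  by move=> eps he; exact: osc_outer_is_int.
have h2 : 0 < (2 * PI) ^ n by apply: pow_lt; have := PI_RGT_0; lra.
have [g hg] := symbol_op_dom Ha.
have -> : symbol_op a = scal (/ (2 * PI) ^ n) (Sum (fun m : Zn => cscal (RtoC ((2 * PI) ^ n)) (cmul (rho (toR m)) (cscal (coef a m) (mon m))))).
  rewrite (Sum_lin (is_linear_cscal A (RtoC ((2 * PI) ^ n))) hg) -cscalR cscalA -RtoC_mult Rinv_l; last lra.
  by rewrite cscalR scal_one.
apply: (lim_comp (U := A) (W := A) (h := scal (/ (2 * PI) ^ n))); last exact: (filterlim_scal_r (V := A)).
apply/tendsP.
have [K [q [hK hk]]] := scaled_nice Hchi.
have hsum := rapid_summable q Hr.
apply: (tends_ext_ev (f := fun eps => Sum (fun m : Zn => osc_outer chi eps (cscal (coef a m) (mon m))))).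
  apply: filter_imp at_right_01 => eps [he _].
  rewrite (Sum_lin (osc_outer_linear Hchi he) (rser_dom HT Hr)); congr (osc_outer _ _ _).
  exact: (ser_coef HT Hr).
have hp : 0 <= PI ^ n by apply: pow_le; have := PI_RGT_0; lra.
apply: (Sum_dct (g := fun m => (K * PI ^ n) * (wt (toR m) ^ q * Cmod (coef a m)))).
- apply: filter_imp at_right_01 => eps he m; rewrite (osc_outer_mon Hchi) //; last lra.
  apply: Rle_trans (Int_le (hk eps m (coef a m) _)) _; first lra.
  by right; ring.
- split; first by apply: summable_scal => //; exact: Rmult_le_pos.
  move=> m; rewrite (scaled0 Hchi chi0).
  by apply: Rle_trans (Int_le (hk 0 m (coef a m) _)) _; [lra | right; ring].
move=> m; have := osc_outer_mon_lim Hchi chi0 m (coef a m); apply: tends_ext_ev.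
by apply: filter_imp at_right_01 => eps [he _]; rewrite (osc_outer_mon Hchi).
Qed.

End Osc.

(** * A Gaussian is a Schwartz function *)

(** From [(1 + x / N) ^ N <= exp x], with [K = N ^ N] for positive [N]. *)
Lemma pow_le_exp N : exists K, 0 <= K /\ forall x, 0 <= x -> x ^ N <= K * exp x.
Proof.
case: N => [|N]; first by exists 1; split=> [|x hx]; [lra | have := exp_ineq1_le x; rewrite /=; lra].
exists (INR N.+1 ^ N.+1); split; first by apply: pow_le; exact: pos_INR.
move=> x hx; have hN : 0 < INR N.+1 by apply: lt_0_INR; lia.
have -> : x = INR N.+1 * (x / INR N.+1) by field; lra.
rewrite Rpow_mult_distr; apply: Rmult_le_compat_l; first by apply: pow_le; lra.
have h0 : 0 <= x / INR N.+1 by apply: Rdiv_le_0_compat.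
have -> : exp (INR N.+1 * (x / INR N.+1)) = exp (x / INR N.+1) ^ N.+1.
  move: (x / _) => y; elim: (N.+1) => [|k IH]; first by rewrite Rmult_0_l exp_0.
  by rewrite S_INR Rmult_plus_distr_r exp_plus IH Rmult_1_l /=; ring.
by apply: pow_incr; have := exp_ineq1_le (x / INR N.+1); lra.
Qed.

(** [(gauss2 k t).1] is the [k]-th derivative of [exp (- t ^ 2)], by the Hermite recurrence. *)
Fixpoint gauss2 (k : nat) (t : R) : R * R :=
  match k with
  | O => (exp (- t ^ 2), - 2 * t * exp (- t ^ 2))
  | S k' => let p := gauss2 k' t in (p.2, - 2 * t * p.2 - 2 * INR k'.+1 * p.1)
  end.
Definition gauss k t := (gauss2 k t).1.

Lemma gauss_rec k t : gauss k.+2 t = - 2 * t * gauss k.+1 t - 2 * INR k.+1 * gauss k t.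
Proof. by []. Qed.

Lemma gauss_derive k t : is_derive (gauss k) t (gauss k.+1 t).
Proof.
suff H : is_derive (gauss k) t (gauss k.+1 t) /\ is_derive (gauss k.+1) t (gauss k.+2 t) by case: H.
elim: k => [|k [IH1 IH2]].
  split; first by rewrite /gauss /=; auto_derive => //; ring.
  by rewrite gauss_rec /gauss /=; auto_derive => //; ring.
split=> //.
apply: (is_derive_ext (fun t => - 2 * t * gauss k.+1 t - 2 * INR k.+1 * gauss k t)) => //.
rewrite gauss_rec (S_INR k.+1); move: (INR k.+1) => c; auto_derive.
  by split; [exists (gauss k.+2 t) | split; [exists (gauss k.+1 t) | ]].
rewrite (is_derive_unique _ _ _ IH1) (is_derive_unique _ _ _ IH2); ring.
Qed.

Lemma gauss_decay k N : exists K, 0 <= K /\ forall t, (1 + Rabs t) ^ N * Rabs (gauss k t) <= K.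
Proof.
suff H j : exists K, 0 <= K /\ forall t, Rabs (gauss j t) <= K * (1 + Rabs t) ^ j * exp (- t ^ 2).
  have [K [hK h]] := H k; have [K' [hK' h']] := pow_le_exp (N + k).
  (* [1 + |t| - t ^ 2] is at most [5 / 4], so [exp 2] suffices. *)
  exists (K * (K' * exp 2)); split.
    by apply: Rmult_le_pos => //; apply: Rmult_le_pos => //; left; exact: exp_pos.
  move=> t; have ht := Rabs_pos t.
  have h1 : 0 <= (1 + Rabs t) ^ N by apply: pow_le; lra.
  apply: Rle_trans (Rmult_le_compat_l _ _ _ h1 (h t)) _.
  have -> : (1 + Rabs t) ^ N * (K * (1 + Rabs t) ^ k * exp (- t ^ 2)) = K * ((1 + Rabs t) ^ (N + k) * exp (- t ^ 2)).
    by rewrite pow_add; ring.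
  apply: Rmult_le_compat_l => //.
  have h2 := h' (1 + Rabs t) ltac:(lra).
  apply: Rle_trans (Rmult_le_compat_r _ _ _ (Rlt_le _ _ (exp_pos _)) h2) _.
  rewrite Rmult_assoc; apply: Rmult_le_compat_l => //; rewrite -exp_plus.
  have hexp x y : x <= y -> exp x <= exp y by case=> [h3|->]; [left; exact: exp_increasing | right].
  apply: hexp; have -> : t ^ 2 = Rabs t ^ 2 by rewrite pow2_abs.
  by have := pow2_ge_0 (Rabs t - 1 / 2); nra.
(* The recurrence has two terms, so two consecutive indices are carried through the induction. *)
suff H2 : (exists K, 0 <= K /\ forall t, Rabs (gauss j t) <= K * (1 + Rabs t) ^ j * exp (- t ^ 2)) /\
  (exists K, 0 <= K /\ forall t, Rabs (gauss j.+1 t) <= K * (1 + Rabs t) ^ j.+1 * exp (- t ^ 2)) by case: H2.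
have he t : 0 < exp (- t ^ 2) by exact: exp_pos.
elim: j => [|j [[K [hK h]] [K' [hK' h']]]].
  split.
    exists 1; split; first lra.
    by move=> t; rewrite /gauss /= Rabs_pos_eq; [lra | left; exact: exp_pos].
  exists 2; split; first lra.
  move=> t; rewrite /gauss /gauss2 !Rabs_mult (Rabs_left (- 2)); last lra.
  rewrite (Rabs_pos_eq (exp _)) /=; last by left; exact: exp_pos.
  have := he t; have := Rabs_pos t; rewrite /=; nra.
split; first by exists K'.
exists (2 * K' + 2 * INR j.+1 * K); have hj := pos_INR j.+1; split; first nra.
move=> t; rewrite gauss_rec; have ht := Rabs_pos t; have := he t; set e := exp _ => e0.
have p0 : 0 <= (1 + Rabs t) ^ j by apply: pow_le; lra.
apply: Rle_trans (Rabs_triang _ _) _; rewrite Rabs_Ropp !Rabs_mult (Rabs_left (- 2)); last lra.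
rewrite (Rabs_pos_eq 2) ?(Rabs_pos_eq (INR _)) //; last lra.
have -> : - - 2 = 2 by ring.
have a1 := h' t; have a2 := h t; rewrite -/e in a1 a2.
apply: Rle_trans (_ : 2 * Rabs t * (K' * (1 + Rabs t) ^ j.+1 * e) + 2 * INR j.+1 * (K * (1 + Rabs t) ^ j * e) <= _).
  apply: Rplus_le_compat; apply: Rmult_le_compat_l => //; nra.
set P := (1 + Rabs t) ^ j in p0 *.
have -> : (1 + Rabs t) ^ j.+1 = (1 + Rabs t) * P by [].
have -> : (1 + Rabs t) ^ j.+2 = (1 + Rabs t) * ((1 + Rabs t) * P) by [].
have q1 : 0 <= K' * P * e by apply: Rmult_le_pos; [exact: Rmult_le_pos | lra].
have q2 : 0 <= INR j.+1 * K * P * e by apply: Rmult_le_pos; [apply: Rmult_le_pos => //; exact: Rmult_le_pos | lra].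
have r1 : Rabs t * (1 + Rabs t) <= (1 + Rabs t) * (1 + Rabs t) by nra.
have r2 : 1 <= (1 + Rabs t) * (1 + Rabs t) by nra.
have := Rmult_le_compat_r _ _ _ q1 r1; have := Rmult_le_compat_r _ _ _ q2 r2; nra.
Qed.

Section Gaussian.
Variable d : nat.
Implicit Types l : 'I_d -> nat.
(** All partial derivatives of the Gaussian at once: the family is closed under differentiation, by
    [inc], which turns the Schwartz property into a bound on its members. *)
Definition gaussian l (x : 'I_d -> R) : C := RtoC (\big[Rmult/1]_(i < d) gauss (l i) (x i)).
Local Notation P := (@partial CV unit (fun _ => True) (fun _ => Cmod) d).

Lemma gaussian_derive l j x : derC (fun t => gaussian l (shift x j t)) 0 (gaussian (inc j l) x).
Proof.
apply/derC_pair; split=> /=; last exact: (@is_derive_const R_AbsRing R_NormedModule).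
apply: (is_derive_ext (fun t => \big[Rmult/1]_(i < d | i != j) gauss (l i) (x i) * gauss (l j) (x j + t))).
  move=> t; rewrite [RHS](bigD1 j) //=.
  have -> : shift x j t j = x j + t by rewrite /shift eqxx.
  rewrite Rmult_comm; congr (_ * _).
  by apply: eq_bigr => i hi; rewrite /shift (negbTE hi).
rewrite [X in is_derive _ _ X](bigD1 j) //=; have -> : inc j l j = (l j).+1 by rewrite /inc eqxx.
have -> : \big[Rmult/1]_(i < d | i != j) gauss (inc j l i) (x i) = \big[Rmult/1]_(i < d | i != j) gauss (l i) (x i).
  by apply: eq_bigr => i hi; rewrite /inc (negbTE hi).
set c := bigop _ _ _; rewrite Rmult_comm.
have H := gauss_derive (l j) (x j + 0).
auto_derive; first by exists (gauss (l j).+1 (x j + 0)).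
by rewrite (is_derive_unique _ _ _ H) Rplus_0_r; ring.
Qed.

Lemma gaussian_partial l j : P j (gaussian l) = gaussian (inc j l).
Proof.
apply: functional_extensionality => x; rewrite Cmod_norm.
apply: (@partial_norm_eq CV); exact: gaussian_derive.
Qed.

Lemma gaussian_foldr l js : exists l', foldr P (gaussian l) js = gaussian l'.
Proof.
by elim: js => [|j js [l' IH]]; [exists l | exists (inc j l'); rewrite /= IH gaussian_partial].
Qed.

Lemma gaussian_cont l x : continuous (gaussian l : _ -> CV) x.
Proof.
apply: lim_RtoC; apply: (lim_prodR (f := fun x i => gauss (l i) (x i))) => i.
apply: (lim_comp (h := gauss (l i))); first exact: lim_proj.
by apply: (@ex_derive_continuous R_AbsRing R_NormedModule); exists (gauss (l i).+1 (x i)); exact: gauss_derive.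
Qed.

Lemma prodR_le (I : Type) (s : seq I) (a b : I -> R) : (forall i, 0 <= a i <= b i) ->
  0 <= \big[Rmult/1]_(i <- s) a i <= \big[Rmult/1]_(i <- s) b i.
Proof.
move=> H; apply: (big_ind2 (fun x y => 0 <= x <= y)) => [|x y z t h1 h2|i _]; [lra | | exact: H].
by split; [apply: Rmult_le_pos; lra | apply: Rmult_le_compat; lra].
Qed.

Lemma wt_le_prod (x : 'I_d -> R) : wt x <= \big[Rmult/1]_(i < d) (1 + Rabs (x i)).
Proof.
suff : 0 <= sumR (fun i => Rabs (x i)) /\ 1 + sumR (fun i => Rabs (x i)) <= \big[Rmult/1]_(i < d) (1 + Rabs (x i)) by case.
apply: (big_ind2 (fun s p => 0 <= s /\ 1 + s <= p)) => [|a b c e [h1 h2] [h3 h4]|i _]; first lra.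
  by split; nra.
by have := Rabs_pos (x i); lra.
Qed.

Lemma gaussian_schwartz l : @schwartz d (gaussian l).
Proof.
split.
  split=> // js /=; have [l' ->] := gaussian_foldr l js; split.
    move=> x _; apply/lim0P => [t|e he]; first exact: Cmod_ge_0.
    have /contP h := @gaussian_cont l' x; apply: filter_imp (h e he) => y.
    by rewrite -normC.
  move=> j x; exists (gaussian (inc j l') x).
  by have /(@is_partial_norm CV) := gaussian_derive l' j x; rewrite -Cmod_norm.
move=> N i; rewrite /C_deriv mi_iter_foldr.
have [l' ->] := gaussian_foldr l (flatten [seq nseq (i j) j | j <- enum 'I_d]).
pose K k := proj1_sig (constructive_indefinite_description _ (gauss_decay k N)).
have hK k : 0 <= K k /\ forall t, (1 + Rabs t) ^ N * Rabs (gauss k t) <= K k.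
  exact: (proj2_sig (constructive_indefinite_description _ (gauss_decay k N))).
exists (\big[Rmult/1]_(i < d) K (l' i)) => x.
rewrite Cmod_R.
have -> : Rabs (\big[Rmult/1]_(i0 < d) gauss (l' i0) (x i0)) = \big[Rmult/1]_(i0 < d) Rabs (gauss (l' i0) (x i0)).
  by apply: (big_morph Rabs) => [a b|]; [exact: Rabs_mult | exact: Rabs_R1].
have h1 : (1 + enorm x) ^ N <= \big[Rmult/1]_(i < d) (1 + Rabs (x i)) ^ N.
  have -> : \big[Rmult/1]_(i < d) (1 + Rabs (x i)) ^ N = (\big[Rmult/1]_(i < d) (1 + Rabs (x i))) ^ N.
    by symmetry; apply: (big_morph (fun x => x ^ N)) => [a b|]; [exact: Rpow_mult_distr | exact: pow1].
  apply: pow_incr; split; first by have := enorm_ge0 x; lra.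
  by apply: Rle_trans (wt_le_prod x); have := enorm_le_sum x; rewrite /wt; lra.
have h2 := prodR_le (index_enum _) (fun i => conj (Rabs_pos (gauss (l' i) (x i))) (Rle_refl _)).
apply: Rle_trans (Rmult_le_compat_r _ _ _ (proj1 h2) h1) _.
rewrite -big_split /=; apply: (proj2 (prodR_le _ _)) => k; split; last exact: (proj2 (hK _)).
by apply: Rmult_le_pos; [apply: pow_le; have := Rabs_pos (x k); lra | exact: Rabs_pos].
Qed.

Lemma gaussian0 : gaussian (fun=> 0%N) (fun=> 0) = RtoC 1.
Proof.
rewrite /gaussian; congr RtoC; rewrite big1 // => i _.
by rewrite /gauss /= Rmult_0_l Ropp_0 exp_0.
Qed.

End Gaussian.

(** * Composition *)

Section Osc.
Variables (n : nat) (theta : 'I_n -> 'I_n -> R) (A : CstarAlgebra) (U : 'I_n -> A).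
Variables (alpha : ('I_n -> R) -> A -> A) (tau : A -> C) (delta : 'I_n -> A -> A).
Hypothesis HT : torus_data theta U alpha tau.
Hypothesis Hdelta : is_basic_derivations U alpha delta.

Local Notation mon := (@monomial n A U).
Local Notation Zn := (Zn n).
Local Notation cf := (cf U tau).
Local Notation coef := (fcoef U tau).
Local Notation sc := (scoef U tau).
Local Notation Ainf := (Ainf alpha).
Local Notation ph := (ph U tau).

(** Both hypotheses are instantiated at the Gaussian; iterated integrals and limits are unique. *)
Lemma osc_integral_unique rho a b b' :
  is_osc_integral alpha rho a b -> is_osc_integral alpha rho a b' -> b = b'.
Proof.
move=> H H'; have hS := gaussian_schwartz (fun _ : 'I_(n + n) => 0%N).
have [osc_inner [osc_outer [h l]]] := H _ hS (gaussian0 _); have [inn' [out' [h' l']]] := H' _ hS (gaussian0 _).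
have e eps : 0 < eps -> osc_outer eps = out' eps.
  move=> he; have [h1 h2] := h eps he; have [h1' h2'] := h' eps he.
  have E : osc_inner eps = inn' eps.
    by apply: functional_extensionality => xi; rewrite -(Int_unique (h1 xi)) -(Int_unique (h1' xi)).
  by rewrite -(Int_unique h2) -(Int_unique h2') E.
move/tendsP: l => l; move/tendsP: l' => l'.
apply: (@tends_unique _ A (at_right 0) at_right_proper _ _ _ l).
apply: tends_ext_ev l'; apply: filter_imp at_right_01 => eps [he _].
by rewrite e.
Qed.

Section Coef.
Variables (M : R) (rho : ('I_n -> R) -> A).
Hypothesis hrho : symbol alpha tau delta M rho.

Lemma cf_symbol_op a r : Ainf a -> cf r (symbol_op U tau rho a) =
  Sum (fun m : Zn => Cmult (ph (zsub r m) m) (Cmult (sc rho (zsub r m) (toR m)) (coef a m)) : CV).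
Proof.
move=> Ha; have [g hg] := symbol_op_dom HT Hdelta hrho Ha.
rewrite /symbol_op -(Sum_lin (is_linear_cf HT r) hg); refine (@Sum_ext Zn CV _ _ _) => m.
rewrite cmulZr (cfZ HT) (cf_mul_mon HT) -[cf _ (rho _)]/(sc rho (zsub r m) (toR m)).
have H (x y z : C) : Cmult x (Cmult y z) = Cmult y (Cmult z x) by ring.
exact: H.
Qed.

Lemma symbol_op_row_dom a r : Ainf a -> exists g,
  dominated (fun m : Zn => Cmult (ph (zsub r m) m) (Cmult (sc rho (zsub r m) (toR m)) (coef a m)) : CV) g.
Proof.
move=> Ha; have [g [hg h]] := symbol_op_dom HT Hdelta hrho Ha; exists g; split=> // m.
rewrite normC; apply: Rle_trans (h m).
have := cf_le HT r (cmul (rho (toR m)) (cscal (coef a m) (mon m))).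
rewrite cmulZr (cfZ HT) (cf_mul_mon HT) -[cf _ (rho _)]/(sc rho (zsub r m) (toR m)) !Cmod_mult.
by move=> h1; apply: Rle_trans h1; right; ring.
Qed.

End Coef.

Variables (M1 M2 : R) (rho phi : ('I_n -> R) -> A).
Hypothesis hrho : symbol alpha tau delta M1 rho.
Hypothesis hphi : symbol alpha tau delta M2 phi.

Let sigma := synth U (product_coef U tau rho phi).

Lemma product_symbol : symbol alpha tau delta (M1 + M2) sigma.
Proof. exact: (CS_symbol HT Hdelta (product_coef_CS HT Hdelta hrho hphi)). Qed.

Lemma Rp_le_wt M (m : Zn) q : M <= INR q -> Rp M (toR m) <= wt (toR m) ^ q.
Proof. by move=> hq; apply: Rpower_pow_le => //; exact: wt_ge1. Qed.

(** Contribution to mode [r] of the final result from mode [m] of [a] passing through mode [l] of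
    the intermediate element. *)
Definition comp_term a r (m l : Zn) : CV :=
  Cmult (ph (zsub r l) l) (Cmult (sc phi (zsub r l) (toR l))
    (Cmult (ph (zsub l m) m) (Cmult (sc rho (zsub l m) (toR m)) (coef a m)))).

(** The decay of [rho] in [l - m] is traded, by submultiplicativity, for decay in [l] at the price
    of a power of [wt (toR m)], which [a] pays for. The bound then factors, as [Sum_fubini]
    requires. *)
Lemma comp_term_bound a r : Ainf a -> exists g h, summable g /\ summable h /\
  forall m l : Zn, norm (comp_term a r m l) <= g m * h l.
Proof.
move=> Ha; have Hr := Ainf_rapid HT Ha.
have [_ /(_ O) [B [hB hb]]] := CSg_bd (symbol_CS HT Hdelta hphi).
have [q hq] := nat_above M2; have [q' hq'] := nat_above M1.
(* The [q] powers cancel the growth of [phi] at [l], and [2 * n] more make the sum over [l]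
   converge. *)
have [_ /(_ (q + 2 * n)%N) [B' [hB' hb']]] := CSg_bd (symbol_CS HT Hdelta hrho).
exists (fun m => (B * B') * (wt (toR m) ^ (q + 2 * n + q') * Cmod (coef a m))), (fun l => / wt (toR l) ^ (2 * n)).
split; first by apply: summable_scal; [exact: Rmult_le_pos | exact: rapid_summable].
split; first exact: summable_wt.
move=> m l; rewrite normC /comp_term !Cmod_mult !(proj1 (phP HT _ _)) !Rmult_1_l.
have h1 : Cmod (sc phi (zsub r l) (toR l)) <= B * wt (toR l) ^ q.
  apply: Rle_trans (hb _ _) _; rewrite /= Rinv_1 Rmult_1_r; apply: Rmult_le_compat_l => //; exact: Rp_le_wt.
have h2 : Cmod (sc rho (zsub l m) (toR m)) <= B' * / wt (toR (zsub l m)) ^ (q + 2 * n) * wt (toR m) ^ q'.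
  apply: Rle_trans (hb' _ _) _; apply: Rmult_le_compat_l; last exact: Rp_le_wt.
  by apply: Rmult_le_pos => //; left; exact: winv_pos.
have h3 : / wt (toR (zsub l m)) ^ (q + 2 * n) <= wt (toR m) ^ (q + 2 * n) * / wt (toR l) ^ (q + 2 * n).
  have p1 := wt_pos (toR (zsub l m)) (q + 2 * n); have p2 := wt_pos (toR l) (q + 2 * n).
  apply: (Rmult_le_reg_l (wt (toR (zsub l m)) ^ (q + 2 * n))) => //; rewrite Rinv_r; last lra.
  apply: (Rmult_le_reg_r (wt (toR l) ^ (q + 2 * n))) => //.
  rewrite Rmult_1_l -!Rmult_assoc (Rmult_assoc _ (/ _)) Rinv_l ?Rmult_1_r; last lra.
  rewrite -Rpow_mult_distr; apply: pow_incr; split; first by have := wt_ge1 (toR l); lra.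
  exact: wt_zsub.
have hc := Cmod_ge_0 (coef a m).
have pq := wt_pos (toR l) q; have pq' := wt_pos (toR m) q'.
apply: Rle_trans (_ : (B * wt (toR l) ^ q) * ((B' * (wt (toR m) ^ (q + 2 * n) * / wt (toR l) ^ (q + 2 * n)) * wt (toR m) ^ q') * Cmod (coef a m)) <= _).
  apply: Rmult_le_compat => //; try exact: Cmod_ge_0.
    by apply: Rmult_le_pos => //; exact: Cmod_ge_0.
  apply: Rmult_le_compat_r => //; apply: Rle_trans h2 _; apply: Rmult_le_compat_r; first lra.
  exact: Rmult_le_compat_l.
right; rewrite (pow_add _ (q + 2 * n) q') (pow_add (wt (toR l)) q); field.
by have := wt_pos (toR l) (2 * n); split; lra.
Qed.

(** Coefficients are compared: after interchanging the sums, [k = l - m] turns the point [l] at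
    which [phi] is evaluated into [m + k], which is the translate in [product_coef] at [xi = m]. *)
Lemma symbol_op_comp a : Ainf a -> Ainf (symbol_op U tau rho a) ->
  symbol_op U tau phi (symbol_op U tau rho a) = symbol_op U tau sigma a.
Proof.
move=> Ha Hb; apply: (cf_eq HT) => r.
rewrite (cf_symbol_op hphi _ Hb) (cf_symbol_op product_symbol _ Ha).
have -> : sc sigma = product_coef U tau rho phi := sc_synth HT (CSg_bd (product_coef_CS HT Hdelta hrho hphi)).
have [g [h [hg [hh hT]]]] := comp_term_bound r Ha.
transitivity (Sum (fun l => Sum (fun m => comp_term a r m l))).
  refine (@Sum_ext Zn CV _ _ _) => l.
  have [k hk] := symbol_op_row_dom hrho l Ha.
  have -> : coef (symbol_op U tau rho a) l = _ := cf_symbol_op hrho l Ha.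
  refine (eq_trans (Cmult_assoc _ _ _) _).
  refine (eq_trans (esym (Sum_lin (is_linear_Cmult_l _) hk)) _).
  by refine (@Sum_ext Zn CV _ _ _) => m; rewrite /comp_term; symmetry; exact: Cmult_assoc.
rewrite (Sum_fubini hg hh hT); refine (@Sum_ext Zn CV _ _ _) => m.
pose f k : CV := Cmult (ph (zsub (zsub r m) k) k) (Cmult (remainder_fam 0 0 (sc phi) (zsub (zsub r m) k, k) (toR m)) (sc rho k (toR m))).
have [k [hks hk]] := conv_dom (fun k m => proj1 (phP HT k m)) (zsub r m) (toR m)
  (CSg_bd (translate_CK HT Hdelta hphi 0)) (CSg_bd (symbol_CS HT Hdelta hrho)).
have -> : product_coef U tau rho phi (zsub r m) (toR m) = Sum f by [].
pose c : C := Cmult (ph (zsub r m) m) (coef a m).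
have -> : Cmult (ph (zsub r m) m) (Cmult (Sum f) (coef a m)) = Cmult c (Sum f) by rewrite /c; ring.
refine (eq_trans _ (Sum_lin (is_linear_Cmult_l c) (conj hks hk))).
have hd : dominated (fun k => Cmult c (f k) : CV) (fun x => Cmod c * k x).
  apply: dominated_scal_le => //; first exact: Cmod_ge_0.
  move=> x; rewrite normC Cmod_mult -(normC (f x)); apply: Rmult_le_compat_l (hk x); exact: Cmod_ge_0.
refine (eq_trans _ (@Sum_bij Zn Zn CV (fun l => zsub l m) (fun k => zadd k m) _ _ _ _ hd)).
- refine (@Sum_ext Zn CV _ _ _) => l; rewrite /f /comp_term remainder_fam0.
  have -> : (fun i => toR m i + toR (zsub l m) i) = toR l.
    by apply: functional_extensionality => i; rewrite /toR /zsub minus_IZR; ring.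
  have -> : zsub (zsub r m) (zsub l m) = zsub r l by apply: functional_extensionality => i; rewrite /zsub; lia.
  (* The cocycle identity for [r - l], [l - m] and [m] matches the four phases. *)
  have := ph_cocycle HT (zsub r l) (zsub l m) m.
  have -> : zadd (zsub l m) m = l by apply: functional_extensionality => i; rewrite /zsub /zadd; lia.
  have -> : zadd (zsub r l) (zsub l m) = zsub r m by apply: functional_extensionality => i; rewrite /zsub /zadd; lia.
  have H (p q s t x y z : C) : Cmult s p = Cmult q t ->
      Cmult p (Cmult x (Cmult s (Cmult y z))) = Cmult (Cmult t z) (Cmult q (Cmult x y)).
    by move=> h0; transitivity (Cmult (Cmult s p) (Cmult x (Cmult y z))); [ring | rewrite h0; ring].
  exact: H.
- by move=> l; apply: functional_extensionality => i; rewrite /zsub /zadd; lia.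
- by move=> l; apply: functional_extensionality => i; rewrite /zsub /zadd; lia.
Qed.

End Osc.

Theorem theorem1p2 (n : nat) (hn : (0 < n)%N)
  (theta : 'I_n -> 'I_n -> R)
  (theta_skew : skew_symmetric theta) (theta_generic : generic theta)
  (A : CstarAlgebra) (U : 'I_n -> A) (hA : is_nc_torus theta U)
  (alpha : ('I_n -> R) -> A -> A) (halpha : is_gauge_action U alpha)
  (tau : A -> C) (htau : is_canonical_trace U tau)
  (delta : 'I_n -> A -> A) (hdelta : is_basic_derivations U alpha delta)
  (M1 M2 : R) (rho phi : ('I_n -> R) -> A)
  (hrho : symbol alpha tau delta M1 rho) (hphi : symbol alpha tau delta M2 phi)
  (P Q : {a : A | Ainf alpha a} -> {a : A | Ainf alpha a})
  (hP : is_psido rho P) (hQ : is_psido phi Q) :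
  exists sigma : ('I_n -> R) -> A,
    symbol alpha tau delta (M1 + M2) sigma /\
    is_psido sigma (fun a => Q (P a)) /\
    asymptotic alpha tau delta (M1 + M2) sigma
      (fun l xi => scal (/ INR (mi_fact l))
                     (cmul (deriv alpha l phi xi) (mi_iter delta l (rho xi)))).
Proof.
have [hrel [hgen _]] := hA.
have HT : torus_data theta U alpha tau := TorusData hrel hgen halpha htau.
exists (synth U (product_coef U tau rho phi)).
have hs := product_symbol HT hdelta hrho hphi.
split=> //; split; last exact: (product_asymptotic HT hdelta hrho hphi).
move=> a; have hPa := proj2_sig (P a).
(* [hP] says that [P a] is a value of the oscillatory integral; uniqueness identifies it. *)
have eP : sval (P a) = symbol_op U tau rho (sval a).
  exact: (osc_integral_unique (hP a) (osc_integral_symbol_op HT hdelta hrho (proj2_sig a))).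
have eQ : sval (Q (P a)) = symbol_op U tau phi (sval (P a)).
  exact: (osc_integral_unique (hQ (P a)) (osc_integral_symbol_op HT hdelta hphi hPa)).
(* Membership of [symbol_op U tau rho (sval a)] in [Ainf] holds because it equals [P a], whose type
   carries the proof. *)
rewrite eQ eP (symbol_op_comp HT hdelta hrho hphi (proj2_sig a)) -?eP //.
exact: (osc_integral_symbol_op HT hdelta hs (proj2_sig a)).
Qed.
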